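(* For every integer $t>0$ there exists an integer $c=c(t)$ such that every graph in $\mathcal{F}_t$ with treewidth more than $c$ contains a subdivision of the wall $W_{t\times t}$ as an induced subgraph.
   Context: All graphs are finite and simple. A hole is an induced cycle of length at least four. A graph $G$ is sparse if for every hole $H$ of $G$ and every vertex $v\notin V(H)$ there is an edge $ab$ of $H$ with $N(v)\cap V(H)\subseteq\{a,b\}$. A pyramid consists of a vertex $a$, a triangle $\{b_1,b_2,b_3\}$ and three paths $P_i$ from $a$ to $b_i$ of length at least one such that for $i\neq j$ the sets $P_i\setminus\{a\},P_j\setminus\{a\}$ are disjoint with the only edge between them being $b_ib_j$, and at most one $P_i$ has length exactly one. A prism consists of two disjoint triangles $\{a_1,a_2,a_3\},\{b_1,b_2,b_3\}$ and three pairwise disjoint paths $P_i$ from $a_i$ to $b_i$ of length at least one such that for $i\ne j$ the only edges between $P_i$ and $P_j$ are $a_ia_j$ and $b_ib_j$. A graph is very sparse if it is sparse and has no induced subgraph that is a pyramid or a prism. $\mathcal{F}_t$ is the class of very sparse graphs with no clique of size $t+1$. Walls: for $k\ge1$, $\Gamma_k$ has vertex set $\{(i,j):1\le i\le k,\ 0\le j\le 2k-1\}$, with $(i,j)\sim(i,j+1)$ for $0\le j\le 2k-2$ and $(i,j)\sim(i+1,j)$ whenever $1\le i\le k-1$ and $i+j$ is odd; $W_{k\times k}$ is obtained from $\Gamma_k$ by deleting vertices of degree one and then suppressing each remaining vertex of row $1$ or row $k$ with no neighbor in another row. A subdivision replaces edges by paths. *)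

(* Defs.v *)
From HB Require Import structures.
From mathcomp Require Import boolp.
From mathcomp Require Import all_boot.

Set Implicit Arguments.
Unset Strict Implicit.
Unset Printing Implicit Defensive.

Record sgraph := SGraph {
  svertex :> finType;
  sedge : rel svertex;
  sedge_sym : symmetric sedge;
  sedge_irr : irreflexive sedge }.

Definition neighbors (G : sgraph) (v : G) : {set G} := [set u | sedge v u].

Definition degree (G : sgraph) (v : G) : nat := #|neighbors v|.

Definition clique (G : sgraph) (K : {set G}) : Prop :=
  {in K &, forall x y, x != y -> sedge x y}.

Section Induced.
Variables (G : sgraph) (S : {set G}).
Definition induced_rel : rel {x : G | x \in S} :=
  fun x y => sedge (val x) (val y).
Lemma induced_sym : symmetric induced_rel.
Proof. by move=> x y; exact: sedge_sym. Qed.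
Lemma induced_irr : irreflexive induced_rel.
Proof. by move=> x; exact: sedge_irr. Qed.
Definition induced : sgraph := SGraph induced_sym induced_irr.
End Induced.

Definition graph_iso (G H : sgraph) : Prop :=
  exists f : G -> H,
    bijective f /\ forall x y : G, sedge (f x) (f y) = sedge x y.

Definition induced_subgraph (H G : sgraph) : Prop :=
  exists S : {set G}, graph_iso H (induced S).

(* Holes *)

Definition is_hole (G : sgraph) (s : seq G) : Prop :=
  [/\ 4 <= size s, uniq s &
      {in s &, forall x y, sedge x y = (y == next s x) || (x == next s y)}].

Definition sparse (G : sgraph) : Prop :=
  forall (s : seq G) (v : G), is_hole s -> v \notin s ->
    exists a b : G, [/\ a \in s, b \in s, sedge a b &
      neighbors v :&: [set x in s] \subset [set a; b]].

(* Pyramids and prisms *)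

Definition consecutive (T : eqType) (s : seq T) (x y : T) : bool :=
  infix [:: x; y] s || infix [:: y; x] s.

(* The vertices of s, in this order, form a path with no further edge between
   them; the length of this path is (size s).-1. *)
Definition is_path (G : sgraph) (s : seq G) : Prop :=
  uniq s /\ {in s &, forall x y, sedge x y = consecutive s x y}.

Definition triangle (G : sgraph) (b : 'I_3 -> G) : Prop :=
  forall i j, i != j -> sedge (b i) (b j).

(* The path P_i is a :: p i, so p i is P_i without a and size (p i) is the
   length of P_i. *)
Definition is_pyramid (H : sgraph) : Prop :=
  exists (a : H) (b : 'I_3 -> H) (p : 'I_3 -> seq H),
    [/\ triangle b,
        forall i, [/\ is_path (a :: p i), last a (p i) = b i & 1 <= size (p i)],
        forall i j, i != j ->
          [disjoint p i & p j] /\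
          {in p i & p j, forall x y, sedge x y -> x = b i /\ y = b j},
        forall i j, size (p i) = 1 -> size (p j) = 1 -> i = j &
        forall x : H, exists i, x \in a :: p i].

(* The path P_i is a i :: p i. *)
Definition is_prism (H : sgraph) : Prop :=
  exists (a b : 'I_3 -> H) (p : 'I_3 -> seq H),
    [/\ [/\ triangle a, triangle b & forall i j, a i != b j],
        forall i,
          [/\ is_path (a i :: p i), last (a i) (p i) = b i & 1 <= size (p i)],
        forall i j, i != j ->
          [disjoint a i :: p i & a j :: p j] /\
          {in a i :: p i & a j :: p j, forall x y, sedge x y ->
             (x = a i /\ y = a j) \/ (x = b i /\ y = b j)} &
        forall x : H, exists i, x \in a i :: p i].

Definition very_sparse (G : sgraph) : Prop :=
  sparse G /\
  forall H : sgraph, induced_subgraph H G -> ~ is_pyramid H /\ ~ is_prism H.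

Definition class_F (t : nat) (G : sgraph) : Prop :=
  very_sparse G /\ ~ exists K : {set G}, clique K /\ #|K| = t.+1.

(* Treewidth *)

Definition connected_in (G : sgraph) (S : {set G}) : Prop :=
  {in S &, forall x y,
     connect [rel u v | [&& u \in S, v \in S & sedge u v]] x y}.

Definition is_tree (T : sgraph) : Prop :=
  [/\ 0 < #|T|, connected_in [set: T] &
      forall s : seq T, uniq s -> cycle (@sedge T) s -> size s < 3].

Definition tree_decomposition (G T : sgraph) (B : T -> {set G}) : Prop :=
  [/\ is_tree T,
      forall v : G, exists x : T, v \in B x,
      forall u v : G, sedge u v -> exists x : T, (u \in B x) && (v \in B x) &
      forall v : G, connected_in [set x : T | v \in B x]].

(* The truncated predecessor gives the graph with no vertices treewidth 0
   rather than -1. *)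
Definition width (G T : sgraph) (B : T -> {set G}) : nat :=
  (\max_(x : T) #|B x|).-1.

Definition has_decomposition_of_width (G : sgraph) (w : nat) : Prop :=
  exists (T : sgraph) (B : T -> {set G}), tree_decomposition B /\ width B = w.

Lemma has_some_decomposition (G : sgraph) :
  exists w, `[< has_decomposition_of_width G w >].
Proof.
have sym1 : symmetric (fun _ _ : unit => false) by [].
have irr1 : irreflexive (fun _ _ : unit => false) by [].
pose T := SGraph sym1 irr1; pose B (_ : T) := [set: G].
exists (width B); apply/asboolP; exists T, B; split=> //; split.
- split=> [|[] [] _ _|[|x [|y s]] //]; rewrite ?card_unit //.
- by move=> v; exists tt; rewrite inE.
- by move=> u v _; exists tt; rewrite !inE.
- by move=> v [] [] _ _; exact: connect0.
Qed.

Definition treewidth (G : sgraph) : nat := ex_minn (has_some_decomposition G).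

(* Walls *)

Section Gamma.
Variable k : nat.
(* The vertex (i, j) of Gamma_k with 1 <= i <= k is represented by the pair of
   ordinals (i - 1, j), hence the successors on first coordinates below. *)
Definition gamma_arc : rel ('I_k * 'I_(2 * k)) := fun x y =>
  ((x.1 == y.1) && (y.2 == x.2.+1 :> nat)) ||
  [&& x.2 == y.2, y.1 == x.1.+1 :> nat & odd (x.1.+1 + x.2)].
Definition gamma_rel : rel ('I_k * 'I_(2 * k)) := fun x y =>
  gamma_arc x y || gamma_arc y x.
Lemma gamma_sym : symmetric gamma_rel.
Proof. by move=> x y; rewrite /gamma_rel orbC. Qed.
Lemma gamma_irr : irreflexive gamma_rel.
Proof.
move=> x; rewrite /gamma_rel /gamma_arc orbb.
by rewrite [_ == x.2.+1]ltn_eqF // [_ == x.1.+1]ltn_eqF // !andbF.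
Qed.
Definition gamma : sgraph := SGraph gamma_sym gamma_irr.
End Gamma.

(* Simultaneous suppression of the vertices in S: each is removed and its
   neighbors are joined.  This is the usual operation when the vertices in S
   have degree two and are pairwise nonadjacent, as is the case for walls. *)
Section Suppress.
Variables (G : sgraph) (S : {set G}).
Definition suppress_rel : rel {x : G | x \notin S} := fun x y =>
  (x != y) && (sedge (val x) (val y) ||
               [exists z in S, sedge (val x) z && sedge z (val y)]).
Lemma suppress_sym : symmetric suppress_rel.
Proof.
move=> x y; rewrite /suppress_rel eq_sym sedge_sym; congr (_ && (_ || _)).
apply/exists_inP/exists_inP => -[z zS /andP[xz zy]]; exists z => //;
  by rewrite sedge_sym zy sedge_sym.
Qed.
Lemma suppress_irr : irreflexive suppress_rel.
Proof. by move=> x; rewrite /suppress_rel eqxx. Qed.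
Definition suppress : sgraph := SGraph suppress_sym suppress_irr.
End Suppress.

Definition gamma_pruned (k : nat) : sgraph :=
  induced [set x : gamma k | degree x != 1].

Definition gamma_suppressed (k : nat) : {set gamma_pruned k} :=
  [set x : gamma_pruned k |
     (((val x).1.+1 == 1) || ((val x).1.+1 == k)) &&
     [forall y, sedge x y ==> ((val y).1 == (val x).1)]].

Definition wall (k : nat) : sgraph := suppress (gamma_suppressed k).

(* Subdivisions: f embeds the branch vertices, and p u v lists the internal
   vertices, from f u to f v, of the path replacing the edge uv.  An edge may be
   replaced by a path of length one. *)
Definition is_subdivision (H W : sgraph) : Prop :=
  exists (f : W -> H) (p : W -> W -> seq H),
    let P u v := f u :: rcons (p u v) (f v) in
    [/\ injective f,
        forall u v, sedge u v -> uniq (P u v) /\ p v u = rev (p u v),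
        forall u v x, sedge u v -> x \in p u v ->
          (forall w, x != f w) /\
          (forall u' v', sedge u' v' -> x \in p u' v' ->
             [set u; v] = [set u'; v']),
        forall x : H, (exists w, x = f w) \/
          (exists u v, sedge u v /\ x \in p u v) &
        forall x y : H, sedge x y <->
          exists u v, sedge u v /\ consecutive (P u v) x y].

(* Main.v *)
(* Consider a graph of the class with as few vertices as possible among those without a tree
   decomposition into bags of size at most k.  Gluing decompositions along cliques shows that it has
   no clique cutset, and hence no triangle: a maximal clique of size at least three would be attached
   to a minimal connected set, in which a pyramid or a prism is found.  So a vertex has at most one
   neighbour on a hole avoiding it, and it follows that two nonadjacent vertices on no common hole
   are separated by a clique.  Applied to two neighbours of x in G - x, which by sparsity lie on no
   common hole, this shows that one of them is light for x: it merely subdivides an edge, or a path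
   replacing an edge, except for its adjacency to x.  Hence the edges that are light in neither
   direction form a matching, and contracting it at most halves the treewidth.

   The excluded grid theorem provides, in the contracted graph, a model of the wall together with two
   vertices that raise all degrees to three; lifted to G, no edge of the matching joins two of its
   parts.  In a smallest such model two parts are joined by an edge only if needed, and by one edge
   only, for otherwise the light end of a superfluous edge could be bypassed.  Since the wall has
   maximum degree three and G has no triangle, joining the ends of these edges inside the parts yields
   an induced subdivision.

   For the excluded grid theorem, large treewidth gives a path that meets all large connected sets.
   Many segments of it are pairwise linked by many disjoint paths.  Choosing these linkages minimal
   one after the other, either they can be thinned to be pairwise disjoint, which gives a large clique
   minor, or two of them cross in a grid-like way. *)
Require Import Defs.
From mathcomp Require Import all_boot.
From mathcomp Require Import boolp zify.
Set Implicit Arguments.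
Unset Strict Implicit.
Unset Printing Implicit Defensive.

(** * Connected sets and induced paths *)

(** It comes from torsos. Let a smallest clique K separate the neighbours y1 and y2 of x in G - x,
    and turn K + x into a clique. If deleting the component of y1 and deleting the component of y2
    both left a torso with small bags, the two decompositions could be glued along K + x; so for one
    component C there is none. Contracting onto x a proper connected part B of C that sees x and all
    of K would produce this torso from a proper induced subgraph of G, which does have a
    decomposition. So C has no such part, and as G has no triangle, C is a path, or a path with a
    second one leading to it: y is light. This fails only if a whole part sits inside that path, and
    such a part has at most two neighbours; hence degree three is wanted everywhere. It says nothing
    about an edge light in neither direction, hence the matching has to stay inside the parts. *)

Lemma mem_nthV (V : finType) (x : V) (s : seq V) i : i < size s -> nth x s i \in s.
Proof. exact: mem_nth. Qed.

(** The hypothesis is the form in which [shortest] says that a path meets [B] at its end only. *)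
Lemma only_last (V : finType) (x : V) (s : seq V) (B : pred V) z :
  (forall i, i.+1 < size s -> ~~ B (nth x s i)) -> z \in s -> B z -> z = last x s.
Proof.
move=> h zs Bz; have il : index z s < size s by rewrite index_mem.
have [lt|ge] := ltnP (index z s).+1 (size s).
  by have := h _ lt; rewrite nth_index // Bz.
by rewrite -nth_last -{1}(nth_index x zs); congr (nth x s _); move: il ge; clear; lia.
Qed.

Lemma only_head (V : finType) (x : V) (s : seq V) (A : pred V) z :
  (forall i, 0 < i < size s -> ~~ A (nth x s i)) -> z \in s -> A z -> z = head x s.
Proof.
move=> h zs Az; have il : index z s < size s by rewrite index_mem.
have [E|lt] := posnP (index z s); first by rewrite -nth0 -E nth_index.
by have := h (index z s); rewrite lt il nth_index // Az => /(_ isT).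
Qed.

Section Connected.
Variables (V : finType) (e : rel V).
Hypothesis eS : symmetric e.

Definition restr (S : {set V}) : rel V := fun u v => [&& u \in S, v \in S & e u v].
Arguments restr S u v /.
(** Convertible with [connected_in]; in particular the empty set is connected. *)
Definition conn (S : {set V}) : Prop := {in S &, forall x y, connect (restr S) x y}.

Lemma restr_sym S : symmetric (restr S).
Proof. by move=> x y /=; rewrite eS andbCA. Qed.

Lemma conn_sym S x y : connect (restr S) x y = connect (restr S) y x.
Proof. by apply: sym_connect_sym; exact: restr_sym. Qed.

Lemma connect_restr_mono (S S' : {set V}) x y :
  S \subset S' -> connect (restr S) x y -> connect (restr S') x y.
Proof.
move=> sSS'; apply: connect_sub => a b /= /and3P[aS bS ab].
by apply: connect1; rewrite /= ab !(subsetP sSS').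
Qed.

Lemma connect_restr_in (S : {set V}) x y : x \in S -> connect (restr S) x y -> y \in S.
Proof.
move=> xS /connectP[p]; elim: p x xS => [|z p IH] x xS /= => [_ ->//|].
by case/andP=> /and3P[_ zS _] /IH; apply.
Qed.

Lemma path_restr (S : {set V}) x p :
  path (restr S) x p -> path e x p /\ {subset p <= S}.
Proof.
elim: p x => [|y p IH] x //= /andP[/and3P[xS yS xy] /IH[-> pS]]; split; first by rewrite xy.
by move=> z; rewrite inE => /orP[/eqP->|/pS].
Qed.

Lemma restr_path (S : {set V}) x p :
  x \in S -> {subset p <= S} -> path e x p -> path (restr S) x p.
Proof.
elim: p x => [|y p IH] x //= xS pS /andP[xy yp].
have yS : y \in S by apply: pS; rewrite inE eqxx.
rewrite xS yS xy /=; apply: IH => // z zp; apply: pS; by rewrite inE zp orbT.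
Qed.

Lemma connect_path (S : {set V}) x p : x \in S -> {subset p <= S} -> path e x p ->
  connect (restr S) x (last x p).
Proof. by move=> xS pS xp; apply/connectP; exists p => //; exact: restr_path. Qed.

Lemma conn1 x : conn [set x].
Proof. by move=> a b; rewrite !inE => /eqP-> /eqP->. Qed.

Lemma connect_restr1 (S : {set V}) x y : x \in S -> y \in S -> e x y -> connect (restr S) x y.
Proof. by move=> xS yS xy; apply: connect1; rewrite /= xS yS. Qed.

Lemma conn_base (S : {set V}) c :
  (forall x, x \in S -> connect (restr S) c x) -> conn S.
Proof.
move=> h x y xS yS; apply: connect_trans (h _ yS); rewrite conn_sym; exact: h.
Qed.

Lemma connU (A B : {set V}) a b : conn A -> conn B -> a \in A -> b \in B ->
  (a == b) || e a b -> conn (A :|: B).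
Proof.
move=> cA cB aA bB ab; apply: (@conn_base _ a) => x; rewrite inE => /orP[xA|xB].
  by apply: connect_restr_mono (cA _ _ aA xA); exact: subsetUl.
apply: (@connect_trans _ _ b); last first.
  by apply: connect_restr_mono (cB _ _ bB xB); exact: subsetUr.
case/orP: ab => [/eqP->//|ab]; apply: connect_restr1 => //; by rewrite inE ?aA ?bB ?orbT.
Qed.

Lemma conn_path x p : path e x p -> conn [set z in x :: p].
Proof.
move=> xp; apply: (@conn_base _ x) => z; rewrite inE => zp.
case/splitPl: zp xp => p1 p2 <-; rewrite cat_path => /andP[xp1 _].
by apply: connect_path => // [|y]; rewrite !inE ?eqxx // mem_cat => ->; rewrite orbT.
Qed.

Definition comp (S : {set V}) x : {set V} := [set y | connect (restr S) x y].

Lemma comp_id (S : {set V}) x : x \in comp S x.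
Proof. by rewrite inE connect0. Qed.

Lemma comp_sub (S : {set V}) x : x \in S -> comp S x \subset S.
Proof. by move=> xS; apply/subsetP => y; rewrite inE; exact: connect_restr_in. Qed.

Lemma comp_closed (S : {set V}) x y z : x \in S -> y \in comp S x -> z \in S -> e y z -> z \in comp S x.
Proof.
move=> xS yC zS yz; have yS := subsetP (comp_sub xS) _ yC; move: yC.
by rewrite !inE => /connect_trans; apply; exact: connect_restr1.
Qed.

Lemma closed_connect (S C : {set V}) x y :
  (forall a b, a \in C -> b \in S -> e a b -> b \in C) -> x \in C ->
  connect (restr S) x y -> y \in C.
Proof.
move=> clC xC /connectP[p xp ->]; elim: p x xC xp => [|z p IH] x xC //=.
by case/andP=> /and3P[_ zS xz] /IH; apply; exact: clC xz.
Qed.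

Lemma comp_conn (S : {set V}) x : x \in S -> conn (comp S x).
Proof.
move=> xS; apply: (@conn_base _ x) => y; rewrite inE => /connectP[p].
elim/last_ind: p y => [|p z IH] y; first by move=> _ ->.
rewrite rcons_path last_rcons => /andP[xp lz ->]; move/(_ _ xp erefl): IH => IH.
apply: connect_trans IH _; apply: connect1; move: lz => /= /and3P[lS zS lz].
have cl : connect (restr S) x (last x p) by apply/connectP; exists p.
rewrite !inE lz cl (connect_trans cl) //; exact: connect_restr1.
Qed.

Lemma conn_closed (S C : {set V}) x : conn S -> x \in S -> x \in C ->
  (forall a b, a \in C -> b \in S -> e a b -> b \in C) -> S \subset C.
Proof.
move=> cS xS xC clC; apply/subsetP => y yS.
exact: closed_connect clC xC (cS _ _ xS yS).
Qed.

Lemma conn_sub_comp (S A : {set V}) x : conn A -> A \subset S -> x \in A -> A \subset comp S x.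
Proof.
move=> cA AS xA; apply/subsetP => y yA; rewrite inE.
exact: connect_restr_mono AS (cA _ _ xA yA).
Qed.

(* Growing a connected subset through x by one vertex at a time stops at S minus one vertex. *)
Lemma noncut (S : {set V}) x : conn S -> x \in S -> 1 < #|S| ->
  exists y, [/\ y \in S, y != x & conn (S :\ y)].
Proof.
move=> cS xS S1.
pose P (X : {set V}) := `[< conn X >] && (X \proper S) && (x \in X).
have P1 : P [set x].
  rewrite /P set11 andbT; apply/andP; split; first exact/asboolP/conn1.
  by rewrite properEcard sub1set xS cards1.
case: (arg_maxnP (fun X : {set V} => #|X|) P1) => X /andP[/andP[/asboolP cX XS] xX] maxX.
have : ~~ (S \subset X) by case/andP: XS.
move=> nSX.
have [a [b [aX bS ab bX]]] : exists a b, [/\ a \in X, b \in S, e a b & b \notin X].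
  apply: contrapT => H; move/negP: nSX; apply.
  apply: (conn_closed cS xS xX) => a b aX bS ab; apply: contrapT => /negP bX.
  by apply: H; exists a, b.
have XS' := proper_sub XS.
have cXb : conn (X :|: [set b]).
  by apply: (connU cX (@conn1 b) aX (set11 b)); rewrite ab orbT.
have bx : b != x by apply: contraNneq bX => ->.
exists b; split => //.
have [eqS|neS] := eqVneq (X :|: [set b]) S.
  suff -> : S :\ b = X by [].
  apply/setP => z; rewrite -eqS !inE; case: (eqVneq z b) => [->|] //=.
    by rewrite (negbTE bX).
  by rewrite orbF.
have : P (X :|: [set b]).
  rewrite /P !inE xX /= andbT; apply/andP; split; first exact/asboolP.
  by rewrite properEneq neS subUset XS' sub1set.
move/maxX; rewrite setUC cardsU1 bX; lia.
Qed.

(** An induced path as a sequence. The default of [nth] is quantified, so that every use may choose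
    its own. *)
Definition ipath (s : seq V) : Prop := uniq s /\
  forall d i j, i < j -> j < size s -> e (nth d s i) (nth d s j) = (j == i.+1).

Lemma ipath_sorted s : ipath s -> sorted e s.
Proof.
case: s => [|x s] // [_ h]; apply/(sortedP x) => i il.
by rewrite h ?eqxx.
Qed.

(** A walk of least length from [A] to [B] inside [S]: a chord, a repeated vertex, a later visit to
    [A] or an earlier one to [B] would each shorten it. *)
Lemma shortest_min (S : {set V}) (A B : pred V) x y :
  A x -> B y -> x \in S -> connect (restr S) x y ->
  exists s, [/\ 0 < size s, {subset s <= S}, ipath s,
    A (head x s) /\ B (last x s) &
    (forall i, 0 < i < size s -> ~~ A (nth x s i)) /\
    (forall i, i.+1 < size s -> ~~ B (nth x s i)) /\
    forall s', 0 < size s' -> {subset s' <= S} -> sorted e s' -> A (head x s') -> B (last x s') ->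
      size s <= size s'].
Proof.
move=> Ax By xS /connectP[p0 xp0 yE].
pose P n := `[< exists s, [/\ size s = n, 0 < size s, all (mem S) s, sorted e s &
                   A (head x s) /\ B (last x s)] >].
have ex : exists n, P n.
  exists (size p0).+1; apply/asboolP; exists (x :: p0).
  have [xp pS] := path_restr xp0.
  by split => //=; rewrite -?yE // xS; apply/allP => z /pS.
case: (ex_minnP ex) => n /asboolP[s [sn s0 /allP sS ss [As Bs]]] minn.
have sub : forall s', 0 < size s' < size s -> all (mem S) s' -> sorted e s' ->
    A (head x s') -> B (last x s') -> False.
  move=> s' /andP[s'0 s's] a1 a2 a3 a4.
  have /minn : P (size s') by apply/asboolP; exists s'.
  lia.
have sE := sortedP x ss.
(* A chord cuts out the vertices strictly between its ends. *)
have jump i j : i < j -> j < size s -> i.+1 < j -> e (nth x s i) (nth x s j) -> False.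
  move=> ij js i1j eij.
  have szt : size (take i.+1 s) = i.+1 by rewrite size_take; case: ltnP => //; lia.
  pose t := take i.+1 s ++ drop j s.
  have nt l : nth x t l = if l < i.+1 then nth x s l else nth x s (l - i.+1 + j).
    rewrite nth_cat szt; case: ltnP => li; first by rewrite nth_take.
    by rewrite nth_drop addnC.
  have st : size t = i.+1 + (size s - j) by rewrite size_cat szt size_drop.
  apply: (sub t).
  - by rewrite st; lia.
  - apply/(all_nthP x) => l lt; rewrite nt; rewrite st in lt; case: ifP => li /=; apply/sS/mem_nthV; lia.
  - apply/(sortedP x) => l lt; rewrite !nt; rewrite st in lt.
    case: (ltnP l i.+1) => li; last first.
      rewrite ifF; last by lia.
      have -> : l.+1 - i.+1 + j = (l - i.+1 + j).+1 by lia.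
      apply: sE; lia.
    case: ifP => l1; first by apply: sE; lia.
    have -> : l = i by lia.
    by have -> : i.+1 - i.+1 + j = j by lia.
  - rewrite -nth0 nt /= nth0 //.
  - rewrite -nth_last nt st ifF; last by lia.
    have -> : (i.+1 + (size s - j)).-1 - i.+1 + j = (size s).-1 by lia.
    by rewrite nth_last.
have suf i : i < size s -> 0 < i -> A (nth x s i) -> False.
  move=> il i0 Ai; apply: (sub (drop i s)).
  - by rewrite size_drop; lia.
  - by apply/allP => z /mem_drop/sS.
  - exact: drop_sorted.
  - by rewrite -nth0 nth_drop addn0.
  - rewrite -nth_last nth_drop size_drop.
    have -> : i + (size s - i).-1 = (size s).-1 by lia.
    by rewrite nth_last.
have pre i : i.+1 < size s -> B (nth x s i) -> False.
  move=> il Bi; apply: (sub (take i.+1 s)).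
  - by rewrite size_takel; lia.
  - by apply/allP => z /mem_take/sS.
  - exact: take_sorted.
  - by rewrite -nth0 nth_take // nth0.
  - by rewrite -nth_last size_take il /= nth_take.
(* A vertex repeated at [i] and [j] yields a chord from [i] to [j.+1], or an early visit to [B] if
   [j] is the last position. *)
have dif i j : i < j -> j < size s -> nth x s i != nth x s j.
  move=> ij js; apply/eqP => E.
  case: (ltnP j.+1 (size s)) => j1.
    have := sE j j1; rewrite -E => /jump; apply; lia.
  have := pre i; rewrite E; have -> : j = (size s).-1 by lia.
  rewrite nth_last; apply => //; lia.
exists s; split => //.
- split.
    apply: contraT => /(uniqPn x)[i [j [ij js /eqP]]]; by rewrite (negbTE (dif _ _ ij js)).
  move=> d i j ij js; rewrite !(set_nth_default x d) //; last by lia.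
  have [-> |/eqP nj] := eqVneq j i.+1; first by apply: sE; lia.
  apply/negbTE/negP; apply: jump => //; lia.
- split; first by move=> i /andP[i0 il]; apply/negP; exact: suf.
  split; first by move=> i il; apply/negP; exact: pre.
  move=> s' s'0 s'S ss' h1 h2; rewrite leqNgt; apply/negP => lt.
  by apply: (sub s') => //; [rewrite s'0|apply/allP].
Qed.

Lemma shortest (S : {set V}) (A B : pred V) x y :
  A x -> B y -> x \in S -> connect (restr S) x y ->
  exists s, [/\ 0 < size s, {subset s <= S}, ipath s,
    A (head x s) /\ B (last x s) &
    (forall i, 0 < i < size s -> ~~ A (nth x s i)) /\
    (forall i, i.+1 < size s -> ~~ B (nth x s i))].
Proof.
move=> h1 h2 h3 h4; have [s [a1 a2 a3 a4 [a5 [a6 _]]]] := shortest_min h1 h2 h3 h4.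
by exists s.
Qed.

End Connected.
Arguments comp_sub {V e S x} _.

(** * Tree decompositions *)

Section TreeData.
Variable V : finType.
Implicit Types (e : rel V) (W X Z F : {set V}).

(* A tree decomposition of W with nodes 0, ..., n - 1, bags b, parent map q and root r.  The injective
   rank rk increases away from the root, so that a vertex of bag i that is also in a bag of smaller
   rank must be in the bag of the parent of i. *)
Definition tdata e k W (n : nat) (b : nat -> {set V}) (q rk : nat -> nat) r : Prop :=
  [/\ r < n,
      forall i, i < n -> b i \subset W /\ #|b i| <= k,
      (forall i, i < n -> i != r -> [/\ q i < n, rk (q i) < rk i & rk r < rk i]) /\
      (forall i j, i < n -> j < n -> rk i = rk j -> i = j),
      forall i l v, i < n -> l < n -> rk l < rk i -> v \in b i -> v \in b l -> v \in b (q i) &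
      (forall v, v \in W -> exists2 i, i < n & v \in b i) /\
      (forall u v, u \in W -> v \in W -> e u v -> exists2 i, i < n & (u \in b i) && (v \in b i))].

(** [k] bounds the bags themselves, so the width is less than [k]; the root bag contains [X], along
    which decompositions are glued. *)
Definition rtd e k W X : Prop := exists n b q rk r, tdata e k W n b q rk r /\ X \subset b r.
Definition tdl e k W : Prop := rtd e k W set0.

Lemma rtd_leaf e k W X : #|W| <= k -> X \subset W -> rtd e k W X.
Proof.
move=> Wk XW; exists 1, (fun _ => W), id, id, 0; split=> //; split=> //.
- by split=> [i i1 i0|i j]; [lia|lia].
- by split=> [v vW|u v uW vW _]; exists 0; rewrite ?vW ?uW.
Qed.

Lemma rtd_sub e k W X X' : X' \subset X -> rtd e k W X -> rtd e k W X'.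
Proof.
move=> sX [n [b [q [rk [r [t Xb]]]]]]; exists n, b, q, rk, r; split=> //.
exact: subset_trans Xb.
Qed.

(** The root of the second tree becomes a child of the root of the first. Raising the second ranks
    by [M], which exceeds all first ranks, keeps the rank injective and increasing. *)
Lemma rtd_glue e k W1 W2 X1 X2 : rtd e k W1 X1 -> rtd e k W2 X2 ->
  W1 :&: W2 \subset X1 -> W1 :&: W2 \subset X2 -> symmetric e ->
  (forall u v, u \in W1 -> v \in W2 -> e u v -> (u \in W2) || (v \in W1)) ->
  rtd e k (W1 :|: W2) X1.
Proof.
move=> [n1 [b1 [q1 [rk1 [r1 [[r1n B1 [q1n i1] T1 [c1 d1]] Xb1]]]]]].
move=> [n2 [b2 [q2 [rk2 [r2 [[r2n B2 [q2n i2] T2 [c2 d2]] Xb2]]]]]] sX1 sX2 eS sep.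
pose M := (\sum_(i < n1) rk1 i).+1.
have rkM i : i < n1 -> rk1 i < M.
  by move=> il; rewrite /M ltnS (bigD1 (Ordinal il)) //= leq_addr.
pose b i := if i < n1 then b1 i else b2 (i - n1).
pose q i := if i < n1 then q1 i else if i - n1 == r2 then r1 else n1 + q2 (i - n1).
pose rk i := if i < n1 then rk1 i else M + rk2 (i - n1).
have bl i : i < n1 -> b i = b1 i by rewrite /b => ->.
have br i : b (n1 + i) = b2 i by rewrite /b ifF ?addKn //; lia.
have rl i : i < n1 -> rk i = rk1 i by rewrite /rk => ->.
have rr i : rk (n1 + i) = M + rk2 i by rewrite /rk ifF ?addKn //; lia.
have ql i : i < n1 -> q i = q1 i by rewrite /q => ->.
have qr i : i != r2 -> q (n1 + i) = n1 + q2 i.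
  by rewrite /q ifF ?addKn; [move/negbTE->|lia].
have qr2 : q (n1 + r2) = r1 by rewrite /q ifF ?addKn ?eqxx //; lia.
have spl i : i < n1 + n2 -> i < n1 \/ exists2 j, j < n2 & i = n1 + j.
  by move=> il; case: (ltnP i n1) => h; [left|right; exists (i - n1); lia].
have r1min i : i < n1 -> rk1 r1 <= rk1 i.
  by move=> il; have [->//|/(q1n _ il)[_ _ /ltnW]] := eqVneq i r1.
have r2min i : i < n2 -> rk2 r2 <= rk2 i.
  by move=> il; have [->//|/(q2n _ il)[_ _ /ltnW]] := eqVneq i r2.
exists (n1 + n2), b, q, rk, r1; split; last by rewrite bl.
split; first by lia.
- move=> i /spl[il|[j jl ->]].
    by rewrite bl //; have [s ?] := B1 _ il; rewrite subsetU ?s.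
  by rewrite br; have [s ?] := B2 _ jl; rewrite subsetU ?s ?orbT.
- split=> [i /spl[il|[j jl ->]] ir|i j /spl[il|[i' il ->]] /spl[jl|[j' jl ->]]].
  + by have [a1 a2 a3] := q1n _ il ir; rewrite (ql _ il) (rl _ a1) (rl _ il) (rl _ r1n); split=> //; lia.
  + rewrite rr (rl r1) //; have ? := rkM _ r1n; have [->|jr] := eqVneq j r2.
      by rewrite qr2 (rl r1) //; split; lia.
    by have [a1 a2 a3] := q2n _ jl jr; rewrite qr // rr; split; lia.
  + by rewrite (rl _ il) (rl _ jl); exact: i1.
  + by rewrite (rl _ il) rr; have := rkM _ il; lia.
  + by rewrite (rl _ jl) rr; have := rkM _ jl; lia.
  + by rewrite !rr => /addnI h; rewrite (i2 i' j').
- move=> i l v /spl[il|[i' il ->]] /spl[ll|[l' ll ->]].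
  + rewrite (rl _ il) (rl _ ll) (bl _ il) (bl _ ll) (ql _ il) => h v1 v2.
    have ir : i != r1 by apply: contraTneq h => ->; rewrite -leqNgt r1min.
    by have [h1 _ _] := q1n i il ir; rewrite (bl _ h1); exact: T1 v1 v2.
  + by rewrite (rl _ il) rr; have := rkM _ il; lia.
  + rewrite (rl _ ll) rr (bl _ ll) br => _ v2 v1.
    have vX : v \in W1 :&: W2.
      rewrite inE; have [/subsetP s _] := B1 _ ll; have [/subsetP s' _] := B2 _ il.
      by rewrite s ?s'.
    have [->|ir] := eqVneq i' r2; first by rewrite qr2 (bl _ r1n) (subsetP Xb1) // (subsetP sX1).
    rewrite qr // br; apply: (T2 i' r2) => //.
      by have [] := q2n _ il ir.
    by rewrite (subsetP Xb2) // (subsetP sX2).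
  + rewrite !rr !br ltn_add2l => h v1 v2; rewrite qr ?br; first exact: T2 v1 v2.
    by apply: contraTneq h => ->; rewrite -leqNgt r2min.
- split=> [v|u v].
    rewrite inE => /orP[/c1[i il vi]|/c2[i il vi]].
      by exists i; rewrite ?bl //; lia.
    by exists (n1 + i); rewrite ?br //; lia.
  have E1 a c : a \in W1 -> c \in W1 -> e a c -> exists2 i, i < n1 + n2 & (a \in b i) && (c \in b i).
    by move=> aW cW /(d1 _ _ aW cW)[i il h]; exists i; rewrite ?bl //; lia.
  have E2 a c : a \in W2 -> c \in W2 -> e a c -> exists2 i, i < n1 + n2 & (a \in b i) && (c \in b i).
    by move=> aW cW /(d2 _ _ aW cW)[i il h]; exists (n1 + i); rewrite ?br //; lia.
  rewrite !inE => /orP[u1|u2] /orP[v1|v2] euv.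
  + exact: E1.
  + by case/orP: (sep _ _ u1 v2 euv) => h; [exact: E2|exact: E1].
  + by rewrite eS in euv; case/orP: (sep _ _ v1 u2 euv) => h; rewrite eS in euv; [exact: E2|exact: E1].
  + exact: E2.
Qed.

(** * Subtrees of a tree decomposition and change of its root *)

Section Nodes.
Variables (e : rel V) (k : nat) (W : {set V}) (n : nat) (b : nat -> {set V})
  (q rk : nat -> nat) (r : nat).
Hypothesis td : tdata e k W n b q rk r.

(** Connectedness in terms of ranks: from each of its nodes, a subtree is climbed by parents without
    leaving it until its node of least rank is reached. *)
Definition subtree (I : nat -> Prop) : Prop :=
  forall i l, i < n -> l < n -> rk l < rk i -> I i -> I l -> I (q i).

Lemma root_min i : i < n -> rk r <= rk i.
Proof.
by case: td => _ _ [qn _] _ _ il; have [->//|/(qn _ il)[_ _ /ltnW]] := eqVneq i r.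
Qed.

Lemma parent_ok i l : i < n -> l < n -> rk l < rk i -> q i < n /\ rk (q i) < rk i.
Proof.
move=> il ll h; case: td => _ _ [qn _] _ _.
have ir : i != r by apply: contraTneq h => ->; rewrite -leqNgt root_min.
by case: (qn _ il ir).
Qed.

Lemma node_min (P : nat -> Prop) : (exists2 c, c < n & P c) ->
  exists2 c, c < n & P c /\ forall l, l < n -> P l -> rk c <= rk l.
Proof.
move=> ex.
pose Q m := `[< exists2 c, c < n & P c /\ rk c = m >].
have exQ : exists m, Q m by case: ex => c cn Pc; exists (rk c); apply/asboolP; exists c.
case: (ex_minnP exQ) => m /asboolP[c cn [Pc cm]] mm; exists c => //; split=> // l ll Pl.
by rewrite cm; apply: mm; apply/asboolP; exists l.
Qed.

(** The common node of least rank is the top of one of the two subtrees, since otherwise its parent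
    would be a common node of smaller rank. *)
Lemma subtree_common I J : subtree I -> subtree J -> (exists2 c, c < n & I c /\ J c) ->
  exists2 c, c < n & [/\ I c, J c &
    (forall l, l < n -> I l -> rk c <= rk l) \/ (forall l, l < n -> J l -> rk c <= rk l)].
Proof.
move=> sI sJ /node_min[c cn [[Ic Jc] cm]]; exists c => //; split=> //.
apply: contrapT => /not_orP[nI nJ].
have ext K : ~ (forall l, l < n -> K l -> rk c <= rk l) -> exists l, [/\ l < n, K l & rk l < rk c].
  move=> nK; apply: contrapT => H; apply: nK => l ll Kl; rewrite leqNgt; apply/negP => h.
  by apply: H; exists l.
have [l [ll Il h]] := ext _ nI; have [l' [ll' Jl h']] := ext _ nJ.
have [qn qc] := parent_ok cn ll h.
have := cm _ qn (conj (sI _ _ cn ll h Ic Il) (sJ _ _ cn ll' h' Jc Jl)); lia.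
Qed.

Lemma rk_inj i j : i < n -> j < n -> rk i <= rk j -> rk j <= rk i -> i = j.
Proof. by case: td => _ _ [_ inj] _ _ il jl h1 h2; apply: inj => //; lia. Qed.

Lemma subtreeU I J : subtree I -> subtree J -> (exists2 c, c < n & I c /\ J c) ->
  subtree (fun i => I i \/ J i).
Proof.
move=> sI sJ ex.
have key K L : subtree K -> subtree L -> (exists2 c, c < n & K c /\ L c) ->
    forall i l, i < n -> l < n -> rk l < rk i -> K i -> L l -> K (q i) \/ L (q i).
  move=> sK sL exKL i l il ll h Ki Ll.
  have [c cn [Kc Lc [cm|cm]]] := subtree_common sK sL exKL.
    have hc := cm _ il Ki; case: (ltnP (rk c) (rk i)) => hc'.
      by left; exact: sK Ki Kc.
    by right; apply: sL Ll => //; rewrite -(rk_inj cn il hc hc').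
  by left; apply: sK Kc => //; have := cm _ ll Ll; lia.
move=> i l il ll h [Ii|Ji] [Il|Jl].
- by left; exact: sI Ii Il.
- exact: (key I J sI sJ ex _ _ il ll h Ii Jl).
- have ex' : exists2 c, c < n & J c /\ I c by case: ex => c cn []; exists c.
  by case: (key J I sJ sI ex' _ _ il ll h Ji Il); [right|left].
- by right; exact: sJ Ji Jl.
Qed.

Lemma vertex_subtree v : subtree (fun i => v \in b i).
Proof. by case: td => _ _ _ T _ i l; exact: T. Qed.

(** Grow a subset of [F] whose bags form a subtree: an edge leaving it lies in a bag, which joins
    the subtree of the new vertex to the old one. *)
Lemma conn_subtree F x : symmetric e -> conn e F -> x \in F -> F \subset W ->
  subtree (fun i => exists2 v, v \in F & v \in b i).
Proof.
move=> eS cF xF FW.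
pose P (X : {set V}) := `[< subtree (fun i => exists2 v, v \in X & v \in b i) >] &&
  (x \in X) && (X \subset F).
have P1 : P [set x].
  rewrite /P set11 sub1set xF !andbT; apply/asboolP => i l il ll h [v]; rewrite inE => /eqP-> vi.
  by case=> w; rewrite inE => /eqP-> wl; exists x; rewrite ?set11 //; exact: vertex_subtree vi wl.
case: (arg_maxnP (fun X : {set V} => #|X|) P1) => X /andP[/andP[/asboolP sX xX] XF] maxX.
suff -> : F = X by [].
apply/eqP; rewrite eqEsubset XF andbT; apply: (conn_closed cF xF xX) => a c aX cF' ac.
apply: contraT => cX.
suff : P (X :|: [set c]) by move/maxX; rewrite setUC cardsU1 cX; lia.
rewrite /P inE xX subUset XF sub1set cF' !andbT; apply/asboolP.
have exC : exists2 i, i < n & (exists2 v, v \in X & v \in b i) /\ c \in b i.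
  case: td => _ _ _ _ [_ ed]; case: (ed a c) => //; [exact/(subsetP FW)/(subsetP XF)|exact: (subsetP FW)|].
  by move=> i il /andP[ai ci]; exists i => //; split=> //; exists a.
have eqU i : (exists2 v, v \in X :|: [set c] & v \in b i) <->
    ((exists2 v, v \in X & v \in b i) \/ c \in b i).
  split=> [[v]|[[v vX vi]|ci]].
  - by rewrite !inE => /orP[vX vi|/eqP->]; [left; exists v|right].
  - by exists v; rewrite // inE vX.
  - by exists c; rewrite // !inE eqxx orbT.
have h := subtreeU sX (@vertex_subtree c) exC.
by move=> i l il ll hr /eqU hi /eqU hl; apply/eqU; exact: h il ll hr hi hl.
Qed.

(** Helly property of subtrees: among the top nodes of the vertices of [Z], the one of largest rank
    lies in the subtrees of all the others. *)
Lemma clique_bag Z : Z \subset W -> {in Z &, forall x y, x != y -> e x y} ->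
  exists2 c, c < n & Z \subset b c.
Proof.
move=> ZW cZ; have [rn _ _ _ [cov ed]] := td.
have [->|[z zZ]] := set_0Vmem Z; first by exists r; rewrite ?sub0set.
have ex v : exists m, v \in Z ->
    [/\ m < n, v \in b m & forall l, l < n -> v \in b l -> rk m <= rk l].
  have [vZ|] := boolP (v \in Z); last by exists 0.
  have [i il vi] := cov _ (subsetP ZW _ vZ).
  have [|m mn [vm mm]] := @node_min (fun i => v \in b i); first by exists i.
  by exists m.
have [m mP] := choice ex.
case: (arg_maxnP (fun v => rk (m v)) zZ) => v0 v0Z maxv.
have [m0n v0m min0] := mP _ v0Z; exists (m v0) => //; apply/subsetP => v vZ.
have [mn vm minv] := mP _ vZ.
have [c cn [v0c vc H]] : exists2 c, c < n & [/\ v0 \in b c, v \in b c &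
    (forall l, l < n -> v0 \in b l -> rk c <= rk l) \/ (forall l, l < n -> v \in b l -> rk c <= rk l)].
  apply: (subtree_common (@vertex_subtree v0) (@vertex_subtree v)).
  have [->|nv] := eqVneq v v0; first by exists (m v0).
  rewrite eq_sym in nv; have [i il /andP[h1 h2]] := ed v0 v (subsetP ZW _ v0Z) (subsetP ZW _ vZ) (cZ _ _ v0Z vZ nv).
  by exists i.
have h1 := min0 _ cn v0c; have h3 := maxv _ vZ; have h4 := minv _ cn vc.
suff -> : m v0 = c by [].
case: H => H; apply: rk_inj => //; first exact: H.
have := H _ mn vm; lia.
Qed.

(** Only the link between [c] and the old root is reversed; [c] gets rank 0 and all other ranks go
    up by one. *)
Lemma reroot_step c : c < n -> c != r -> q c = r ->
  let q' := fun i => if i == r then c else q i in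
  let rk' := fun i => if i == c then 0 else (rk i).+1 in
  tdata e k W n b q' rk' c.
Proof.
move=> cn cr qc q' rk'; have [rn B [qn inj] T cov] := td; split=> //.
- split=> [i il ic|i j il jl].
    rewrite /q' /rk' (negbTE ic) eqxx; have [ir|ir] := eqVneq i r; first by rewrite eqxx.
    have [a1 a2 a3] := qn _ il ir; split=> //; case: ifP => _ //; lia.
  rewrite /rk'; case: eqVneq => [->|_]; case: eqVneq => [->|_] // [] ; exact: inj.
- move=> i l v il ll; rewrite /rk' /q'; have [->|ic] := eqVneq i c; first by rewrite ltn0.
  have [->|ir] := eqVneq i r.
    case: eqVneq => [-> //|lc]; rewrite ltnS => h.
    by have := root_min ll; lia.
  case: eqVneq => [->|lc]; last by rewrite ltnS; exact: T.
  move=> _ vi vc; have [h|h] := ltnP (rk c) (rk i); first exact: T vi vc.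
  have ne : rk i < rk c.
    rewrite ltn_neqAle h andbT; apply/eqP => /(inj _ _ il cn) E.
    by rewrite E eqxx in ic.
  have vr : v \in b r by rewrite -qc; exact: T vc vi.
  by apply: T vi vr => //; have [] := qn _ il ir.
Qed.

End Nodes.

(** Induction on the number of parent steps from [c] to the root: moving the root to its child on
    this path saves one step. *)
Lemma reroot e k W n b q rk r c : tdata e k W n b q rk r -> c < n ->
  exists q' rk', tdata e k W n b q' rk' c.
Proof.
move=> td cn.
have [t tE] : exists t, iter t q c = r.
  move: {2}(rk c).+1 (ltnSn (rk c)) => m; elim: m c cn => // m IH c cn cm.
  have [->|cr] := eqVneq c r; first by exists 0.
  have [rn _ [qn _] _ _] := td; have [a1 a2 a3] := qn _ cn cr.
  by case: (IH _ a1) => [|t <-]; [lia|exists t.+1; rewrite iterSr].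
have [s [sE smin]] : exists s, iter s q c = r /\ forall t, t < s -> iter t q c != r.
  have ex : exists t, iter t q c == r by exists t; apply/eqP.
  case: (ex_minnP ex) => s /eqP sE smin; exists s; split=> // u us.
  by apply/negP => /smin; lia.
elim: s q rk r td {t tE} sE smin => [|s IH] q rk r td sE smin.
  by rewrite -sE in td; exists q, rk.
have [rn _ [qn _] _ _] := td.
have ln l : l <= s -> iter l q c < n.
  elim: l => [|l IHl] //= ls; have [] := qn (iter l q c) => //; first by apply: IHl; lia.
  by apply: smin; lia.
have cr := smin s (ltnSn s).
have td' := reroot_step td (ln s (leqnn s)) cr sE.
apply: (IH _ _ _ td').
  have it l : l <= s -> iter l (fun i => if i == r then iter s q c else q i) c = iter l q c.
    elim: l => [|l IHl] //= ls; rewrite IHl; last by lia.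
    by rewrite (negbTE (smin l _)) //; lia.
  exact: it.
move=> t ts.
have it l : l <= s -> iter l (fun i => if i == r then iter s q c else q i) c = iter l q c.
  elim: l => [|l IHl] //= ls; rewrite IHl; last by lia.
  by rewrite (negbTE (smin l _)) //; lia.
rewrite it; last by lia.
apply/eqP => E.
have : rk (iter s q c) < rk (iter t q c).
  have dec l : t < l <= s -> rk (iter l q c) < rk (iter t q c).
    elim: l => [|l IHl] // /andP[tl ls]; rewrite /=.
    have [a1 a2 a3] := qn _ (ln l (ltnW ls)) (smin l (ltn_trans ls (ltnSn s))).
    have [->//|tl'] := eqVneq t l; have : t < l <= s by lia.
    by move/IHl; lia.
  by apply: dec; lia.
by rewrite E ltnn.
Qed.

Lemma rtd_clique e k W Z : tdl e k W -> Z \subset W ->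
  {in Z &, forall x y, x != y -> e x y} -> rtd e k W Z.
Proof.
move=> [n [b [q [rk [r [td _]]]]]] ZW cZ.
have [c cn Zb] := clique_bag td ZW cZ; have [q' [rk' td']] := reroot td cn.
by exists n, b, q', rk', c.
Qed.

(** Contraction of [F] to [x]. In every bag that meets [F] the vertices of [F] are replaced by [x],
    so no bag grows; by [conn_subtree] these bags form a subtree. *)
Lemma tdl_contract e e' k W F x : tdl e k W -> symmetric e -> symmetric e' ->
  conn e F -> x \in F -> F \subset W ->
  (forall u v, u \in W :\: F -> v \in W :\: F -> e' u v -> e u v) ->
  (forall v, v \in W :\: F -> e' x v -> exists2 f, f \in F & e f v) ->
  tdl e' k (x |: (W :\: F)).
Proof.
move=> [n [b [q [rk [r [td _]]]]]] eS e'S cF xF FW e1 e2.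
have sF := conn_subtree td eS cF xF FW.
have [rn B [qn inj] T [cov ed]] := td.
pose hit i := [exists v in F, v \in b i].
have hitP i : reflect (exists2 v, v \in F & v \in b i) (hit i) by exact: exists_inP.
pose b' i := (b i :\: F) :|: (if hit i then [set x] else set0).
have b'x i : (x \in b' i) = hit i.
  by rewrite /b' !inE xF /=; case: (hit i); rewrite ?inE ?eqxx.
have b'n i v : v \in W :\: F -> (v \in b' i) = (v \in b i).
  rewrite /b' !inE => /andP[vF vW]; rewrite vF /=.
  have vx : v != x by apply: contraNneq vF => ->.
  by case: (hit i); rewrite ?inE ?(negbTE vx) orbF.
exists n, b', q, rk, r; rewrite sub0set; split=> //; split=> //.
- move=> i il; have [bW bk] := B _ il; split.
    apply/subsetP => v; rewrite /b' !inE => /orP[/andP[-> /(subsetP bW)->]|]; first by rewrite orbT.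
    by case: (hit i); rewrite ?inE // => ->.
  rewrite /b'; case: hitP => [[v vF vb]|_]; last first.
    by rewrite setU0; apply: leq_trans bk; exact: subset_leq_card (subsetDl _ _).
  apply: leq_trans bk; rewrite -(cardsID F (b i)) addnC.
  apply: leq_trans (leq_card_setU _ _) _; rewrite leq_add2l cards1.
  by rewrite card_gt0; apply/set0Pn; exists v; rewrite inE vb.
- move=> i l v il ll h; have [E|vx] := eqVneq v x.
    by rewrite E !b'x => /hitP hi /hitP hl; apply/hitP; exact: sF hi hl.
  case vWF : (v \in W :\: F); first by rewrite !b'n //; exact: T.
  have nb j : j < n -> v \notin b' j.
    move=> jl; apply/negP; rewrite /b' !inE.
    have [bW _] := B _ jl; move: vWF; rewrite !inE => vWF.
    by case/orP => [/andP[h1 /(subsetP bW) h2]|]; [rewrite h1 h2 in vWF|case: (hit j); rewrite !inE // (negbTE vx)].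
  by rewrite (negbTE (nb i il)).
- have xh : exists2 i, i < n & hit i.
    by have [i il xi] := cov _ (subsetP FW _ xF); exists i => //; apply/hitP; exists x.
  split=> [v|u v].
    rewrite !inE => /orP[/eqP->|vWF]; first by have [i il h] := xh; exists i; rewrite ?b'x.
    have [|i il vi] := cov v; first by case/andP: vWF.
    by exists i; rewrite ?b'n // inE.
  have key w : w \in W :\: F -> e' x w -> exists2 i, i < n & (x \in b' i) && (w \in b' i).
    move=> wWF xw; have [f fF fw] := e2 _ wWF xw.
    have wW : w \in W by move: wWF; rewrite inE => /andP[].
    have [i il /andP[fi wi]] := ed _ _ (subsetP FW _ fF) wW fw.
    by exists i => //; rewrite b'x b'n // wi andbT; apply/hitP; exists f.
  rewrite 2!(in_setU1 _ x) => /orP[/eqP->|uW] /orP[/eqP->|vW] uv.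
  + by have [i il h] := xh; exists i; rewrite ?b'x ?h.
  + exact: key.
  + rewrite e'S in uv; have [i il /andP[h1 h2]] := key _ uW uv.
    by exists i; rewrite ?h1 ?h2.
  + have uW' : u \in W by move: uW; rewrite inE => /andP[].
    have vW' : v \in W by move: vW; rewrite inE => /andP[].
    have [i il h] := ed _ _ uW' vW' (e1 _ _ uW vW uv).
    by exists i; rewrite ?b'n.
Qed.

(** A decomposition of a quotient lifts by taking preimages of bags, whose size grows by the largest
    size of a fibre. *)
Lemma tdl_preim e (eQ : rel V) (rho : V -> V) k m :
  (forall u v, e u v -> rho u = rho v \/ eQ (rho u) (rho v)) ->
  (forall v, #|[set u | rho u == v]| <= m) ->
  tdl eQ k setT -> tdl e (k * m) setT.
Proof.
move=> he hm [n [b [q [rk [r [[rn B Q T [cov ed]] _]]]]]].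
exists n, (fun i => rho @^-1: b i), q, rk, r; split; last exact: sub0set.
split=> //.
- move=> i il; split; first exact: subsetT.
  have [_ bk] := B _ il.
  have -> : rho @^-1: b i = \bigcup_(v in b i) [set u | rho u == v].
    apply/setP => u; rewrite inE; apply/idP/bigcupP => [h|[v vb]]; last by rewrite inE => /eqP->.
    by exists (rho u); rewrite ?inE.
  apply: leq_trans (_ : \sum_(v in b i) m <= _); last by rewrite sum_nat_const leq_mul2r bk orbT.
  apply: (@leq_trans (\sum_(v in b i) #|[set u | rho u == v]|)); last by apply: leq_sum.
  elim/big_ind2: _ => // [|A1 n1 A2 n2 h1 h2]; first by rewrite cards0.
  by apply: leq_trans (leq_card_setU _ _) _; exact: leq_add.
- by move=> i l v il ll h; rewrite !inE; exact: T.
- split=> [v _|u v _ _ /he[E|E]].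
  + by have [i il h] := cov (rho v) (in_setT _); exists i; rewrite ?inE.
  + by have [i il h] := cov (rho v) (in_setT _); exists i; rewrite ?inE ?E ?h.
  + by have [i il h] := ed _ _ (in_setT _) (in_setT _) E; exists i; rewrite ?inE.
Qed.

End TreeData.

Lemma tdl_treewidth (G : sgraph) k : tdl (@sedge G) k.+1 setT -> treewidth G <= k.
Proof.
case=> n [b [q [rk [r [td _]]]]]; have [rn B [qn inj] T [cov ed]] := td.
pose te : rel 'I_n := fun i j => ((i != r :> nat) && (q i == j)) || ((j != r :> nat) && (q j == i)).
have teS : symmetric te by move=> i j; rewrite /te orbC.
have teI : irreflexive te.
  move=> i; rewrite /te orbb; apply/negbTE/negP => /andP[ir /eqP E].
  by have [_] := qn _ (ltn_ord i) ir; rewrite E ltnn.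
have teq (i j : 'I_n) : i != r :> nat -> q i = j -> te i j by rewrite /te => -> ->; rewrite eqxx.
pose T0 := SGraph teS teI; pose bb (i : T0) := b i.
suff : has_decomposition_of_width G (width bb).
  move=> h; rewrite /treewidth; case: ex_minnP => m _ minm.
  have wk : width bb <= k.
    rewrite /width -ltnS; case E : (\max_(x : T0) #|bb x|) => [|w] //=; rewrite -E.
    by apply/bigmax_leqP => i _; case: (B _ (ltn_ord i)).
  by apply: leq_trans wk; apply: minm; apply/asboolP.
have prec (i j : 'I_n) : te i j -> rk j <= rk i -> q i = j.
  case/orP => /andP[ir /eqP E //] h; have [_ a2 _] := qn _ (ltn_ord j) ir.
  rewrite E in a2; lia.
exists T0, bb; split=> //; split.
- split; first by apply/card_gt0P; exists (Ordinal rn).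
    apply: (@conn_base _ _ teS _ (Ordinal rn : T0)) => x _.
    rewrite (conn_sym teS).
    move: {2}(rk x).+1 (ltnSn (rk x)) => m; elim: m x => // m IH x xm.
    have [E|xr] := eqVneq (x : nat) r.
      by have -> : x = Ordinal rn by exact: val_inj.
    have [a1 a2 a3] := qn _ (ltn_ord x) xr.
    apply: connect_trans (IH (Ordinal a1 : T0) _); last by rewrite /=; lia.
    by apply: connect_restr1; rewrite ?in_setT //; apply: teq.
  move=> s us cs; rewrite ltnNge; apply/negP => s3.
  have s0 : 0 < size s by lia.
  case: s us cs s3 s0 => // y s us cs s3 _.
  (* Acyclicity: at a node of largest rank on a cycle, both neighbours on the cycle would be its
     parent. *)
  have [x xs maxx] : exists2 x, x \in y :: s & forall z, z \in y :: s -> rk (z : 'I_n) <= rk (x : 'I_n).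
    case: (@arg_maxnP T0 y (mem (y :: s)) (fun z => rk (z : 'I_n))) => [|x xs h]; first exact: mem_head.
    by exists x.
  have [i s' E] := rot_to xs.
  have sub z : z \in x :: s' -> z \in y :: s by rewrite -E mem_rot.
  rewrite -(rot_cycle i) E in cs; rewrite -(rot_uniq i) E in us.
  rewrite -(size_rot i) E in s3.
  case: s' cs us s3 sub {E} => [|a [|a' t]] //= /andP[xa].
  rewrite rcons_path => /and3P[_ _ lx] /and4P[_ /negP na _ _] _ sub.
  have l_in : last a' t \in a' :: t by exact: mem_last.
  have qa : q (x : 'I_n) = (a : 'I_n).
    by apply: prec xa (maxx _ (sub _ _)); rewrite !inE eqxx orbT.
  have ql : q (x : 'I_n) = (last a' t : 'I_n).
    apply: prec; first by rewrite teS.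
    by apply: maxx; apply: sub; rewrite 2!inE l_in !orbT.
  by apply: na; rewrite (_ : a = last a' t) //; apply: val_inj; rewrite /= -qa -ql.
- move=> v; have [i il vi] := cov v (in_setT _); by exists (Ordinal il).
- move=> u v uv; have [i il h] := ed u v (in_setT _) (in_setT _) uv; by exists (Ordinal il).
- move=> v.
  (* From any node whose bag contains [v], parents lead to the one of least rank. *)
  have [|c cn [vc cm]] := @node_min n rk (fun i => v \in b i).
    by have [i il vi] := cov v (in_setT _); exists i.
  apply: (@conn_base _ _ teS _ (Ordinal cn : T0)) => x; rewrite inE (conn_sym teS).
  move: {2}(rk x).+1 (ltnSn (rk x)) => m; elim: m x => // m IH x xm vx.
  have [E|xc] := eqVneq (x : nat) c.
    by have -> : x = Ordinal cn by exact: val_inj.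
  have hc : rk c < rk x.
    rewrite ltn_neqAle cm // andbT; apply/eqP => /inj E; rewrite E ?eqxx // in xc.
  have [a1 a2] := parent_ok td (ltn_ord x) cn hc.
  have vq : v \in b (q x) by apply: T vx vc.
  apply: connect_trans (IH (Ordinal a1 : T0) _ _) => //; last by rewrite /=; lia.
  apply: connect_restr1; rewrite ?inE //.
  apply: teq => //; apply: contraTneq hc => ->; rewrite -leqNgt; exact: root_min td _ cn.
Qed.

(** * A path meeting all large connected sets *)

Lemma extend_card (T : finType) (X W : {set T}) m : X \subset W -> #|X| <= m <= #|W| ->
  exists X' : {set T}, [/\ X \subset X', X' \subset W & #|X'| = m].
Proof.
move=> XW /andP[Xm mW].
elim: m Xm mW => [|m IH] Xm mW.
  by exists X; split=> //; apply/eqP; rewrite -leqn0.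
have [E|ne] := eqVneq #|X| m.+1; first by exists X.
have [|X' [XX' X'W E]] := IH _ (ltnW mW); first by lia.
have /card_gt0P[x] : 0 < #|W :\: X'| by rewrite cardsD (setIidPr X'W) E subn_gt0.
rewrite inE => /andP[xX' xW]; exists (x |: X'); split.
- exact: subset_trans XX' (subsetUr _ _).
- by rewrite subUset sub1set xW.
- by rewrite cardsU1 xX' E.
Qed.

Lemma meets (T : finType) (S A B : {set T}) : A \subset S -> B \subset S -> #|S| < #|A| + #|B| ->
  exists2 x, x \in A & x \in B.
Proof.
move=> AS BS lt; suff /card_gt0P[x] : 0 < #|A :&: B| by rewrite inE => /andP[]; exists x.
have : #|A :|: B| <= #|S| by apply: subset_leq_card; rewrite subUset AS.
by rewrite cardsU; have := subset_leq_card (subsetIl A B); lia.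
Qed.

Section Bramble.
Variables (V : finType) (e : rel V).
Hypothesis eS : symmetric e.

(** If every [X] had a balanced separator [Z], a decomposition could be built from the root
    downwards: the root bag is [X] with [Z], and each remaining component is decomposed recursively
    with its neighbours in that bag prescribed for its own root. *)
Lemma bramble_set theta (W : {set V}) : ~ tdl e (3 * theta) W ->
  exists X : {set V}, #|X| = 2 * theta /\
    forall Z : {set V}, #|Z| < theta ->
      exists C, [/\ conn e C, C \subset W :\: Z & theta < #|X :&: C|].
Proof.
move=> ntd; apply: contrapT => noX.
have H (X : {set V}) : #|X| = 2 * theta -> exists Z : {set V}, #|Z| < theta /\
    forall C, conn e C -> C \subset W :\: Z -> #|X :&: C| <= theta.
  move=> Xt; apply: contrapT => nZ; apply: noX; exists X; split=> // Z Zt.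
  apply: contrapT => nC; apply: nZ; exists Z; split=> // C cC CW.
  by rewrite leqNgt; apply/negP => h; apply: nC; exists C.
apply: ntd; rewrite /tdl.
suff main m : forall W' X : {set V}, #|W'| < m -> W' \subset W -> X \subset W' -> #|X| <= 2 * theta ->
    rtd e (3 * theta) W' X.
  by apply: (main #|W|.+1) => //; rewrite ?sub0set ?cards0.
elim: m => // m IH W' X0 W'm W'W XW' X0t.
have [W't|W't] := leqP #|W'| (3 * theta); first exact: rtd_leaf.
have [|X [X0X XW Xt]] := @extend_card _ X0 W' (2 * theta) XW'; first by lia.
have [Z [Zt HZ]] := H X Xt.
pose Y := X :|: (Z :&: W').
have YW' : Y \subset W' by rewrite subUset XW subsetIr.
have Yt : #|Y| <= 3 * theta.
  apply: leq_trans (leq_card_setU _ _) _; rewrite Xt.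
  by have := subset_leq_card (subsetIl Z W'); lia.
have XY : X \subset Y := subsetUl _ _.
apply: (rtd_sub (subset_trans X0X XY)).
(* [W2] consists of [Y] and some components of [W' :\: Y]; these are split off one at a time, and
   the rest keeps [Y] in its root bag. *)
suff inner l : forall W2 : {set V}, #|W2| < l -> Y \subset W2 -> W2 \subset W' ->
    (forall a b, a \in W2 :\: Y -> b \in W' :\: Y -> e a b -> b \in W2) -> rtd e (3 * theta) W2 Y.
  by apply: (inner #|W'|.+1) => // a b _; rewrite inE => /andP[].
elim: l => // l IHl W2 W2l YW2 W2W' cl.
have [E|[x xW2]] := set_0Vmem (W2 :\: Y).
  apply: rtd_leaf => //; suff -> : W2 = Y by [].
  by apply/eqP; rewrite eqEsubset YW2 andbT -setD_eq0 E.
have xS : x \in W' :\: Y by move: xW2; rewrite !inE => /andP[-> /(subsetP W2W')].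
pose C := comp e (W' :\: Y) x; have CS : C \subset W' :\: Y := comp_sub xS.
have CY c : c \in C -> c \notin Y by move=> /(subsetP CS); rewrite inE => /andP[].
have xC : x \in C := comp_id _ _ _.
have CW2 : C \subset W2.
  apply/subsetP => c; rewrite inE => /closed_connect h.
  suff : c \in W2 :\: Y by rewrite inE => /andP[].
  apply: h xW2 => a b aS bS ab; rewrite inE (cl _ _ aS bS ab) andbT.
  by move: bS; rewrite inE => /andP[].
pose N := [set y in Y | [exists c in C, e c y]].
have NY : N \subset Y by apply/subsetP => y; rewrite inE => /andP[].
(* By the choice of [Z] at most [theta] neighbours of [C] outside [Z] lie in [X], and fewer than
   [theta] are in [Z]; so they qualify as a prescribed set for the recursion. *)
have Nt : #|N| < 2 * theta.
  pose C' := comp e (W' :\: Z) x.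
  have sYZ : W' :\: Y \subset W' :\: Z.
    apply/subsetP => z; rewrite !in_setD => /andP[zY zW]; rewrite zW andbT.
    by apply: contra zY => zZ; rewrite /Y !inE zZ zW orbT.
  have xS' := subsetP sYZ _ xS.
  have CC' : C \subset C'.
    exact: conn_sub_comp (comp_conn eS xS) (subset_trans CS sYZ) (comp_id _ _ _).
  have hC : #|X :&: C'| <= theta.
    apply: HZ; first exact: comp_conn.
    exact: subset_trans (comp_sub xS') (setSD _ W'W).
  have : N \subset (X :&: C') :|: Z.
    apply/subsetP => y; rewrite inE => /andP[yY /exists_inP[c cC cy]].
    have [yZ|yZ] := boolP (y \in Z); first by rewrite inE yZ orbT.
    have yX : y \in X by move: yY; rewrite !inE (negbTE yZ) orbF.
    rewrite !inE yX /= orbC (negbTE yZ) /=.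
    have := comp_closed xS' (subsetP CC' _ cC) _ cy; rewrite !inE yZ (subsetP YW') //.
    exact.
  move=> /subset_leq_card h; have h' := leq_trans h (leq_card_setU _ _).
  by apply: (leq_ltn_trans h'); clear -hC Zt; lia.
have W2E : W2 = (W2 :\: C) :|: (C :|: N).
  apply/setP => z; rewrite 2!in_setU in_setD; case: (boolP (z \in C)) => [/(subsetP CW2)->//|_] /=.
  by case: (boolP (z \in N)) => [/(subsetP NY)/(subsetP YW2)->|_]; rewrite ?orbF ?orbT.
rewrite W2E; apply: (rtd_glue (X2 := N)) => //.
- apply: IHl.
  + have : W2 :\: C \proper W2.
      rewrite properE subsetDl; apply/subsetPn; exists x; first exact: (subsetP CW2).
      by rewrite inE xC.
    by move/proper_card => h; exact: leq_trans h W2l.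
  + by apply/subsetP => y yY; rewrite inE (subsetP YW2) // andbT; apply: contraL yY; exact: CY.
  + exact: subset_trans (subsetDl _ _) W2W'.
  + move=> a b; rewrite [a \in _]in_setD [a \in _ :\: C]in_setD => /and3P[aY aC aW2] bS ab.
    have aS : a \in W' :\: Y by rewrite inE aY (subsetP W2W').
    rewrite in_setD (cl a b) ?in_setD ?aY // ?andbT; last by rewrite -in_setD.
    by apply: contra aC => bC; apply: (comp_closed xS bC aS); rewrite eS.
- apply: IH.
  + have : C :|: N \proper W'.
      rewrite properEneq subUset (subset_trans CS (subsetDl _ _)) (subset_trans NY) // !andbT.
      apply/eqP => E; have : X \subset N.
        apply/subsetP => y yX; have := subsetP XW _ yX; rewrite -E inE => /orP[/CY|//].
        by rewrite (subsetP XY).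
      by move/subset_leq_card; rewrite Xt leqNgt Nt.
    by move/proper_card => h; exact: leq_trans h W'm.
  + rewrite subUset; apply/andP; split; last exact: subset_trans NY (subset_trans YW' W'W).
    exact: subset_trans CS (subset_trans (subsetDl _ _) W'W).
  + exact: subsetUr.
  + exact: ltnW.
- apply/subsetP => z; rewrite inE in_setD in_setU => /andP[/andP[/negbTE->] _] /=.
  exact: (subsetP NY).
- apply/subsetP => z; rewrite inE in_setD in_setU => /andP[/andP[/negbTE->] _] //.
- move=> u v; rewrite in_setD => /andP[uC uW2]; rewrite in_setU => /orP[vC|vN] uv; last first.
    by rewrite in_setD (subsetP YW2) ?(subsetP NY) // andbT; apply/orP; right; apply: contraL (subsetP NY _ vN) => /CY.
  have uY : u \in Y.
    apply: contraT => uY; case/negP: uC; apply: (comp_closed xS vC); last by rewrite eS.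
    by rewrite inE uY (subsetP W2W').
  by rewrite in_setU [u \in N]inE uY /=; apply/orP; left; apply/orP; right; apply/exists_inP; exists v; rewrite // eS.
Qed.

(** * Big connected sets and a path cut into rich segments *)

Section Big.
Variables (theta : nat) (X : {set V}).
Hypothesis Xt : #|X| = 2 * theta.
Hypothesis Xbig : forall Z : {set V}, #|Z| < theta ->
  exists C, [/\ conn e C, [disjoint C & Z] & theta < #|X :&: C|].

(** More than half of [X], so that any two big sets meet. *)
Definition big (C : {set V}) : Prop := conn e C /\ theta < #|X :&: C|.

Lemma big_meet C C' : big C -> big C' -> exists2 x, x \in C & x \in C'.
Proof.
move=> [_ h] [_ h'].
have [|x xC xC'] := @meets _ X (X :&: C) (X :&: C') (subsetIl _ _) (subsetIl _ _); first by lia.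
by exists x; [move: xC|move: xC']; rewrite inE => /andP[].
Qed.

(** Take a path meeting as many big sets as possible among those that meet some big set [B] in their
    last vertex only. If it missed a big set [C], a shortest path inside [B] from its end to [C]
    would extend it: the extension avoids the old path because it runs in [B], and it meets [C] in
    its end only. *)
Lemma bramble_path : 0 < theta ->
  exists s, [/\ uniq s, sorted e s & forall C, big C -> exists2 x, x \in s & x \in C].
Proof.
move=> t0.
pose hits s := #|[set C : {set V} | `[< big C >] && has (mem C) s]|.
pose P s := [/\ uniq s, sorted e s & exists x p B, [/\ s = x :: p, big B, last x p \in B &
   forall z, z \in x :: p -> z \in B -> z = last x p]].
pose Q n := `[< exists2 s, P s & hits s = n >].
have exQ : exists n, Q n.
  have [|B [cB _ hB]] := Xbig (Z := set0); first by rewrite cards0.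
  have /card_gt0P[x] : 0 < #|X :&: B| by lia.
  rewrite inE => /andP[_ xB]; exists (hits [:: x]); apply/asboolP; exists [:: x] => //.
  by split=> //; exists x, [::], B; split=> // z; rewrite inE => /eqP.
have ubQ n : Q n -> n <= #|{set V}|.
  by move=> /asboolP[s _ <-]; exact: max_card.
case: (ex_maxnP exQ ubQ) => n /asboolP[s [us ss [x [p [B [sE bB lB HB]]]]] sn] maxn.
exists s; split=> // C bC; apply: contrapT => nC.
have noC z : z \in s -> z \in C -> False by move=> zs zC; apply: nC; exists z.
have [w wB wC] := big_meet bB bC.
have [s' [s'0 s'B [us' ip] [h1 h2] [h3 h4]]] :=
  shortest (e := e) (A := pred1 (last x p)) (B := mem C) (eqxx _ : pred1 (last x p) (last x p)) wC lB (bB.1 _ _ lB wB).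
have ss' := ipath_sorted (conj us' ip).
case: s' s'0 s'B us' ss' {ip} h1 h2 h3 h4 => // v q _ s'B us' ss' /= /eqP vE h2 _ h4.
subst v.
pose t := x :: p ++ q.
have tE : t = s ++ q by rewrite sE.
have ts : sorted e t by rewrite /t /= cat_path; move: ss; rewrite sE /= => ->.
have ut : uniq t.
  rewrite tE cat_uniq us /=; move: us' => /= /andP[lq ->]; rewrite andbT.
  apply/hasPn => z zq; apply/negP => zs; have zB : z \in B by apply: s'B; rewrite inE zq orbT.
  by move: lq; rewrite -(HB z) ?zq // -sE.
have lt : last x (p ++ q) = last (last x p) q by rewrite last_cat.
have Pt : P t.
  split=> //; exists x, (p ++ q), C; split=> //; first by rewrite lt.
  move=> z; rewrite -/t tE mem_cat => /orP[zs zC|zq zC]; first by case: (noC z).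
  have zi : z \in last x p :: q by rewrite inE zq orbT.
  rewrite lt; exact: (@only_last _ (last x p) (last x p :: q) (mem C) z h4 zi zC).
have : hits s < hits t.
  apply: proper_card; rewrite properE; apply/andP; split.
    apply/subsetP => D; rewrite !inE tE has_cat => /andP[-> ->] //.
  apply/subsetPn; exists C; rewrite !inE.
    apply/andP; split; first exact/asboolP.
    by apply/hasP; exists (last x (p ++ q)); [exact: mem_last|rewrite lt].
  by rewrite negb_and; apply/orP; right; apply/hasPn => z /noC zC; apply/negP.
have : Q (hits t) by apply/asboolP; exists t.
move/maxn; lia.
Qed.

(** It takes at least [k] vertices to meet all the big sets that meet [s]. *)
Definition rich k (s : seq V) : Prop := forall Z : {set V}, #|Z| < k ->
  exists B, [/\ big B, [disjoint B & Z] & exists2 x, x \in s & x \in B].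

(** Cut off the shortest rich prefix. Without its last vertex [y] it is not rich, which is witnessed
    by a set [Z1] of fewer than [k] vertices; adding [Z1] and [y] to a set of fewer than [k * m]
    vertices stays below the richness of [s], so the remainder is still rich enough for
    induction. *)
Lemma rich_segments k m s : 0 < k -> uniq s -> sorted e s -> rich (k * m) s ->
  exists Q : nat -> seq V, forall i, i < m ->
    [/\ uniq (Q i), sorted e (Q i), rich k (Q i), {subset Q i <= s} &
        forall j x, j < m -> x \in Q i -> x \in Q j -> i = j].
Proof.
move=> k0; elim: m s => [|m IH] s us ss rs; first by exists (fun=> [::]).
have ex : exists i, `[< rich k (take i s) >].
  exists (size s); apply/asboolP; rewrite take_size => Z Zk; apply: rs; lia.
case: (ex_minnP ex) => i /asboolP ri mini.
have i0 : 0 < i.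
  rewrite lt0n; apply/eqP => i0; have [|B [_ _ [x]]] := ri set0; first by rewrite cards0.
  by rewrite i0 take0.
have [Z1 [Z1k HZ1]] : exists Z1 : {set V}, #|Z1| < k /\ forall B, big B -> [disjoint B & Z1] ->
    forall x, x \in take i.-1 s -> x \in B -> False.
  apply: contrapT => H; have : `[< rich k (take i.-1 s) >].
    apply/asboolP => Z Zk; apply: contrapT => H2; apply: H; exists Z; split=> // B bB BZ x xs xB.
    by apply: H2; exists B; split=> //; exists x.
  by move/mini; lia.
have [i_s|si] := ltnP i.-1 (size s); last first.
  exfalso; have : `[< rich k (take i.-1 s) >].
    apply/asboolP; move: ri; rewrite !take_oversize //; lia.
  by move/mini; lia.
have [x0 _] : exists x0, x0 \in s by case: (s) i_s => // x0 ? _; exists x0; rewrite mem_head.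
pose y := nth x0 s i.-1.
have rd : rich (k * m) (drop i s).
  move=> Z Zk; have [|B [bB BZ [x xs xB]]] := rs (Z :|: Z1 :|: [set y]).
    apply: leq_ltn_trans (leq_card_setU _ _) _; rewrite cards1.
    rewrite mulnS; move: (leq_card_setU Z Z1).1 Zk Z1k; clear; lia.
  have [BZ1 BZ2 By] : [/\ [disjoint B & Z], [disjoint B & Z1] & y \notin B].
    move: BZ; rewrite !(disjoint_sym B) -!setI_eq0 => /eqP BZ.
    have sub (D : {set V}) : D \subset Z :|: Z1 :|: [set y] -> D :&: B == set0.
      by move=> sD; rewrite -subset0 -BZ; exact: setSI.
    split; [apply: sub|apply: sub|].
    - by rewrite -setUA subsetUl.
    - by rewrite -setUA subsetU // orbC subsetUl.
    - apply/negP => yB; have : y \in (Z :|: Z1 :|: [set y]) :&: B by rewrite !inE eqxx orbT yB.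
      by rewrite BZ inE.
  exists B; split=> //; exists x => //.
  have : x \in take i s ++ drop i s by rewrite cat_take_drop.
  rewrite mem_cat => /orP[|//].
  have -> : i = i.-1.+1 by lia.
  rewrite (take_nth x0) // mem_rcons inE => /orP[/eqP E|xt].
    by rewrite E -/y (negbTE By) in xB.
  by case: (HZ1 B bB BZ2 x).
have [Q HQ] := IH _ (drop_uniq i us) (drop_sorted i ss) rd.
exists (fun j => if j is j'.+1 then Q j' else take i s).
have tQ x j : j < m -> x \in take i s -> x \in Q j -> False.
  move=> jm xt /(let: And5 _ _ _ h _ := HQ _ jm in h) xd.
  by move: us; rewrite -(cat_take_drop i s) cat_uniq => /and3P[_ /hasPn/(_ _ xd)/negP].
case=> [_|j jm] /=.
  split=> //; [exact: take_uniq|exact: take_sorted|by move=> x /mem_take|].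
  by case=> // j x jm xt xQ; case: (tQ x j).
have [a1 a2 a3 a4 a5] := HQ j jm.
split=> //; first by move=> x /a4/mem_drop.
by case=> [|l] x lm xQ xt; [case: (tQ x j)|rewrite (a5 l x)].
Qed.

End Big.
End Bramble.

(** * Menger's theorem *)

Section Menger.
Variable V : finType.
Implicit Types (e : rel V) (A B S T U : {set V}).

Definition joined e A B S : Prop :=
  exists a b, [/\ a \in A :\: S, b \in B & connect (restr e (~: S)) a b].

(** Disjoint connected sets instead of paths: they can be joined by unions, and paths are extracted
    by [linked_seq] when an order is wanted. *)
Definition linked e A B k (P : 'I_k -> {set V}) : Prop :=
  (forall i, [/\ conn e (P i), exists2 a, a \in P i & a \in A & exists2 b, b \in P i & b \in B]) /\
  (forall i j x, x \in P i -> x \in P j -> i = j).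

Lemma joinedC e A B S : symmetric e -> joined e A B S -> joined e B A S.
Proof.
move=> eS [a [b [aA bB ab]]]; exists b, a.
have aS : a \in ~: S by move: aA; rewrite !inE => /andP[].
have := connect_restr_in aS ab; rewrite inE => bS; rewrite inE bS bB (conn_sym eS) ab.
by split=> //; move: aA; rewrite inE => /andP[].
Qed.

Lemma connect_rel_mono e e' S x y : subrel e' e -> connect (restr e' S) x y -> connect (restr e S) x y.
Proof.
move=> sub; apply: connect_sub => a b /= /and3P[aS bS ab].
by apply: connect_restr1 => //; exact: sub.
Qed.

Lemma conn_rel_mono e e' S : subrel e' e -> conn e' S -> conn e S.
Proof. by move=> sub cS x y xS yS; apply: connect_rel_mono sub _; exact: cS. Qed.

(* The step of Goering's proof: S separates A from B once the edge xy is deleted, x being on the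
   side of A.  Then separating A from S + x without xy also separates A from B. *)
Lemma menger_half e A B S x y T : symmetric e ->
  let e' : rel V := fun u v => e u v && ~~ (((u == x) && (v == y)) || ((u == y) && (v == x))) in
  ~ joined e' A B S -> x \notin S -> y \notin S ->
  (exists2 b, b \in B & connect (restr e' (~: S)) y b) ->
  joined e A B T -> joined e' A (x |: S) T.
Proof.
move=> eS e' nj xS yS [b' b'B yb'] [a [b [aA bB ab]]].
apply: contrapT => nT.
have e'S : symmetric e' by move=> u v; rewrite /e' eS orbC ![(v == _) && _]andbC.
have aT : a \in ~: T by move: aA; rewrite !inE => /andP[].
have aA' : a \in A by move: aA; rewrite !inE => /andP[].
pose D := x |: S.
have inD c : c \in D -> connect (restr e' (~: T)) a c -> False.
  by move=> cD ac; apply: nT; exists a, c.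
have aS : a \notin D by apply/negP => /inD; apply; exact: connect0.
(* The component of a in e' minus S and T never leaves through D, nor reaches B. *)
pose R := [set c | connect (restr e' (~: (T :|: S))) a c].
have Rsub c : c \in R -> connect (restr e' (~: T)) a c /\ connect (restr e' (~: S)) a c.
  rewrite inE => ac; split; apply: connect_restr_mono ac; apply/subsetP => z; rewrite !inE negb_or.
    by case/andP.
  by case/andP.
have aR : a \in R by rewrite inE connect0.
have aS' : a \in A :\: S.
  by rewrite inE aA' andbT; apply: contra aS; rewrite !inE => ->; rewrite orbT.
have bR : b \in R.
  apply: closed_connect aR ab => c d cR dT cd.
  have [cT cS] := Rsub _ cR.
  have cx : c != x by apply/eqP => E; apply: (inD x); rewrite ?inE ?eqxx // -E.
  have cy : c != y.
    apply/eqP => E; apply: nj; exists a, b'; split=> //.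
    by apply: connect_trans yb'; rewrite -E.
  have cd' : e' c d by rewrite /e' cd (negbTE cx) (negbTE cy).
  have cT' := connect_restr_in aT cT.
  have dS : d \notin S.
    apply/negP => dS; apply: (inD d); first by rewrite !inE dS orbT.
    by apply: connect_trans cT _; apply: connect_restr1.
  move: cR; rewrite !inE => cR; apply: connect_trans cR (connect_restr1 _ _ cd').
    rewrite !inE negb_or; move: cT'; rewrite inE => ->.
    have aS2 : a \in ~: S by move: aS'; rewrite !inE => /andP[].
    by move: (connect_restr_in aS2 cS); rewrite inE.
  by rewrite !inE negb_or dS andbT; move: dT; rewrite inE.
have [_ bS] := Rsub _ bR; apply: nj; exists a, b; split=> //.
Qed.

Lemma linked_seq e A B k (P : 'I_k -> {set V}) : symmetric e -> linked e A B P ->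
  forall i, exists a s, [/\ a \in A, path e a s /\ uniq (a :: s), {subset a :: s <= P i}, last a s \in B &
    forall z, z \in a :: s -> z \in B -> z = last a s].
Proof.
move=> eS [HP _] i; have [cP [a aP aA] [b bP bB]] := HP i.
have [s [s0 sP ip [h1 h2] [_ h4]]] :=
  shortest (A := mem A) (B := mem B) aA bB aP (cP _ _ aP bP).
case: s s0 sP ip h1 h2 h4 => // c s _ sP ip cA lB h4.
exists c, s; split=> //; first by split; [exact: ipath_sorted ip|exact: ip.1].
by move=> z zs zB; exact: (@only_last _ a (c :: s) (mem B) z h4 zs zB).
Qed.

(** Induction on the number of edges. If deleting an edge destroys the linkage, a set [S] of [k - 1]
    vertices separates [A] from [B] after the deletion; linkages from [A] to [S] plus one end of the
    edge and from [B] to [S] plus the other end exist by induction and are joined along [S] and the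
    edge. *)
Lemma menger e A B k : symmetric e ->
  (forall S, #|S| < k -> joined e A B S) -> exists P : 'I_k -> {set V}, linked e A B P.
Proof.
move: {2}(#|[set p : V * V | e p.1 p.2]|).+1 (ltnSn #|[set p : V * V | e p.1 p.2]|) => m.
elim: m e A B => // m IH e A B em eS sepk.
have [|noedge] := boolP [exists x, exists y, (x != y) && e x y]; last first.
  have kAB : k <= #|A :&: B|.
    rewrite leqNgt; apply/negP => /sepk[a [b [aA bB ab]]].
    have E : b = a.
      case/connectP: ab => p; elim: p a {aA} => [|c p IHp] a //= /andP[/and3P[_ _ ac] cp].
      case: (eqVneq a c) cp => [<-|ne] cp; first exact: IHp.
      by case/existsP: noedge; exists a; apply/existsP; exists c; rewrite ne.
    by move: aA; rewrite !inE -E bB andbT; case/andP=> /negP.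
  exists (fun i => [set enum_val (widen_ord kAB i)]); split=> [i|i j x].
    have := enum_valP (widen_ord kAB i); rewrite inE => /andP[h1 h2].
    by split; [exact: conn1|exists (enum_val (widen_ord kAB i)); rewrite ?set11|exists (enum_val (widen_ord kAB i)); rewrite ?set11].
  rewrite !inE => /eqP-> /eqP/enum_val_inj E; apply: val_inj; exact: (congr1 val E).
case/existsP=> x /existsP[y /andP[nxy xy]].
pose del x y : rel V := fun u v => e u v && ~~ (((u == x) && (v == y)) || ((u == y) && (v == x))).
have delC x0 y0 : del y0 x0 =2 del x0 y0 by move=> u v; rewrite /del orbC.
have delS x0 y0 : symmetric (del x0 y0).
  by move=> u v; rewrite /del eS orbC ![(v == _) && _]andbC.
have delsub x0 y0 : subrel (del x0 y0) e by move=> u v /andP[].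
have edel : #|[set p : V * V | del x y p.1 p.2]| < m.
  rewrite -ltnS; apply: leq_trans em; rewrite ltnS; apply: proper_card; rewrite properE; apply/andP; split.
    by apply/subsetP => p; rewrite !inE => /andP[].
  by apply/subsetPn; exists (x, y); rewrite !inE /del /= ?xy // !eqxx.
have [all|] := pselect (forall S, #|S| < k -> joined (del x y) A B S).
  have [P [P1 P2]] := IH _ _ _ edel (delS _ _) all; exists P; split=> // i.
  by have [a1 a2 a3] := P1 i; split=> //; exact: conn_rel_mono a1.
move/existsNP=> [S /not_implyP[Sk nj]].
have [a [b [aA bB ab]]] := sepk S Sk.
have aS : a \in ~: S by move: aA; rewrite !inE => /andP[].
(* [S] separates only after the deletion, so a walk avoiding [S] uses the deleted edge; [x'] and
   [y'] are its ends, named such that [x'] is on the side of [A] and [y'] on the side of [B]. *)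
have [x' [y' [E' x'S y'S xa yb]]] : exists x' y', [/\ del x' y' =2 del x y /\ e x' y',
    x' \notin S, y' \notin S, exists2 a, a \in A :\: S & connect (restr (del x y) (~: S)) x' a &
    exists2 b, b \in B & connect (restr (del x y) (~: S)) y' b].
  pose R := [set c | connect (restr (del x y) (~: S)) a c].
  have RS c : c \in R -> c \notin S by rewrite inE => /(connect_restr_in aS); rewrite inE.
  have nRB c : c \in R -> (exists2 b, b \in B & connect (restr (del x y) (~: S)) c b) -> False.
    rewrite inE => ac [b0 b0B cb0]; apply: nj; exists a, b0; split=> //.
    exact: connect_trans ac cb0.
  have aR : a \in R by rewrite inE connect0.
  have key c p : c \in R -> path (restr e (~: S)) c p -> last c p = b ->
      exists x' y', [/\ x' \in R, y' \notin S, e x' y', del x' y' =2 del x y &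
        exists2 b, b \in B & connect (restr (del x y) (~: S)) y' b].
    elim: p c => [|d p IHp] c cR /=.
      by move=> _ E; case: (nRB c cR); exists b; rewrite // E.
    case/andP=> /and3P[cS dS cd] dp lE.
    have [dR|dR] := boolP (d \in R); first exact: IHp dR dp lE.
    have ncd : ~~ del x y c d.
      apply: contra dR => h; move: cR; rewrite !inE => cR.
      exact: connect_trans cR (connect_restr1 cS dS h).
    have Ecd : del c d =2 del x y.
      move: ncd; rewrite /del cd /= negbK => /orP[]/andP[/eqP-> /eqP->] u v //.
      by rewrite orbC.
    have suf q w : path (restr e (~: S)) w q -> last w q = b -> w \notin S ->
        (exists2 b, b \in B & connect (restr (del x y) (~: S)) w b) \/
        (exists z, (z == c) || (z == d) /\ (exists2 b, b \in B & connect (restr (del x y) (~: S)) z b)).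
      elim: q w => [|u q IHq] w /=; first by move=> _ -> _; left; exists b; rewrite ?connect0.
      case/andP=> /and3P[wS uS wu] uq lq _.
      have uS' : u \notin S by rewrite inE in uS.
      case: (IHq _ uq lq uS') => [[b0 b0B ub0]|]; last by right.
      have [dwu|] := boolP (del c d w u).
        left; exists b0 => //; apply: connect_trans ub0; apply: connect_restr1 => //.
        by rewrite -Ecd.
      rewrite /del wu /= negbK => /orP[]/andP[_ uE]; right; exists u; rewrite uE ?orbT /=.
        by split; [|exists b0].
      by split; [|exists b0].
    have dS' : d \notin S by rewrite inE in dS.
    exists c, d; split=> //; case: (suf _ _ dp lE dS') => [//|[z [/orP[]/eqP-> //]]].
    by move=> h; case: (nRB c cR).
  case/connectP: ab => p ap lE.
  have [x' [y' [xR yS xy' E hb]]] := key a p aR ap (esym lE).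
  exists x', y'; split=> //; first exact: RS.
  by exists a => //; rewrite (conn_sym (delS _ _)); rewrite inE in xR.
case: E' => E' x'y'.
have delE : del x y = del x' y' by apply/funext => u; apply/funext => v; rewrite E'.
rewrite delE in nj xa yb edel.
have nx'y' : x' != y'.
  apply/eqP => E; apply: nj; case: xa => a' a'A x'a'; case: yb => b' b'B y'b'.
  exists a', b'; split=> //; rewrite E in x'a'.
  by apply: connect_trans y'b'; rewrite (conn_sym (delS _ _)) E.
(* Adding [x'] to [S] removes the edge as well, hence separates [A] from [B] in [e]. *)
have kS : k <= #|S|.+1.
  rewrite leqNgt; apply/negP => h; have := sepk (x' |: S); rewrite cardsU1 x'S => /(_ h).
  case=> [a1 [b1 [a1A b1B ab1]]]; apply: nj; exists a1, b1; split=> //.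
    by move: a1A; rewrite !inE negb_or => /andP[/andP[_ ->] ->].
  apply: connect_sub ab1 => u v /= /and3P[uS vS uv]; apply: connect_restr1.
  - by move: uS; rewrite !inE negb_or => /andP[].
  - by move: vS; rewrite !inE negb_or => /andP[].
  - move: uS vS; rewrite /del uv !inE !negb_or => /andP[/negbTE-> _] /andP[/negbTE-> _].
    by rewrite andbF.
have Sk1 : #|S|.+1 = k by lia.
have [P LP] : exists P : 'I_k -> {set V}, linked (del x' y') A (x' |: S) P.
  apply: IH edel (delS _ _) _ => T Tk.
  exact: (menger_half eS nj x'S y'S yb (sepk T Tk)).
have [R LR] : exists R : 'I_k -> {set V}, linked (del x' y') B (y' |: S) R.
  apply: IH edel (delS _ _) _ => T Tk.
  have njC : ~ joined (del y' x') B A S.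
    have -> : del y' x' = del x' y' by apply/funext => u; apply/funext => v; rewrite delC.
    by move/(joinedC (delS _ _)).
  have xa' : exists2 b, b \in A & connect (restr (del y' x') (~: S)) x' b.
    have -> : del y' x' = del x' y' by apply/funext => u; apply/funext => v; rewrite delC.
    by case: xa => a' a'A h; exists a' => //; move: a'A; rewrite inE => /andP[].
  have := menger_half (T := T) eS njC y'S x'S xa' (joinedC eS (sepk T Tk)).
  by have -> : del x' y' = del y' x' by apply/funext => u; apply/funext => v; rewrite delC.
have ends C (z : V) (Q : 'I_k -> {set V}) : linked (del x' y') C (z |: S) Q -> z \notin S ->
    exists (s : 'I_k -> seq V) (f g : 'I_k -> V), [/\ injective f,
      forall i, [/\ f i \in z |: S, g i \in C, path (del x' y') (g i) (s i) /\ uniq (g i :: s i), last (g i) (s i) = f i &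
         {subset g i :: s i <= Q i}],
      forall i w, w \in g i :: s i -> w \in z |: S -> w = f i &
      forall t, t \in z |: S -> exists i, f i = t].
  move=> LQ zS; have QS := linked_seq (delS _ _) LQ.
  have /choice[gs gsP] : forall i, exists as_ : V * seq V, [/\ as_.1 \in C, path (del x' y') as_.1 as_.2 /\ uniq (as_.1 :: as_.2),
      {subset as_.1 :: as_.2 <= Q i}, last as_.1 as_.2 \in z |: S &
      forall w, w \in as_.1 :: as_.2 -> w \in z |: S -> w = last as_.1 as_.2].
    by move=> i; have [a' [s' h]] := QS i; exists (a', s').
  pose f i := last (gs i).1 (gs i).2.
  have fin i : f i \in Q i by have [_ _ h _ _] := gsP i; apply: h; exact: mem_last.
  have finj : injective f by move=> i j E; apply: (LQ.2 i j (f i)); rewrite // E.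
  exists (fun i => (gs i).2), f, (fun i => (gs i).1); split=> //.
  - by move=> i; have [h1 h2 h3 h4 h5] := gsP i.
  - by move=> i w; have [h1 h2 h3 h4 h5] := gsP i; exact: h5.
  - move=> t tS; have : t \in f @: [set: 'I_k].
      suff -> : f @: [set: 'I_k] = z |: S by [].
      apply/eqP; rewrite eqEcard; apply/andP; split.
        by apply/subsetP => w /imsetP[i _ ->]; have [_ _ _ h _] := gsP i.
      by rewrite card_imset // cardsT card_ord cardsU1 zS add1n Sk1.
    by case/imsetP => i _ ->; exists i.
have [sp [fp [gp [fpI HP1 HP2 _]]]] := ends _ _ _ LP x'S.
have [sr [fr [gr [frI HR1 HR2 HR3]]]] := ends _ _ _ LR y'S.
(* Path [i] from [A] continues on the path from [B] that ends in the same vertex of [S]; the one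
   ending in [x'] continues, across the edge, on the one ending in [y']. *)
have /choice[j jP] : forall i, exists j, fr j = if fp i == x' then y' else fp i.
  move=> i; apply: HR3; case: eqVneq => [_|ne]; first by rewrite setU11.
  by have [h _ _ _ _] := HP1 i; move: h; rewrite !inE (negbTE ne) => /= ->; rewrite orbT.
have jI : injective j.
  move=> i i' /(congr1 fr); rewrite !jP; have [h _ _ _ _] := HP1 i; have [h' _ _ _ _] := HP1 i'.
  move: h h'; rewrite !inE; case: eqVneq => [E1|n1]; case: eqVneq => [E2|n2] //=.
  - by move=> _ _ _; apply: fpI; rewrite E1 E2.
  - by move=> _ h E; rewrite -E (negbTE y'S) in h.
  - by move=> h _ E; rewrite E (negbTE y'S) in h.
  - by move=> _ _ /fpI.
have prefix (C : {set V}) z (Q : 'I_k -> {set V}) (f g : 'I_k -> V) (s : 'I_k -> seq V) :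
    (forall i, [/\ f i \in z |: S, g i \in C, path (del x' y') (g i) (s i) /\ uniq (g i :: s i),
       last (g i) (s i) = f i & {subset g i :: s i <= Q i}]) ->
    (forall i w, w \in g i :: s i -> w \in z |: S -> w = f i) ->
    forall i w, w \in g i :: s i -> w \notin S ->
      g i \in C :\: S /\ connect (restr (del x' y') (~: S)) (g i) w.
  move=> H1 H2 i w ws wS; have [h1 h2 [h3 h4] h5 _] := H1 i.
  have [p1 [p2 [E lw]]] : exists p1 p2, s i = p1 ++ p2 /\ last (g i) p1 = w.
    by case/splitPl: ws => p1 p2 lw; exists p1, p2.
  have sub v : v \in g i :: p1 -> v \in ~: S.
    move=> v1; rewrite inE; apply/negP => vS.
    have vf : v = f i.
      by apply: H2; [rewrite E -cat_cons mem_cat v1|rewrite inE vS orbT].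
    move: h4 h5; rewrite E -cat_cons cat_uniq last_cat lw => /and3P[_ /hasPn np _] lf.
    case: p2 np lf {E} => [|c p2] np lf; first by rewrite /= in lf; rewrite lf -vf vS in wS.
    by have /negP := np _ (mem_last c p2); apply; rewrite /= in lf; rewrite lf -vf.
  have gS : g i \in ~: S by apply: sub; rewrite mem_head.
  split; first by rewrite inE h2 andbT; rewrite inE in gS.
  rewrite -lw; apply: connect_path => //; last by move: h3; rewrite E cat_path => /andP[].
  by move=> v vp; apply: sub; rewrite inE vp orbT.
pose Np i : {set V} := [set w in gp i :: sp i].
pose Nr i : {set V} := [set w in gr i :: sr i].
(* A meeting point outside [S] would connect [A] to [B] without [S] and without the edge. *)
have meetS i l w : w \in Np i -> w \in Nr l -> w \in S.
  rewrite !inE -!in_cons => wp wr; apply: contraT => wS.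
  have [g1 c1] := prefix _ _ _ _ _ _ HP1 HP2 _ _ wp wS.
  have [g2 c2] := prefix _ _ _ _ _ _ HR1 HR2 _ _ wr wS.
  exfalso; apply: nj; exists (gp i), (gr l); split=> //; first by move: g2; rewrite inE => /andP[].
  by apply: connect_trans c1 _; rewrite (conn_sym (delS _ _)).
have NpP i w : w \in Np i -> w \in P i by rewrite inE => h; have [_ _ _ _ ->] := HP1 i.
have NrR i w : w \in Nr i -> w \in R i by rewrite inE => h; have [_ _ _ _ ->] := HR1 i.
have fNp i : fp i \in Np i by have [_ _ _ <- _] := HP1 i; rewrite inE mem_last.
have fNr i : fr i \in Nr i by have [_ _ _ <- _] := HR1 i; rewrite inE mem_last.
have gNp i : gp i \in Np i by rewrite inE mem_head.
have gNr i : gr i \in Nr i by rewrite inE mem_head.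
exists (fun i => Np i :|: Nr (j i)); split.
  move=> i; split.
  - apply: (connU eS _ _ (fNp i) (fNr (j i))).
    + apply: conn_path => //; have [_ _ [h _] _ _] := HP1 i.
      exact: (sub_path (@delsub x' y') h).
    + apply: conn_path => //; have [_ _ [h _] _ _] := HR1 (j i).
      exact: (sub_path (@delsub x' y') h).
    + by rewrite jP; case: (eqVneq (fp i) x') => [->|_]; rewrite ?x'y' ?eqxx ?orbT.
  - by exists (gp i); [rewrite inE gNp|have [_ ? _ _ _] := HP1 i].
  - by exists (gr (j i)); [rewrite inE gNr orbT|have [_ ? _ _ _] := HR1 (j i)].
have cross i l w : w \in Np i -> w \in Nr (j l) -> i = l.
  move=> wp wr; have wS := meetS _ _ _ wp wr.
  have Ep : w = fp i by apply: HP2; [rewrite inE in wp|rewrite inE wS orbT].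
  have Er : w = fr (j l) by apply: HR2; [rewrite inE in wr|rewrite inE wS orbT].
  move: Er; rewrite jP; case: eqVneq => [_ E|_ E]; first by rewrite E (negbTE y'S) in wS.
  by apply: fpI; rewrite -Ep.
move=> i l w; rewrite !in_setU => /orP[wi|wi] /orP[wl|wl].
- exact: (LP.2 i l w (NpP _ _ wi) (NpP _ _ wl)).
- exact: cross wi wl.
- by rewrite (cross _ _ _ wl wi).
- exact: jI (LR.2 _ _ w (NrR _ _ wi) (NrR _ _ wl)).
Qed.

(** * Linkages by paths *)

Definition abpath e U A B (s : seq V) : Prop :=
  [/\ uniq s, sorted e s, {subset s <= U} &
      exists x p, [/\ s = x :: p, x \in A & last x p \in B]].

Definition linkage e U A B k (P : 'I_k -> seq V) : Prop :=
  (forall i, abpath e U A B (P i)) /\ (forall i j x, x \in P i -> x \in P j -> i = j).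

Lemma menger_in e U A B k : symmetric e ->
  (forall S, #|S| < k -> exists a b, [/\ a \in A, a \in U :\: S, b \in B &
     connect (restr e (U :\: S)) a b]) ->
  exists P : 'I_k -> seq V, linkage e U A B P.
Proof.
move=> eS sep; have eUS : symmetric (restr e U) := restr_sym eS U.
have [P LP] : exists P : 'I_k -> {set V}, linked (restr e U) (A :&: U) (B :&: U) P.
  apply: menger => // S Sk; have [a [b [aA aU bB ab]]] := sep S Sk.
  exists a, b; have bU := connect_restr_in aU ab; move: (aU) (bU).
  rewrite !inE aA bB => /andP[-> ->] /andP[_ ->]; split=> //.
  apply: connect_sub ab => u v /= /and3P[uU vU uv]; move: uU vU; rewrite !inE => /andP[uS uU] /andP[vS vU].
  by apply: connect_restr1; [rewrite inE|rewrite inE|apply/and3P].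
have /choice[xs xsP] : forall i, exists xs : V * seq V, [/\ xs.1 \in A :&: U,
    path (restr e U) xs.1 xs.2 /\ uniq (xs.1 :: xs.2), {subset xs.1 :: xs.2 <= P i} &
    last xs.1 xs.2 \in B :&: U].
  by move=> i; have [a [s [h1 h2 h3 h4 _]]] := linked_seq eUS LP i; exists (a, s).
exists (fun i => (xs i).1 :: (xs i).2); split.
  move=> i; have [h1 [h2 h3] h4 h5] := xsP i; have [h6 h7] := path_restr h2.
  move: h1; rewrite inE => /andP[h1 h1']; move: h5; rewrite inE => /andP[h5 _].
  split=> //; first by move=> z; rewrite inE => /orP[/eqP->|/h7].
  by exists (xs i).1, (xs i).2.
move=> i j x xi xj; have [_ _ h _] := xsP i; have [_ _ h' _] := xsP j.
exact: (LP.2 i j x (h _ xi) (h' _ xj)).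
Qed.

End Menger.

(** * Minimal linkages *)

Lemma inj_into (T : finType) (S : {set T}) N : N <= #|S| ->
  exists h : 'I_N -> T, injective h /\ forall i, h i \in S.
Proof.
move=> NS; exists (fun i => enum_val (widen_ord NS i)); split=> [i j /enum_val_inj E|i].
  by apply: val_inj; exact: (congr1 val E).
exact: enum_valP.
Qed.

Lemma pigeon (T U : finType) (S : {set U}) (g : U -> T) N : #|T| * N < #|S| ->
  exists t (h : 'I_N -> U), [/\ injective h, forall i, h i \in S & forall i, g (h i) = t].
Proof.
move=> lt; have [t ht] : exists t, N <= #|[set i in S | g i == t]|.
  apply: contrapT => H; have {}H t : #|[set i in S | g i == t]| <= N.
    by rewrite leqNgt; apply/negP => h; apply: H; exists t; exact: ltnW.
  move: lt; apply/negP; rewrite -leqNgt -sum1_card (partition_big g xpredT) //=.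
  rewrite -sum_nat_const; apply: leq_sum => t _.
  apply: leq_trans (H t); rewrite -sum1_card; apply/eq_leq/eq_bigl => i; by rewrite inE.
have [h [hI hS]] := inj_into ht; exists t, h; split=> // i; have := hS i; rewrite inE.
  by case/andP.
by case/andP=> _ /eqP.
Qed.

(* Union bound over all maps x, counted through the bijection exchanging the value at c with a
   fresh one. *)
Lemma free_set m n b (F : 'I_m -> 'I_m -> {set 'I_m}) :
  (forall i j, #|F i j| <= b) -> n ^ 3 * b < m ->
  exists x : 'I_n -> 'I_m, forall i j c, c != i -> c != j -> x c \notin F (x i) (x j).
Proof.
move=> Fb nbm.
pose X := {ffun 'I_n -> 'I_m}.
pose bad (t : 'I_n * 'I_n * 'I_n) : {set X} :=
  [set x : X | [&& t.2 != t.1.1, t.2 != t.1.2 & x t.2 \in F (x t.1.1) (x t.1.2)]].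
have badle t : #|bad t| * m <= b * m ^ n.
  case: t => [[i j] c]; pose upd (x : X) v : X := [ffun a => if a == c then v else x a].
  pose g (p : X * 'I_m) := (upd p.1 p.2, p.1 c).
  have gI : injective g.
    move=> [x v] [y w] /= [/ffunP E1 E2]; congr (_, _).
      by apply/ffunP => a; have := E1 a; rewrite !ffunE; case: eqVneq => [->|].
    by have := E1 c; rewrite /= !ffunE eqxx.
  have -> : #|bad (i, j, c)| * m = #|g @: setX (bad (i, j, c)) setT|.
    by rewrite card_imset // cardsX cardsT card_ord.
  have sub : g @: setX (bad (i, j, c)) setT \subset
      [set p : X * 'I_m | p.2 \in F (p.1 i) (p.1 j)].
    apply/subsetP => q /imsetP[[x v]]; rewrite !inE andbT /= => /and3P[/negbTE ci /negbTE cj h] ->.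
    by rewrite /= !ffunE ![_ == c]eq_sym ci cj.
  apply: leq_trans (subset_leq_card sub) _.
  rewrite -sum1_card (partition_big (fun p : X * 'I_m => p.1) xpredT) //=.
  apply: (@leq_trans (\sum_(x : X) b)); last by rewrite sum_nat_const card_ffun !card_ord mulnC.
  apply: leq_sum => x _; rewrite sum1dep_card; apply: leq_trans (Fb (x i) (x j)).
  rewrite -(card_imset (mem (F (x i) (x j))) (f := pair x)); last by move=> v w [].
  apply: subset_leq_card; apply/subsetP => -[y v]; rewrite !inE /= => /andP[h /eqP E].
  by rewrite E in h *; apply/imsetP; exists v.
apply: contrapT => nx.
have all x : exists t, x \in bad t.
  apply: contrapT => nt; apply: nx; exists x => i j c ci cj; apply/negP => h; apply: nt.
  by exists (i, j, c); rewrite inE ci cj.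
have cover : #|X| <= \sum_t #|bad t|.
  rewrite -sum1_card.
  apply: (@leq_trans (\sum_(x : X) \sum_t (x \in bad t))).
    apply: leq_sum => x _; have [t xt] := all x.
    by rewrite (bigD1 t) //= xt leq_addr.
  rewrite exchange_big /=; apply: leq_sum => t _.
  by rewrite -sum1_card [X in _ <= X]big_mkcond /=; apply: leq_sum => x _; case: ifP.
have : #|X| * m <= n ^ 3 * b * #|X|.
  apply: (@leq_trans ((\sum_t #|bad t|) * m)); first by rewrite leq_mul2r cover orbT.
  rewrite big_distrl /=; apply: (@leq_trans (\sum_(t : 'I_n * 'I_n * 'I_n) (b * m ^ n))).
    by apply: leq_sum => t _; exact: badle.
  rewrite sum_nat_const !card_prod !card_ord card_ffun !card_ord.
  by rewrite mulnA; apply: leq_mul => //; apply: leq_mul => //; rewrite expnS expnS expn1 mulnA.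
have X0 : 0 < #|X|.
  have m0 : 0 < m := leq_ltn_trans (leq0n _) nbm.
  by rewrite card_ffun !card_ord expn_gt0 m0.
by rewrite [_ * #|X|]mulnC (leq_pmul2l X0) leqNgt nbm.
Qed.

Section Linkages.
Variables (V : finType) (e : rel V).
Hypothesis eS : symmetric e.
Implicit Types (s : seq V) (U S : {set V}).

Definition nxt s (u v : V) : Prop := exists s1 s2, s = s1 ++ u :: v :: s2.
Definition adj s (u v : V) : Prop := nxt s u v \/ nxt s v u.

Lemma adj_mem s u v : adj s u v -> u \in s /\ v \in s.
Proof. by case=> -[s1 [s2 ->]]; rewrite !mem_cat !inE !eqxx !orbT. Qed.

Lemma adj_rel s u v : sorted e s -> adj s u v -> e u v.
Proof.
move=> ss [] [s1 [s2 E]]; move: ss; rewrite E.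
  by case: s1 {E} => [|a s1] /=; [case/andP|rewrite cat_path /= => /and3P[_ _ /andP[]]].
rewrite eS; by case: s1 {E} => [|a s1] /=; [case/andP|rewrite cat_path /= => /and3P[_ _ /andP[]]].
Qed.

Lemma sorted_adj (h : rel V) s : (forall u v, adj s u v -> h u v) -> sorted h s.
Proof.
case: s => // a s; elim: s a => //= b s IH a H; apply/andP; split.
  by apply: H; left; exists [::], s.
apply: IH => u v [] [s1 [s2 E]]; apply: H.
  by left; exists (a :: s1), s2; rewrite E.
by right; exists (a :: s1), s2; rewrite E.
Qed.

Lemma nxt_nth d s i : i.+1 < size s -> nxt s (nth d s i) (nth d s i.+1).
Proof.
move=> il; exists (take i s), (drop i.+2 s).
by rewrite -!drop_nth ?cat_take_drop //; apply: ltnW.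
Qed.

Lemma linkage_sub U (X Y : {set V}) k k' (P : 'I_k -> seq V) : k' <= k -> linkage e U X Y P ->
  exists P' : 'I_k' -> seq V, linkage e U X Y P'.
Proof.
move=> kk [h1 h2]; exists (fun i => P (widen_ord kk i)); split=> // i j x hi hj.
by apply: val_inj; exact: (congr1 val (h2 _ _ _ hi hj)).
Qed.

(** Half of a grid: every [R a] passes the [Q i] one after the other, in the order of [i], while a
    [Q i] may visit the [R a] in any order and repeatedly. *)
Definition crossing r d : Prop := exists (R : 'I_r -> seq V) (Q : 'I_d -> seq V),
  [/\ forall a, sorted e (R a) /\ uniq (R a),
      forall a b x, x \in R a -> x \in R b -> a = b,
      forall i, sorted e (Q i),
      forall i j x, x \in Q i -> x \in Q j -> i = j &
      (forall i a, exists2 x, x \in Q i & x \in R a) /\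
      forall (i j : 'I_d) a x y, i < j -> x \in Q i -> x \in R a -> y \in Q j -> y \in R a ->
        index x (R a) < index y (R a)].

Section Minimal.
Variables (U X Y : {set V}) (k n : nat) (Q : 'I_n -> seq V).
Hypothesis Qs : forall i, sorted e (Q i).
Hypothesis Qd : forall i j x, x \in Q i -> x \in Q j -> i = j.
Hypothesis QU : forall i, {subset Q i <= U}.

(** The edges of [P] outside all the [Q i], as ordered pairs. A cheapest linkage follows the [Q i]
    as much as it can. *)
Definition cost (P : 'I_k -> seq V) : nat :=
  #|[set p : V * V | `[< (exists a, adj (P a) p.1 p.2) /\ ~ exists i, adj (Q i) p.1 p.2 >]]|.

Lemma min_linkage : (exists P : 'I_k -> seq V, linkage e U X Y P) ->
  exists P : 'I_k -> seq V, linkage e U X Y P /\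
    forall P' : 'I_k -> seq V, linkage e U X Y P' -> cost P <= cost P'.
Proof.
move=> ex; pose p c := `[< exists P : 'I_k -> seq V, linkage e U X Y P /\ cost P = c >].
have exp : exists c, p c by case: ex => P LP; exists (cost P); apply/asboolP; exists P.
case: (ex_minnP exp) => c /asboolP[P [LP Pc]] minc; exists P; split=> // P' LP'.
by rewrite Pc; apply: minc; apply/asboolP; exists P'.
Qed.

Variable P : 'I_k -> seq V.
Hypothesis LP : linkage e U X Y P.
Hypothesis Pmin : forall P' : 'I_k -> seq V, linkage e U X Y P' -> cost P <= cost P'.
Variables (N : nat) (g : 'I_N -> 'I_n).
Hypothesis gI : injective g.
Variable a0 : 'I_k.
Let hit (l : 'I_N) := find (mem (Q (g l))) (P a0).

(* The edge entering the first vertex of Q (g i) on P a0 is outside all Q's, so by minimality it is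
   needed: once it is deleted, k - 1 vertices separate the ends of the linkage. *)
Lemma separator i : (forall l, exists2 x, x \in Q (g l) & x \in P a0) -> 0 < hit i ->
  exists S : {set V}, #|S| < k /\ exists sg : 'I_k -> nat, forall l, [disjoint Q (g l) & S] ->
    forall a x, x \in Q (g l) -> x \in P a ->
      if hit l < hit i then index x (P a) < sg a else sg a <= index x (P a).
Proof.
move=> Qhit i0.
have [Pab Pd] := LP.
have [u0 _] := Qhit i.
have hl l : hit l < size (P a0).
  by have [x xQ xP] := Qhit l; rewrite -has_find; apply/hasP; exists x.
pose w := nth u0 (P a0) (hit i); pose u := nth u0 (P a0) (hit i).-1.
have wQ : w \in Q (g i) by have [x xQ xP] := Qhit i; apply: (@nth_find _ u0 (mem (Q (g i)))); apply/hasP; exists x.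
have uQ : u \notin Q (g i).
  by have := @before_find _ u0 (mem (Q (g i))) (P a0) (hit i).-1; rewrite prednK // leqnn => /(_ isT)/negbT.
have uw : nxt (P a0) u w.
  by have := @nxt_nth u0 (P a0) (hit i).-1; rewrite prednK // => /(_ (hl i)).
(* [w] lies on [Q (g i)] and [u] does not, while the [Q] are pairwise disjoint. *)
have uwQ l : ~ adj (Q l) u w.
  by case/adj_mem => h1 h2; move: uQ; rewrite (Qd wQ h2) h1.
have uwQ' l : ~ adj (Q l) w u by move=> h; apply: (uwQ l); case: h; [right|left].
(* All edges of the two families except [uw]. A linkage inside [h] would cost less than [P]. *)
pose h : rel V := fun x y => `[< (exists a, adj (P a) x y) \/ exists l, adj (Q l) x y >] &&
  ~~ (((x == u) && (y == w)) || ((x == w) && (y == u))).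
have adjC s x y : adj s x y -> adj s y x by case; [right|left].
have hS : symmetric h.
  move=> x y; rewrite /h orbC ![(y == _) && _]andbC; congr (_ && _).
  by apply: asbool_equiv_eq; split; (case=> -[z /adjC hz]; [left|right]; exists z).
have he : subrel h e.
  move=> x y /andP[/asboolP[[a] |[l]] H _]; first by apply: adj_rel H; case: (Pab a).
  by apply: adj_rel H.
have noL : ~ exists P' : 'I_k -> seq V, linkage h U X Y P'.
  move=> [P' [P'ab P'd]].
  have LP' : linkage e U X Y P'.
    split=> // a; have [q1 q2 q3 q4] := P'ab a; split=> //.
    by move: q2; case: (P' a) => // z q; exact: sub_path.
  have := Pmin LP'; rewrite leqNgt; apply/negP; rewrite negbK; apply: proper_card.
  rewrite properE; apply/andP; split.
    apply/subsetP => -[x y]; rewrite !inE /= => /asboolP[[a ha] nl].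
    apply/asboolP; split=> //; have [_ q2 _ _] := P'ab a.
    have : h x y.
      case: ha => -[s1 [s2 E]]; move: q2; rewrite E.
        by case: s1 {E} => [|z s1] /=; [case/andP|rewrite cat_path /= => /and3P[_ _ /andP[]]].
      by rewrite hS; case: s1 {E} => [|z s1] /=; [case/andP|rewrite cat_path /= => /and3P[_ _ /andP[]]].
    by case/andP=> /asboolP[].
  apply/subsetPn; exists (u, w); rewrite !inE /=.
    by apply/asboolP; split; [exists a0; left|case=> l /uwQ].
  apply/asboolP => -[[a ha] _]; have [_ q2 _ _] := P'ab a.
  have : h u w.
    case: ha => -[s1 [s2 E]]; move: q2; rewrite E.
      by case: s1 {E} => [|z s1] /=; [case/andP|rewrite cat_path /= => /and3P[_ _ /andP[]]].
    by rewrite hS; case: s1 {E} => [|z s1] /=; [case/andP|rewrite cat_path /= => /and3P[_ _ /andP[]]].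
  by case/andP=> _; rewrite !eqxx.
have [S [Sk Ssep]] : exists S : {set V}, #|S| < k /\ forall a b, a \in X -> a \in U :\: S -> b \in Y ->
    ~ connect (restr h (U :\: S)) a b.
  apply: contrapT => H; apply: noL; apply: menger_in => // S Sk; apply: contrapT => H'.
  by apply: H; exists S; split=> // a b aX aU bY ab; apply: H'; exists a, b.
exists S; split=> //.
(* The side of [X] with respect to [S]. *)
pose L := [set z | `[< exists2 a, (a \in X) && (a \in U :\: S) & connect (restr h (U :\: S)) a z >]].
have Lcl z z' : z \in L -> z' \in U :\: S -> h z z' -> z' \in L.
  rewrite inE => /asboolP[a aXU az] z'U zz'; rewrite inE; apply/asboolP; exists a => //.
  have /andP[_ aU] := aXU.
  have zU := connect_restr_in aU az.
  exact: (connect_trans az (connect_restr1 zU z'U zz')).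
have LY z : z \in L -> z \in Y -> False.
  by rewrite inE => /asboolP[a /andP[aX aU] az] zY; exact: (Ssep a z).
have hP a j : j.+1 < size (P a) -> a != a0 \/ j.+1 != hit i ->
    h (nth u0 (P a) j) (nth u0 (P a) j.+1).
  move=> jl ne; apply/andP; split.
    by apply/asboolP; left; exists a; left; exact: nxt_nth.
  have [ua _ _ _] := Pab a.
  apply/negP => H.
  have [uP wP] := adj_mem (or_introl uw : adj (P a0) u w).
  have m1 : nth u0 (P a) j \in P a by apply: mem_nthV; exact: ltnW.
  have aa : a = a0.
    by case/orP: H => /andP[/eqP E _]; apply: (Pd _ _ (nth u0 (P a) j)) => //; rewrite E.
  subst a; case: ne => [|ne]; first by rewrite eqxx.
  have ui j1 j2 : j1 < size (P a0) -> j2 < size (P a0) -> nth u0 (P a0) j1 = nth u0 (P a0) j2 -> j1 = j2.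
    by move=> l1 l2 /eqP; rewrite nth_uniq // => /eqP.
  have hi := hl i; case/orP: H => /andP[/eqP E1 /eqP E2].
    by have := ui _ _ jl hi E2; move/eqP: ne.
  have h1 := ui _ _ (ltnW jl) hi E1; have := ui _ _ jl _ E2; rewrite h1.
  by move: hi i0 jl; clear; lia.
have prefix a j : j < size (P a) -> (forall j', j' <= j -> nth u0 (P a) j' \notin S) ->
    (a = a0 -> j < hit i) -> nth u0 (P a) j \in L.
  have [_ _ aU [x [p [E xX _]]]] := Pab a.
  elim: j => [|j IHj] jl nS j0.
    rewrite inE; apply/asboolP; exists (nth u0 (P a) 0) => //.
    by rewrite inE nS // aU ?mem_nthV // E /= xX.
  apply: (Lcl (nth u0 (P a) j)).
  - by apply: IHj => [|j' j'j|/j0]; [exact: ltnW|apply: nS; exact: leqW|exact: ltnW].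
  - by rewrite inE nS // aU ?mem_nthV.
  - apply: hP => //; case: (eqVneq a a0) => [/j0 lt|]; [right|by left].
    by move: lt; clear; lia.
have suffix a j : j < size (P a) -> (forall j', j <= j' -> j' < size (P a) -> nth u0 (P a) j' \notin S) ->
    (a = a0 -> hit i <= j) -> nth u0 (P a) j \notin L.
  have [_ _ aU [x [p [E _ lY]]]] := Pab a.
  move=> jl nS j0; apply/negP => jL.
  have all j' : j <= j' -> j' < size (P a) -> nth u0 (P a) j' \in L.
    elim: j' => [|j' IHj]; first by rewrite leqn0 => /eqP<-.
    rewrite leq_eqVlt => /orP[/eqP<-//|jj'] j'l.
    apply: (Lcl (nth u0 (P a) j')); first by apply: IHj => //; exact: ltnW.
    - by rewrite inE nS // ?aU ?mem_nthV //; exact: leqW.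
    - apply: hP => //; case: (eqVneq a a0) => [/j0 lt|]; [right|by left].
      by move: lt jj'; clear; lia.
  apply: (LY (nth u0 (P a) (size (P a)).-1)).
    by apply: all; move: jl; clear; lia.
  by rewrite nth_last E.
have Shit a : a != a0 -> exists2 x, x \in P a & x \in S.
  move=> aa0; apply: contrapT => H.
  have nS z : z \in P a -> z \notin S by move=> zP; apply/negP => zS; apply: H; exists z.
  have [_ _ aU [x [p [E xX lY]]]] := Pab a.
  apply: (LY (nth u0 (P a) (size (P a)).-1)); last by rewrite nth_last E.
  have s0 : 0 < size (P a) by rewrite E.
  apply: prefix; first by move: s0; clear; lia.
    by move=> j' jl; apply/nS/mem_nthV; move: jl s0; clear; lia.
  by move=> E'; rewrite E' eqxx in aa0.
have /choice[t tP] : forall a, exists x, a != a0 -> x \in P a /\ x \in S.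
  by move=> a; have [->|/Shit[x x1 x2]] := eqVneq a a0; [exists u0|exists x].
(* Every [P a] with [a != a0] survives in [h] and must meet [S]. As [S] has fewer than [k] vertices,
   it has exactly one on each of them and none on [P a0]. *)
have SE : S = t @: [set a | a != a0].
  apply/esym/eqP; rewrite eqEcard; apply/andP; split.
    by apply/subsetP => x /imsetP[a]; rewrite inE => /tP[_ h2] ->.
  rewrite card_in_imset; last first.
    move=> a b; rewrite !inE => /tP[h1 _] /tP[h2 _] E; apply: (Pd _ _ (t a)) => //; by rewrite E.
  have -> : [set a | a != a0] = [set~ a0] by apply/setP => a; rewrite !inE.
  by rewrite cardsC1 card_ord; move: Sk; clear; lia.
have Sa a x : x \in P a -> x \in S -> a != a0 /\ x = t a.
  rewrite SE => xa /imsetP[b]; rewrite inE => b0 E; have [h1 _] := tP _ b0.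
  by rewrite -E in h1; rewrite (Pd _ _ _ xa h1).
(* Where [P a] changes sides: at its vertex of [S], or for [P a0] at the deleted edge. *)
pose sg a := if a == a0 then hit i else index (t a) (P a).
exists sg => l lS.
have Ql z : z \in Q (g l) -> z \notin S by move=> zl; rewrite (disjointFr lS zl).
(* [Q (g l)] is connected in [h] and avoids [S], hence stays on one side; its first vertex on [P a0]
   tells which. *)
have QL x y : x \in Q (g l) -> y \in Q (g l) -> x \in L -> y \in L.
  move=> xl yl xL.
  have sh : sorted h (Q (g l)).
    apply: sorted_adj => v1 v2 v12; apply/andP; split; first by apply/asboolP; right; exists (g l).
    by apply/negP => /orP[] /andP[/eqP E1 /eqP E2]; rewrite E1 E2 in v12; [apply: (uwQ (g l))|apply: (uwQ' (g l))].
  have cQ : conn h [set z in Q (g l)].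
    by case: (Q (g l)) sh => [|z q0] sh; [move=> ? ?; rewrite inE|exact: conn_path].
  have := conn_closed (C := L) cQ (x := x); rewrite inE => /(_ xl xL) H.
  apply: (subsetP (H _) y); last by rewrite inE.
  move=> v1 v2 pL; rewrite inE => qQ; apply: Lcl pL _.
  by rewrite inE Ql // (QU qQ).
have Qside x a : x \in Q (g l) -> x \in P a -> (x \in L) = (index x (P a) < sg a).
  move=> xl xa; have [ua _ _ _] := Pab a.
  have xi : index x (P a) < size (P a) by rewrite index_mem.
  have xE : nth u0 (P a) (index x (P a)) = x by rewrite nth_index.
  have inS j : j < size (P a) -> nth u0 (P a) j \in S -> j = sg a /\ a != a0.
    move=> jl /(Sa a _ (mem_nthV u0 jl))[a00 E]; split=> //.
    by rewrite /sg (negbTE a00) -E index_uniq.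
  apply/idP/idP => [|lt].
    apply: contraTT; rewrite -leqNgt => ge; rewrite -xE; apply: suffix => //.
      move=> j' jj' j'l; apply/negP => /(inS _ j'l)[E a00].
      have E' : index x (P a) = j' by apply/eqP; rewrite eqn_leq jj' E ge.
      by have := Ql _ xl; rewrite -xE E'; case/negP: (Ql _ xl); rewrite -xE E' E /sg (negbTE a00) nth_index; have [] := tP _ a00.
    by move=> E; move: ge; rewrite /sg E eqxx.
  rewrite -xE; apply: prefix => //.
    move=> j' jj'; apply/negP => hS'.
    have j'l : j' < size (P a) by apply: leq_ltn_trans jj' xi.
    by have [E _] := inS _ j'l hS'; move: lt jj'; rewrite E; clear; lia.
  by move=> E; move: lt; rewrite /sg E eqxx.
pose z := nth u0 (P a0) (hit l).
have zQ : z \in Q (g l) by have [x xQ xP] := Qhit l; apply: (@nth_find _ u0 (mem (Q (g l)))); apply/hasP; exists x.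
have zP : z \in P a0 by apply: mem_nthV.
have zi : index z (P a0) = hit l by rewrite index_uniq //; case: (Pab a0).
have zL : (z \in L) = (hit l < hit i) by rewrite (Qside _ _ zQ zP) zi /sg eqxx.
move=> a x xl xa; case: ifP => lt.
  by rewrite -(Qside _ _ xl xa); apply: QL zQ xl _; rewrite zL.
by rewrite leqNgt -(Qside _ _ xl xa); apply/negP => /(QL _ _ xl zQ); rewrite zL lt.
Qed.

(** Choose [2 * d] of the [Q (g l)] such that each avoids the separators of the others, and order
    them by their first vertices on [P a0]. Two with even numbers have one with an odd number
    between them, and its separator puts them in the same order on all the [P a]. The bound on [N]
    is the one of [free_set]. *)
Lemma crossing_of_minimal (R0 : {set 'I_k}) r d : 0 < r -> r <= #|R0| ->
  (2 * d) ^ 3 * k.+2 < N -> (forall l a, a \in R0 -> exists2 x, x \in Q (g l) & x \in P a) ->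
  a0 \in R0 -> crossing r d.
Proof.
move=> r0 rR dn QR a0R; have [Pab Pd] := LP.
have Qhit l : exists2 x, x \in Q (g l) & x \in P a0 by exact: QR.
have hl l : hit l < size (P a0).
  by have [x xQ xP] := Qhit l; rewrite -has_find; apply/hasP; exists x.
have hitI : injective hit.
  move=> l l' E; have [x0 _ _] := Qhit l.
  have m1 : nth x0 (P a0) (hit l) \in Q (g l).
    by have [x xQ xP] := Qhit l; apply: (@nth_find _ x0 (mem (Q (g l)))); apply/hasP; exists x.
  have m2 : nth x0 (P a0) (hit l') \in Q (g l').
    by have [x xQ xP] := Qhit l'; apply: (@nth_find _ x0 (mem (Q (g l')))); apply/hasP; exists x.
  by rewrite -E in m2; apply: gI; exact: Qd m1 m2.
have /choice[S SP] : forall i, exists S : {set V}, 0 < hit i -> #|S| < k /\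
    exists sg : 'I_k -> nat, forall l, [disjoint Q (g l) & S] ->
    forall a x, x \in Q (g l) -> x \in P a ->
      if hit l < hit i then index x (P a) < sg a else sg a <= index x (P a).
  by move=> i; case: (posnP (hit i)) => [->|/(separator Qhit)[S h]]; [exists set0|exists S].
pose B i := [set l | ~~ [disjoint Q (g l) & S i]].
have Bk i : 0 < hit i -> #|B i| <= k.
  move=> /SP[Sk _]; apply: leq_trans (ltnW Sk).
  have /choice[t tP] : forall l, exists x, l \in B i -> x \in Q (g l) /\ x \in S i.
    move=> l; case: (boolP (l \in B i)) => [|_]; last by have [x _ _] := Qhit l; exists x.
    rewrite inE disjoint_has => /negPn/hasP[x x1 x2]; by exists x.
  rewrite -(@card_in_imset _ _ t (B i)).
    by apply: subset_leq_card; apply/subsetP => x /imsetP[l /tP[_ h] ->].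
  move=> l l' /tP[h1 _] /tP[h2 _] E; rewrite E in h1; apply: gI; exact: Qd h1 h2.
(* A separator has fewer than [k] vertices and so meets at most [k] of the disjoint [Q (g l)];
   adding [i] itself makes the choice [x] injective. *)
pose F i (_ : 'I_N) := i |: (if 0 < hit i then B i else set0).
have Fk i j : #|F i j| <= k.+2.
  rewrite /F cardsU1; have : #|(if 0 < hit i then B i else set0)| <= k.
    by case: ifP => [/Bk//|_]; rewrite cards0.
  by case: (_ \notin _); lia.
have [x xP] := free_set Fk dn.
have xI : injective x.
  move=> c c' E; apply/eqP; apply: contraT => ne.
  by have := xP c' c' c ne ne; rewrite E /F setU11.
have xB c c' : c != c' -> 0 < hit (x c') -> [disjoint Q (g (x c)) & S (x c')].
  move=> ne h0; have := xP c' c' c ne ne; rewrite /F h0 in_setU1 negb_or => /andP[_].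
  by rewrite inE negbK.
pose le : rel 'I_(2 * d) := fun c c' => hit (x c) <= hit (x c').
pose J := sort le (enum 'I_(2 * d)).
have szJ : size J = 2 * d by rewrite size_sort size_enum_ord.
have uJ : uniq J by rewrite sort_uniq enum_uniq.
have sJ : sorted le J by apply: sort_sorted => c c'; exact: leq_total.
have leT : transitive le by move=> ? ? ?; exact: leq_trans.
have [d0|d0] := posnP d.
  subst d; have [h [hI hR]] := inj_into rR.
  exists (fun a => P (h a)), (fun i : 'I_0 => [::]); split=> //; try by case.
  - by move=> a; have [? ? _ _] := Pab (h a).
  - by move=> a b z za zb; apply: hI; exact: Pd za zb.
  - by split; case.
have dd : 0 < 2 * d by move: d0; clear; lia.
pose c0 : 'I_(2 * d) := Ordinal dd.
pose y j := x (nth c0 J j).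
have ylt j j' : j < j' -> j' < 2 * d -> hit (y j) < hit (y j').
  move=> jj' j'd; rewrite ltn_neqAle; apply/andP; split.
    apply/eqP => /hitI/xI/eqP; rewrite nth_uniq ?szJ //; last exact: ltn_trans j'd.
    by move/eqP; move: jj'; clear; lia.
  have := sorted_leq_nth leT (fun _ => leqnn _) c0 sJ; apply; rewrite ?inE ?szJ //.
    exact: ltn_trans j'd.
  exact: ltnW.
have yB j j' : j != j' -> j < 2 * d -> j' < 2 * d -> 0 < hit (y j') -> [disjoint Q (g (y j)) & S (y j')].
  by move=> ne jl j'l; apply: xB; rewrite nth_uniq ?szJ.
have [h [hI hR]] := inj_into rR.
exists (fun a => P (h a)), (fun i => Q (g (y (2 * i)))); split.
- by move=> a; have [? ? _ _] := Pab (h a).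
- by move=> a b z za zb; apply: hI; exact: Pd za zb.
- by move=> i; exact: Qs.
- move=> i j z zi zj; apply: val_inj => /=; have E := gI (Qd zi zj).
  have il := ltn_ord i; have jl := ltn_ord j.
  case: (ltngtP i j) => // lt; exfalso.
    by have := @ylt (2 * i) (2 * j); rewrite E ltnn; move=> H; have := H _ _; move: lt il jl; clear; lia.
  by have := @ylt (2 * j) (2 * i); rewrite E ltnn; move=> H; have := H _ _; move: lt il jl; clear; lia.
split; first by move=> i a; exact: QR.
move=> i j a z z' ij zi za zj z'a.
have jl := ltn_ord j.
have o1 : 2 * i < (2 * i).+1 by [].
have o2 : (2 * i).+1 < 2 * d by move: ij jl; clear; lia.
have o3 : (2 * i).+1 < 2 * j by move: ij; clear; lia.
have o4 : 2 * j < 2 * d by move: jl; clear; lia.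
(* Its predecessor in the order hits earlier, so this odd one does have a separator. *)
have s0 : 0 < hit (y (2 * i).+1) by apply: leq_ltn_trans (ylt _ _ o1 o2).
have [_ [sg Hsg]] := SP _ s0.
have D1 : [disjoint Q (g (y (2 * i))) & S (y (2 * i).+1)].
  by apply: yB => //; [rewrite ltn_eqF|exact: ltn_trans o2].
have D2 : [disjoint Q (g (y (2 * j))) & S (y (2 * i).+1)].
  by apply: yB => //; rewrite gtn_eqF.
have := Hsg _ D1 (h a) z zi za; rewrite (ylt _ _ o1 o2) => h1.
have := Hsg _ D2 (h a) z' zj z'a; rewrite ltnNge (ltnW (ylt _ _ o3 o4)) /= => h2.
exact: leq_trans h1 h2.
Qed.
End Minimal.
End Linkages.

(** * Crossing linkages or clique minors *)

Lemma abpath_sub (V : finType) (e : rel V) (U U' X Y : {set V}) s :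
  U \subset U' -> abpath e U X Y s -> abpath e U' X Y s.
Proof. by move=> /subsetP UU [h1 h2 h3 h4]; split=> // x /h3/UU. Qed.

(* All paths of the first linkage have many choices; either one of them can be sacrificed while
   keeping large parts of the other linkages, or many of them meet the same r paths of another
   one, chosen minimal with respect to the first. *)
Lemma iter_linkages r d n : 0 < r -> exists K, forall (V : finType) (e : rel V) (U : {set V})
    (X Y : 'I_n -> {set V}), symmetric e ->
  (forall q, exists P : 'I_K -> seq V, linkage e U (X q) (Y q) P) ->
  crossing e r d \/ exists P : 'I_n -> seq V, (forall q, abpath e U (X q) (Y q) (P q)) /\
    forall q q' x, x \in P q -> x \in P q' -> q = q'.
Proof.
move=> r0; elim: n => [|n [K IH]].
  by exists 0 => V e U X Y eS _; right; exists (fun=> [::]); split=> [[]|[]].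
(* Each linkage can lose up to [r] paths and keep [K] for the induction; [N] is what
   [crossing_of_minimal] asks for. *)
pose k := K + r; pose N := ((2 * d) ^ 3 * k.+2).+1.
pose T := {ffun 'I_n -> {set 'I_k}}.
exists (maxn k (#|T| * N).+1) => V e U X Y eS H.
have kM := leq_maxl k (#|T| * N).+1; have tM := leq_maxr k (#|T| * N).+1.
move: (maxn _ _) kM tM H => M kM tM H.
have [Q [Qab Qd]] := H ord0.
have /choice[P LP] : forall q : 'I_n, exists P : 'I_k -> seq V, linkage e U (X (lift ord0 q)) (Y (lift ord0 q)) P /\
   forall P' : 'I_k -> seq V, linkage e U (X (lift ord0 q)) (Y (lift ord0 q)) P' -> cost Q P <= cost Q P'.
  move=> q; have [P LP] := H (lift ord0 q).
  by apply: min_linkage; exact: linkage_sub LP.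
(* For each of the other linkages, the set of its paths that [Q i] meets. *)
pose g i : T := [ffun q => [set a | has (mem (P q a)) (Q i)]].
have [|t [h [hI _ ht]]] := @pigeon T 'I_M [set: 'I_M] g N; first by rewrite cardsT card_ord.
have [[q rq]|/forallNP small] := pselect (exists q, r <= #|t q|).
  left; have /card_gt0P[a0 a0t] : 0 < #|t q| by exact: leq_trans rq.
  apply: (@crossing_of_minimal _ _ eS _ _ _ _ _ Q _ Qd _ _ (LP q).1 (LP q).2 _ h hI a0 (t q) r d) => //.
  - by move=> i; have [_ ? _ _] := Qab i.
  - by move=> i; have [_ _ ? _] := Qab i.
  - move=> l a; rewrite -(ht l) ffunE inE => /hasP[x xQ xP]; by exists x.
(* No trace has [r] elements: [Q i0] becomes the path for the first pair, and the paths meeting it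
   are given up. *)
have N0 : 0 < N by [].
pose i0 := h (Ordinal N0); have gi0 : g i0 = t := ht _.
pose U' := U :\: [set x in Q i0].
have [||] := IH V e U' (fun q => X (lift ord0 q)) (fun q => Y (lift ord0 q)) eS.
- move=> q; have [[Pab Pd] _] := LP q.
  have tr : #|t q| < r by have := small q; move/negP; rewrite -ltnNge.
  have Kt : K <= #|~: t q|.
    have := cardsC (t q); rewrite card_ord => E; have kE : k = K + r by [].
    by move: tr E kE; clear; move: (#|t q|) (#|~: t q|) => a1 a2; lia.
  have [f [fI fS]] := inj_into Kt; exists (fun a => P q (f a)); split.
    move=> a; have [h1 h2 h3 h4] := Pab (f a); split=> // x xP; rewrite !inE h3 // andbT.
    apply/negP => xQ; have := fS a; rewrite -gi0 ffunE !inE => /hasP; apply; by exists x.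
  by move=> a b x xa xb; apply: fI; exact: Pd xa xb.
- by left.
move=> [P' [P'ab P'd]]; right.
exists (fun q => if unlift ord0 q is Some q' then P' q' else Q i0); split.
  move=> q; case: unliftP => [q' ->|->]; last exact: Qab.
  by apply: abpath_sub (P'ab q'); exact: subsetDl.
have PQ q x : x \in P' q -> x \in Q i0 -> False.
  by have [_ _ h3 _] := P'ab q; move=> /h3; rewrite !inE => /andP[/negP h4 _] /h4.
move=> q q' x; case: unliftP => [p ->|->]; case: unliftP => [p' ->|->] //.
- by move=> h1 h2; rewrite (P'd _ _ _ h1 h2).
- by move=> /PQ h1 /h1.
- by move=> h1 /PQ h2; case: h2.
Qed.

Definition clique_model (V : finType) (e : rel V) m : Prop := exists Y : 'I_m -> {set V},
  [/\ forall i, conn e (Y i), forall i j x, x \in Y i -> x \in Y j -> i = j &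
      forall i j, i != j -> exists x y, [/\ x \in Y i, y \in Y j & e x y]].

Lemma conn_bigU (V : finType) (e : rel V) (I : finType) (D : pred I) (Z : {set V}) (P : I -> {set V}) z :
  symmetric e -> z \in Z -> conn e Z ->
  (forall i, D i -> conn e (P i) /\ exists x y, [/\ x \in Z, y \in P i & e x y]) ->
  conn e (Z :|: \bigcup_(i | D i) P i).
Proof.
move=> eS zZ cZ H; apply: (@conn_base _ _ eS _ z) => w; rewrite inE => /orP[wZ|/bigcupP[i Di wP]].
  by apply: connect_restr_mono (cZ _ _ zZ wZ); exact: subsetUl.
have [cP [x [y [xZ yP xy]]]] := H i Di.
have PU : P i \subset Z :|: \bigcup_(i | D i) P i by rewrite subsetU // (bigcup_sup i) ?orbT.
apply: connect_trans (connect_restr_mono (subsetUl _ _) (cZ _ _ zZ xZ)) _.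
apply: connect_trans (connect_restr_mono PU (cP _ _ yP wP)).
by apply: connect_restr1 => //; [rewrite inE xZ|exact: (subsetP PU)].
Qed.

(** Fewer than [k] vertices leave a big set meeting either of two rich segments; these two big sets
    meet each other, so Menger's theorem links the segments. *)
Lemma linked_segments k m : 0 < k -> exists K, forall (V : finType) (e : rel V), symmetric e ->
  ~ tdl e K setT -> exists Q : 'I_m -> seq V,
  [/\ forall i, [/\ uniq (Q i), sorted e (Q i) & Q i != [::]],
      forall i j x, x \in Q i -> x \in Q j -> i = j &
      forall i j, exists P : 'I_k -> seq V, linkage e setT [set x in Q i] [set x in Q j] P].
Proof.
move=> k0; exists (3 * (k * m.+1)) => V e eS ntd.
have [X [Xt Xbig]] := bramble_set eS ntd.
have {}Xbig (Z : {set V}) : #|Z| < k * m.+1 -> exists C, [/\ conn e C, [disjoint C & Z] & k * m.+1 < #|X :&: C|].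
  by move=> /Xbig[C [cC CZ XC]]; exists C; split=> //; move: CZ; rewrite subsetD => /andP[].
have t0 : 0 < k * m.+1 by rewrite muln_gt0 k0.
have [s [us ss hits]] := bramble_path Xt Xbig t0.
have rs : rich e (k * m.+1) X (k * m.+1) s.
  move=> Z /Xbig[C [cC CZ XC]]; have bC : big e (k * m.+1) X C by [].
  by exists C; split=> //; exact: hits.
have [Q HQ] := rich_segments Xt k0 us ss rs.
have im (i : 'I_m) : i < m.+1 by apply: ltnW; rewrite ltnS; exact: ltn_ord.
have Qr (i : 'I_m) : rich e (k * m.+1) X k (Q i) by have [_ _ ? _ _] := HQ _ (im i).
exists (fun i : 'I_m => Q i); split.
- move=> i; have [h1 h2 h3 _ _] := HQ _ (im i); split=> //.
  apply/eqP => E; have [|B [_ _ [x]]] := h3 set0; first by rewrite cards0.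
  by rewrite E.
- move=> i j x xi xj; have [_ _ _ _ h] := HQ _ (im i); apply: val_inj.
  exact: h xi xj.
- move=> i j; apply: menger_in => // S Sk.
  have [B1 [b1 d1 [x xQ xB]]] := Qr i S Sk; have [B2 [b2 d2 [y yQ yB]]] := Qr j S Sk.
  have [z z1 z2] := big_meet Xt b1 b2.
  have sub (B : {set V}) : [disjoint B & S] -> B \subset setT :\: S.
    by move=> d; rewrite subsetD subsetT.
  exists x, y; rewrite !inE xQ yQ (disjointFr d1 xB); split=> //.
  apply: connect_trans (connect_restr_mono (sub _ d1) (b1.1 _ _ xB z1)) _.
  exact: connect_restr_mono (sub _ d2) (b2.1 _ _ z2 yB).
Qed.

(** If no crossing arises, a minimal linkage between two segments has many paths on only a bounded
    number of other segments. So [m] segments can be chosen such that each pair keeps many paths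
    avoiding the other chosen ones. [iter_linkages] picks one path per pair, pairwise disjoint, and
    these connect the segments to a clique model. *)
Lemma crossing_or_clique m r d : 0 < r -> exists K, forall (V : finType) (e : rel V), symmetric e ->
  ~ tdl e K setT -> crossing e r d \/ clique_model e m.
Proof.
move=> r0.
have /choice[KI HKI] : forall n, exists K, forall (V : finType) (e : rel V) (U : {set V})
    (X Y : 'I_n -> {set V}), symmetric e ->
  (forall q, exists P : 'I_K -> seq V, linkage e U (X q) (Y q) P) ->
  crossing e r d \/ exists P : 'I_n -> seq V, (forall q, abpath e U (X q) (Y q) (P q)) /\
    forall q q' x, x \in P q -> x \in P q' -> q = q'.
  by move=> n; exact: iter_linkages.
pose K1 := \max_(n < (m * m).+1) KI n.
(* [m * r] accounts for the paths that meet a third chosen segment; [K1] suffices for disjoint paths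
   for any number of pairs up to [m * m]. *)
pose K2 := K1 + m * r + r.
pose N := ((2 * d) ^ 3 * K2.+2).+1.
pose b := #|{set 'I_K2}| * N.
pose M := (m ^ 3 * b.+2).+1.
have K20 : 0 < K2 by rewrite /K2 addn_gt0 r0 orbT.
have [K HK] := linked_segments M K20; exists K => V e eS ntd.
have [Q [Q1 Qd Qlk]] := HK V e eS ntd.
have Qs i : sorted e (Q i) by have [_ ? _] := Q1 i.
have [nc|] := pselect (crossing e r d); first by left.
move=> nc; right.
have /choice[P LP] : forall ij : 'I_M * 'I_M, exists P : 'I_K2 -> seq V,
    linkage e setT [set x in Q ij.1] [set x in Q ij.2] P /\
    forall P' : 'I_K2 -> seq V, linkage e setT [set x in Q ij.1] [set x in Q ij.2] P' -> cost Q P <= cost Q P'.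
  by move=> ij; apply: min_linkage; exact: Qlk.
pose tr ij l := [set a | has (mem (P ij a)) (Q l)].
(* Too many bad segments would share a trace of size at least [r], which gives a crossing. *)
pose bad ij := [set l | r <= #|tr ij l|].
have badb ij : #|bad ij| <= b.
  rewrite leqNgt; apply/negP => /(@pigeon _ _ (bad ij) (tr ij))[t [h [hI hS ht]]].
  apply: nc; have N0 : 0 < N by [].
  have rt : r <= #|t| by have := hS (Ordinal N0); rewrite inE ht.
  have /card_gt0P[a0 a0t] : 0 < #|t| by exact: leq_trans rt.
  apply: (@crossing_of_minimal _ _ eS _ _ _ _ _ Q Qs Qd _ _ (LP ij).1 (LP ij).2 _ h hI a0 t r d) => //.
    by move=> l z _; rewrite inE.
  by move=> l a; rewrite -(ht l) inE => /hasP[x xQ xP]; exists x.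
have [|| x xP] := @free_set M m b.+2 (fun i j => i |: (j |: bad (i, j))).
- move=> i j; rewrite !cardsU1; have := badb (i, j).
  by case: (_ \notin _); case: (_ \notin _); move: (#|_|) => c; clear; lia.
- exact: ltnSn.
have xI : injective x.
  move=> c c' E; apply/eqP; apply: contraT => ne; have := xP c' c' c ne ne.
  by rewrite E setU11.
pose Qx c := Q (x c).
pose W := \bigcup_c [set z in Qx c].
have Qxd c c' z : z \in Qx c -> z \in Qx c' -> c = c' by move=> h1 h2; apply: xI; exact: Qd h1 h2.
(* Pairs of segments joined by an edge receive no path, as the interior of a path between them might
   be empty. *)
pose dir (p : 'I_m * 'I_m) := [exists u, exists v, [&& u \in Qx p.1, v \in Qx p.2 & e u v]].
pose D := [set p : 'I_m * 'I_m | (p.1 < p.2) && ~~ dir p].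
pose nb c : {set V} := [set z | [exists y, (y \in Qx c) && e y z]].
have lnk (p : 'I_m * 'I_m) : p \in D ->
    exists P' : 'I_K1 -> seq V, linkage e (~: W) (nb p.1) (nb p.2) P'.
  case: p => i j; rewrite inE /= => /andP[ij ndir].
  have neij : i != j by apply: contraTneq ij => ->; rewrite ltnn.
  pose hitset := \bigcup_(c | (c != i) && (c != j)) tr (x i, x j) (x c).
  have hs : #|hitset| <= m * r.
    apply: (@leq_trans (\sum_(c < m | (c != i) && (c != j)) r)).
      apply: (@leq_trans (\sum_(c < m | (c != i) && (c != j)) #|tr (x i, x j) (x c)|)).
        rewrite /hitset; elim/big_ind2: _ => // [|A1 n1 A2 n2 h1 h2]; first by rewrite cards0.
        by rewrite (leq_trans (leq_card_setU _ _).1) // leq_add.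
      apply: leq_sum => c /andP[ci cj]; have := xP i j c ci cj.
      by rewrite !in_setU1 !negb_or inE -ltnNge => /and3P[_ _ /ltnW].
    by rewrite sum_nat_const leq_mul2r -[X in _ <= X]card_ord max_card orbT.
  have Kh : K1 <= #|~: hitset|.
    have := cardsC hitset; rewrite card_ord => E; have kE : K2 = K1 + m * r + r by [].
    by move: hs E kE; clear; move: (#|hitset|) (#|~: hitset|) (m * r) => a1 a2 a3; lia.
  have [f [fI fS]] := inj_into Kh.
  have [[Pab Pd] _] := LP (x i, x j).
  suff /choice[P' HP'] : forall a, exists s, abpath e (~: W) (nb i) (nb j) s /\ {subset s <= P (x i, x j) (f a)}.
    exists P'; split; first by move=> a; case: (HP' a).
    move=> a a' z za za'; apply: fI; apply: (Pd _ _ z).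
      by have [_ ->] := HP' a.
    by have [_ ->] := HP' a'.
  move=> a; have [us ss _ [u [q [E uQ vQ]]]] := Pab (f a).
  move: uQ vQ; rewrite !inE => uQ vQ.
  have cP : conn e [set z in P (x i, x j) (f a)].
    by rewrite E in ss *; exact: conn_path.
  have uP : u \in [set z in P (x i, x j) (f a)] by rewrite inE E mem_head.
  have vP : last u q \in [set z in P (x i, x j) (f a)] by rewrite inE E mem_last.
  (* A shortest piece between the two segments. Without its ends it lies outside all chosen
     segments, and it is nonempty since no edge joins the two. *)
  have [s [s0 sP ip [h1 h2] [h3 h4]]] :=
    shortest (A := mem (Q (x i))) (B := mem (Q (x j))) uQ vQ uP (cP _ _ uP vP).
  have avoid c z : z \in s -> z \in Qx c -> c = i \/ c = j.
    move=> /sP; rewrite inE => zP zQ; apply: contrapT => /not_orP[/eqP ci /eqP cj].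
    have := fS a; rewrite inE => /negP; apply; apply/bigcupP; exists c; first by rewrite ci.
    by rewrite inE; apply/hasP; exists z.
  case: s s0 sP ip h1 h2 h3 h4 avoid => // w s _ sP ip wi lj h3 h4 avoid.
  rewrite /= in wi.
  case/lastP: s sP ip lj h3 h4 avoid => [|s w'] sP ip lj h3 h4 avoid.
    by move: neij; rewrite (Qxd _ _ _ wi lj) eqxx.
  rewrite /= last_rcons in lj.
  have [uip _] := ip; have sip := ipath_sorted ip.
  case: s sP ip h3 h4 avoid uip sip => [|y s] sP ip h3 h4 avoid uip sip.
    case/negP: ndir; apply/existsP; exists w; apply/existsP; exists w'.
    by move: sip => /= /andP[-> _]; rewrite wi lj.
  exists (y :: s).
  have ysub z : z \in y :: s -> z \in w :: rcons (y :: s) w'.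
    by move=> zs; rewrite in_cons mem_rcons in_cons zs !orbT.
  split; last by move=> z /ysub/sP; rewrite inE.
  move: sip; rewrite /= rcons_path => /and3P[wy ys lw'].
  split=> //.
  - by move: uip; rewrite cons_uniq rcons_uniq => /and3P[].
  - move=> z zs; rewrite inE; apply/bigcupP => -[c _]; rewrite inE => zc.
    have zin := ysub z zs.
    have [E1|E1] := avoid c z zin zc; rewrite E1 in zc.
      have E2 := @only_head _ u _ (mem (Q (x i))) z h3 zin zc.
      by rewrite /= in E2; move: uip; rewrite cons_uniq -E2 mem_rcons in_cons zs orbT.
    have E2 := @only_last _ u _ (mem (Q (x j))) z h4 zin zc.
    by move: uip; rewrite cons_uniq rcons_uniq => /and3P[_]; rewrite E2 last_cons last_rcons in zs; rewrite zs.
  - exists y, s; split=> //; rewrite inE; apply/existsP.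
      by exists w; rewrite wi.
    by exists w'; rewrite lj eS.
have KD : KI #|D| <= K1.
  have Dm : #|D| < (m * m).+1 by rewrite ltnS; have := max_card D; rewrite card_prod card_ord.
  by rewrite /K1 (bigmax_sup (Ordinal Dm)).
have [|//|[R [Rab Rd]]] := HKI #|D| V e (~: W) (fun q => nb (enum_val q).1) (fun q => nb (enum_val q).2) eS.
  by move=> q; have [P' LP'] := lnk _ (enum_valP q); exact: linkage_sub KD LP'.
pose Rs q : {set V} := [set z in R q].
(* The path of a pair goes to the smaller of its two indices. *)
pose Y c : {set V} := [set z in Qx c] :|: \bigcup_(q : 'I_#|D| | (enum_val q).1 == c) Rs q.
have RW q z : z \in R q -> z \notin W by have [_ _ h _] := Rab q; move=> /h; rewrite inE.
have QW c z : z \in Qx c -> z \in W by move=> zc; apply/bigcupP; exists c; rewrite ?inE.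
have Qne c : exists z, z \in Qx c.
  by have [_ _] := Q1 (x c); rewrite /Qx; case: (Q (x c)) => // z ? _; exists z; rewrite mem_head.
have Rc q : conn e (Rs q).
  have [_ ss _ [u [p [E _ _]]]] := Rab q; rewrite /Rs E in ss *; exact: conn_path.
exists Y; split.
- move=> c; have [z zc] := Qne c; apply: (@conn_bigU _ _ _ _ _ _ z) => //; first by rewrite inE.
    have [_ ss _] := Q1 (x c); move: ss zc; rewrite /Qx; case: (Q (x c)) => // w s ss _.
    exact: conn_path.
  move=> q /eqP E; split; first exact: Rc.
  have [_ _ _ [u [p [E1 uX _]]]] := Rab q; move: uX; rewrite E inE => /existsP[y /andP[yc yu]].
  by exists y, u; rewrite !inE yc E1 mem_head.
- move=> c c' z; rewrite !in_setU !inE => /orP[zc|/bigcupP[q /eqP<-]]; rewrite ?inE => hz.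
    case/orP: hz => [zc'|/bigcupP[q _]]; first exact: Qxd zc zc'.
    by rewrite inE => /RW; rewrite (QW _ _ zc).
  case/orP=> [zc'|/bigcupP[q' /eqP<-]]; first by have := RW _ _ hz; rewrite (QW _ _ zc').
  by rewrite inE => hz'; rewrite (Rd _ _ _ hz hz').
have main (i j : 'I_m) : i < j -> exists x y, [/\ x \in Y i, y \in Y j & e x y].
  move=> ij; have [/existsP[u /existsP[v /and3P[ui vj uv]]]|nd] := boolP (dir (i, j)).
    by exists u, v; rewrite !inE ui vj.
  have pD : (i, j) \in D by rewrite inE ij.
  pose q := enum_rank_in pD (i, j); have qE : enum_val q = (i, j) by rewrite enum_rankK_in.
  have [_ _ _ [u [p [E1 _ vX]]]] := Rab q; move: vX; rewrite qE inE => /existsP[y /andP[yc yu]].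
  exists (last u p), y; rewrite eS yu; split=> //; last by rewrite !inE yc.
  rewrite inE; apply/orP; right; apply/bigcupP; exists q; first by rewrite qE.
  by rewrite inE E1 mem_last.
move=> i j; rewrite neq_ltn => /orP[/main//|/main[x1 [y1 [h1 h2 h3]]]].
by exists y1, x1; rewrite eS.
Qed.

(** * Ladders *)

(** If all degrees are less than [s], a ball of radius [s] has at most [s ^ s] vertices, so some
    vertex lies farther away. *)
Lemma long_path_or_star (T : finType) (g : rel T) s : s ^ s < #|T| ->
  (forall a b, connect g a b) ->
  (exists a p, [/\ path g a p, uniq (a :: p) & s <= size p]) \/
  (exists c, s <= #|[set b | (b != c) && g c b]|).
Proof.
move=> sT cg; have [|nostar] := pselect (exists c, s <= #|[set b | (b != c) && g c b]|); first by right.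
left; have deg c : #|[set b | (b != c) && g c b]| < s.
  by rewrite ltnNge; apply/negP => h; apply: nostar; exists c.
have /card_gt0P[a _] : 0 < #|T| by apply: leq_ltn_trans sT.
pose grow (X : {set T}) := X :|: \bigcup_(c in X) [set b | (b != c) && g c b].
pose ball l := iter l grow [set a].
have ballS l : #|ball l| <= s ^ l.
  elim: l => [|l IH]; first by rewrite cards1.
  rewrite /= expnS; apply: (@leq_trans (#|ball l| + #|ball l| * s.-1)).
    apply: leq_trans (leq_card_setU _ _).1 _; rewrite leq_add2l.
    rewrite -sum_nat_const; apply: (@leq_trans (\sum_(c in ball l) #|[set b | (b != c) && g c b]|)).
      elim/big_ind2: _ => // [|A1 n1 A2 n2 h1 h2]; first by rewrite cards0.
      by rewrite (leq_trans (leq_card_setU _ _).1) // leq_add.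
    by apply: leq_sum => c _; move: (deg c); clear; lia.
  by rewrite -mulnS prednK ?(leq_ltn_trans _ (deg a)) // mulnC leq_mul2l IH orbT.
have [b bB] : exists b, b \notin ball s.
  apply: contrapT => H; move: sT; apply/negP; rewrite -leqNgt.
  apply: leq_trans (ballS s); apply: subset_leq_card; apply/subsetP => b _.
  by apply: contraT => bB; case: H; exists b.
have inball p : path g a p -> last a p \in ball (size p).
  elim/last_ind: p => [|p z IH]; first by rewrite inE.
  rewrite rcons_path last_rcons size_rcons => /andP[/IH lb gz] /=; rewrite inE.
  have [->|ne] := eqVneq z (last a p); first by rewrite lb.
  by apply/orP; right; apply/bigcupP; exists (last a p); rewrite // inE ne.
have ballm l m : l <= m -> ball l \subset ball m.
  move=> /subnKC <-; elim: (m - l) => [|k IH]; first by rewrite addn0.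
  by rewrite addnS; apply: subset_trans IH _; exact: subsetUl.
case/connectP: (cg a b) => p0 gp bE; case: (shortenP gp) bE => p gp' up _ bE.
exists a, p; split=> //; rewrite leqNgt; apply/negP => /ltnW /ballm/subsetP sub.
by case/negP: bB; rewrite bE; apply/sub/inball.
Qed.

Lemma mono_enum d (S : {set 'I_d}) N : 0 < N -> N <= #|S| ->
  exists h : nat -> 'I_d, (forall i, i < N -> h i \in S) /\
    forall i j, i < j -> j < N -> h i < h j.
Proof.
move=> N0 NS; have /card_gt0P[x0 _] : 0 < #|S| by exact: leq_trans NS.
pose l := [seq i <- enum 'I_d | i \in S].
have szl : size l = #|S|.
  by rewrite cardE /l /enum_mem -!enumT; congr (size _); rewrite -filter_predI; apply: eq_filter => i /=; rewrite andbT.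
have ltT : transitive (fun i j : 'I_d => i < j) by move=> ? ? ?; exact: ltn_trans.
have sl : sorted (fun i j : 'I_d => i < j) l.
  apply: sorted_filter => //.
  have : sorted ltn (map val (enum 'I_d)) by rewrite val_enum_ord iota_ltn_sorted.
  by rewrite sorted_map.
exists (nth x0 l); split=> [i iN|i j ij jN].
  have : nth x0 l i \in l by apply: mem_nthV; rewrite szl; exact: leq_trans NS.
  by rewrite mem_filter => /andP[].
apply: (sorted_ltn_nth ltT x0 sl) => //; rewrite inE szl.
  exact: leq_trans (ltn_trans ij jN) NS.
exact: leq_trans NS.
Qed.

Section Ladder.
Variables (V : finType) (e : rel V).
Hypothesis eS : symmetric e.

Definition link s (R : 'I_s -> seq V) (Z : {set V}) x y : Prop := e x y \/
  exists L : {set V}, [/\ conn e L, L \subset Z, forall i z, z \in L -> z \notin R i,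
    exists2 z, z \in L & e x z & exists2 z, z \in L & e y z].

(** Paths [R i] as rails, and disjoint zones [Z k] that follow each other along every rail; each
    zone contains a rung between any two consecutive rails. *)
Definition ladder s N : Prop := exists (R : 'I_s -> seq V) (Z : nat -> {set V}),
  [/\ forall i, sorted e (R i) /\ uniq (R i),
      forall i j x, x \in R i -> x \in R j -> i = j,
      forall k l x, k < N -> l < N -> x \in Z k -> x \in Z l -> k = l,
      forall i k l x y, k < l -> l < N -> x \in Z k -> x \in R i -> y \in Z l -> y \in R i ->
        index x (R i) < index y (R i) &
      forall k (i j : 'I_s), k < N -> j = i.+1 :> nat -> exists x y,
        [/\ x \in Z k, x \in R i, y \in Z k, y \in R j & link R (Z k) x y]].

Lemma link_sym s (R : 'I_s -> seq V) Z x y : link R Z x y -> link R Z y x.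
Proof. by case=> [h|[L [h1 h2 h3 h4 h5]]]; [left; rewrite eS|right; exists L]. Qed.

Lemma link_sub s s' (R : 'I_s -> seq V) (R' : 'I_s' -> seq V) (Z Z' : {set V}) x y :
  Z \subset Z' -> (forall i, exists j, R' i = R j) -> link R Z x y -> link R' Z' x y.
Proof.
move=> ZZ RR [h|[L [h1 h2 h3 h4 h5]]]; [by left|right; exists L; split=> //].
  exact: subset_trans ZZ.
by move=> i z zL; have [j ->] := RR i; exact: h3.
Qed.

Lemma conn_sorted s : sorted e s -> conn e [set z in s].
Proof. by case: s => [|x s] ss; [move=> ? ?; rewrite inE|exact: conn_path]. Qed.

Lemma conn_segment s lo hi : sorted e s -> uniq s -> conn e [set z in s | lo <= index z s <= hi].
Proof.
move=> ss us.
have [x0 _|n0] := pickP (fun z : V => z \in s); last by move=> x y; rewrite !inE n0.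
apply: (@conn_base _ _ eS _ (nth x0 s lo)) => z; rewrite inE => /andP[zs /andP[lz zh]].
have il : index z s < size s by rewrite index_mem.
have seg m : lo <= m -> m <= index z s -> nth x0 s m \in [set z in s | lo <= index z s <= hi].
  move=> lm mz; have ms := leq_ltn_trans mz il.
  by rewrite inE mem_nthV // index_uniq // lm (leq_trans mz zh).
have step m : lo <= m -> m <= index z s ->
    connect (restr e [set z in s | lo <= index z s <= hi]) (nth x0 s lo) (nth x0 s m).
  elim: m => [|m IH]; first by rewrite leqn0 => /eqP->.
  rewrite leq_eqVlt => /orP[/eqP-> //|lm] mz.
  apply: connect_trans (IH lm (ltnW mz)) (connect_restr1 (seg _ lm (ltnW mz)) (seg _ (leqW lm) mz) _).
  by apply: (sortedP x0 ss); exact: leq_ltn_trans mz il.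
by have := step _ lz (leqnn _); rewrite nth_index.
Qed.

Definition rlink r d (R : 'I_r -> seq V) (Q : 'I_d -> seq V) (i : 'I_d) (a b : 'I_r) : Prop :=
  exists x y, [/\ x \in Q i, x \in R a, y \in Q i, y \in R b & link R [set z in Q i] x y].

(** [Q i] is connected and meets all the [R a]. Were the links not connecting, a shortest piece of
    [Q i] from one class of the [R a] to the others would be a missing link. *)
Lemma rlink_connect r d (R : 'I_r -> seq V) (Q : 'I_d -> seq V) i (g : rel 'I_r) a b :
  sorted e (Q i) -> (forall a, exists2 x, x \in Q i & x \in R a) ->
  (forall a b x, x \in R a -> x \in R b -> a = b) ->
  (forall a b, rlink R Q i a b -> g a b) -> connect g a b.
Proof.
move=> sQ hit Rd rg; apply: contrapT => /negP nab.
pose C := [pred c | connect g a c].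
pose inC := [pred z | [exists c, (c \in C) && (z \in R c)]].
pose outC := [pred z | [exists c, (c \notin C) && (z \in R c)]].
have [x xQ xR] := hit a; have [y yQ yR] := hit b.
have xC : inC x by apply/existsP; exists a; rewrite inE connect0.
have yC : outC y by apply/existsP; exists b; rewrite inE nab.
have cQ := conn_sorted sQ.
have xQ' : x \in [set z in Q i] by rewrite inE.
have yQ' : y \in [set z in Q i] by rewrite inE.
have [s [s0 sP ip [h1 h2] [h3 h4]]] := shortest xC yC xQ' (cQ _ _ xQ' yQ').
have both z : inC z -> outC z -> False.
  move=> /existsP[c /andP[cC zc]] /existsP[c' /andP[c'C zc']].
  by rewrite (Rd _ _ _ zc zc') (negbTE c'C) in cC.
case: s s0 sP ip h1 h2 h3 h4 => // w s _ sP ip h1; rewrite [head _ _]/= in h1.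
case/lastP: s sP ip => [|s w'] sP ip h2 h3 h4; first by case: (both w).
rewrite last_cons last_rcons in h2.
have [uip _] := ip; have sip := ipath_sorted ip.
have mQ z : z \in w :: rcons s w' -> z \in Q i by move/sP; rewrite inE.
case/existsP: h1 => c /andP[cC wc]; case/existsP: h2 => c' /andP[c'C w'c'].
suff cc' : g c c' by case/negP: c'C; rewrite inE; apply: connect_trans (connect1 cc').
apply: rg; exists w, w'; split=> //.
- by apply: mQ; rewrite mem_head.
- by apply: mQ; rewrite in_cons mem_rcons mem_head orbT.
case: s sP ip h3 h4 uip sip mQ => [|z s] sP ip h3 h4 uip sip mQ.
  by left; move: sip => /= /andP[].
have sub v : v \in z :: s -> v \in w :: rcons (z :: s) w'.
  by move=> vs; rewrite in_cons mem_rcons in_cons vs !orbT.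
move: sip; rewrite /= rcons_path => /and3P[wz zs lw'].
right; exists [set v in z :: s]; split.
- exact: conn_path.
- by apply/subsetP => v; rewrite !inE -in_cons => /sub/mQ.
- move=> c0 v; rewrite inE => vs; apply/negP => vc0.
  have [c0C|c0C] := boolP (c0 \in C).
    have vin : inC v by apply/existsP; exists c0; rewrite c0C.
    have /= E := @only_head _ x _ _ v h3 (sub _ vs) vin.
    by move: uip; rewrite cons_uniq -E mem_rcons in_cons vs orbT.
  have vout : outC v by apply/existsP; exists c0; rewrite c0C.
  have E := @only_last _ x _ _ v h4 (sub _ vs) vout.
  by move: uip; rewrite cons_uniq rcons_uniq => /and3P[_]; rewrite E last_cons last_rcons in vs; rewrite vs.
- by exists z; rewrite ?inE ?eqxx.
- by exists (last z s); rewrite ?inE -?in_cons ?mem_last // eS.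
Qed.

(** Many [Q i] realise the same link graph on the [R a], which is connected. A long path in it
    orders the rails, each [Q i] being a zone. With a star the leaves are the rails: a rung leads
    from one leaf to the central path through one [Q i], along the central path, and back to the
    next leaf through the following [Q i]. *)
Lemma ladder_of_crossing s N r d : 0 < N -> r = (s.+1 ^ s.+1).+1 ->
  d = (#|{ffun 'I_r * 'I_r -> bool}| * (2 * N)).+1 -> crossing e r d -> ladder s N.
Proof.
move=> N0 rE dE [R [Q [Rs Rd Qs Qd [hits ord]]]].
pose g i : {ffun 'I_r * 'I_r -> bool} := [ffun p => `[< rlink R Q i p.1 p.2 >]].
have [|t [h0 [h0I _ h0t]]] := @pigeon _ _ [set: 'I_d] g (2 * N); first by rewrite cardsT card_ord dE.
have N20 : 0 < 2 * N by rewrite muln_gt0.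
have [h [hS hm]] : exists h : nat -> 'I_d, (forall i, i < 2 * N -> h i \in [set i | g i == t]) /\
    forall i j, i < j -> j < 2 * N -> h i < h j.
  apply: mono_enum => //; rewrite -[2 * N]card_ord -(card_imset _ h0I).
  by apply: subset_leq_card; apply/subsetP => i /imsetP[j _ ->]; rewrite inE h0t.
have tl i a b : i < 2 * N -> t (a, b) -> rlink R Q (h i) a b.
  by move=> /hS; rewrite inE => /eqP <-; rewrite ffunE => /asboolP.
have ord' i j a x y : i < j -> j < 2 * N -> x \in Q (h i) -> x \in R a -> y \in Q (h j) ->
    y \in R a -> index x (R a) < index y (R a).
  by move=> ij jN; apply: ord; exact: hm.
have Qd' i j x : i < 2 * N -> j < 2 * N -> x \in Q (h i) -> x \in Q (h j) -> i = j.
  move=> iN jN xi xj; have E := Qd _ _ _ xi xj.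
  by case: (ltngtP i j) => // [/hm|/hm] lt; [move: (lt jN)|move: (lt iN)]; rewrite E ltnn.
pose gam : rel 'I_r := fun a b => t (a, b).
have cg a b : connect gam a b.
  apply: (@rlink_connect r d R Q (h 0) gam) => // a' b' H.
  by have := hS 0 N20; rewrite inE /gam => /eqP <-; rewrite ffunE; apply/asboolP.
have k2 k : k < N -> 2 * k < 2 * N by move=> kN; rewrite ltn_pmul2l.
have k2' k : k < N -> (2 * k).+1 < 2 * N by clear; lia.
have [||[a [p [ap up sp]]]|[c cs]] := @long_path_or_star _ gam s.+1; rewrite ?card_ord ?rE //.
  have il (i : 'I_s) : i < size (a :: p) by move: (ltn_ord i) sp; rewrite /=; clear; lia.
  have ninj (i j : 'I_s) : nth a (a :: p) i = nth a (a :: p) j -> i = j.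
    by move/eqP; rewrite nth_uniq // => /eqP/val_inj.
  exists (fun i => R (nth a (a :: p) i)), (fun k => [set z in Q (h (2 * k))]); split.
  - by move=> i; exact: Rs.
  - by move=> i j x xi xj; apply: ninj; exact: Rd xi xj.
  - move=> k l x kN lN; rewrite !inE => xk xl.
    by have := Qd' _ _ _ (k2 _ kN) (k2 _ lN) xk xl; clear; lia.
  - move=> i k l x y kl lN; rewrite !inE => xk xi yl yi.
    by apply: ord' xk xi yl yi; [rewrite ltn_pmul2l|exact: k2].
  - move=> k i j kN ji.
    have /(tl _ _ _ (k2 _ kN))[x [y [x1 x2 y1 y2 lk]]] : t (nth a (a :: p) i, nth a (a :: p) j).
      by rewrite ji; apply: (pathP a ap); move: (il j); rewrite ji.
    exists x, y; rewrite !inE; split=> //; apply: link_sub lk => // l.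
    by exists (nth a (a :: p) l).
have [f [fI fS]] := inj_into (ltnW cs).
(* The stretch of the central path between [Q (h (2 * k))] and its successor; by the common order no
   other selected [Q] meets it. *)
pose seg k := [set z in R c | [exists x, exists y, [&& x \in Q (h (2 * k)), x \in R c,
   y \in Q (h (2 * k).+1), y \in R c & index x (R c) <= index z (R c) <= index y (R c)]]].
have segP k z : z \in seg k -> z \in R c /\ exists x y, [/\ x \in Q (h (2 * k)), x \in R c,
   y \in Q (h (2 * k).+1), y \in R c & index x (R c) <= index z (R c) <= index y (R c)].
  rewrite inE => /andP[zc /existsP[x /existsP[y /and5P[h1 h2 h3 h4 h5]]]].
  by split=> //; exists x, y.
pose Z k := [set z in Q (h (2 * k))] :|: seg k :|: [set z in Q (h (2 * k).+1)].
have ZP k z : z \in Z k -> z \in Q (h (2 * k)) \/ z \in Q (h (2 * k).+1) \/ z \in seg k.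
  by rewrite /Z !in_setU ![z \in [set _ in _]]inE => /orP[/orP[]|]; tauto.
have fc i : f i != c by have := fS i; rewrite inE => /andP[].
have Zf i k z : z \in Z k -> z \in R (f i) -> z \in Q (h (2 * k)) \/ z \in Q (h (2 * k).+1).
  move=> /ZP[|[|/segP[zc _]]] h1; [by left|by right|].
  by have := fc i; rewrite (Rd _ _ _ h1 zc) eqxx.
have segQ k m z : k < N -> m < 2 * N -> z \in seg k -> z \in Q (h m) -> m = 2 * k \/ m = (2 * k).+1.
  move=> kN mN /segP[zc [x [y [xQ xc yQ yc /andP[xz zy]]]]] zQ.
  have [lt|ge] := ltnP m (2 * k).
    by have := ord' _ _ c _ _ lt (k2 _ kN) zQ zc xQ xc; rewrite ltnNge xz.
  have [lt|ge'] := ltnP (2 * k).+1 m.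
    by have := ord' _ _ c _ _ lt mN yQ yc zQ zc; rewrite ltnNge zy.
  by move: ge ge'; clear; lia.
exists (fun i => R (f i)), Z; split.
- by move=> i; exact: Rs.
- by move=> i j x xi xj; apply: fI; exact: Rd xi xj.
- have key k l x : k < l -> l < N -> x \in Z k -> x \in Z l -> False.
    move=> kl lN; have kN := ltn_trans kl lN.
    have a1 := k2 _ kN; have a2 := k2' _ kN; have a3 := k2 _ lN; have a4 := k2' _ lN.
    case/ZP => [xk|[xk|xk]] /ZP[xl|[xl|xl]].
    + by have := Qd' _ _ _ a1 a3 xk xl; move: kl; clear; lia.
    + by have := Qd' _ _ _ a1 a4 xk xl; move: kl; clear; lia.
    + by have := segQ _ _ _ lN a1 xl xk; move: kl; clear; lia.
    + by have := Qd' _ _ _ a2 a3 xk xl; move: kl; clear; lia.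
    + by have := Qd' _ _ _ a2 a4 xk xl; move: kl; clear; lia.
    + by have := segQ _ _ _ lN a2 xl xk; move: kl; clear; lia.
    + by have := segQ _ _ _ kN a3 xk xl; move: kl; clear; lia.
    + by have := segQ _ _ _ kN a4 xk xl; move: kl; clear; lia.
    + have [xc [_ [y [_ _ yQ yc /andP[_ xy]]]]] := segP _ _ xk.
      have [_ [w [_ [wQ wc _ _ /andP[wx _]]]]] := segP _ _ xl.
      have lt : (2 * k).+1 < 2 * l by move: kl; clear; lia.
      by have := ord' _ _ c _ _ lt a3 yQ yc wQ wc; rewrite ltnNge (leq_trans wx xy).
  by move=> k l x kN lN xk xl; case: (ltngtP k l) => // lt; [case: (key k l x)|case: (key l k x)].
- move=> i k l x y kl lN /Zf xk xi /Zf yl yi; have kN := ltn_trans kl lN.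
  have a3 := k2 _ lN; have a4 := k2' _ lN.
  by case: (xk _ xi) => xq; case: (yl _ yi) => yq; apply: ord' xq xi yq yi => //; move: kl; clear; lia.
- move=> k i j kN ji.
  have gs i0 : gam c (f i0) by have := fS i0; rewrite inE => /andP[].
  have [y [x [y1 y2 x1 x2 /link_sym lk]]] := tl _ _ _ (k2 _ kN) (gs i).
  have [y' [x' [y'1 y'2 x'1 x'2 lk']]] := tl _ _ _ (k2' _ kN) (gs j).
  exists x, x'; rewrite !in_setU ![_ \in [set _ in _]]inE x1 x'1 orbT; split=> //.
  have yy' : index y (R c) < index y' (R c) by apply: ord' y1 y2 y'1 y'2; rewrite ?k2'.
  have [sc uc] := Rs c.
  pose S := [set z in R c | index y (R c) <= index z (R c) <= index y' (R c)].
  have cS : conn e S by exact: conn_segment.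
  have yS : y \in S by rewrite inE y2 leqnn (ltnW yy').
  have y'S : y' \in S by rewrite inE y'2 leqnn (ltnW yy').
  have SZ : S \subset seg k.
    apply/subsetP => z; rewrite !inE => /andP[-> h1] /=.
    by apply/existsP; exists y; apply/existsP; exists y'; rewrite y1 y2 y'1 y'2.
  have SR l z : z \in S -> z \notin R (f l).
    rewrite inE => /andP[zc _]; apply/negP => zf.
    by have := fc l; rewrite (Rd _ _ _ zf zc) eqxx.
  have ext x0 y0 m (L0 : {set V}) : link R [set z in Q (h m)] x0 y0 -> conn e L0 -> y0 \in L0 ->
      [set z in Q (h m)] \subset Z k -> L0 \subset Z k -> (forall l z, z \in L0 -> z \notin R (f l)) ->
      exists L1 : {set V}, [/\ conn e L1, L1 \subset Z k, forall l z, z \in L1 -> z \notin R (f l),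
         exists2 z, z \in L1 & e x0 z & L0 \subset L1].
    move=> [xy|[L [L1 L2 L3 [u uL xu] [v vL yv]]]] c0 y0L QZ LZ LR; first by exists L0; split=> //; exists y0.
    exists (L :|: L0); split.
    - by apply: (connU eS L1 c0 vL y0L); rewrite eS yv orbT.
    - by rewrite subUset LZ (subset_trans L2).
    - by move=> l z; rewrite inE => /orP[/L3//|/LR].
    - by exists u; rewrite ?inE ?uL.
    - exact: subsetUr.
  have QZ : [set z in Q (h (2 * k))] \subset Z k by rewrite /Z -setUA subsetUl.
  have QZ' : [set z in Q (h (2 * k).+1)] \subset Z k by rewrite /Z subsetUr.
  have SZ' : S \subset Z k by apply: subset_trans SZ _; rewrite /Z -setUA setUCA subsetUl.
  have [L1 [c1 z1 r1 n1 s1]] := ext _ _ _ _ lk cS yS QZ SZ' SR.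
  have [L2 [c2 z2 r2 n2 s2]] := ext _ _ _ _ (link_sym lk') c1 (subsetP s1 _ y'S) QZ' z1 r1.
  right; exists L2; split=> //.
  by have [z zL xz] := n1; exists z => //; exact: (subsetP s2).
Qed.

End Ladder.

(** * Coordinates in walls *)

Section Coordinates.
Variable t : nat.
Hypothesis t2 : 1 < t.

(* The vertices of the wall are the vertices of Gamma_t incident with a vertical edge. *)
Definition valid (r c : nat) : bool := if odd (r + c) then 0 < r else r.+1 < t.

Definition row (w : wall t) : nat := (sval (sval w)).1.
Definition col (w : wall t) : nat := (sval (sval w)).2.

Lemma row_lt w : row w < t. Proof. exact: ltn_ord. Qed.
Lemma col_lt w : col w < 2 * t. Proof. exact: ltn_ord. Qed.

Lemma coord_inj w w' : row w = row w' -> col w = col w' -> w = w'.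
Proof.
move=> E1 E2; apply: val_inj; apply: val_inj => /=.
move: E1 E2; rewrite /row /col; case: (sval (sval w)) (sval (sval w')) => [a b] [a' b'] /= E1 E2.
by congr (_, _); exact: val_inj.
Qed.

Lemma gamma_arcE (x y : 'I_t * 'I_(2 * t)) : gamma_arc x y =
  ((x.1 == y.1 :> nat) && (y.2 == x.2.+1 :> nat)) ||
  [&& x.2 == y.2 :> nat, y.1 == x.1.+1 :> nat & ~~ odd (x.1 + x.2)].
Proof. by rewrite /gamma_arc addSn oddS. Qed.

Lemma partner (x : gamma t) : valid x.1 x.2 ->
  exists y : gamma t, [/\ valid y.1 y.2, sedge x y & y.1 != x.1].
Proof.
case: x => -[r rt] [c ct] /=; rewrite /valid; case: ifPn => o h.
  have r't : r.-1 < t by move: rt; clear; lia.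
  exists (Ordinal r't, Ordinal ct); split=> /=.
  - by rewrite ifF; move: h o rt; clear; lia.
  - by rewrite /gamma_rel !gamma_arcE /= !eqxx; move: h o; clear; lia.
  - by rewrite -val_eqE /=; move: h; clear; lia.
exists (Ordinal h, Ordinal ct); split=> /=.
- by rewrite ifT //; move: o; clear; lia.
- by rewrite /gamma_rel !gamma_arcE /= !eqxx; move: o; clear; lia.
- by rewrite -val_eqE /=; clear; lia.
Qed.

Lemma invalid_row (x y : gamma t) : ~~ valid x.1 x.2 -> sedge x y -> x.1 = y.1.
Proof.
case: x y => -[r rt] [c ct] [[r' rt'] [c' ct']] /=; rewrite /gamma_rel !gamma_arcE /valid /=.
move=> nv h; apply: val_inj => /=; move: nv h rt rt'.
by case: ifP => o; move: o; clear; lia.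
Qed.

Lemma horizontal (x : gamma t) : exists y : gamma t, sedge x y /\ y.1 = x.1.
Proof.
case: x => r [c ct]; case: (ltnP c.+1 (2 * t)) => h.
  exists (r, Ordinal h); split=> //=; by rewrite /gamma_rel !gamma_arcE /= !eqxx.
have h' : c.-1 < 2 * t by move: ct; clear; lia.
exists (r, Ordinal h'); split=> //=; rewrite /gamma_rel !gamma_arcE /= !eqxx.
by move: h t2; clear; lia.
Qed.

Lemma valid_degree (x : gamma t) : valid x.1 x.2 -> degree x != 1.
Proof.
move=> /partner[y [_ xy ne]]; have [z [xz E]] := horizontal x.
have yz : y != z by apply: contraNneq ne => ->; rewrite E.
rewrite /degree; apply/eqP => h1.
have : [set y; z] \subset neighbors x by apply/subsetP => w; rewrite !inE => /orP[]/eqP->.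
by move/subset_leq_card; rewrite cards2 yz h1.
Qed.

Lemma suppressed_invalid (z : gamma_pruned t) :
  (z \in gamma_suppressed t) = ~~ valid (sval z).1 (sval z).2.
Proof.
rewrite inE; case: (boolP (valid _ _)) => v /=.
  have [y [yv zy ne]] := partner v.
  apply/negbTE; rewrite negb_and; apply/orP; right; apply/forallPn.
  have yp : y \in [set x : gamma t | degree x != 1] by rewrite inE valid_degree.
  exists (exist _ y yp : gamma_pruned t); rewrite negb_imply ne andbT; exact: zy.
apply/andP; split.
  move: v; rewrite /valid; case: (odd _) => /=; rewrite -leqNgt; move: (ltn_ord (sval z).1).
    by rewrite leqn0 => _ /eqP->.
  by move=> h1 h2; apply/orP; right; apply/eqP; apply/eqP; rewrite eqn_leq h1 h2.
apply/forallP => y; apply/implyP => zy; apply/eqP; apply/esym.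
exact: (invalid_row v zy).
Qed.

Lemma wall_valid w : valid (row w) (col w).
Proof. by have := svalP w; rewrite suppressed_invalid negbK. Qed.

Lemma wall_vertex r c : r < t -> c < 2 * t -> valid r c -> exists w : wall t, row w = r /\ col w = c.
Proof.
move=> rt ct v; pose x : gamma t := (Ordinal rt, Ordinal ct).
have vx : valid x.1 x.2 by [].
have xp : x \in [set x : gamma t | degree x != 1] by rewrite inE valid_degree.
pose xx : gamma_pruned t := exist _ x xp.
have xs : xx \notin gamma_suppressed t by rewrite suppressed_invalid negbK.
by exists (exist _ xx xs).
Qed.

(** Vertical edges. The horizontal ones are given by [before], which includes those arising from a
    suppression. *)
Definition below (w w' : wall t) : Prop :=
  [/\ col w = col w', row w' = (row w).+1 & ~~ odd (row w + col w)].
Definition before (w w' : wall t) : Prop :=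
  [/\ row w = row w', col w < col w' & forall c, col w < c < col w' -> ~~ valid (row w) c].

Lemma wall_edge (w w' : wall t) : sedge w w' ->
  below w w' \/ below w' w \/ before w w' \/ before w' w.
Proof.
have gam (x y : wall t) : sedge (sval (sval x)) (sval (sval y)) ->
    below x y \/ below y x \/ before x y \/ before y x.
  rewrite /= /gamma_rel !gamma_arcE -/(row x) -/(row y) -/(col x) -/(col y).
  have noc c c' : forall d, c < d < c.+1 -> ~~ valid c' d by move=> d; clear; lia.
  case/orP => /orP[/andP[/eqP E1 /eqP E2]|/and3P[/eqP E1 /eqP E2 o]].
  - by right; right; left; split; rewrite ?E2 //; exact: noc.
  - by left; split.
  - by right; right; right; split; rewrite ?E2 //; exact: noc.
  - by right; left; split.
case/andP=> ne /orP[|/exists_inP[z zs]]; first exact: gam.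
case/andP => wz zw'; rewrite suppressed_invalid in zs.
have E1 := invalid_row zs zw'.
have E2 : (sval (sval w)).1 = (sval z).1.
  by apply/esym; apply: (invalid_row zs); rewrite sedge_sym.
move: wz zw'; rewrite /= /gamma_rel !gamma_arcE E2 -E1 !eqxx /=.
have n1 : ((sval z).1 == (sval z).1.+1 :> nat) = false by rewrite ltn_eqF.
rewrite n1 !andbF !orbF => h1 h2.
have rE : row w = row w' by rewrite /row E2 E1.
have nc : col w != col w' by apply: contra ne => /eqP E; apply/eqP; exact: coord_inj.
have mid (d : nat) : d = (sval z).2 -> ~~ valid (row w) d by move=> ->; rewrite /row E2.
right; right; move: h1 h2 nc; rewrite -/(col w) -/(col w') => h1 h2 nc.
have [lt|ge] := ltnP (col w) (col w'); [left|right]; split=> //.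
- move=> c hc; apply: mid; apply/eqP; move: h1 h2 nc lt hc; set zc := nat_of_ord (sval z).2; clearbody zc; clear; lia.
- by move: ge nc; clear; lia.
- rewrite -rE => c hc; apply: mid; apply/eqP; move: h1 h2 nc ge hc; set zc := nat_of_ord (sval z).2; clearbody zc; clear; lia.
Qed.

Lemma below_edge (w w' : wall t) : below w w' -> sedge w w'.
Proof.
case=> E1 E2 o; rewrite /= /suppress_rel; apply/andP; split.
  by apply/eqP => E; move: E2; rewrite E; clear; lia.
apply/orP; left; rewrite /= /gamma_rel !gamma_arcE -/(row w) -/(row w') -/(col w) -/(col w').
by rewrite E1 E2 !eqxx /= -E1 o orbT.
Qed.

(** Validity depends on the parity of the column only, so there is at most one invalid vertex
    between [w] and [w'], and it is suppressed. *)
Lemma before_edge (w w' : wall t) : before w w' -> sedge w w'.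
Proof.
case=> E1 lt nv; rewrite /= /suppress_rel; apply/andP; split.
  by apply/eqP => E; move: lt; rewrite E ltnn.
have [E|ne] := eqVneq (col w') (col w).+1.
  apply/orP; left; rewrite /= /gamma_rel !gamma_arcE -/(row w) -/(row w') -/(col w) -/(col w').
  by rewrite E1 E !eqxx.
have v1 : ~~ valid (row w) (col w).+1 by apply: nv; move: lt ne; clear; lia.
have v2 : valid (row w) (col w).+2.
  by have := wall_valid w; rewrite /valid !addnS /= negbK.
have E2 : col w' = (col w).+2.
  apply/eqP; apply: contraT => ne2; have := nv (col w).+2; rewrite v2; apply.
  by move: lt ne ne2; clear; lia.
have ct : (col w).+1 < 2 * t by have := col_lt w'; rewrite E2; exact: ltnW.
pose z : gamma t := ((sval (sval w)).1, Ordinal ct).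
have wz : sedge (sval (sval w)) z by rewrite /= /gamma_rel !gamma_arcE /= !eqxx.
have zw' : sedge z (sval (sval w')).
  by rewrite /= /gamma_rel !gamma_arcE /= -/(row w) -/(row w') -/(col w') E1 E2 !eqxx.
have zp : z \in [set x : gamma t | degree x != 1].
  rewrite inE /degree; apply/eqP => h1.
  have ne' : sval (sval w) != sval (sval w').
    by apply/eqP => E; move: E2; rewrite /col E; clear; lia.
  have : [set sval (sval w); sval (sval w')] \subset neighbors z.
    by apply/subsetP => u; rewrite !inE => /orP[]/eqP-> //; rewrite sedge_sym.
  by move/subset_leq_card; rewrite cards2 ne' h1.
apply/orP; right; apply/exists_inP; exists (exist _ z zp : gamma_pruned t).
  by rewrite suppressed_invalid.
by apply/andP; split; [exact: wz|exact: zw'].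
Qed.

Definition leftmost (w : wall t) : bool := [forall w' : wall t, (row w' == row w) ==> (col w <= col w')].
Definition rightmost (w : wall t) : bool := [forall w' : wall t, (row w' == row w) ==> (col w' <= col w)].

(* inr false and inr true are new vertices seeing the left and the right ends of the rows; they raise
   all degrees to at least three. *)
Definition wall_ext : rel (wall t + bool) := fun u v =>
  match u, v with
  | inl w, inl w' => sedge w w'
  | inl w, inr b | inr b, inl w => if b then rightmost w else leftmost w
  | inr a, inr b => a != b
  end.

Lemma wall_ext_sym : symmetric wall_ext.
Proof. by move=> [u|a] [v|b] //=; [exact: suppress_sym|rewrite eq_sym]. Qed.

Lemma wall_ext_irr : irreflexive wall_ext.
Proof. by move=> [u|a] /=; [exact: suppress_irr|rewrite eqxx]. Qed.

Lemma valid_in_row r : r < t -> exists2 c, c < 2 * t & valid r c.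
Proof.
move=> rt; case o : (odd r).
  by exists 0; [move: t2; clear; lia|rewrite /valid addn0 o; move: o; clear; lia].
case: (ltnP r.+1 t) => h; first by exists 0; [move: t2; clear; lia|rewrite /valid addn0 o].
by exists 1; rewrite /valid ?addn1 /= ?o /=; move: h t2; clear; lia.
Qed.

Lemma row_ends r : r < t -> exists w w' : wall t,
  [/\ row w = r, leftmost w, row w' = r & rightmost w'].
Proof.
move=> rt; have [c ct v] := valid_in_row rt; have [w0 [E0 _]] := wall_vertex rt ct v.
have P0 : row w0 == r by apply/eqP.
case: (arg_minnP (P := fun w : wall t => row w == r) col P0) => w /eqP wr wm.
case: (arg_maxnP (P := fun w : wall t => row w == r) col P0) => w' /eqP w'r w'm.
exists w, w'; split=> //; apply/forallP => u; apply/implyP; rewrite ?wr ?w'r; [exact: wm|exact: w'm].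
Qed.

Lemma partner_wall w : exists w', below w w' \/ below w' w.
Proof.
have [y [yv xy ne]] := partner (wall_valid w : valid (sval (sval w)).1 (sval (sval w)).2).
have [w' [E1 E2]] := wall_vertex (ltn_ord y.1) (ltn_ord y.2) yv; exists w'.
move: xy ne; rewrite /= /gamma_rel !gamma_arcE -val_eqE /= -/(row w) -/(col w) -E1 -E2 => xy ne.
rewrite (negbTE ne) eq_sym (negbTE ne) /= in xy.
case/orP: xy => /and3P[/eqP h1 /eqP h2 o]; [by left|by right].
Qed.

Lemma next_right w : rightmost w \/ exists w', before w w'.
Proof.
case: (boolP (rightmost w)) => [|/forallPn[u]]; first by left.
rewrite negb_imply -ltnNge => /andP[ur lt]; right.
have Pu : (row u == row w) && (col w < col u) by rewrite ur.
case: (arg_minnP (P := fun u => (row u == row w) && (col w < col u)) col Pu) => w' /andP[/eqP E l'] m.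
exists w'; split=> // c /andP[h1 h2]; apply/negP => v.
have [x [x1 x2]] := wall_vertex (row_lt w) (ltn_trans h2 (col_lt w')) v.
by have := m x; rewrite x1 x2 eqxx h1 /= leqNgt h2 => /(_ isT).
Qed.

Lemma next_left w : leftmost w \/ exists w', before w' w.
Proof.
case: (boolP (leftmost w)) => [|/forallPn[u]]; first by left.
rewrite negb_imply -ltnNge => /andP[ur lt]; right.
have Pu : (row u == row w) && (col u < col w) by rewrite ur.
case: (arg_maxnP (P := fun u => (row u == row w) && (col u < col w)) col Pu) => w' /andP[/eqP E l'] m.
exists w'; split=> // c /andP[h1 h2]; apply/negP => v; rewrite E in v.
have [x [x1 x2]] := wall_vertex (row_lt w) (ltn_trans h2 (col_lt w)) v.
by have := m x; rewrite x1 x2 eqxx h2 /= leqNgt h1 => /(_ isT).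
Qed.

(** A vertex of the wall has a vertical neighbour and one on each side, possibly a new vertex. A new
    vertex sees the other one and an end of each of the [t >= 2] rows. *)
Lemma wall_ext_degree u : 2 < #|[set v | wall_ext u v]|.
Proof.
case: u => [w|b].
  have three (a b c : wall t + bool) : wall_ext (inl w) a -> wall_ext (inl w) b -> wall_ext (inl w) c ->
      a != b -> a != c -> b != c -> 2 < #|[set v | wall_ext (inl w) v]|.
    move=> ha hb hc ab ac bc; have : [set a; b; c] \subset [set v | wall_ext (inl w) v].
      by apply/subsetP => v; rewrite !inE => /orP[/orP[]|] /eqP->.
    move/subset_leq_card; rewrite setUC cardsU1 cards2 !inE ab negb_or.
    by rewrite ![c == _]eq_sym ac bc.
  have [p pP] := partner_wall w.
  have pe : sedge w p by case: pP => /below_edge h; [|rewrite sedge_sym].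
  have pc : col p = col w by case: pP => -[].
  have [x [xe xne]] : exists x, wall_ext (inl w) x /\ (x = inr true \/ exists2 w', x = inl w' & col w < col w').
    case: (next_right w) => [h|[w' h]]; first by exists (inr true); split=> //; left.
    exists (inl w'); split; first exact: before_edge.
    by right; exists w'; case: h.
  have [y [ye yne]] : exists y, wall_ext (inl w) y /\ (y = inr false \/ exists2 w', y = inl w' & col w' < col w).
    case: (next_left w) => [h|[w' h]]; first by exists (inr false); split=> //; left.
    exists (inl w'); split; first by have := before_edge h; rewrite sedge_sym.
    by right; exists w'; case: h.
  apply: (three (inl p) x y) => //.
  - by case: xne => [->//|[w' -> lt]]; apply/eqP => -[E]; rewrite -E pc ltnn in lt.
  - by case: yne => [->//|[w' -> lt]]; apply/eqP => -[E]; rewrite -E pc ltnn in lt.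
  - case: xne => [->|[w' -> lt]]; case: yne => [->|[w2 -> lt2]] //.
    by apply/eqP => -[E]; rewrite E in lt; move: lt lt2; clear; lia.
have /choice[f fP] : forall i : 'I_t, exists w, row w = i /\ if b then rightmost w else leftmost w.
  by move=> i; have [w [w' [h1 h2 h3 h4]]] := row_ends (ltn_ord i); case: b; [exists w'|exists w].
have fI : injective f.
  by move=> i j E; apply: val_inj => /=; rewrite -(fP i).1 -(fP j).1 E.
have : (inr (~~ b)) |: [set (inl (f i) : wall t + bool) | i in 'I_t] \subset [set v | wall_ext (inr b) v].
  apply/subsetP => v; rewrite !inE => /orP[/eqP-> /=|/imsetP[i _ ->]]; first by case: b {fP}.
  by case: (fP i).
move/subset_leq_card; rewrite cardsU1.
have -> : inr (~~ b) \notin [set (inl (f i) : wall t + bool) | i in 'I_t].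
  by apply/negP => /imsetP[].
rewrite card_imset ?card_ord; last by move=> i j [/fI].
by move/(leq_trans _); apply; rewrite add1n ltnS.
Qed.

End Coordinates.

(** * Models of walls *)

Definition model (V U : finType) (e : rel V) (r : rel U) (X : U -> {set V}) : Prop :=
  [/\ forall u, conn e (X u),
      forall u v z, z \in X u -> z \in X v -> u = v &
      forall u v, r u v -> exists x y, [/\ x \in X u, y \in X v & e x y]].

Section LadderModel.
Variables (V : finType) (e : rel V).
Hypothesis eS : symmetric e.

Lemma conn_convex (s : seq V) (S : {set V}) : sorted e s -> uniq s -> {subset S <= s} ->
  (forall x y z, x \in S -> y \in S -> z \in s -> index x s <= index z s <= index y s -> z \in S) ->
  conn e S.
Proof.
move=> ss us Ss cv.
have half x y : x \in S -> y \in S -> index x s <= index y s -> connect (restr e S) x y.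
  move=> xS yS xy.
  have cs := @conn_segment _ _ eS s (index x s) (index y s) ss us.
  apply: connect_restr_mono (cs x y _ _); rewrite ?inE ?Ss ?leqnn ?xy //.
  by apply/subsetP => z; rewrite inE => /andP[zs h]; exact: cv xS yS zs h.
move=> x y xS yS; case: (leqP (index x s) (index y s)) => h; first exact: half.
by rewrite (conn_sym eS); apply: half => //; exact: ltnW.
Qed.

(** An empty [L] encodes a direct edge, so that the vertex set of a link is always available. *)
Definition joins (L : {set V}) x y : Prop :=
  (L = set0 /\ e x y) \/ [/\ conn e L, exists2 z, z \in L & e x z & exists2 z, z \in L & e y z].

Lemma conn_joins (A B L : {set V}) x y : conn e A -> conn e B -> x \in A -> y \in B -> joins L x y ->
  conn e (A :|: L :|: B).
Proof.
move=> cA cB xA yB [[-> xy]|[cL [z zL xz] [z' z'L yz']]].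
  by rewrite setU0; apply: (connU eS cA cB xA yB); rewrite xy orbT.
have cAL : conn e (A :|: L) by apply: (connU eS cA cL xA zL); rewrite xz orbT.
by apply: (connU eS cAL cB (_ : z' \in A :|: L) yB); rewrite ?inE ?z'L ?orbT // eS yz' orbT.
Qed.

Lemma conn_chain n (S L : nat -> {set V}) : (forall i, i <= n -> conn e (S i)) ->
  (forall i, i < n -> exists x y, [/\ x \in S i, y \in S i.+1 & joins (L i) x y]) ->
  conn e ((\bigcup_(i < n.+1) S i) :|: \bigcup_(i < n) L i).
Proof.
elim: n => [|n IH] cS jL.
  by rewrite big_ord_recl !big_ord0 !setU0; exact: cS.
have [x [y [xS yS j]]] := jL n (ltnSn n).
have IH' := IH (fun i h => cS i (leqW h)) (fun i h => jL i (leqW h)).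
have xA : x \in (\bigcup_(i < n.+1) S i) :|: \bigcup_(i < n) L i.
  by rewrite inE; apply/orP; left; apply/bigcupP; exists ord_max.
have := conn_joins IH' (cS n.+1 (leqnn _)) xA yS j.
by rewrite [\bigcup_(i < n.+2) _]big_ord_recr [\bigcup_(i < n.+1) L i]big_ord_recr /= setUACA [S n.+1 :|: _]setUC setUA.
Qed.

(** Rails 0 to [t - 1] carry the rows. Each vertex of the wall owns the stretch of its rail from its
    own rung to that of the next vertex. The initial and final stretches of all rails, joined by the
    first and the last [t] rungs, form the parts of the two new vertices, and the additional rail
    [t] makes these two adjacent. *)
Lemma wall_of_ladder t : 1 < t -> ladder e t.+1 (t + 2 * t * t + t) ->
  exists X : wall t + bool -> {set V}, model e (@wall_ext t) X.
Proof.
move=> t2; set TR := t + 2 * t * t; set N := TR + t; move=> [R [Z [Rs Rd Zd ord lk]]].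
pose Rn i := R (inord i).
have Rns i : sorted e (Rn i) by case: (Rs (inord i)).
have Rnu i : uniq (Rn i) by case: (Rs (inord i)).
have Rnd i j x : i <= t -> j <= t -> x \in Rn i -> x \in Rn j -> i = j.
  by move=> it jt xi xj; have := Rd _ _ _ xi xj => /(congr1 val) /=; rewrite !inordK.
have ordn i k l x y : k < l -> l < N -> x \in Z k -> x \in Rn i -> y \in Z l -> y \in Rn i ->
    index x (Rn i) < index y (Rn i) by exact: ord.
have lkn k i : k < N -> i < t -> exists x y, [/\ x \in Z k, x \in Rn i, y \in Z k, y \in Rn i.+1 &
    link e R (Z k) x y].
  by move=> kN it; apply: lk => //; rewrite !inordK //; exact: leqW.
have N0 : 0 < N by rewrite /N /TR; move: t2; clear; lia.
have [v0 _] := lkn 0 0 N0 (ltnW t2).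
have /choice[f fP] : forall p : nat * nat, exists q : V * V * {set V}, p.1 < N -> p.2 < t ->
    [/\ q.1.1 \in Z p.1 /\ q.1.1 \in Rn p.2, q.1.2 \in Z p.1 /\ q.1.2 \in Rn p.2.+1,
        q.2 \subset Z p.1, forall i z, z \in q.2 -> z \notin Rn i & joins q.2 q.1.1 q.1.2].
  move=> [k i] /=; case: (ltnP k N) => kN; last by exists (v0, v0, set0).
  case: (ltnP i t) => it; last by exists (v0, v0, set0).
  have [x [y [x1 x2 y1 y2 [xy|[L [L1 L2 L3 L4 L5]]]]]] := lkn k i kN it.
    exists (x, y, set0) => _ _; split=> //=; first exact: sub0set.
      by move=> ? ?; rewrite inE.
    by left.
  by exists (x, y, L) => _ _; split=> //=; [move=> j z; exact: L3|right].
pose xe k i := (f (k, i)).1.1; pose ye k i := (f (k, i)).1.2; pose La k i := (f (k, i)).2.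
have {}fP k i : k < N -> i < t -> [/\ xe k i \in Z k /\ xe k i \in Rn i,
   ye k i \in Z k /\ ye k i \in Rn i.+1, La k i \subset Z k, forall j z, z \in La k i -> z \notin Rn j &
   joins (La k i) (xe k i) (ye k i)] by exact: (fP (k, i)).
(* The upper row of the vertical edge at [w], the same for both ends of that edge. *)
pose lrow (w : wall t) := if odd (row w + col w) then (row w).-1 else row w.
(* Each vertical edge has a zone of its own, ordered by columns. The zones below [t] and from [TR]
   on are reserved for the two new vertices. *)
pose time (w : wall t) := t + col w * t + lrow w.
pose endv (w : wall t) := if odd (row w + col w) then ye (time w) (lrow w) else xe (time w) (lrow w).
have lrow_lt (w : wall t) : lrow w < t by rewrite /lrow; have := row_lt w; case: ifP; lia.
have time_lt (w : wall t) : time w < TR.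
  have h : (col w).+1 * t <= 2 * t * t by rewrite leq_mul2r col_lt orbT.
  by rewrite /time /TR; move: h (lrow_lt w); rewrite mulSn; clear; lia.
have time_ge (w : wall t) : t <= time w by rewrite /time -addnA leq_addr.
have TRN : TR <= N by exact: leq_addr.
have time_ltN w : time w < N by exact: leq_trans (time_lt w) TRN.
have time_mono (w w' : wall t) : col w < col w' -> time w < time w'.
  move=> lt; have h : (col w).+1 * t <= col w' * t by rewrite leq_mul2r lt orbT.
  by rewrite /time; move: h (lrow_lt w); rewrite mulSn; clear; lia.
have end_in (w : wall t) : endv w \in Z (time w) /\ endv w \in Rn (row w).
  have [[a1 a2] [b1 b2] _ _ _] := fP _ _ (time_ltN w) (lrow_lt w).
  have := wall_valid t2 w; rewrite /endv /valid; case: ifP => o v.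
    split=> //; move: b2; rewrite {2}/lrow o prednK //.
  by split=> //; move: a2; rewrite {2}/lrow o.
pose pos w := index (endv w) (Rn (row w)).
have pos_mono (w w' : wall t) : row w = row w' -> col w < col w' -> pos w < pos w'.
  move=> E lt; have [a1 a2] := end_in w; have [b1 b2] := end_in w'.
  by rewrite /pos E; apply: ordn a1 _ b1 b2 => //; [exact: time_mono|rewrite -E].
(* The part of [inr true] begins here on rail [i]: on rail 0 with the first of its rungs, on rail
   [j.+1] with the arrival of the rung from rail [j]. *)
pose rend i := if i is j.+1 then ye (TR + j) j else xe TR 0.
have rtime i : i < t -> TR + i < N by rewrite /N ltn_add2l.
have rend_in i : i <= t -> rend i \in Z (TR + i.-1) /\ rend i \in Rn i.
  case: i => [|i] it /=.
    by have [[a1 a2] _ _ _ _] := fP TR 0 (leq_ltn_trans (leq_addr 0 _) (rtime 0 (ltnW t2))) (ltnW t2); rewrite addn0.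
  by have [_ [b1 b2] _ _ _] := fP _ _ (rtime i it) it.
have rtime' i : i <= t -> TR + i.-1 < N by move=> it; apply: rtime; move: it t2; clear; lia.
pose epos i := index (rend i) (Rn i).
have early k i z : k < TR -> i <= t -> z \in Z k -> z \in Rn i -> index z (Rn i) < epos i.
  move=> kT it zk zi; have [a1 a2] := rend_in _ it.
  by apply: ordn zk zi a1 a2; [exact: ltn_addr|exact: rtime'].
have pos_e w : pos w < epos (row w).
  by have [a1 a2] := end_in w; apply: early a1 a2; rewrite ?time_lt // ltnW // row_lt.
pose inrow (u : wall t + bool) i z := (z \in Rn i) && match u with
  | inl w => [&& row w == i, pos w <= index z (Rn i), index z (Rn i) < epos i &
               [forall w' : wall t, (row w' == row w) && (col w < col w') ==> (index z (Rn i) < pos w')]]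
  | inr false => (index z (Rn i) < epos i) && [forall w' : wall t, (row w' == i) ==> (index z (Rn i) < pos w')]
  | inr true => epos i <= index z (Rn i) end.
(* The interior of a vertical rung is given to its upper end, whose row and column have an even
   sum. *)
pose inlink (u : wall t + bool) k i := match u with
  | inl w => [&& k == time w, i == row w & ~~ odd (row w + col w)]
  | inr false => k == i
  | inr true => k == TR + i end.
pose X u := [set z | [exists i : 'I_t.+1, inrow u i z] ||
   [exists i : 'I_t, exists k : 'I_N, inlink u k i && (z \in La k i)]].
have Xrow u i z : i <= t -> inrow u i z -> z \in X u.
  by move=> it h; rewrite inE; apply/orP; left; apply/existsP; exists (Ordinal (it : i < t.+1)).
have Xlink u k i z : k < N -> i < t -> inlink u k i -> z \in La k i -> z \in X u.
  move=> kN it h zL; rewrite inE; apply/orP; right; apply/existsP; exists (Ordinal it).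
  by apply/existsP; exists (Ordinal kN); rewrite h.
have XP u z : z \in X u -> (exists i, i <= t /\ inrow u i z) \/
    (exists k i, [/\ k < N, i < t, inlink u k i & z \in La k i]).
  rewrite inE => /orP[/existsP[i h]|/existsP[i /existsP[k /andP[h1 h2]]]].
    by left; exists i; split=> //; rewrite -ltnS.
  by right; exists k, i.
have Lrow k i j z : k < N -> i < t -> z \in La k i -> z \notin Rn j.
  by move=> kN it; have [_ _ _ h _] := fP _ _ kN it; exact: h.
have LZ k i z : k < N -> i < t -> z \in La k i -> z \in Z k.
  by move=> kN it; have [_ _ /subsetP h _ _] := fP _ _ kN it; exact: h.
have inrow_conn u i : conn e [set z | inrow u i z].
  apply: (conn_convex (Rns i) (Rnu i)); first by move=> z; rewrite inE => /andP[].
  move=> x y z; rewrite !inE /inrow => /andP[xR hx] /andP[yR hy] -> /andP[xz zy] /=.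
  case: u hx hy => [w|[]].
  - move=> /and4P[-> px _ _] /and4P[_ _ ye' /forallP fy]; rewrite (leq_trans px xz) (leq_ltn_trans zy ye') /=.
    by apply/forallP => w'; apply/implyP => h; have /implyP/(_ h) := fy w'; exact: leq_ltn_trans.
  - by move=> h _; exact: leq_trans xz.
  - move=> _ /andP[ye' /forallP fy]; rewrite (leq_ltn_trans zy ye') /=.
    by apply/forallP => w'; apply/implyP => h; have /implyP/(_ h) := fy w'; exact: leq_ltn_trans.
have xe_row k i : k < N -> i < t -> xe k i \in Rn i by move=> kN it; have [[_ ?] _ _ _ _] := fP _ _ kN it.
have ye_row k i : k < N -> i < t -> ye k i \in Rn i.+1 by move=> kN it; have [_ [_ ?] _ _ _] := fP _ _ kN it.
have end_inrow w : inrow (inl w) (row w) (endv w).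
  rewrite /inrow (end_in w).2 eqxx leqnn pos_e /=.
  by apply/forallP => w'; apply/implyP => /andP[/eqP E lt]; exact: pos_mono.
exists X; split.
- case=> [w|b].
    have E : X (inl w) = [set z | inrow (inl w) (row w) z] :|:
        (if odd (row w + col w) then set0 else La (time w) (row w)).
      apply/setP => z; rewrite in_setU [z \in [set _ | _]]inE; apply/idP/orP => [/XP[[i [it h]]|[k [i [kN it h zL]]]]|[h|]].
      - by left; move: (h) => /andP[_ /and4P[/eqP-> _ _ _]].
      - by right; case/and3P: h zL => /eqP-> /eqP-> /negbTE->.
      - by apply: Xrow h; rewrite ltnW // row_lt.
      - case: ifPn => o zL; first by rewrite inE in zL.
        by apply: Xlink zL; rewrite ?time_ltN ?row_lt //= !eqxx.
    rewrite E; case: ifPn => o; first by rewrite setU0; exact: inrow_conn.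
    have [_ _ _ _ []] := fP _ _ (time_ltN w) (row_lt w); first by case=> -> _; rewrite setU0; exact: inrow_conn.
    have end_o : endv w = xe (time w) (row w) by rewrite /endv /lrow (negbTE o).
    case=> cL [z zL xz] _; apply: (connU eS (inrow_conn _ _) cL (_ : endv w \in _) zL).
      by rewrite inE end_inrow.
    by rewrite end_o xz orbT.
  pose L i := La (if b then TR + i else i) i.
  have bN i : i < t -> (if b then TR + i else i) < N.
    by move=> it; case: b {L}; [exact: rtime|apply: leq_trans it _; rewrite /N leq_addl].
  have E : X (inr b) = (\bigcup_(i < t.+1) [set z | inrow (inr b) i z]) :|: \bigcup_(i < t) L i.
    apply/setP => z; rewrite in_setU; apply/idP/orP => [/XP[[i [it h]]|[k [i [kN it h zL]]]]|[/bigcupP[i _]|/bigcupP[i _]]].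
    - by left; apply/bigcupP; exists (Ordinal (it : i < t.+1)); rewrite ?inE.
    - right; apply/bigcupP; exists (Ordinal it) => //; rewrite /L /=.
      by have -> : (if b then TR + i else i) = k by move: h; rewrite /inlink; case: (b) => /eqP.
    - by rewrite inE; apply: Xrow; rewrite -ltnS.
    - move=> zL; apply: (Xlink _ (if b then TR + i else i) i) => //; first exact: bN.
      by rewrite /inlink; case: (b).
  rewrite E; apply: (@conn_chain t (fun i => [set z | inrow (inr b) i z]) L).
    by move=> i _; exact: inrow_conn.
  move=> i it; have [[a1 a2] [b1 b2] _ _ j] := fP _ _ (bN _ it) it.
  have iTR : i < TR := leq_trans it (leq_addr _ _).
  exists (xe (if b then TR + i else i) i), (ye (if b then TR + i else i) i); split=> //.
    rewrite inE /inrow a2 /=; case: b {L bN E} a1 a2 b1 b2 j => a1 a2 b1 b2 j.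
      case: (i) a1 a2 it => [|i'] a1 a2 it; first by rewrite addn0.
      have [c1 c2] := rend_in i'.+1 (ltnW it).
      by apply/ltnW; apply: ordn c1 c2 a1 a2; [rewrite ltn_add2l|exact: rtime].
    rewrite (early i i _ iTR (ltnW it) a1 a2) /=.
    apply/forallP => w'; apply/implyP => /eqP E; have [c1 c2] := end_in w'; rewrite /pos E.
    apply: ordn a1 a2 c1 _ => //; last by rewrite -E.
    exact: leq_trans it (time_ge _).
  rewrite inE /inrow b2 /=; case: b {L bN E} a1 a2 b1 b2 j => a1 a2 b1 b2 j; first by rewrite leqnn.
  rewrite (early i i.+1 _ iTR it b1 b2) /=.
  apply/forallP => w'; apply/implyP => /eqP E; have [c1 c2] := end_in w'; rewrite /pos E.
  apply: ordn b1 b2 c1 _ => //; last by rewrite -E.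
  exact: leq_trans it (time_ge _).
- move=> u v z /XP[[i [it zu]]|[k [i [kN it hu zu]]]] /XP[[j [jt zv]]|[l [j [lN jt hv zv]]]].
  + case/andP: zu => zi hu; case/andP: zv => zj hv; have E := Rnd _ _ _ it jt zi zj; subst j.
    case: u hu => [w|[]]; case: v hv => [w'|[]] //.
    * move=> /and4P[/eqP E' p' e' /forallP f'] /and4P[/eqP E'' p'' e'' /forallP f''].
      congr inl; apply: coord_inj; first by rewrite E' E''.
      case: (ltngtP (col w) (col w')) => // lt.
        by have := f'' w'; rewrite E' E'' eqxx lt /= ltnNge p'.
      by have := f' w; rewrite E' E'' eqxx lt /= ltnNge p''.
    * by move=> h /and4P[_ _ h' _]; move: h; rewrite leqNgt h'.
    * by move=> /andP[_ /forallP h] /and4P[E p _ _]; have := h w; rewrite E /= ltnNge p.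
    * by move=> /and4P[_ _ h' _] h; move: h; rewrite leqNgt h'.
    * by move=> /andP[h' _] h; move: h; rewrite leqNgt h'.
    * by move=> /and4P[E p _ _] /andP[_ /forallP h]; have := h w'; rewrite E /= ltnNge p.
    * by move=> h /andP[h' _]; move: h; rewrite leqNgt h'.
  + by case/andP: zu => zi _; have := Lrow l j i z lN jt zv; rewrite zi.
  + by case/andP: zv => zj _; have := Lrow k i j z kN it zu; rewrite zj.
  + have E := Zd _ _ _ kN lN (LZ _ _ _ kN it zu) (LZ _ _ _ lN jt zv); subst l.
    have big1 w : time w <> TR + i by move=> E; have := time_lt w; rewrite E; clear; lia.
    have big2 w : time w <> TR + j by move=> E; have := time_lt w; rewrite E; clear; lia.
    have sm1 w : time w <> i by move=> E; have := time_ge w; rewrite E; move: it; clear; lia.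
    have sm2 w : time w <> j by move=> E; have := time_ge w; rewrite E; move: jt; clear; lia.
    have TRt : t <= TR by exact: leq_addr.
    case: u hu => [w|[]]; case: v hv => [w'|[]] //=.
    * move=> /and3P[/eqP -> _ o'] /and3P[/eqP E _ o]; congr inl.
      have [lt|gt|Ec] := ltngtP (col w) (col w').
        by have := time_mono _ _ lt; rewrite E ltnn.
        by have := time_mono _ _ gt; rewrite E ltnn.
      apply: coord_inj => //; move: E; rewrite /time /lrow (negbTE o) (negbTE o') Ec.
      by move/addnI.
    * by move=> /eqP -> /and3P[/eqP E _ _]; case: (big2 w).
    * by move=> /eqP -> /and3P[/eqP E _ _]; case: (sm2 w).
    * by move=> /and3P[/eqP-> _ _] /eqP E; case: (big1 w').
    * by move=> /eqP -> /eqP E; exfalso; move: E jt TRt; clear; lia.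
    * by move=> /and3P[/eqP-> _ _] /eqP E; case: (sm1 w').
    * by move=> /eqP -> /eqP E; exfalso; move: E it TRt; clear; lia.
- have symm u v : (exists x y, [/\ x \in X u, y \in X v & e x y]) -> exists x y, [/\ x \in X v, y \in X u & e x y].
    by move=> [x [y [h1 h2 h3]]]; exists y, x; rewrite eS.
  have endX w : endv w \in X (inl w) by apply: Xrow (end_inrow w); rewrite ltnW // row_lt.
  have edge_below w w' : below w w' -> exists x y, [/\ x \in X (inl w), y \in X (inl w') & e x y].
    move=> [E1 E2 o]; have o' : odd (row w' + col w') by rewrite E2 -E1 addSn /= o.
    have lE : lrow w = lrow w' by rewrite /lrow o' (negbTE o) E2.
    have tE : time w = time w' by rewrite /time lE E1.
    have lw : lrow w = row w by rewrite /lrow (negbTE o).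
    have e1 : endv w = xe (time w) (row w) by rewrite /endv (negbTE o) lw.
    have e2 : endv w' = ye (time w) (row w) by rewrite /endv o' -tE -lE lw.
    have [_ _ _ _ [[_ xy]|[_ _ [z zL yz]]]] := fP _ _ (time_ltN w) (row_lt w).
      by exists (endv w), (endv w'); rewrite !endX e1 e2.
    exists z, (endv w'); rewrite endX e2 eS; split=> //.
    by apply: Xlink zL; rewrite ?time_ltN ?row_lt //= !eqxx o.
  have pred i p : 0 < p -> p < size (Rn i) -> exists x y, [/\ x \in Rn i, index x (Rn i) = p.-1,
      y \in Rn i, index y (Rn i) = p & e x y].
    move=> p0 ps; have ps' : p.-1 < size (Rn i) by move: ps; clear; lia.
    exists (nth v0 (Rn i) p.-1), (nth v0 (Rn i) p); rewrite !mem_nthV // !index_uniq //; split=> //.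
    by have := sortedP v0 (Rns i) p.-1; rewrite prednK //; apply.
  have pos_size w : pos w < size (Rn (row w)) by rewrite index_mem; case: (end_in w).
  have epos_size i : i <= t -> epos i < size (Rn i) by move=> it; rewrite index_mem; case: (rend_in _ it).
  have left_end i : i <= t -> exists k z, [/\ k < t, z \in Z k & z \in Rn i].
    case: i => [|i] it.
      have h0 : 0 < t by exact: ltnW.
      by have [[a1 a2] _ _ _ _] := fP 0 0 N0 h0; exists 0, (xe 0 0).
    have [_ [b1 b2] _ _ _] := fP i i (leq_trans it (leq_addl _ _)) it; by exists i, (ye i i).
  have pos0 w : 0 < pos w.
    have [k [z [kt zk zi]]] := left_end _ (ltnW (row_lt w)); have [a1 a2] := end_in w.
    by apply: leq_ltn_trans (ordn _ _ _ _ _ _ _ zk zi a1 a2) => //; exact: leq_trans kt (time_ge _).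
  have epos0 i : i <= t -> 0 < epos i.
    move=> it; have [k [z [kt zk zi]]] := left_end _ it.
    by apply: leq_ltn_trans (early k i z _ it zk zi) => //; exact: ltn_addr.
  have atpos w y : y \in Rn (row w) -> index y (Rn (row w)) = pos w -> y = endv w.
    move=> yR E; rewrite -(nth_index v0 yR) E nth_index //; exact: (end_in w).2.
  have edge_before w w' : before w w' -> exists x y, [/\ x \in X (inl w), y \in X (inl w') & e x y].
    move=> [E1 lt nv]; have [x [y [xR xi yR yi xy]]] := pred (row w') (pos w') (pos0 _) (pos_size _).
    exists x, y; split=> //; last by rewrite (atpos _ _ yR yi).
    apply: (Xrow _ (row w)); first by rewrite ltnW // row_lt.
    have pw := pos_mono _ _ E1 lt; have pw' := pos0 w'; have pe := pos_e w'.
    rewrite /inrow E1 xR eqxx xi /=; apply/and3P; split.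
    - by move: pw; clear; lia.
    - by move: pw' pe; clear; lia.
    apply/forallP => u; apply/implyP => /andP[/eqP Eu lu].
    have [lt'|ge] := ltnP (col u) (col w').
      by have := wall_valid t2 u; rewrite Eu -E1 (negbTE (nv _ _)) // lu lt'.
    have : pos w' <= pos u.
      move: ge; rewrite leq_eqVlt => /orP[/eqP Ec|h]; last by rewrite ltnW // pos_mono.
      by rewrite (coord_inj (esym Eu) Ec).
    by move: pw'; clear; lia.
  have edge_left w : leftmost w -> exists x y, [/\ x \in X (inl w), y \in X (inr false) & e x y].
    move=> /forallP lm; have [x [y [xR xi yR yi xy]]] := pred (row w) (pos w) (pos0 _) (pos_size _).
    exists y, x; rewrite eS (atpos _ _ yR yi) endX -(atpos _ _ yR yi); split=> //.
    apply: (Xrow _ (row w)); first by rewrite ltnW // row_lt.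
    have pw := pos0 w; have pe := pos_e w.
    rewrite /inrow xR xi /=; apply/andP; split; first by move: pw pe; clear; lia.
    apply/forallP => u; apply/implyP => /eqP Eu; have := lm u; rewrite Eu eqxx /= leq_eqVlt => /orP[/eqP Ec|h].
      by rewrite (coord_inj Eu (esym Ec)); move: pw; clear; lia.
    by have := pos_mono _ _ (esym Eu) h; move: pw; clear; lia.
  have edge_right w : rightmost w -> exists x y, [/\ x \in X (inl w), y \in X (inr true) & e x y].
    move=> /forallP rm; have rt : row w <= t by rewrite ltnW // row_lt.
    have [x [y [xR xi yR yi xy]]] := pred (row w) (epos (row w)) (epos0 _ rt) (epos_size _ rt).
    exists x, y; split=> //; last by apply: (Xrow _ (row w)) => //; rewrite /inrow yR yi leqnn.
    apply: (Xrow _ (row w)) => //; have pe := pos_e w.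
    rewrite /inrow xR xi eqxx /=; apply/and3P; split; try by move: pe; clear; lia.
    apply/forallP => u; apply/implyP => /andP[Eu lu]; have := rm u; rewrite Eu /= leqNgt lu //.
  have edge_LR : exists x y, [/\ x \in X (inr false), y \in X (inr true) & e x y].
    have [x [y [xR xi yR yi xy]]] := pred t (epos t) (epos0 _ (leqnn t)) (epos_size _ (leqnn t)).
    exists x, y; split=> //; last by apply: (Xrow _ t) => //; rewrite /inrow yR yi leqnn.
    apply: (Xrow _ t) => //; have pe := epos0 _ (leqnn t).
    rewrite /inrow xR xi /=; apply/andP; split; first by move: pe; clear; lia.
    apply/forallP => u; apply/implyP => /eqP Eu; have := row_lt u; rewrite Eu ltnn //.
  case=> [w|[]] [w'|[]] //=.
  + move=> /(wall_edge t2)[|[|[|]]] //; first exact: edge_below.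
    - by move=> h; apply: symm; exact: edge_below.
    - exact: edge_before.
    - by move=> h; apply: symm; exact: edge_before.
  + exact: edge_right.
  + exact: edge_left.
  + by move=> h; apply: symm; exact: edge_right.
  + by move=> _; apply: symm.
  + by move=> h; apply: symm; exact: edge_left.
Qed.

End LadderModel.

(** A clique model with as many parts as [wall_ext] has vertices already contains it. Otherwise [r]
    and [d] are the sizes from which [ladder_of_crossing] builds [t.+1] rails and [N] zones. *)
Lemma wall_minor t : 1 < t -> exists K, forall (V : finType) (e : rel V), symmetric e ->
  ~ tdl e K setT -> exists X : wall t + bool -> {set V}, model e (@wall_ext t) X.
Proof.
move=> t2; pose N := t + 2 * t * t + t; pose r := (t.+2 ^ t.+2).+1.
pose d := (#|{ffun 'I_r * 'I_r -> bool}| * (2 * N)).+1.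
have [K HK] := @crossing_or_clique #|{: wall t + bool}| r d (ltn0Sn _).
exists K => V e eS ntd; case: (HK V e eS ntd) => [cr|[Y [Y1 Y2 Y3]]].
  apply: wall_of_ladder => //; apply: ladder_of_crossing cr => //.
  by move: t2; clear; lia.
exists (fun u => Y (enum_rank u)); split=> //.
- by move=> u v z zu zv; apply: enum_rank_inj; exact: Y2 zu zv.
- move=> u v uv; apply: Y3; apply/eqP => /enum_rank_inj E.
  by move: uv; rewrite E wall_ext_irr.
Qed.

(** * Minimal models *)

Section Retract.
Variables (V : finType) (e : rel V).
Hypothesis eS : symmetric e.
Hypothesis eI : irreflexive e.

(** A map that sends every edge to an edge or to a single vertex preserves connectedness; all
    deletions below are justified by such maps. *)
Lemma conn_retract (S S' : {set V}) (phi : V -> V) : conn e S ->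
  {in S, forall x, phi x \in S'} -> {in S', forall y, exists2 x, x \in S & phi x = y} ->
  {in S &, forall x y, e x y -> phi x = phi y \/ e (phi x) (phi y)} -> conn e S'.
Proof.
move=> cS h1 h2 h3 y y' /h2[x xS <-] /h2[x' x'S <-] {y y'}.
case/connectP: (cS _ _ xS x'S) => p; elim: p x xS => [|z p IH] x xS /= => [_ ->|]; first exact: connect0.
case/andP=> /and3P[_ zS xz] zp lE; apply: connect_trans (IH z zS zp lE).
case: (h3 _ _ xS zS xz) => [->|h]; first exact: connect0.
by apply: connect_restr1 => //; exact: h1.
Qed.

Lemma conn_leaf (S : {set V}) z a : conn e S -> a \in S -> a != z ->
  (forall b, b \in S -> e z b -> b = a) -> conn e (S :\ z).
Proof.
move=> cS aS az only.
apply: (conn_retract (phi := fun x => if x == z then a else x) cS) => [x xS|y yS0|x y xS yS xy].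
- by case: eqVneq => [_|ne]; rewrite !inE ?az ?aS ?ne ?xS.
- by move: (yS0); rewrite !inE => /andP[ne yS]; exists y; rewrite ?(negbTE ne).
- case: eqVneq => [E|_]; case: eqVneq => [E'|_]; try by left.
  + by left; rewrite (only y) // -E.
  + by left; rewrite (only x) // -E' eS.
  + by right.
Qed.

Lemma conn_nbr (S : {set V}) z z' : conn e S -> z \in S -> z' \in S -> z != z' ->
  exists2 a, a \in S & e z a.
Proof.
move=> cS zS z'S ne; case/connectP: (cS _ _ zS z'S) => -[|a p] /=.
  by move=> _ E; rewrite E eqxx in ne.
by case/andP=> /and3P[_ aS za] _ _; exists a.
Qed.

(* A neighbour y of x is light if its only role is to be on a path replacing an edge. *)
Definition light (x y : V) : Prop :=
  (exists a, forall z, e y z -> z = x \/ z = a) \/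
  exists k (c : nat -> V) i, [/\ 0 < i <= k /\ c i = y,
    forall a b, a <= k.+1 -> b <= k.+1 -> c a = c b -> a = b,
    forall j, j <= k -> e (c j) (c j.+1), e (c 0) (c k.+1) &
    forall j z, 0 < j <= k -> e (c j) z -> [\/ z = c j.-1, z = c j.+1 | z = x /\ j = i]].

Section Minimal.
Variables (U : finType) (r : rel U) (M : V -> V -> Prop).
Hypothesis rS : symmetric r.
Hypothesis rI : irreflexive r.
Hypothesis rdeg : forall u, 2 < #|[set v | r u v]|.
Hypothesis MS : forall x y, M x y -> M y x.
Hypothesis lightE : forall x y, e x y -> [\/ M x y, light x y | light y x].

(** In the application [M] is the relation of being light in neither direction; its edges must not
    join two parts. *)
Definition mmodel (X : U -> {set V}) : Prop := model e r X /\
  forall u v x y, x \in X u -> y \in X v -> e x y -> M x y -> u = v.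

Definition weight (X : U -> {set V}) : nat := \sum_u #|X u|.

Section Chosen.
Variable X : U -> {set V}.
Hypothesis mX : mmodel X.
Hypothesis minX : forall X', mmodel X' -> weight X <= weight X'.

Lemma not_smaller (X' : U -> {set V}) v y : mmodel X' -> (forall u, X' u \subset X u) ->
  y \in X v -> y \notin X' v -> False.
Proof.
move=> mX' sub yX yX'; have := minX mX'; rewrite leqNgt => /negP; apply.
rewrite /weight (bigD1 v) //= [X in _ < X](bigD1 v) //= -addSn leq_add //.
  by apply: proper_card; rewrite properE sub; apply/subsetPn; exists y.
by apply: leq_sum => u _; exact: subset_leq_card.
Qed.

Lemma submodel (X' : U -> {set V}) : (forall u, X' u \subset X u) -> (forall u, conn e (X' u)) ->
  (forall u v, r u v -> exists x y, [/\ x \in X' u, y \in X' v & e x y]) -> mmodel X'.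
Proof.
move=> sub cX' eX'; have [[_ d _] nM] := mX; split; first split=> //.
  by move=> u v z /(subsetP (sub u)) zu /(subsetP (sub v)); exact: d zu.
by move=> u v x y /(subsetP (sub u)) xu /(subsetP (sub v)); exact: nM xu.
Qed.

Variable cx : U -> U -> V.
Hypothesis cxE : forall u v, r u v -> [/\ cx u v \in X u, cx v u \in X v & e (cx u v) (cx v u)].

(** The edges that count for the model: those inside parts, and one chosen edge for each adjacent
    pair. *)
Definition st (a b : V) : Prop := e a b /\ exists u v, [/\ a \in X u, b \in X v &
  u = v \/ [/\ r u v, a = cx u v & b = cx v u]].

Lemma st_sym a b : st a b -> st b a.
Proof.
move=> [ab [u [v [au bv h]]]]; split; first by rewrite eS.
by exists v, u; split=> //; case: h => [->|[h1 h2 h3]]; [left|right; split=> //; rewrite rS].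
Qed.

Lemma Xdisj u v z : z \in X u -> z \in X v -> u = v.
Proof. by case: mX => -[_ d _] _; exact: d. Qed.

(** A part with a single vertex carries at least three chosen edges. In a larger part, a vertex with
    only one edge that counts is a leaf without a chosen edge and could be dropped, against
    minimality. *)
Lemma st_degree w z : z \in X w -> exists a b, [/\ a != b, st z a & st z b].
Proof.
move=> zX; have [[cX _ _] _] := mX; apply: contrapT => H.
have two a b : st z a -> st z b -> a = b.
  by move=> ha hb; apply/eqP; apply: contraT => ne; case: H; exists a, b.
have term v : r w v -> cx w v = z -> st z (cx v w).
  move=> wv E; have [h1 h2 h3] := cxE wv; split; first by rewrite -E.
  by exists w, v; split=> //; right; split.
have [[z' z'X ne]|single] := pselect (exists2 z', z' \in X w & z' != z); last first.
  have /card_gt1P[v1 [v2 [rv1 rv2 nv]]] := ltnW (rdeg w); rewrite !inE in rv1 rv2.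
  have tz v : r w v -> cx w v = z.
    move=> wv; have [h1 _ _] := cxE wv; apply/eqP; apply: contraT => ne.
    by case: single; exists (cx w v).
  have E := two _ _ (term _ rv1 (tz _ rv1)) (term _ rv2 (tz _ rv2)).
  have [_ m1 _] := cxE rv1; have [_ m2 _] := cxE rv2.
  by move/eqP: nv; apply; apply: (Xdisj m1); rewrite E.
rewrite eq_sym in ne; have [a aX za] := conn_nbr (cX w) zX z'X ne.
have sta b : b \in X w -> e z b -> st z b.
  by move=> bX zb; split=> //; exists w, w; split=> //; left.
have [[v wv E]|nt] := pselect (exists2 v, r w v & cx w v = z).
  have E' := two _ _ (term _ wv E) (sta _ aX za); have [_ m1 _] := cxE wv.
  by rewrite E' in m1; have E2 := Xdisj aX m1; move: wv; rewrite E2 rI.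
have az : a != z by apply: contraTneq za => ->; rewrite eI.
have cc : conn e (X w :\ z).
  apply: (conn_leaf (cX w) aX az) => b bX zb; exact: two (sta _ bX zb) (sta _ aX za).
pose X' u := if u == w then X w :\ z else X u.
have sub u : X' u \subset X u by rewrite /X'; case: eqVneq => [->|_] //; exact: subsetDl.
have mX' : mmodel X'.
  apply: submodel => // [u|u v uv]; first by rewrite /X'; case: ifP.
  have [h1 h2 h3] := cxE uv; exists (cx u v), (cx v u).
  have key u' v' : r u' v' -> cx u' v' \in X u' -> cx u' v' \in X' u'.
    rewrite /X'; case: eqVneq => [->|_] // wv m; rewrite !inE m andbT; apply/eqP => E.
    by apply: nt; exists v'.
  by rewrite !key // rS.
by apply: (not_smaller mX' sub zX); rewrite /X' eqxx !inE eqxx.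
Qed.

(** [y] has at least two edges that count, and [yx] is not among them. This rules out the first form
    of lightness. In the second form, the whole path through [y] is covered by parts, and its
    interior can be deleted in favour of the edge [c 0 -- c k.+1], against minimality. *)
Lemma no_light_chord u v x y : u != v -> x \in X u -> y \in X v -> e x y ->
  ~ (r u v /\ x = cx u v /\ y = cx v u) -> light x y -> False.
Proof.
move=> uv xX yX xy nch.
have nst : ~ st y x.
  move=> [_ [u' [v' [yu' xv' h]]]]; have Eu := Xdisj xX xv'; have Ev := Xdisj yX yu'; subst u' v'.
  case: h => [E|[h1 h2 h3]]; first by rewrite E eqxx in uv.
  by apply: nch; rewrite rS.
have [[cX _ eX] nM] := mX.
case=> [[a0 only]|[k [c [i [[ik ciy] cI cE cke cN]]]]].
  have [a [b [ab sa sb]]] := st_degree yX.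
  have E z : st y z -> z = a0 by move=> sz; case: (only z sz.1) => // zx; case: nst; rewrite -zx.
  by rewrite (E _ sa) (E _ sb) eqxx in ab.
pose cov z := exists w, z \in X w.
have nb j z : 0 < j <= k -> st (c j) z -> z = c j.-1 \/ z = c j.+1.
  move=> jk sz; case: (cN j z jk sz.1) => [->|->|[zx ji]]; [by left|by right|].
  by case: nst; rewrite -zx -ciy -ji.
(* An interior vertex has no other candidates than its two neighbours on the path, so both edges
   count; coverage spreads from [c i] to the entire path. *)
have both j : 0 < j <= k -> cov (c j) -> st (c j) (c j.-1) /\ st (c j) (c j.+1).
  move=> jk [w wX]; have [a [b [ab sa sb]]] := st_degree wX.
  by case: (nb j a jk sa) (sa) (nb j b jk sb) (sb) ab => -> s1 [] -> s2; rewrite ?eqxx.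
have stcov a b : st a b -> cov b by move=> [_ [u' [v' [_ h _]]]]; exists v'.
have covi : cov (c i) by rewrite ciy; exists v.
have up d : i + d <= k.+1 -> cov (c (i + d)).
  elim: d => [|d IH] h; first by rewrite addn0.
  have h' : 0 < i + d <= k by move: ik h; clear; lia.
  have h2 : i + d <= k.+1 by move: h; clear; lia.
  by have [_ s] := both _ h' (IH h2); rewrite addnS; exact: stcov s.
have down d : d <= i -> cov (c (i - d)).
  elim: d => [|d IH] h; first by rewrite subn0.
  have h' : 0 < i - d <= k by move: ik h; clear; lia.
  have [s _] := both _ h' (IH (ltnW h)); have := stcov _ _ s.
  by have -> : (i - d).-1 = i - d.+1 by move: h; clear; lia.
have covj j : j <= k.+1 -> cov (c j).
  move=> jk; case: (leqP i j) => h.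
    by have := up (j - i); rewrite subnKC //; exact.
  have := down (i - j); have -> : i - (i - j) = j by move: h; clear; lia.
  by apply; exact: leq_subr.
have stj j : j <= k -> st (c j) (c j.+1).
  case: j => [|j] jk; last by have [] := both j.+1 _ (covj _ (leqW jk)).
  have h1 : 0 < 1 <= k by move: ik; clear; lia.
  have [s _] := both 1 h1 (covj 1 (ltn0Sn k)); exact: st_sym.
have /choice[lab labP] : forall j, exists w, j <= k.+1 -> c j \in X w.
  by move=> j; case: (leqP j k.+1) => h; [have [w wX] := covj _ h; exists w|exists u].
(* The path changes parts at most once. *)
have [cut [p [q [ck labp labq]]]] : exists cut p q, [/\ cut <= k,
    forall j, j <= cut -> lab j = p & forall j, cut < j <= k.+1 -> lab j = q].
  have [[j0 j0P]|nochange] := pselect (exists j, (j <= k) && (lab j.+1 != lab j)); last first.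
    have all j : j <= k.+1 -> lab j = lab 0.
      elim: j => // j IH jk; rewrite -IH; last by exact: ltnW.
      apply/eqP; apply: contraT => ne; case: nochange; exists j; by rewrite ne andbT.
    exists 0, (lab 0), (lab 0); split=> //.
      by move=> j; rewrite leqn0 => /eqP->.
    by move=> j /andP[_ /all].
  have ex0 : exists j, (j <= k) && (lab j.+1 != lab j) by exists j0.
  case: (ex_minnP ex0) => {j0P ex0} j0 /andP[j0k ne0] min0.
  exists j0, (lab 0), (lab j0.+1); split=> //.
    elim=> // j IH jj0; rewrite -(IH (ltnW jj0)); apply/eqP; apply: contraT => ne.
    have := min0 j; rewrite ne andbT => h; have := h (leq_trans (ltnW jj0) j0k).
    by move: jj0; clear; lia.
  have [[j1 j1P]|nochange] := pselect (exists j, [&& j0 < j, j <= k & lab j.+1 != lab j]); last first.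
    elim=> // j IH /andP[j0j jk]; have [->//|lt] := eqVneq j0 j.
    have j0j' : j0 < j by move: j0j lt; clear; lia.
    rewrite -(IH _); last by rewrite j0j'; exact: ltnW.
    apply/eqP; apply: contraT => ne; case: nochange; exists j; by rewrite j0j' ne andbT.
  have ex1 : exists j, [&& j0 < j, j <= k & lab j.+1 != lab j] by exists j1.
  case: (ex_minnP ex1) => {j1P ex1} j1 /and3P[j0j1 j1k ne1] min1.
  (* After two changes the part [d] in between would lie wholly inside the path, and its only
     possible neighbours in [r] would be the parts before and after it. *)
  exfalso; pose d := lab j0.+1.
  have labd j : j0 < j <= j1 -> lab j = d.
    elim: j => // j IH /andP[h1 h2]; have [E|lt] := eqVneq j0 j; first by rewrite /d E.
    have h1' : j0 < j by move: h1 lt; clear; lia.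
    rewrite -(IH _); last by rewrite h1' ltnW.
    apply/eqP; apply: contraT => ne; have := min1 j; rewrite h1' ne /= andbT.
    by move=> /(_ (leq_trans (ltnW h2) j1k)); move: h2; clear; lia.
  pose Sg := [set z | [exists j : 'I_k.+2, (j0 < j <= j1) && (z == c j)]].
  have SgP z : z \in Sg -> exists j, j0 < j <= j1 /\ z = c j.
    by rewrite inE => /existsP[j /andP[h /eqP->]]; exists j.
  have inSg j : j0 < j <= j1 -> c j \in Sg.
    move=> h; have jk : j < k.+2 by move: h j1k; clear; lia.
    by rewrite inE; apply/existsP; exists (Ordinal jk); rewrite h /=.
  have j1mem : c j1 \in X d.
    rewrite -(labd j1); last by rewrite j0j1 leqnn.
    by apply: labP; exact: leqW.
  have XSg : X d \subset Sg.
    apply: (conn_closed (cX d) j1mem); first by apply: inSg; rewrite j0j1 leqnn.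
    move=> a b /SgP[j [jj ->]] bX ab.
    have jk : 0 < j <= k by move: jj j1k; clear; lia.
    have cjX : c j \in X d by rewrite -(labd j) //; apply: labP; move: jk; clear; lia.
    case: (cN j b jk ab) => [E|E|[E ji]].
    - rewrite E; apply: inSg; have [jj0|] := eqVneq j.-1 j0; last by move: jj; clear; lia.
      have bl : c j0 \in X (lab j0) by apply: labP; exact: leqW.
      by rewrite E jj0 in bX; move: ne0; rewrite -/d (Xdisj bX bl) eqxx.
    - rewrite E; apply: inSg; have [jj1|] := eqVneq j j1; last by move: jj; clear; lia.
      have bl : c j1.+1 \in X (lab j1.+1) by apply: labP.
      rewrite E jj1 in bX; move: ne1; rewrite -(Xdisj bX bl) (labd j1) ?eqxx //.
      by rewrite j0j1 leqnn.
    - rewrite E in bX; rewrite ji ciy in cjX.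
      by move: uv; rewrite (Xdisj xX bX) (Xdisj yX cjX) eqxx.
  have : [set v' | r d v'] \subset [set lab j0; lab j1.+1].
    apply/subsetP => v'; rewrite !inE => dv'; have [h1 h2 h3] := cxE dv'.
    have [j [jj E]] := SgP _ (subsetP XSg _ h1).
    have sj : st (c j) (cx v' d).
      split; first by rewrite -E.
      by exists d, v'; rewrite -E; split=> //; right.
    have jk : 0 < j <= k by move: jj j1k; clear; lia.
    have nd : v' != d by apply: contraTneq dv' => ->; rewrite rI.
    case: (nb j _ jk sj) => E'; rewrite E' in h2.
    - have lj : c j.-1 \in X (lab j.-1) by apply: labP; move: jk; clear; lia.
      have [E0|ne] := eqVneq j.-1 j0; first by rewrite -E0 (Xdisj h2 lj) eqxx.
      have hj : j0 < j.-1 <= j1 by move: jj ne; clear; lia.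
      by move: nd; rewrite (Xdisj h2 lj) (labd _ hj) eqxx.
    - have lj : c j.+1 \in X (lab j.+1) by apply: labP; move: jk; clear; lia.
      have [E0|ne] := eqVneq j j1; first by rewrite -E0 (Xdisj h2 lj) eqxx orbT.
      have hj : j0 < j.+1 <= j1 by move: jj ne; clear; lia.
      by move: nd; rewrite (Xdisj h2 lj) (labd _ hj) eqxx.
  move/subset_leq_card; rewrite leqNgt => /negP; apply; apply: leq_trans (rdeg d).
  by rewrite ltnS cards2; case: (_ == _).
pose C := [set z | [exists j : 'I_k.+1, (0 < j) && (z == c j)]].
have CP z : z \in C -> exists j, 0 < j <= k /\ z = c j.
  by rewrite inE => /existsP[j /andP[h /eqP->]]; exists j; rewrite h -ltnS ltn_ord.
have inC j : 0 < j <= k -> c j \in C.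
  case/andP=> h h'; rewrite inE; apply/existsP; exists (Ordinal (h' : j < k.+1)).
  by rewrite h /=.
(* Interior vertices are moved to the end of the path in the same part; the edge at which the path
   changes parts is replaced by [c 0 -- c k.+1]. *)
pose phi z := if [pick j : 'I_k.+1 | (0 < j) && (z == c j)] is Some j then
   (if j <= cut then c 0 else c k.+1) else z.
have phiN z : z \notin C -> phi z = z.
  rewrite /phi; case: pickP => // j h /negP[]; rewrite inE; by apply/existsP; exists j.
have phiC j : 0 < j <= k -> phi (c j) = if j <= cut then c 0 else c k.+1.
  move=> jk; rewrite /phi; case: pickP => [j' /andP[h /eqP E]|h].
    have j'k := ltn_ord j'.
    by rewrite (_ : j = j') //; apply: cI E; [move: jk|move: j'k]; clear; lia.
  have jk1 : j < k.+1 by move: jk; clear; lia.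
  by have := h (Ordinal jk1); rewrite eqxx andbT /=; move: jk; clear; lia.
have nC0 : c 0 \notin C.
  by apply/negP => /CP[j [jk E]]; have := cI 0 j; move: jk; clear -E; move=> jk h; have := h _ _ E; lia.
have nCk : c k.+1 \notin C.
  by apply/negP => /CP[j [jk E]]; have := cI k.+1 j; move: jk; clear -E; move=> jk h; have := h _ _ E; lia.
have phij j : j <= k.+1 -> phi (c j) = if j <= cut then c 0 else c k.+1.
  move=> jk; have [->|j0] := posnP j; first by rewrite phiN.
  have [->|ne] := eqVneq j k.+1; first by rewrite phiN // leqNgt ltnS ck.
  by apply: phiC; move: jk j0 ne; clear; lia.
have phiX w z : z \in X w -> phi z \in X w :\: C.
  move=> zw; have [/CP[j [jk E]]|nz] := boolP (z \in C); last by rewrite phiN // inE nz.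
  have jk1 : j <= k.+1 by move: jk; clear; lia.
  rewrite E phij // inE; rewrite E in zw; have lj := labP j jk1.
  case: leqP => h; rewrite ?nC0 ?nCk /=.
    by have := labP 0 (leq0n _); rewrite labp // (Xdisj zw lj) labp.
  have := labP k.+1 (leqnn _); rewrite labq ?(Xdisj zw lj) ?labq //.
    by rewrite h jk1.
  by rewrite ltnS ck leqnn.
have phi_st a b : st a b -> phi a = phi b \/ e (phi a) (phi b).
  have path_case j : j <= k -> phi (c j) = phi (c j.+1) \/ e (phi (c j)) (phi (c j.+1)).
    move=> jk; rewrite !phij ?(leqW jk) //; case: (ltngtP j cut) => h.
    - by left.
    - by left.
    - by right.
  have half a' b' : a' \in C -> st a' b' -> phi a' = phi b' \/ e (phi a') (phi b').
    move=> /CP[j [jk ->]] s; case: (nb j b' jk s) => ->.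
      have -> : c j = c j.-1.+1 by rewrite prednK //; case/andP: jk.
      case: (path_case j.-1); first by move: jk; clear; lia.
        by move=> ->; left.
      by rewrite eS; right.
    by apply: path_case; case/andP: jk.
  move=> s; have [/half|na] := boolP (a \in C); first exact.
  have [/half h|nb'] := boolP (b \in C); last by right; rewrite !phiN //; case: s.
  by case: (h _ (st_sym s)) => [->|h']; [left|right; rewrite eS].
pose X' w := X w :\: C.
have sub w : X' w \subset X w by exact: subsetDl.
have mX' : mmodel X'.
  apply: submodel => // [w|w w' ww'].
    apply: (conn_retract (phi := phi) (cX w)) => [z|z|z z' zw z'w zz'].
    - exact: phiX.
    - by rewrite inE => /andP[zC zw]; exists z; rewrite ?phiN.
    - by apply: phi_st; split=> //; exists w, w; split=> //; left.
  have [h1 h2 h3] := cxE ww'; exists (phi (cx w w')), (phi (cx w' w)).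
  have p1 := phiX _ _ h1; have p2 := phiX _ _ h2; split=> //.
  have [|E|//] := phi_st (cx w w') (cx w' w).
    by split=> //; exists w, w'; split=> //; right.
  rewrite E in p1; move: p1 p2; rewrite !inE => /andP[_ p1] /andP[_ p2].
  by move: ww'; rewrite (Xdisj p1 p2) rI.
apply: (not_smaller mX' sub yX); rewrite inE -ciy inC //.
Qed.
End Chosen.

Lemma minimal_model : (exists X, mmodel X) -> exists X, model e r X /\
  (forall u v x y, u != v -> x \in X u -> y \in X v -> e x y -> r u v) /\
  (forall u v x y x' y', u != v -> x \in X u -> x' \in X u -> y \in X v -> y' \in X v ->
     e x y -> e x' y' -> x = x' /\ y = y').
Proof.
move=> exX; pose P n := `[< exists2 X, mmodel X & weight X = n >].
have exP : exists n, P n by have [X mX] := exX; exists (weight X); apply/asboolP; exists X.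
case: (ex_minnP exP) => n /asboolP[X mX Xn] minn.
have minX X' : mmodel X' -> weight X <= weight X'.
  by move=> mX'; rewrite Xn; apply: minn; apply/asboolP; exists X'.
have [[cX dX eX] nM] := mX.
have /choice[ch chP] : forall uv : U * U, exists xy : V * V, r uv.1 uv.2 ->
    [/\ xy.1 \in X uv.1, xy.2 \in X uv.2 & e xy.1 xy.2].
  move=> [u v] /=; have [uv|nuv] := boolP (r u v).
    by have [x [y h]] := eX u v uv; exists (x, y).
  have /card_gt0P[v' ] : 0 < #|[set v | r u v]| by apply: leq_ltn_trans (rdeg u).
  by rewrite inE => /eX[x _]; exists (x, x).
(* Both [cx u v] and [cx v u] are read off one choice for the unordered pair, so that they are the
   ends of the same edge. *)
pose cx u v := if enum_rank u < enum_rank v then (ch (u, v)).1 else (ch (v, u)).2.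
have cxE u v : r u v -> [/\ cx u v \in X u, cx v u \in X v & e (cx u v) (cx v u)].
  move=> uv; have vu : r v u by rewrite rS.
  have [h1 h2 h3] := chP (u, v) uv; have [h4 h5 h6] := chP (v, u) vu; rewrite /= in h1 h2 h3 h4 h5 h6.
  rewrite /cx; case: (ltngtP (enum_rank u) (enum_rank v)) => h; first by split.
    by split; rewrite // eS.
  by move: vu; rewrite (enum_rank_inj (val_inj h)) rI.
have key u v x y : u != v -> x \in X u -> y \in X v -> e x y -> r u v /\ x = cx u v /\ y = cx v u.
  move=> uv xu yv xy; apply: contrapT => nch.
  case: (lightE xy) => [m|l|l].
  - by move: uv; rewrite (nM u v x y) ?eqxx.
  - exact: (no_light_chord mX minX cxE uv xu yv xy nch l).
  - have vu : v != u by rewrite eq_sym.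
    have yx : e y x by rewrite eS.
    apply: (no_light_chord mX minX cxE vu yv xu yx _ l) => -[h1 [h2 h3]].
    by apply: nch; rewrite rS.
exists X; split=> //; split=> [u v x y uv xu yv xy|u v x y x' y' uv xu x'u yv y'v xy x'y'].
  by case: (key u v x y).
by have [_ [-> ->]] := key u v x y uv xu yv xy; have [_ [-> ->]] := key u v x' y' uv x'u y'v x'y'.
Qed.
End Minimal.
End Retract.

(** * Subdivisions from models *)

Lemma infix2P (T : eqType) (d : T) (s : seq T) x y :
  reflect (exists2 i, i.+1 < size s & nth d s i = x /\ nth d s i.+1 = y) (infix [:: x; y] s).
Proof.
apply: (iffP idP) => [/infixP[s1 [s2 ->]]|[i il [E1 E2]]]; last apply/infixP.
  exists (size s1); first by rewrite !size_cat /=; lia.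
  by rewrite !(nth_cat _ s1) ltnn subnn ltnNge (leqnSn (size s1)) subSnn.
exists (take i s), (drop i.+2 s); rewrite -{1}(cat_take_drop i s); congr (_ ++ _).
by rewrite (drop_nth d (ltnW il)) (drop_nth d il) E1 E2.
Qed.

Lemma consecutive_map (T T' : eqType) (f : T -> T') (s : seq T) x y : injective f ->
  consecutive (map f s) (f x) (f y) = consecutive s x y.
Proof.
move=> fI; have key a b : infix [:: f a; f b] (map f s) = infix [:: a; b] s.
  apply/(infix2P (f a))/(infix2P a) => -[i]; rewrite size_map => il [].
    by rewrite !(nth_map a) //; [move=> /fI E1 /fI E2; exists i|exact: ltnW].
  by move=> E1 E2; exists i; rewrite ?size_map // !(nth_map a) ?E1 ?E2 //; exact: ltnW.
by rewrite /consecutive !key.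
Qed.

Lemma sorted_consecutive (T : eqType) (e : rel T) (s : seq T) x y : symmetric e -> sorted e s ->
  consecutive s x y -> e x y.
Proof.
move=> eS ss; have h := sortedP x ss.
by case/orP=> /(infix2P x)[i il [E1 E2]]; have := h i il; rewrite E1 E2 // eS.
Qed.

Section Paths.
Variables (V : finType) (e : rel V).
Hypothesis eS : symmetric e.
Hypothesis eI : irreflexive e.

Lemma ipath_consecutive (s : seq V) : ipath e s -> {in s &, forall x y, e x y = consecutive s x y}.
Proof.
move=> ips x y xs ys; have ss := ipath_sorted ips; case: ips => us h.
apply/idP/idP; last exact: sorted_consecutive.
move=> xy; rewrite -(nth_index x xs) -(nth_index x ys) in xy.
have ix : index x s < size s by rewrite index_mem.
have iy : index y s < size s by rewrite index_mem.
apply/orP; case: (ltngtP (index x s) (index y s)) => lt.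
- left; apply/(infix2P x); rewrite h // in xy; exists (index x s); rewrite -(eqP xy) ?nth_index //.
- right; rewrite eS h // in xy; apply/(infix2P x); exists (index y s); rewrite -(eqP xy) ?nth_index //.
- by rewrite lt eI in xy.
Qed.

Lemma short_ipath (S : {set V}) c p : path e c p -> c \in S -> {subset p <= S} ->
  exists p', [/\ ipath e (c :: p'), {subset p' <= S}, last c p' = last c p & size p' <= size p].
Proof.
move=> cp cS pS.
have [s [s0 sS si [/eqP hs /eqP ls] [_ [_ mins]]]] :=
  shortest_min (eqxx c : pred1 c c) (eqxx (last c p) : pred1 (last c p) _) cS (connect_path cS pS cp).
case: s s0 sS si hs ls mins => [//|x s] _ sS si /= hs ls mins; rewrite hs in si sS ls.
exists s; split=> //; first by move=> z zs; apply: sS; rewrite inE zs orbT.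
have := mins (c :: p); rewrite /= !eqxx; apply=> //.
by move=> z; rewrite inE => /orP[/eqP->|/pS].
Qed.

Section Center.
Variables (W : finType) (N : {set W}) (S : {set V}) (tau : W -> V).
Hypothesis N0 : N != set0.
Hypothesis N3 : #|N| <= 3.
Hypothesis cS : conn e S.
Hypothesis tauS : forall w, w \in N -> tau w \in S.
Hypothesis trif : forall x y z, e x y -> e y z -> e x z -> False.

(** One path from a common center to each terminal; the paths may overlap until their total length
    is minimised. *)
Definition fan (c : V) (p : W -> seq V) : Prop := c \in S /\
  forall w, w \in N -> [/\ path e c (p w), {subset p w <= S} & last c (p w) = tau w].

(* Moving the center along a path shortens two of the three paths by what it adds to the third. *)
Lemma center : exists c p, [/\ fan c p, forall w, w \in N -> ipath e (c :: p w) &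
  forall w w' x y, w \in N -> w' \in N -> w != w' -> x \in p w -> y \in p w' -> x != y /\ ~~ e x y].
Proof.
pose cost p := \sum_(w in N) size (p w : seq V).
have [w0 w0N] := set0Pn _ N0.
have fan_of c : c \in S -> exists p, fan c p.
  move=> cS'; have /choice[p pP] : forall w, exists s : seq V, w \in N ->
      [/\ path e c s, {subset s <= S} & last c s = tau w].
    move=> w; have [wN|] := boolP (w \in N); last by exists [::].
    case/connectP: (cS cS' (tauS wN)) => s /path_restr[h1 h2] E; exists s; split=> //.
  by exists p; split.
pose P n := `[< exists c p, fan c p /\ cost p = n >].
have exP : exists n, P n.
  have [p pP] := fan_of _ (tauS w0N); exists (cost p); apply/asboolP.
  by exists (tau w0), p.
case: (ex_minnP exP) => n /asboolP[c [p0 [[cin p0P] p0n]]] minn.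
have min c' p' : fan c' p' -> n <= cost p' by move=> h; apply: minn; apply/asboolP; exists c', p'.
have /choice[p pP] : forall w, exists s, w \in N ->
    [/\ ipath e (c :: s), {subset s <= S}, last c s = tau w & size s <= size (p0 w)].
  move=> w; have [wN|] := boolP (w \in N); last by exists [::].
  have [h1 h2 <-] := p0P w wN; have [s hs] := short_ipath h1 cin h2; by exists s.
have pth w : w \in N -> path e c (p w).
  by move=> /pP[/ipath_sorted h _ _ _].
have fp : fan c p by split=> // w wN; have [h1 h2 h3 _] := pP w wN; split=> //; exact: pth.
have cn : cost p <= n by rewrite -p0n; apply: leq_sum => w /pP[].
exists c, p; split=> //; first by move=> w /pP[].
(* With center [x], path [w] loses [i.+1] vertices and the third path gains at most as many. Path
   [w'] loses at least one: it starts at [y], which is [x] or, as [j] is not 0, costs less than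
   before. *)
have move_center w w' i j : w \in N -> w' \in N -> w != w' -> i < size (p w) -> j < size (p w') ->
    let x := nth c (p w) i in let y := nth c (p w') j in
    x = y \/ (e x y /\ j != 0) -> False.
  move=> wN w'N ww' il jl x y h.
  have [h1 h2 h3 _] := pP w wN; have [k1 k2 k3 _] := pP w' w'N.
  have xS : x \in S by apply: h2; exact: mem_nthV.
  pose q u := if u == w then drop i.+1 (p w) else
     if u == w' then (if x == y then drop j.+1 (p w') else drop j (p w'))
     else rev (c :: take i (p w)) ++ p u.
  have last_take : last c (take i.+1 (p w)) = x.
    by rewrite -nth_last size_takel //= nth_take.
  have last_take' : last c (take j.+1 (p w')) = y.
    by rewrite -nth_last size_takel //= nth_take.
  have pw := pth _ wN; have pw' := pth _ w'N.
  have pdrop : path e x (drop i.+1 (p w)).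
    by move: pw; rewrite -{1}(cat_take_drop i.+1 (p w)) cat_path last_take => /andP[].
  have pdrop' : path e y (drop j.+1 (p w')).
    by move: pw'; rewrite -{1}(cat_take_drop j.+1 (p w')) cat_path last_take' => /andP[].
  have back : path e x (rev (c :: take i (p w))).
    have := pw; rewrite -{1}(cat_take_drop i.+1 (p w)) cat_path => /andP[pt _].
    have Et : take i.+1 (p w) = rcons (take i (p w)) x by rewrite (take_nth c).
    rewrite Et in pt; have := rev_path e c (rcons (take i (p w)) x).
    rewrite last_rcons belast_rcons => ->; rewrite (eq_path (e' := e)) // => a b; exact: eS.
  have fq : fan x q.
    split=> // u uN; rewrite /q; case: eqVneq => [->|uw].
      split=> //; first by move=> z /mem_drop/h2.
      by rewrite -h3 -{2}(cat_take_drop i.+1 (p w)) last_cat last_take.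
    case: eqVneq => [->|uw'].
      have lst : last y (drop j.+1 (p w')) = tau w'.
        by rewrite -k3 -{2}(cat_take_drop j.+1 (p w')) last_cat last_take'.
      case: eqVneq => [E|ne]; first by rewrite E; split=> // z /mem_drop/k2.
      case: h => [E|[exy _]]; first by rewrite E eqxx in ne.
      rewrite (drop_nth c jl) -/y; split=> //=; first by rewrite exy.
      by move=> z zs; apply: k2; move: zs; rewrite -(drop_nth c jl) => /mem_drop.
    have [g1 g2 g3 _] := pP u uN; split.
    - rewrite cat_path back /=; move: (pth _ uN); by rewrite rev_cons last_rcons.
    - move=> z; rewrite mem_cat mem_rev inE => /orP[/orP[/eqP->//|/mem_take/h2//]|/g2//].
    - by rewrite last_cat rev_cons last_rcons.
  have := min _ _ fq; rewrite leqNgt => /negP; apply; apply: leq_trans cn.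
  rewrite /cost (bigD1 w) //= (bigD1 w') /=; last by rewrite w'N eq_sym.
  rewrite [X in _ < X](bigD1 w) //= [X in _ < _ + X](bigD1 w') /=; last by rewrite w'N eq_sym.
  have third : \sum_(u in N | (u != w) && (u != w')) size (q u) <=
      i.+1 + \sum_(u in N | (u != w) && (u != w')) size (p u).
    case: (pickP [pred u in N | (u != w) && (u != w')]) => [u /= /and3P[uN uw uw']|none]; last first.
      by rewrite big_pred0.
    have only v : (v \in N) && ((v != w) && (v != w')) = (v == u).
      apply/idP/eqP => [/and3P[vN vw vw']|->]; last by rewrite uN uw uw'.
      apply: contraTeq N3 => vu; rewrite -ltnNge.
      have : [set w; w'; u; v] \subset N.
        by apply/subsetP => z; rewrite !inE => /orP[/orP[/orP[]|]|] /eqP->.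
      move/subset_leq_card; rewrite setUC cardsU1 setUC cardsU1 cards2 !inE ww' !negb_or.
      by rewrite vw vw' vu uw uw'.
    rewrite (big_pred1 u) // (big_pred1 u) // /q (negbTE uw) (negbTE uw').
    by rewrite size_cat size_rev /= size_takel // ltnW.
  rewrite (eq_bigl (fun u => (u \in N) && ((u != w) && (u != w')))); last by move=> u; rewrite andbA.
  rewrite [X in _ < _ + (_ + X)](eq_bigl (fun u => (u \in N) && ((u != w) && (u != w')))); last by move=> u; rewrite andbA.
  have s1 : size (q w) + i.+1 = size (p w) by rewrite /q eqxx size_drop subnK.
  have s2 : size (q w') < size (p w').
    rewrite /q eq_sym (negbTE ww') eqxx; case: eqVneq => [E|ne]; rewrite size_drop.
      by move: jl; clear; lia.
    case: h => [E|[_ j0]]; first by rewrite E eqxx in ne.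
    by move: jl j0; clear; lia.
  move: third s1 s2; clear; lia.
move=> w w' x y wN w'N ww' xp yp.
have [ix iy] : index x (p w) < size (p w) /\ index y (p w') < size (p w') by rewrite !index_mem.
have h1 := move_center w w' _ _ wN w'N ww' ix iy; have h2 := move_center w' w _ _ w'N wN _ iy ix.
rewrite /= !nth_index // in h1 h2; rewrite eq_sym in ww'; have {}h2 := h2 ww'.
split; first by apply/eqP => E; apply: h1; left.
apply/negP => xy.
(* The only edge that does not allow a move joins two first vertices, and these form a triangle with
   [c]. *)
have i0 : index x (p w) = 0.
  by apply/eqP; apply: contraT => ne; case: h2; right; rewrite eS.
have j0 : index y (p w') = 0.
  by apply/eqP; apply: contraT => ne; case: h1; right.
have hd u z : u \in N -> z \in p u -> index z (p u) = 0 -> e c z.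
  move=> uN zp E; have := pth _ uN; case: (p u) zp E => [//|a s] /=.
  by case: eqVneq => // -> _ _ /andP[].
by apply: (@trif c x y) => //; [exact: hd i0|exact: hd j0].
Qed.
End Center.
End Paths.

Section Lift.
Variables (G : sgraph) (S : {set G}).
Implicit Type s : seq G.

Definition lift_seq s : seq (induced S) := pmap insub s.

Lemma map_lift s : {subset s <= S} -> map val (lift_seq s) = s.
Proof.
elim: s => [//|x s IH] h; rewrite /lift_seq /= insubT ?h ?inE ?eqxx //= => xS /=.
by rewrite IH // => z zs; apply: h; rewrite inE zs orbT.
Qed.

Lemma mem_lift s (x : induced S) : (x \in lift_seq s) = (val x \in s).
Proof. exact: mem_pmap_sub. Qed.

Lemma lift_ipath s : {subset s <= S} -> ipath (@sedge G) s -> ipath (@sedge (induced S)) (lift_seq s).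
Proof.
move=> sS [us h]; have Es := map_lift sS; split; first by rewrite -(map_inj_uniq val_inj) Es.
have sz : size (lift_seq s) = size s by rewrite -{2}Es size_map.
move=> d i j ij; rewrite sz => js; have il := ltn_trans ij js.
by rewrite -(h (val d)) // -[in RHS]Es !(nth_map d) ?sz.
Qed.

Lemma is_path_lift s : {subset s <= S} -> ipath (@sedge G) s -> is_path (lift_seq s).
Proof.
move=> sS ips; have ipl := lift_ipath sS ips; split; first by case: ipl.
exact: (ipath_consecutive (@sedge_sym _) (@sedge_irr _) ipl).
Qed.
End Lift.

Lemma in_neighbors (G : sgraph) (u v : G) : (v \in neighbors u) = sedge u v.
Proof. by rewrite inE. Qed.

(** The centers of the parts are the branch vertices. The path of an edge [uv] goes from the center
    of [u] to the end of the unique edge between the parts and on to the center of [v]. No further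
    edge arises: inside a part by [center], between parts by uniqueness. *)
Lemma subdivision_of_model (G W : sgraph) (X : W -> {set G}) :
  (forall x y z : G, sedge x y -> sedge y z -> sedge x z -> False) ->
  (forall w : W, 0 < degree w <= 3) ->
  model (@sedge G) (@sedge W) X ->
  (forall u v x y, u != v -> x \in X u -> y \in X v -> sedge x y -> sedge u v) ->
  (forall u v x y x' y', u != v -> x \in X u -> x' \in X u -> y \in X v -> y' \in X v ->
     sedge x y -> sedge x' y' -> x = x' /\ y = y') ->
  exists S : {set G}, is_subdivision (induced S) W.
Proof.
move=> trif deg [cX dX eX] crossE crossU.
have eS := @sedge_sym G; have eI := @sedge_irr G; have wI := @sedge_irr W; have wS := @sedge_sym W.
have ne_of u v : @sedge W u v -> u != v by move=> uv; apply: contraTneq uv => ->; rewrite wI.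
have /choice[ch chP] : forall uv : W * W, exists xy : G * G, sedge uv.1 uv.2 ->
    [/\ xy.1 \in X uv.1, xy.2 \in X uv.2 & sedge xy.1 xy.2].
  move=> [u v] /=; have [uv|nuv] := boolP (sedge u v).
    by have [x [y h]] := eX u v uv; exists (x, y).
  have /andP[/card_gt0P[v'] + _] := deg u.
  by rewrite in_neighbors => /eX[x _]; exists (x, x).
pose tau u v := (ch (u, v)).1.
have tauP u v : sedge u v -> [/\ tau u v \in X u, tau v u \in X v & sedge (tau u v) (tau v u)].
  move=> uv; have vu : sedge v u by rewrite wS.
  have [h1 h2 h3] := chP (u, v) uv; have [h4 h5 h6] := chP (v, u) vu.
  rewrite /= eS in h6; have [E1 E2] := crossU _ _ _ _ _ _ (ne_of _ _ uv) h1 h5 h2 h4 h3 h6.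
  by rewrite /tau; split=> //=; rewrite -E2.
have /choice[cp cpP] : forall w, exists cp : G * (W -> seq G),
    [/\ fan (@sedge G) (neighbors w) (X w) (tau w) cp.1 cp.2,
        forall v, v \in neighbors w -> ipath (@sedge G) (cp.1 :: cp.2 v) &
        forall v v' x y, v \in neighbors w -> v' \in neighbors w -> v != v' ->
          x \in cp.2 v -> y \in cp.2 v' -> x != y /\ ~~ sedge x y].
  move=> w; have /andP[d0 d3] := deg w.
  have N0 : neighbors w != set0 by rewrite -card_gt0.
  have tX v : v \in neighbors w -> tau w v \in X w by rewrite in_neighbors => /tauP[].
  have [c [p [h1 h2 h3]]] := center eS N0 d3 (cX w) tX trif.
  by exists (c, p).
pose c w := (cp w).1; pose pi w := (cp w).2.
have cin w : c w \in X w by have [[]] := cpP w.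
have piP u v : sedge u v -> [/\ ipath (@sedge G) (c u :: pi u v), {subset pi u v <= X u} &
    last (c u) (pi u v) = tau u v].
  move=> uv; have [[_ h] h' _] := cpP u; have vN : v \in neighbors u by rewrite in_neighbors.
  by have [h1 h2 h3] := h v vN; split=> //; exact: h'.
have piD u v v' x y : sedge u v -> sedge u v' -> v != v' -> x \in pi u v -> y \in pi u v' ->
    x != y /\ ~~ sedge x y.
  by move=> uv uv'; have [_ _ h] := cpP u; apply: h; rewrite in_neighbors.
clearbody c pi; clear cp cpP.
pose S := [set x | `[< exists u v, sedge u v /\ x \in c u :: pi u v >]].
have SP x : x \in S -> exists u v, sedge u v /\ x \in c u :: pi u v.
  by rewrite inE => /asboolP.
have inS u v x : sedge u v -> x \in c u :: pi u v -> x \in S.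
  by move=> uv h; rewrite inE; apply/asboolP; exists u, v.
have cS w : c w \in S.
  have /andP[/card_gt0P[v] + _] := deg w; rewrite in_neighbors => wv; apply: (inS w v) => //.
  by rewrite inE eqxx.
have piS u v : sedge u v -> {subset pi u v <= S}.
  by move=> uv x xp; apply: (inS u v) => //; rewrite inE xp orbT.
pose q u v := pi u v ++ rev (pi v u).
pose Q u v := c u :: rcons (q u v) (c v).
have QE u v : Q u v = (c u :: pi u v) ++ rev (c v :: pi v u).
  by rewrite /Q /q rev_cons -rcons_cat -rcons_cons.
have qS u v : sedge u v -> {subset q u v <= S}.
  move=> uv x; have vu : sedge v u by rewrite wS.
  by rewrite mem_cat mem_rev => /orP[/(piS _ _ uv)|/(piS _ _ vu)].
have inX u v x : sedge u v -> x \in c u :: pi u v -> x \in X u.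
  by move=> uv; rewrite inE => /orP[/eqP->//|]; have [_ h _] := piP _ _ uv; exact: h.
have uQ u v : sedge u v -> uniq (Q u v).
  move=> uv; have vu : sedge v u by rewrite wS.
  have [[u1 _] _ _] := piP _ _ uv; have [[u2 _] _ _] := piP _ _ vu.
  rewrite QE cat_uniq rev_uniq u1 u2 andbT; apply/hasPn => x; rewrite mem_rev => xv.
  apply/negP => xu; have := ne_of _ _ uv.
  by rewrite (dX _ _ _ (inX _ _ _ uv xu) (inX _ _ _ vu xv)) eqxx.
have sQ u v : sedge u v -> sorted (@sedge G) (Q u v).
  move=> uv; have vu : sedge v u by rewrite wS.
  have [i1 _ l1] := piP _ _ uv; have [i2 _ l2] := piP _ _ vu; have [_ _ t3] := tauP _ _ uv.
  rewrite QE /= cat_path; have := ipath_sorted i1; rewrite /= l1 => -> /=.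
  have : sorted (@sedge G) (rev (c v :: pi v u)).
    by rewrite rev_sorted (eq_sorted (e' := @sedge G)) => [|a b]; [exact: ipath_sorted i2|exact: eS].
  have : head (tau v u) (rev (c v :: pi v u)) = tau v u.
    rewrite -nth0 nth_rev //= subSS subn0 -l2.
    by rewrite (last_nth (c v)) /= ; case: (pi v u) => //= a s; apply: set_nth_default.
  by case: (rev _) => [|a s] //= -> ->; rewrite t3.
exists S.
pose f w : induced S := exist _ (c w) (cS w).
pose p u v := lift_seq S (q u v).
have lq u v : sedge u v -> map val (p u v) = q u v by move=> uv; apply: map_lift; exact: qS.
have lQ u v : sedge u v -> map val (f u :: rcons (p u v) (f v)) = Q u v.
  by move=> uv; rewrite /= map_rcons lq.
exists f, p; split.
- by move=> u v [E]; apply: (dX _ _ (c u)) => //; rewrite E.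
- move=> u v uv; split; first by rewrite -(map_inj_uniq val_inj) lQ // uQ.
  apply: (inj_map val_inj); rewrite map_rev !lq // 1?wS //.
  by rewrite /q rev_cat revK.
- have only u v x : sedge u v -> x \in q u v -> exists u' v', [/\ sedge u' v', x \in pi u' v' &
      [set u'; v'] = [set u; v]].
    move=> uv; rewrite mem_cat mem_rev => /orP[h|h]; first by exists u, v.
    by exists v, u; split=> //; [rewrite wS|rewrite setUC].
  move=> u v x uv; rewrite mem_lift => /(only _ _ _ uv)[u1 [v1 [uv1 x1 <-]]].
  have x1' : val x \in c u1 :: pi u1 v1 by rewrite inE x1 orbT.
  split=> [w|u' v' uv'].
    apply/eqP => E; rewrite E /= in x1 x1'.
    have Ew := dX _ _ _ (cin w) (inX _ _ _ uv1 x1'); subst w.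
    by have [[/= /andP[/negP h _] _] _ _] := piP _ _ uv1.
  rewrite mem_lift => /(only _ _ _ uv')[u2 [v2 [uv2 x2 <-]]].
  have x2' : val x \in c u2 :: pi u2 v2 by rewrite inE x2 orbT.
  have E := dX _ _ _ (inX _ _ _ uv1 x1') (inX _ _ _ uv2 x2'); subst u2.
  have [->//|ne] := eqVneq v1 v2.
  by have [/eqP] := piD _ _ _ _ _ uv1 uv2 ne x1 x2.
- move=> x; have [u [v [uv]]] := SP _ (svalP x); rewrite inE => /orP[/eqP E|xp].
    by left; exists u; apply: val_inj.
  by right; exists u, v; split=> //; rewrite mem_lift mem_cat xp.
- move=> x y; split=> [xy|[u [v [uv]]]]; last first.
    rewrite -(consecutive_map _ _ _ val_inj) lQ // => /(sorted_consecutive eS (sQ _ _ uv)).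
    exact.
  suff [u [v [uv h]]] : exists u v, sedge u v /\ consecutive (Q u v) (val x) (val y).
    by exists u, v; split=> //; rewrite -(consecutive_map _ _ _ val_inj) lQ.
  have {}xy : sedge (val x) (val y) by [].
  have [u [v [uv xp]]] := SP _ (svalP x); have [u' [v' [uv' yp]]] := SP _ (svalP y).
  have left_part a b s t : consecutive s a b -> consecutive (s ++ t) a (b : G).
    by rewrite /consecutive => /orP[] /(infix_catr t) ->; rewrite ?orbT.
  have [E|ne] := eqVneq u u'.
    subst u'; suff [w [uw xw yw]] : exists w, [/\ sedge u w, val x \in c u :: pi u w & val y \in c u :: pi u w].
      exists u, w; split=> //; rewrite QE; apply: left_part.
      by have [ip _ _] := piP _ _ uw; rewrite -(ipath_consecutive eS eI ip).
    move: xp yp; rewrite inE => /orP[/eqP Ex|xp] yp; first by exists v'; split=> //; apply/orP; left; apply/eqP.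
    move: yp; rewrite inE => /orP[/eqP Ey|yp]; first by exists v; split=> //; rewrite inE; apply/orP; [right|left; apply/eqP].
    have [E|ne] := eqVneq v v'; first by exists v; split=> //; rewrite inE; apply/orP; right; rewrite // E.
    by have [_ /negP] := piD _ _ _ _ _ uv uv' ne xp yp.
  have uu' := crossE _ _ _ _ ne (inX _ _ _ uv xp) (inX _ _ _ uv' yp) xy.
  exists u, u'; split=> //; have [t1 t2 t3] := tauP _ _ uu'.
  have [Ex Ey] := crossU _ _ _ _ _ _ ne (inX _ _ _ uv xp) t1 (inX _ _ _ uv' yp) t2 xy t3.
  rewrite (_ : val x = tau u u') // (_ : val y = tau u' u) //.
  apply/orP; left; apply/(infix2P (tau u u')).
  have [_ _ l1] := piP _ _ uu'; have u'u : sedge u' u by rewrite wS.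
  have [_ _ l2] := piP _ _ u'u.
  exists (size (pi u u')); rewrite QE; first by rewrite size_cat size_rev /=; lia.
  rewrite !nth_cat /= ltnSn ltnn subnn; split.
    rewrite -l1 (last_nth (c u)) /=; case: (pi u u') => //= a s; exact: set_nth_default.
  rewrite nth_rev //= subn1 /= -l2 (last_nth (c u')) /=.
  by case: (pi u' u) => //= a s; exact: set_nth_default.
Qed.

(** * Holes *)

Section Sequences.
Variables (V : finType) (e : rel V).
Hypothesis eS : symmetric e.

Lemma conn_seq (s : seq V) : sorted e s -> conn e [set z in s].
Proof.
case: s => [_ x y|x s /= xs]; first by rewrite inE.
exact: conn_path.
Qed.

Lemma ipath_rev (s : seq V) : ipath e s -> ipath e (rev s).
Proof.
move=> [us h]; split; first by rewrite rev_uniq.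
move=> d i j ij; rewrite size_rev => js; have is' := ltn_trans ij js.
by rewrite !nth_rev // eS h; move: ij js; clear; lia.
Qed.

Lemma ipath_split (s : seq V) i j a b : ipath e s -> i < j -> a \in take i.+1 s -> b \in drop j s ->
  a != b /\ (i.+1 < j -> ~~ e a b).
Proof.
move=> [us h] ij ai bj; have as' := mem_take ai; have bs := mem_drop bj.
have Ia : index a s <= i by rewrite -ltnS -(in_take _ as').
have Ib : j <= index b s.
  rewrite leqNgt; apply/negP => lt; have : b \in take j s by rewrite in_take.
  move=> bt; move: us; rewrite -{1}(cat_take_drop j s) cat_uniq => /and3P[_ /hasPn /(_ _ bj) + _].
  by rewrite /= bt.
have bsz : index b s < size s by rewrite index_mem.
split; first by apply: contraTneq ij => E; rewrite -leqNgt; move: Ia Ib; rewrite E; clear; lia.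
move=> ij'; have := h a (index a s) (index b s); rewrite !nth_index // => -> //.
  by apply/eqP; move: Ia Ib ij'; clear; lia.
by move: Ia Ib ij; clear; lia.
Qed.

Lemma mem_take_nth (s : seq V) d i j : j <= i -> j < size s -> nth d s j \in take i.+1 s.
Proof. by move=> ji js; rewrite -(nth_take d (n0 := i.+1)) // mem_nthV // size_take; case: ifP => _ //; rewrite ltnS. Qed.

Lemma mem_drop_nth (s : seq V) d i j : i <= j -> j < size s -> nth d s j \in drop i s.
Proof.
move=> ij js; rewrite -(subnKC ij) -nth_drop mem_nthV // size_drop.
by move: ij js; clear; lia.
Qed.

Lemma path_exit (s : seq V) d (A : pred V) : sorted e s -> 0 < size s -> A (head d s) -> ~~ A (last d s) ->
  exists a b, [/\ a \in s, b \in s, A a, ~~ A b & e a b].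
Proof.
case: s => [//|x s] /= xs _; elim: s x xs => [|z s IH] x /=; first by move=> _ ->.
case/andP=> xz zs Ax nA; have [Az|nAz] := boolP (A z); last first.
  by exists x, z; rewrite !inE !eqxx !orbT.
have [a [b [ia ib Aa Ab ab]]] := IH z zs Az nA; exists a, b; split=> //.
  by rewrite inE ia orbT.
by rewrite inE ib orbT.
Qed.

Lemma comp_nbr (T : {set V}) x z : conn e T -> x \in T -> z \in T -> x != z ->
  exists2 a, a \in comp e (T :\ x) z & e x a.
Proof.
move=> cT xT zT xz; apply: contrapT => H.
have zx : z \in T :\ x by rewrite !inE eq_sym xz.
have := closed_connect (C := comp e (T :\ x) z) _ (comp_id _ _ _) (cT _ _ zT xT).
move=> /(_ _) h; have : x \in comp e (T :\ x) z.
  apply: h => a b aC bT ab; have [Eb|nb] := eqVneq b x.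
    by case: H; exists a => //; rewrite eS -Eb.
  by apply: (comp_closed zx aC _ ab); rewrite !inE nb.
by move/(subsetP (comp_sub zx)); rewrite !inE eqxx.
Qed.

(** The hole [y :: s], opened at [y]; as [s] has at least three vertices, the length is at least
    four. *)
Definition hole y s : Prop := [/\ ipath e s, 2 < size s, y \notin s &
  forall i, i < size s -> e y (nth y s i) = (i == 0) || (i.+1 == size s)].

Lemma hole_rev y s : hole y s -> hole y (rev s).
Proof.
move=> [h1 h2 h3 h4]; split; rewrite ?size_rev ?mem_rev //; first exact: ipath_rev.
move=> i il; have il' : size s - i.+1 < size s by rewrite ltn_subrL (leq_ltn_trans _ il).
rewrite nth_rev // h4 // orbC; by congr (_ || _); apply/eqP/eqP; move: (size s) il => n il; clear -il; lia.
Qed.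

Lemma hole_head y s d : hole y s -> e y (nth d s 0).
Proof.
move=> [_ s2 _ h]; have s0 : 0 < size s by apply: ltn_trans s2.
by rewrite (set_nth_default y) // h.
Qed.

Lemma hole_last y s d : hole y s -> e y (nth d s (size s).-1).
Proof.
move=> [_ s2 _ h]; have s0 : (size s).-1 < size s by move: s2; clear; lia.
by rewrite (set_nth_default y) // h // prednK ?eqxx ?orbT //; move: s2; clear; lia.
Qed.

Lemma hole_conn y s : hole y s -> conn e [set z in s].
Proof. by move=> [/ipath_sorted/conn_seq]. Qed.

Lemma hole_conn_all y s : hole y s -> conn e [set z in y :: s].
Proof.
move=> h; have [_ s2 _ _] := h; have s0 : 0 < size s by apply: ltn_trans s2.
have -> : [set z in y :: s] = [set y] :|: [set z in s] by apply/setP => z; rewrite !inE.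
apply: (connU eS (a := y) (b := nth y s 0) (@conn1 _ e y) (hole_conn h)); rewrite ?inE //.
  exact: mem_nthV.
by rewrite (hole_head _ h) orbT.
Qed.

Lemma hole_conn_minus y s z : hole y s -> conn e ([set w in y :: s] :\ z).
Proof.
move=> h; have [[us hs] s2 ys hy] := h; have s0 : 0 < size s by apply: ltn_trans s2.
have [->|zy] := eqVneq z y.
  rewrite (_ : _ :\ y = [set w in s]); first exact: hole_conn h.
  apply/setP => w; rewrite !inE; case: eqVneq => [->|//]; by rewrite (negbTE ys).
have [zs|zs] := boolP (z \in s); last first.
  rewrite (_ : _ :\ z = [set w in y :: s]); first exact: hole_conn_all h.
  apply/setP => w; rewrite !inE; case: eqVneq => [->|//]; by rewrite (negbTE zs) (negbTE zy).
have is' : index z s < size s by rewrite index_mem.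
pose A := y |: [set w in take (index z s) s]; pose B := y |: [set w in drop (index z s).+1 s].
have uz : z \notin take (index z s) s by rewrite in_take // ltnn.
have uz' : z \notin drop (index z s).+1 s.
  move: us; rewrite -{1}(cat_take_drop (index z s) s) (drop_nth z is') nth_index //.
  by rewrite cat_uniq => /and3P[_ _ /= /andP[]].
have ss := ipath_sorted (conj us hs).
have cA : conn e A.
  rewrite /A; case E : (index z s) => [|i].
    by rewrite take0 (_ : y |: _ = [set y]); [exact: conn1|apply/setP => w; rewrite !inE orbF].
  apply: (connU eS (a := y) (b := nth y s 0) (@conn1 _ e y) (conn_seq (take_sorted _ ss))); rewrite ?inE //.
    exact: mem_take_nth.
  by rewrite (hole_head _ h) orbT.
have cB : conn e B.
  rewrite /B; have [E|ne] := eqVneq (index z s).+1 (size s).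
    by rewrite E drop_size (_ : y |: _ = [set y]); [exact: conn1|apply/setP => w; rewrite !inE orbF].
  apply: (connU eS (a := y) (b := nth y s (size s).-1) (@conn1 _ e y) (conn_seq (drop_sorted _ ss))); rewrite ?inE //.
    by apply: mem_drop_nth; move: is' ne; clear; lia.
  by rewrite (hole_last _ h) orbT.
rewrite (_ : _ :\ z = A :|: B); first by apply: (connU eS (a := y) (b := y) cA cB); rewrite ?inE eqxx.
apply/setP => w; rewrite !inE -{1}(cat_take_drop (index z s) s) (drop_nth z is') nth_index // mem_cat inE.
have [->|wz] := eqVneq w z; first by rewrite (negbTE zy) (negbTE uz) (negbTE uz').
by rewrite /=; case: (w == y) => //=.
Qed.

End Sequences.

Section Sparse.
Variables (V : finType) (e : rel V).
Hypothesis eS : symmetric e.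
Hypothesis eI : irreflexive e.
Hypothesis trif : forall x y z, e x y -> e y z -> e x z -> False.

(** A shortest path in [C] from a neighbour of [y] in [A] to one in [B] has no further neighbour of
    [y]. It has more than two vertices, as there is no triangle. *)
Lemma hole_two y (C : {set V}) (A B : pred V) a b : conn e C -> y \notin C ->
  a \in C -> b \in C -> e y a -> e y b -> A a -> B b ->
  (forall z, z \in C -> e y z -> A z || B z) -> (forall z, z \in C -> A z -> B z -> False) ->
  exists s, [/\ hole e y s, {subset s <= C}, A (head y s) & B (last y s)].
Proof.
move=> cC yC aC bC ya yb Aa Bb cover disj.
pose A' z := A z && e y z; pose B' z := B z && e y z.
have A'a : A' a by apply/andP.
have B'b : B' b by apply/andP.
have [s [s0 sC ips [hA hB] [oA oB]]] := shortest A'a B'b aC (cC _ _ aC bC).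
have hE d : head d s = nth y s 0 by case: s s0 {sC ips hA hB oA oB}.
have lE d : last d s = nth y s (size s).-1.
  by rewrite (set_nth_default d) ?nth_last //; move: s0; clear; lia.
have l0 : (size s).-1 < size s by move: s0; clear; lia.
have [Ah yh] := andP hA; have [Bl yl] := andP hB.
rewrite !hE in Ah yh; rewrite !lE in Bl yl.
exists s; split=> //; first 1 last.
  by rewrite lE.
have ys : y \notin s by apply: contra yC => /sC.
split=> //; first 1 last.
  move=> i il; apply/idP/idP => [yi|/orP[/eqP->//|/eqP E]]; last first.
    by have -> : i = (size s).-1 by rewrite -E.
  have iC : nth y s i \in C by apply: sC; exact: mem_nthV.
  apply/orP; case/orP: (cover _ iC yi) => h.
    left; apply/eqP/eqP; apply: contraT => i0.
    have := oA i; rewrite lt0n i0 il (set_nth_default y) // /A' h yi => /(_ isT) //.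
  right; rewrite eqn_leq il /= leqNgt; apply/negP => lt.
  by have := oB i lt; rewrite (set_nth_default y) // /B' h yi.
have n1 : size s != 1.
  by apply/eqP => E; rewrite E /= in Bl; apply: (disj (nth y s 0)) => //; exact/sC/mem_nthV.
have n2 : size s != 2.
  apply/eqP => E; have [_ h] := ips; apply: (@trif y (nth y s 0) (nth y s 1)) => //.
    by rewrite h ?E.
  by move: yl; rewrite E.
by move: n1 n2 s0; case: (size s) => [|[|[|n]]].
Qed.
End Sparse.

Section Holes.
Variable G : sgraph.
Notation e := (@sedge G).

Lemma hole_is_hole (y : G) s : hole e y s -> is_hole (y :: s).
Proof.
move=> [[us h] s2 ys hy]; have uys : uniq (y :: s) by rewrite /= ys.
split=> // a b aH bH; rewrite !next_nth aH bH.
have [ia ib] : index a (y :: s) < (size s).+1 /\ index b (y :: s) < (size s).+1.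
  by rewrite -!(index_mem _ (y :: s)) /= in aH bH *.
have nE i : i < (size s).+1 -> nth y s i = nth y (y :: s) (if i == size s then 0 else i.+1).
  by case: eqVneq => [->|_] _ //=; rewrite nth_default.
have key i j : i < j -> j < (size s).+1 ->
    e (nth y (y :: s) i) (nth y (y :: s) j) = (j == i.+1) || (i == 0) && (j == size s).
  case: j => // j; case: i => [|i] ij jl /=; first by rewrite hy.
  by rewrite h // orbF eqSS.
have nn i j : i < (size s).+1 -> j < (size s).+1 -> (nth y (y :: s) i == nth y (y :: s) j) = (i == j).
  by move=> il jl; rewrite nth_uniq.
rewrite -{1 3}(nth_index y aH) -{1 2}(nth_index y bH) !nE //.
move: (index a (y :: s)) (index b (y :: s)) ia ib => i j il jl.
have wrap k : k < (size s).+1 -> (if k == size s then 0 else k.+1) < (size s).+1.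
  by case: ifP => // /negbT; move: s2; clear; lia.
rewrite !nn ?wrap //.
have fin a' b' : (if a' == size s then 0 else a'.+1) == b' =
    ((a' == size s) && (b' == 0)) || ((a' != size s) && (b' == a'.+1)).
  by case: ifP; rewrite eq_sym ?orbF.
rewrite ![_ == (if _ then _ else _)]eq_sym !fin.
case: (ltngtP i j) => lt.
- by rewrite key //; move: s2 lt il jl; clear; lia.
- by rewrite sedge_sym key //; move: s2 lt il jl; clear; lia.
- by rewrite lt sedge_irr; move: s2 jl; clear; lia.
Qed.

Hypothesis sp : sparse G.
Hypothesis trif : forall x y z : G, e x y -> e y z -> e x z -> False.

Lemma hole_one y s v a b : hole e y s -> v \notin y :: s -> a \in y :: s -> b \in y :: s ->
  e v a -> e v b -> a = b.
Proof.
move=> /hole_is_hole hs vs as' bs va vb.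
have [a0 [b0 [a0s b0s ab0 /subsetP sub]]] := sp hs vs.
have ends c : c \in y :: s -> e v c -> c = a0 \/ c = b0.
  move=> cs vc; have := sub c; rewrite in_setI !in_set cs vc => /(_ isT).
  by case/orP => /set1P; [left|right].
case: (ends b bs vb) => E1; case: (ends a as' va) => E2; rewrite ?E1 ?E2 //; exfalso.
  by apply: (trif va _ vb); rewrite E1 E2 sedge_sym.
by apply: (trif va _ vb); rewrite E1 E2.
Qed.
End Holes.

(** * Separating cliques *)

Lemma mem_segment (T : eqType) (s : seq T) d i j w : j < size s ->
  w \in drop i (take j.+1 s) -> exists k, i <= k <= j /\ w = nth d s k.
Proof.
move=> js h; have wt := mem_drop h.
have sz : size (take j.+1 s) = j.+1 by rewrite size_takel.
have kl : index w (drop i (take j.+1 s)) < j.+1 - i by rewrite -{2}sz -size_drop index_mem.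
exists (i + index w (drop i (take j.+1 s))); split; first by move: kl; clear; lia.
rewrite -[in RHS](nth_take d (n0 := j.+1)); last by move: kl; clear; lia.
by rewrite -nth_drop nth_index.
Qed.

Lemma segment_mem (T : eqType) (s : seq T) d i j k : j < size s -> i <= k <= j ->
  nth d s k \in drop i (take j.+1 s).
Proof.
move=> js /andP[ik kj]; rewrite -(nth_take d (n0 := j.+1)) ?ltnS // -(subnKC ik) -nth_drop.
by rewrite mem_nth // size_drop size_takel //; move: ik kj; clear; lia.
Qed.

Section Separation.
Variable G : sgraph.
Notation e := (@sedge G).
Hypothesis sp : sparse G.
Hypothesis trif : forall x y z : G, e x y -> e y z -> e x z -> False.

Let eS : symmetric e := @sedge_sym G.
Let eI : irreflexive e := @sedge_irr G.

(** * Attachments of a connected set that no hole through [y] meets *)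

Section Around.
Variables (V1 D : {set G}) (y : G).
Hypothesis yD : y \notin D.
Hypothesis ndy : forall d, d \in D -> ~~ e y d.
Hypothesis cD : conn e D.
Hypothesis DV : D \subset V1.
Hypothesis nohole : forall s d, hole e y s -> {subset s <= V1} -> d \in s -> d \notin D.

Definition att p : Prop := exists2 d, d \in D & e p d.

Lemma att_y p : att p -> p != y.
Proof. by move=> [d dD pd]; apply: contraTneq pd => ->; exact: ndy. Qed.

(** The source of all contradictions in this section: from [A] to [B] one has to pass through [D],
    so [hole_two] yields a hole through [y] that meets [D]. *)
Lemma arms (A B : {set G}) a b a' b' : A \subset V1 -> B \subset V1 -> conn e A -> conn e B ->
  y \notin A -> y \notin B -> a \in A -> att a -> a' \in A -> e y a' ->
  b \in B -> att b -> b' \in B -> e y b' ->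
  (forall u v, u \in A -> v \in B -> u != v /\ ~~ e u v) -> False.
Proof.
move=> AV BV cA cB yA yB aA [d dD ad] a'A ya' bB [d' d'D bd'] b'B yb' anti.
have cC : conn e ((A :|: D) :|: B).
  apply: (connU eS (a := d') (b := b) _ cB) => //; last 2 first.
  - by rewrite inE d'D orbT.
  - by rewrite eS bd' orbT.
  by apply: (connU eS cA cD aA dD); rewrite ad orbT.
have yC : y \notin (A :|: D) :|: B by rewrite !inE (negbTE yA) (negbTE yB) (negbTE yD).
have [||z|z _ zA zB|s [hs sC hA hB]] :=
  @hole_two _ e trif y _ (mem A) (mem B) a' b' cC yC _ _ ya' yb' a'A b'B.
- by rewrite !inE a'A.
- by rewrite !inE b'B orbT.
- by rewrite !inE => /orP[/orP[->|/ndy /negbTE ->]|->] //; rewrite orbT.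
- by have [/eqP] := anti z z zA zB.
have [ips s2 _ _] := hs.
have nl : last y s \notin A by apply/negP => /anti/(_ hB)[/eqP].
have [a1 [b1 [a1s b1s a1A b1A ab]]] := path_exit (ipath_sorted ips) (leq_trans (ltnW (ltnW (ltnSn 2))) s2) hA nl.
have sV : {subset s <= V1}.
  by move=> w /sC; rewrite !inE => /orP[/orP[]|]; exact: subsetP.
have := sC _ b1s; rewrite !inE => /orP[/orP[h|]|].
- by rewrite /= h in b1A.
- exact/negP/(nohole hs sV b1s).
- by move=> b1B; have [_] := anti _ _ a1A b1B; rewrite ab.
Qed.

(** Cutting the hole between two nonconsecutive attachments leaves two arms, one from each
    attachment to a neighbour of [y]. *)
Lemma two_attached h i j : hole e y h -> {subset h <= V1} -> i.+1 < j -> j < size h ->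
  att (nth y h i) -> att (nth y h j) -> False.
Proof.
move=> hh hV ij jh ai aj; have [ips h2 yh _] := hh; have ss := ipath_sorted ips.
have ih : i < size h by apply: ltn_trans jh; exact: ltnW.
have h0 : 0 < size h by apply: leq_ltn_trans ih.
apply: (@arms [set z in take i.+1 h] [set z in drop j h] (nth y h i) (nth y h j) (nth y h 0) (nth y h (size h).-1)) => //.
- by apply/subsetP => z; rewrite inE => /mem_take/hV.
- by apply/subsetP => z; rewrite inE => /mem_drop/hV.
- by apply: conn_seq => //; exact: take_sorted.
- by apply: conn_seq => //; exact: drop_sorted.
- by rewrite inE; apply: contra yh => /mem_take.
- by rewrite inE; apply: contra yh => /mem_drop.
- by rewrite inE mem_take_nth.
- by rewrite inE mem_take_nth.
- exact: hole_head.
- by rewrite inE mem_drop_nth.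
- by rewrite inE mem_drop_nth //; move: jh h0; clear; lia.
- exact: hole_last.
- move=> u v; rewrite !inE => uA vB; have [h1 h3] := ipath_split ips (ltnW ij) uA vB.
  by split=> //; exact: h3.
Qed.

Lemma attached_clique h a b : hole e y h -> {subset h <= V1} -> a \in h -> b \in h ->
  att a -> att b -> a != b -> e a b.
Proof.
move=> hh hV ah bh aa ab ne; apply: contraT => nab; exfalso.
have [[uh ihs] _ _ _] := hh.
have key u v : u \in h -> v \in h -> att u -> att v -> ~~ e u v -> index u h < index v h -> False.
  move=> uh' vh au av nuv lt; apply: (@two_attached h (index u h) (index v h)) => //.
  - rewrite ltn_neqAle lt andbT; apply: contraNneq nuv => E.
    by have := ihs y _ _ lt; rewrite !nth_index // index_mem vh -E eqxx => ->.
  - by rewrite index_mem.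
  - by rewrite nth_index.
  - by rewrite nth_index.
case: (ltngtP (index a h) (index b h)) => lt.
- exact: (key a b).
- by apply: (key b a) => //; rewrite eS.
- by move/eqP: ne; apply; rewrite -(nth_index y ah) lt nth_index.
Qed.

(** [T] leads from [D] to the hole and touches it at [z] only. If [z] is [y], then [T] and [h] are
    two arms. Otherwise [h] is cut between [z] and [p]: one arm is [T] with the piece at [z], the
    other the piece at [p]. *)
Lemma arm_good (T : {set G}) h p q t z : hole e y h -> {subset h <= V1} -> T \subset V1 ->
  conn e T -> q \in T -> att q -> p \in h -> att p ->
  (forall u, u \in T -> u \notin y :: h) -> t \in T -> e t z -> z \in y :: h ->
  (forall u w, u \in T -> w \in y :: h -> e u w -> w = z) -> z != p -> z = y \/ ~~ e z p -> False.
Proof.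
move=> hh hV TV cT qT aq ph ap Th tT tz zh uniqz zp zyp.
have [ips h2 yh _] := hh; have ss := ipath_sorted ips.
have h0 : 0 < size h by apply: ltn_trans h2.
have yT : y \notin T by apply/negP => /Th; rewrite inE eqxx.
have [zy|zy] := eqVneq z y.
  apply: (@arms T [set w in h] q p t (nth y h 0)) => //.
  - by apply/subsetP => w; rewrite inE => /hV.
  - exact: hole_conn hh.
  - by rewrite inE.
  - by rewrite eS -zy.
  - by rewrite inE.
  - by rewrite inE mem_nthV.
  - exact: hole_head.
  - move=> u v uT; rewrite inE => vh; have vh' : v \in y :: h by rewrite inE vh orbT.
    split; first by apply: contraNneq (Th _ uT) => ->.
    by apply/negP => /(uniqz _ _ uT vh') E; move: yh; rewrite -zy -E vh.
have {}zyp : ~~ e z p by case: zyp => // /eqP; rewrite (negbTE zy).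
have {}zh : z \in h by move: zh; rewrite inE (negbTE zy).
have main h' i j : hole e y h' -> h' =i h -> i < j -> j < size h' -> nth y h' i = z -> nth y h' j = p -> False.
  move=> hh' hE ij jh Ei Ej; have [ips' _ yh' _] := hh'; have ss' := ipath_sorted ips'.
  have ij' : i.+1 < j.
    rewrite ltn_neqAle ij andbT; apply: contraNneq zyp => E.
    by rewrite -Ei -Ej; case: ips' => _ ->; rewrite ?E.
  have ih : i < size h' by apply: ltn_trans jh.
  have h0' : 0 < size h' by apply: leq_ltn_trans ih.
  apply: (@arms (T :|: [set w in take i.+1 h']) [set w in drop j h'] q p (nth y h' 0) (nth y h' (size h').-1)) => //.
  - by rewrite subUset TV; apply/subsetP => w; rewrite inE => /mem_take; rewrite hE => /hV.
  - by apply/subsetP => w; rewrite inE => /mem_drop; rewrite hE => /hV.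
  - apply: (connU eS (a := t) (b := z) cT (conn_seq eS (take_sorted _ ss'))) => //; last by rewrite tz orbT.
    by rewrite inE -Ei mem_take_nth.
  - by apply: conn_seq => //; exact: drop_sorted.
  - by rewrite !inE negb_or yT; apply: contra yh' => /mem_take.
  - by rewrite inE; apply: contra yh' => /mem_drop.
  - by rewrite inE qT.
  - by rewrite !inE mem_take_nth ?orbT.
  - exact: hole_head.
  - by rewrite inE -Ej mem_drop_nth.
  - by rewrite inE mem_drop_nth //; move: jh h0'; clear; lia.
  - exact: hole_last.
  - move=> u v; rewrite !inE => uA vB; have vh : v \in y :: h by rewrite inE -hE (mem_drop vB) orbT.
    case/orP: uA => uA.
      split; first by apply: contraNneq (Th _ uA) => ->.
      apply/negP => /(uniqz _ _ uA vh) E.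
      have zt : z \in take i.+1 h' by rewrite -Ei mem_take_nth.
      by have [/eqP] := ipath_split ips' ij zt vB; rewrite E.
    by have [h1 h3] := ipath_split ips' ij uA vB; split=> //; exact: h3.
have [iz ip] : index z h < size h /\ index p h < size h by rewrite !index_mem.
case: (ltngtP (index z h) (index p h)) => lt.
- by apply: (main h _ _ hh _ lt ip); rewrite ?nth_index.
- apply: (main (rev h) (size h - (index z h).+1) (size h - (index p h).+1)).
  + exact: hole_rev.
  + by move=> w; rewrite mem_rev.
  + by move: lt iz; clear; lia.
  + by rewrite size_rev; move: h0; clear; lia.
  + rewrite nth_rev; last by move: h0; clear; lia.
    by rewrite (_ : _ - _ = index z h) ?nth_index //; move: iz; clear; lia.
  + rewrite nth_rev; last by move: h0; clear; lia.
    by rewrite (_ : _ - _ = index p h) ?nth_index //; move: ip; clear; lia.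
- by move/eqP: zp; apply; rewrite -(nth_index y zh) lt nth_index.
Qed.

(** * Two nonadjacent attachments *)

Section Pair.
Variables (p q : G) (hp hq : seq G).
Hypothesis holep : hole e y hp.
Hypothesis holeq : hole e y hq.
Hypothesis hpV : {subset hp <= V1}.
Hypothesis hqV : {subset hq <= V1}.
Hypothesis php : p \in hp.
Hypothesis qhq : q \in hq.
Hypothesis ap : att p.
Hypothesis aq : att q.
Hypothesis pq : p != q.
Hypothesis npq : ~~ e p q.

Lemma pair_out : q \notin y :: hp /\ p \notin y :: hq.
Proof.
rewrite !inE !negb_or !att_y //=; split; apply: contra npq => h.
  exact: (attached_clique holep hpV php h).
exact: (attached_clique holeq hqV h qhq).
Qed.

Lemma not_both_y : ~~ (e y p && e y q).
Proof.
apply/negP => /andP[yp yq].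
apply: (@arms [set p] [set q] p q p q) => //; rewrite ?sub1set ?set11 ?inE //; try exact: conn1.
- exact: hpV.
- exact: hqV.
- by rewrite eq_sym att_y.
- by rewrite eq_sym att_y.
- by move=> u v; rewrite !inE => /eqP-> /eqP->.
Qed.

(** Either hole has at most one common neighbour of [p] and [q], since one of these lies off it.
    Removing the common neighbours thus keeps the two holes connected through [y], and this union
    together with [R] contains a hole through [p]. It can enter [R] only at [q], so [z], which is
    off it, sees two of its vertices. *)
Lemma common_neighbor (R : seq G) z : sorted e R -> 0 < size R -> {subset R <= D} ->
  e p (head y R) -> e q (last y R) ->
  (forall c r, c \in (y :: hp) ++ (y :: hq) -> c != p -> c != q -> ~~ (e c p && e c q) ->
     r \in R -> ~~ e c r) ->
  z \in (y :: hp) ++ (y :: hq) -> e z p -> e z q -> False.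
Proof.
move=> sR R0 RD pR qR anti zH zp zq; have [qhp phq] := pair_out.
pose Z := [set w | e w p && e w q].
have cZ h u v : hole e y h -> u \in y :: h -> v \notin y :: h -> (forall w, w \in Z -> e v w) ->
    conn e ([set w in y :: h] :\: Z).
  move=> hh uh vh vZ; case: (pickP [pred w in Z | w \in y :: h]) => [w /andP[/= wZ wh]|none].
    rewrite (_ : _ :\: Z = [set w in y :: h] :\ w); first exact: hole_conn_minus hh.
    apply/setP => x; rewrite in_setD in_setD1; have [xh|xh] := boolP (x \in [set w in y :: h]); last by rewrite !andbF.
    rewrite !andbT; congr (~~ _); apply/idP/eqP => [xZ|->//].
    by rewrite in_set in xh; apply: (hole_one sp trif hh vh); rewrite ?vZ.
  rewrite (_ : _ :\: Z = [set w in y :: h]); first exact: hole_conn_all hh.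
  apply/setP => x; rewrite in_setD; have := none x; rewrite /= [x \in [set _ in _]]in_set.
  by case: (x \in Z) => //= ->.
have yZ : y \notin Z by rewrite inE not_both_y.
pose E := ([set w in y :: hp] :\: Z) :|: ([set w in y :: hq] :\: Z).
have yE1 h : y \in [set w in y :: h] :\: Z by rewrite in_setD yZ !inE eqxx.
have cE : conn e E.
  apply: (connU eS (a := y) (b := y)) => //; rewrite ?eqxx //.
    by apply: (cZ hp y q holep (mem_head _ _) qhp) => w; rewrite inE => /andP[_]; rewrite eS.
  by apply: (cZ hq y p holeq (mem_head _ _) phq) => w; rewrite inE => /andP[+ _]; rewrite eS.
have pZ : p \notin Z by rewrite inE eI.
have qZ : q \notin Z by rewrite inE eI andbF.
have pE : p \in E by rewrite in_setU in_setD pZ !inE php orbT.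
have qE : q \in E by rewrite in_setU !in_setD qZ !inE qhq !orbT.
have EH w : w \in E -> w \in (y :: hp) ++ (y :: hq) /\ w \notin Z.
  rewrite mem_cat in_setU !in_setD => /orP[] /andP[-> h]; rewrite in_set in h; by rewrite h ?orbT.
have HD w : w \in (y :: hp) ++ (y :: hq) -> w \notin D.
  rewrite mem_cat !inE => /orP[] /orP[/eqP->//|]; first exact: nohole.
  exact: nohole.
have [a aC pa] := comp_nbr eS cE pE qE pq.
have qE' : q \in E :\ p by rewrite in_setD1 eq_sym pq.
have CE w : w \in comp e (E :\ p) q -> w != p /\ w \in E.
  by move/(subsetP (comp_sub qE')); rewrite in_setD1 => /andP[].
set C0 := comp e (E :\ p) q in aC CE *.
have lR : last y R \in R.
  by case: (R) R0 => //= r R' _; rewrite mem_last.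
have hR : head y R \in R.
  by case: (R) R0 => //= r R' _; rewrite mem_head.
have cC : conn e (C0 :|: [set w in R]).
  apply: (connU eS (comp_conn eS qE') (conn_seq eS sR) (comp_id _ _ _) (b := last y R)); first by rewrite inE.
  by rewrite qR orbT.
have [|||w wC|w _ wC0 wR|s [hs sC hA hB]] :=
  @hole_two _ e trif p _ (mem C0) (mem R) a (head y R) cC _ _ _ pa pR aC hR.
- rewrite in_setU [p \in [set _ in R]]in_set negb_or; apply/andP; split; first by apply/negP => /CE[]; rewrite eqxx.
  by apply/negP => /RD; apply/negP/HD; rewrite mem_cat inE php orbT.
- by rewrite in_setU aC.
- by rewrite in_setU in_set hR orbT.
- by move: wC; rewrite in_setU in_set.
- have [_ /EH[/HD wD _]] := CE _ wC0; by rewrite (RD _ wR) in wD.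
have [ips s2 _ _] := hs.
have R_C0 w : w \in R -> w \notin C0.
  move=> /RD wD; apply/negP => /CE[_ /EH[/HD]]; by rewrite wD.
have hq' : head p s != q.
  apply: contraNneq npq => <-; rewrite -nth0; exact: hole_head.
have [a1 [b1 [a1s b1s /andP[a1C a1q] b1n ab]]] :=
  @path_exit _ e s p (fun w => (w \in C0) && (w != q)) (ipath_sorted ips)
    (leq_trans (ltnW (ltnW (ltnSn 2))) s2) (introT andP (conj hA hq'))
    (introT nandP (or_introl (R_C0 _ hB))).
have qs : q \in s.
  have := sC _ b1s; rewrite in_setU in_set => /orP[b1C|b1R].
    by move: b1n; rewrite b1C /= negbK => /eqP <-.
  have [a1p /EH[a1H a1Z]] := CE _ a1C; rewrite in_set in a1Z.
  by have := anti _ _ a1H a1p a1q a1Z b1R; rewrite ab.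
have zps : z \notin p :: s.
  rewrite inE negb_or; apply/andP; split; first by apply: contraTneq zp => ->; rewrite eI.
  apply/negP => /sC; rewrite in_setU in_set => /orP[/CE[_ /EH[_]]|/RD].
    by rewrite inE zp zq.
  exact/negP/HD.
by move/eqP: pq; apply; apply: (hole_one sp trif hs zps) => //; rewrite inE ?eqxx ?qs ?orbT.
Qed.

Hypothesis noZ : forall z, z \in (y :: hp) ++ (y :: hq) -> ~~ (e z p && e z q).

Lemma p_alone w : w \in y :: hq -> ~~ e p w.
Proof.
move=> wq; apply/negP => pw; have [_ phq] := pair_out.
apply: (@arm_good [set p] hq q p p w) => //; rewrite ?sub1set ?set11 ?inE //; try exact: conn1.
- exact: hpV.
- by move=> u; rewrite !inE => /eqP->.
- move=> u v; rewrite in_set1 => /eqP-> vh pv; exact: (hole_one sp trif holeq phq).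
- by apply: contraNneq npq => <-.
- right; have := noZ (z := w); rewrite mem_cat wq orbT eS pw => /(_ isT) //.
Qed.
End Pair.

(** Walk along [h] from [q] until [hp] is seen for the first time, at [z]. This stretch is an arm,
    so by [arm_good] its contact [z] must be a neighbour of [p] other than [y]. *)
Lemma first_contact p q hp h i : hole e y hp -> hole e y h -> {subset hp <= V1} -> {subset h <= V1} ->
  p \in hp -> att p -> att q -> i < size h -> nth y h i = q -> q \notin y :: hp ->
  (forall w, w \in h -> ~~ e p w) ->
  exists j z, [/\ i <= j < size h, e (nth y h j) z, z \in hp, e z p &
    (forall k, i <= k <= j -> nth y h k \notin y :: hp) /\
    (forall k w, i <= k <= j -> w \in y :: hp -> e (nth y h k) w -> k = j /\ w = z)].
Proof.
move=> hhp hh hpV hV php ap aq ih Eq qhp nop; have [ips h2 yh _] := hh.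
pose P j := (i <= j < size h) && [exists w, (w \in y :: hp) && e (nth y h j) w].
have exP : exists j, P j.
  exists (size h).-1; apply/andP; split; first by move: ih; clear; lia.
  by apply/existsP; exists y; rewrite inE eqxx /= eS; exact: hole_last.
case: (ex_minnP exP) => j /andP[/andP[ij jh] /existsP[z /andP[zh tz]]] minj.
have before k w : i <= k -> k < j -> w \in y :: hp -> ~~ e (nth y h k) w.
  move=> ik kj wh; apply/negP => kw; have := minj k; rewrite leqNgt kj /P ik (ltn_trans kj jh) /= => h'.
  suff : false by [].
  by apply: h'; apply/existsP; exists w; rewrite wh.
have out k : i <= k <= j -> nth y h k \notin y :: hp.
  case/andP => ik kj; have [E|ne] := eqVneq i k; first by rewrite -E Eq.
  have k1 : k.-1 < j /\ i <= k.-1 by move: ik kj ne; clear; lia.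
  apply/negP => kh; have /negP := before _ _ k1.2 k1.1 kh; apply.
  have [_ ->] := ips; first by apply/eqP; move: ik ne; clear; lia.
  - by move: ik ne; clear; lia.
  - exact: leq_ltn_trans jh.
have uz w : w \in y :: hp -> e (nth y h j) w -> w = z.
  move=> wh tw; apply: (hole_one sp trif hhp _ wh zh tw tz); apply: out; by rewrite ij leqnn.
have uni k w : i <= k <= j -> w \in y :: hp -> e (nth y h k) w -> k = j /\ w = z.
  case/andP=> ik; rewrite leq_eqVlt => /orP[/eqP-> wh tw|kj wh]; first by split=> //; exact: uz.
  by rewrite (negbTE (before _ _ ik kj wh)).
have zp : z != p.
  by apply: contraTneq tz => ->; rewrite eS; apply: nop; exact: mem_nthV.
have arm : z = y \/ ~~ e z p -> False.
  apply: (@arm_good [set w in drop i (take j.+1 h)] hp p q (nth y h j) z) => //.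
  - by apply/subsetP => w; rewrite inE => /mem_drop/mem_take/hV.
  - apply: conn_seq => //; apply: drop_sorted; apply: take_sorted; exact: ipath_sorted ips.
  - by rewrite inE -Eq segment_mem // leqnn.
  - by move=> u; rewrite inE => /(mem_segment y jh)[k [/out + ->]].
  - by rewrite inE segment_mem // ij leqnn.
  - by move=> u w; rewrite inE => /(mem_segment y jh)[k [kij ->]] wh /(uni k w kij wh)[].
have [zy zp'] : z != y /\ e z p.
  by split; [apply/eqP => E; apply: arm; left|apply: contraT => n; case: arm; right].
exists j, z; split=> //; first by rewrite ij.
by move: zh; rewrite inE (negbTE zy).
Qed.

(** Walking from [q] in both directions along [hq] gives contacts [z1] and [z2], both neighbours of
    [p]. If they differ, the stretch between the contacts and [hp] without [p] contain a hole
    through both, of which [p] sees two vertices. *)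
Lemma no_far_pair p q hp hq : hole e y hp -> hole e y hq -> {subset hp <= V1} -> {subset hq <= V1} ->
  p \in hp -> q \in hq -> att p -> att q -> p != q -> ~~ e p q ->
  (forall z, z \in (y :: hp) ++ (y :: hq) -> ~~ (e z p && e z q)) -> False.
Proof.
move=> hhp hhq hpV hqV php qhq ap aq pq npq noZ.
have qp : q != p by rewrite eq_sym.
have nqp : ~~ e q p by rewrite eS.
have [qhp phq] := pair_out hhp hhq hpV hqV php qhq ap aq pq npq.
have noZ' z : z \in (y :: hq) ++ (y :: hp) -> ~~ (e z q && e z p).
  by rewrite mem_cat orbC -mem_cat andbC; exact: noZ.
have pal := p_alone hhp hhq hpV hqV php qhq ap aq pq npq noZ.
have qal := p_alone hhq hhp hqV hpV qhq php aq ap qp nqp noZ'.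
have palq w : w \in hq -> ~~ e p w by move=> wq; apply: pal; rewrite inE wq orbT.
have ih : index q hq < size hq by rewrite index_mem.
have [ips h2 yh _] := hhq.
have [j2 [z2 [/andP[ij2 j2h] tz2 z2h z2p [out2 uni2]]]] :=
  first_contact hhp hhq hpV hqV php ap aq ih (nth_index _ qhq) qhp palq.
have revV : {subset rev hq <= V1} by move=> w; rewrite mem_rev => /hqV.
have ih' : size hq - (index q hq).+1 < size (rev hq) by rewrite size_rev; move: ih; clear; lia.
have Eq' : nth y (rev hq) (size hq - (index q hq).+1) = q.
  rewrite nth_rev; last by move: ih; clear; lia.
  by rewrite (_ : _ - _ = index q hq) ?nth_index //; move: ih; clear; lia.
have palr w : w \in rev hq -> ~~ e p w by rewrite mem_rev; exact: palq.
have [j1' [z1 [/andP[ij1' j1h'] tz1 z1h z1p [out1 uni1]]]] :=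
  first_contact hhp (hole_rev eS hhq) hpV revV php ap aq ih' Eq' qhp palr.
set i := index q hq in ih ih' Eq' ij1' ij2 out1 out2 uni1 uni2 *.
rewrite size_rev in j1h'; pose j1 := size hq - j1'.+1.
have j1i : j1 <= i by rewrite /j1; move: ij1' ih; clear; lia.
have flip k : j1 <= k <= i -> size hq - i.+1 <= size hq - k.+1 <= j1' /\
    nth y (rev hq) (size hq - k.+1) = nth y hq k.
  move=> kk; split; first by rewrite /j1 in kk; move: kk ih j1h'; clear; lia.
  rewrite nth_rev; last by move: kk ih; clear; lia.
  by congr nth; move: kk ih; clear; lia.
rewrite nth_rev // -/j1 in tz1.
have nE : nth y hq i = q by rewrite nth_index.
have q_no w : w \in y :: hp -> ~~ e (nth y hq i) w by rewrite nE; exact: qal.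
have z1H : z1 \in y :: hp by rewrite inE z1h orbT.
have z2H : z2 \in y :: hp by rewrite inE z2h orbT.
have lt1 : j1 < i.
  rewrite ltn_neqAle j1i andbT; apply: contraTneq tz1 => ->; exact: q_no.
have lt2 : i < j2.
  rewrite ltn_neqAle ij2 andbT; apply: contraTneq tz2 => <-; exact: q_no.
have out k : j1 <= k <= j2 -> nth y hq k \notin y :: hp.
  case/andP=> h1 h3; have [ki|ik] := leqP k i; last by apply: out2; rewrite ltnW.
  by have [h4 <-] := flip k (introT andP (conj h1 ki)); exact: out1.
have uni k w : j1 <= k <= j2 -> w \in y :: hp -> e (nth y hq k) w -> w = z1 /\ k = j1 \/ w = z2 /\ k = j2.
  case/andP=> h1 h3 wh; have [ki|ik] := leqP k i; last first.
    have ikj : i <= k <= j2 by rewrite ltnW.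
    by case/(uni2 _ _ ikj wh) => -> ->; right.
  have [h4 <-] := flip k (introT andP (conj h1 ki)) => /(uni1 _ _ h4 wh)[E ->]; left; split=> //.
  by rewrite /j1; move: E ki ih j1h' h4; clear; lia.
(* If they agree, this vertex sees [hq] on both sides of [q]: off [hq] that is too much for one
   hole, and on [hq] it would have to lie between its two neighbours. *)
have [Ez|nz] := eqVneq z1 z2.
  have [zq|zq] := boolP (z1 \in hq); last first.
    have zq' : z1 \notin y :: hq.
      by rewrite inE negb_or zq andbT; apply: contraTneq z1h => ->; have [] := hhp.
    have E : nth y hq j1 = nth y hq j2.
      apply: (hole_one sp trif hhq zq'); rewrite ?inE ?mem_nthV ?orbT //; try by rewrite eS // Ez.
      by move: lt1 ih; clear; lia.
    have [uh _] := ips; have := nth_uniq y (ltn_trans lt1 ih) j2h uh; rewrite E eqxx => /esym/eqP.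
    by move: lt1 lt2; clear; lia.
  have kh : index z1 hq < size hq by rewrite index_mem.
  have := nth_index y zq; move: (index z1 hq) kh => k kh Ek.
  have nk : ~~ (j1 <= k <= j2) by apply/negP => /out; rewrite Ek z1H.
  have [_ ih0] := ips; have [lt|lt] : k < j1 \/ j2 < k by move: nk; clear; lia.
    have kj2 : k < j2 by move: lt lt1 lt2; clear; lia.
    have := ih0 y _ _ kj2 j2h; rewrite Ek eS Ez tz2 => /esym/eqP.
    by move: lt lt1 lt2; clear; lia.
  have j1k : j1 < k by move: lt lt1 lt2; clear; lia.
  have := ih0 y _ _ j1k kh; rewrite Ek tz1 => /esym/eqP.
  by move: lt lt1 lt2; clear; lia.
pose T := [set w in drop j1 (take j2.+1 hq)].
have TP w : w \in T -> exists k, j1 <= k <= j2 /\ w = nth y hq k.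
  by rewrite inE => /(mem_segment y j2h).
have j12 : j1 <= j2 by move: lt1 lt2; clear; lia.
have t1T : nth y hq j1 \in T by rewrite inE segment_mem // leqnn.
have t2T : nth y hq j2 \in T by rewrite inE segment_mem // j12 leqnn.
have cT : conn e T by apply: conn_seq => //; apply: drop_sorted; apply: take_sorted; exact: ipath_sorted ips.
have TH w : w \in T -> w \notin y :: hp by move=> /TP[k [/out + ->]].
pose T' := [set w in y :: hp] :\ p.
have cT' : conn e T' by exact: hole_conn_minus hhp.
have z1T : z1 \in T' by rewrite in_setD1 in_set z1H andbT; apply: contraTneq z1p => ->; rewrite eI.
have z2T : z2 \in T' by rewrite in_setD1 in_set z2H andbT; apply: contraTneq z2p => ->; rewrite eI.
have [a aC z1a] := comp_nbr eS cT' z1T z2T nz.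
have z2T' : z2 \in T' :\ z1 by rewrite in_setD1 z2T eq_sym nz.
have CE w : w \in comp e (T' :\ z1) z2 -> [/\ w != z1, w != p & w \in y :: hp].
  by move/(subsetP (comp_sub z2T')); rewrite !in_setD1 in_set => /and3P[].
set C0 := comp e (T' :\ z1) z2 in aC CE.
have z2C : z2 \in C0 := comp_id _ _ _.
have cC : conn e (T :|: C0).
  by apply: (connU eS cT (comp_conn eS z2T') t2T z2C); rewrite tz2 orbT.
have z1C : z1 \notin T :|: C0.
  rewrite in_setU negb_or; apply/andP; split; first by apply/negP => /TH; rewrite z1H.
  by apply/negP => /CE[]; rewrite eqxx.
have z1t : e z1 (nth y hq j1) by rewrite eS.
have [||w|w _ wT /CE[_ _ wh]|s [hs sC hA hB]] :=
  @hole_two _ e trif z1 _ (mem T) (mem C0) _ a cC z1C _ _ z1t z1a t1T aC.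
- by rewrite in_setU t1T.
- by rewrite in_setU aC orbT.
- by rewrite in_setU.
- by have := TH _ wT; rewrite wh.
have [ips' s2 _ _] := hs.
have nl : last z1 s \notin T by apply/negP => /TH/negP; apply; case: (CE _ hB).
have [a1 [b1 [_ b1s a1T b1T ab]]] := path_exit (ipath_sorted ips') (leq_trans (ltnW (ltnW (ltnSn 2))) s2) hA nl.
have {}b1T : b1 \notin T := b1T.
have b1C : b1 \in C0 by move: (sC _ b1s); rewrite in_setU (negbTE b1T).
have z2s : z2 \in s.
  have [b1z _ b1h] := CE _ b1C; have [k [kk Ek]] := TP _ a1T; rewrite Ek in ab.
  case: (uni _ _ kk b1h ab) => -[E _]; first by rewrite E eqxx in b1z.
  by rewrite -E.
have ps : p \notin z1 :: s.
  rewrite inE negb_or; apply/andP; split; first by apply: contraTneq z1p => ->; rewrite eI.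
  apply/negP => /sC; rewrite in_setU => /orP[/TH|/CE[_]]; last by rewrite eqxx.
  by rewrite inE php orbT.
by move/eqP: nz; apply; apply: (hole_one sp trif hs ps); rewrite ?inE ?eqxx ?z2s ?orbT // eS.
Qed.

End Around.

(** Let [U] be the union of all holes through [y], and [D] the component of [y'] outside [U]. The
    attachments of [D] lie in [U] and separate; they form a clique unless [y] is one of them. In
    that case [y] is the only one, and its single neighbour in [D] separates. *)
Lemma separating_clique (V1 : {set G}) y y' : y \in V1 -> y' \in V1 -> y != y' -> ~~ e y y' ->
  (forall s, hole e y s -> {subset s <= V1} -> y' \notin s) ->
  exists K : {set G}, [/\ K \subset V1, y \notin K, y' \notin K,
    {in K &, forall a b, a != b -> e a b} & ~ connect (restr e (V1 :\: K)) y y'].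
Proof.
move=> yV y'V yy' nyy' nohole.
pose U := [set w | `[< w = y \/ exists s, [/\ hole e y s, {subset s <= V1} & w \in s] >]].
have yU : y \in U by rewrite inE; apply/asboolP; left.
have hU s w : hole e y s -> {subset s <= V1} -> w \in s -> w \in U.
  by move=> h1 h2 h3; rewrite inE; apply/asboolP; right; exists s.
have y'U : y' \in V1 :\: U.
  rewrite in_setD y'V andbT; apply/negP; rewrite inE => /asboolP[E|[s [h1 h2 h3]]].
    by rewrite E eqxx in yy'.
  by have := nohole s h1 h2; rewrite h3.
pose D := comp e (V1 :\: U) y'.
have DU d : d \in D -> d \in V1 /\ d \notin U.
  by move/(subsetP (comp_sub y'U)); rewrite in_setD => /andP[].
have cD : conn e D := comp_conn eS y'U.
have DV : D \subset V1 by apply/subsetP => d /DU[].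
have yD : y \notin D by apply/negP => /DU[_]; rewrite yU.
have y'D : y' \in D := comp_id _ _ _.
have noh s d : hole e y s -> {subset s <= V1} -> d \in s -> d \notin D.
  by move=> h1 h2 h3; apply/negP => /DU[_]; rewrite (hU s).
have Dcl a b : a \in D -> b \in V1 :\: U -> e a b -> b \in D by move=> h1 h2 h3; exact: comp_closed h2 h3.
clearbody D.
pose S := [set p in V1 | (p \notin D) && [exists d in D, e p d]].
have SP p : p \in S -> [/\ p \in V1, p \in U & exists2 d, d \in D & e p d].
  rewrite !inE => /and3P[pV pD /exists_inP[d dD pd]]; split=> //; last by exists d.
  apply: contraR pD => pU; apply: (Dcl d); rewrite ?in_setD ?pV ?andbT //; last by rewrite eS.
  by move: pU; rewrite inE.
have clD a b : a \in D -> b \in V1 -> e a b -> b \in D \/ b \in S.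
  move=> aD bV ab; have [bD|bD] := boolP (b \in D); [by left|right].
  by rewrite !inE bV bD; apply/exists_inP; exists a; rewrite // eS.
have [yS|yS] := boolP (y \in S); last first.
  have ndy d : d \in D -> ~~ e y d.
    move=> dD; apply: contra yS => yd; rewrite inE yV yD; by apply/exists_inP; exists d.
  exists S; split=> //.
  - by apply/subsetP => p /SP[].
  - by rewrite !inE y'D andbF.
  - have hole_of p : p \in S -> exists s, [/\ hole e y s, {subset s <= V1} & p \in s].
      move=> pS; have [_ pU _] := SP _ pS; move: pU; rewrite inE => /asboolP[E|//].
      by rewrite -E pS in yS.
    have attS p : p \in S -> att D p by case/SP.
    (* Among the nonadjacent pairs of attachments, take one joined by a shortest path through [D];
       this provides the hypothesis of [common_neighbor] on [R]. *)
    pose far n := `[< exists p q s, [/\ p \in S, q \in S, p != q /\ ~~ e p q,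
       size s = n & [/\ 0 < size s, {subset s <= D}, sorted e s, e p (head y s) & e q (last y s)]] >].
    move=> p q pS qS pq; apply: contraT => npq; exfalso.
    have exf : exists n, far n.
      have [d dD pd] := attS _ pS; have [d' d'D qd'] := attS _ qS.
      have [s [s0 sD ips [h1 h2] _]] := shortest (A := e p) (B := e q) pd qd' dD (cD _ _ dD d'D).
      exists (size s); apply/asboolP; exists p, q, s; split=> //; split=> //; first exact: ipath_sorted.
        by case: (s) s0 h1.
      by case: (s) s0 h2.
    case: (ex_minnP exf) => n /asboolP[{}p [{}q [R [{}pS {}qS [{}pq {}npq] Rn [R0 RD sR pR qR]]]]] minn.
    have [hp [hhp hpV php]] := hole_of _ pS; have [hq [hhq hqV qhq]] := hole_of _ qS.
    have ap := attS _ pS; have aq := attS _ qS.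
    have [z /andP[zH /andP[zp zq]]|none] := pickP [pred z in (y :: hp) ++ (y :: hq) | e z p && e z q]; last first.
      apply: (no_far_pair yD ndy cD DV noh hhp hhq hpV hqV php qhq ap aq pq npq) => z zH.
      by have := none z; rewrite /= zH /= => ->.
    apply: (common_neighbor yD ndy cD DV noh hhp hhq hpV hqV php qhq ap aq pq npq sR R0 RD pR qR _ zH zp zq).
    move=> c r cH cp cq ncc rR; apply/negP => cr.
    have rD := RD _ rR; have cy : c != y by apply: contraTneq cr => ->; exact: ndy.
    have cS : c \in S.
      have cV : c \in V1.
        by move: cH; rewrite mem_cat !inE (negbTE cy) /= => /orP[/hpV|/hqV].
      rewrite !inE cV /=; apply/andP; split; last by apply/exists_inP; exists r.
      by move: cH; rewrite mem_cat !inE (negbTE cy) /= => /orP[/(noh _ _ hhp hpV)|/(noh _ _ hhq hqV)].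
    have ac := attS _ cS.
    have rs : index r R < size R by rewrite index_mem.
    have cpq : e c p \/ e c q.
      move: cH; rewrite mem_cat !inE (negbTE cy) /= => /orP[ch|ch].
        by left; exact: (attached_clique yD ndy cD DV noh hhp hpV ch php ac ap cp).
      by right; exact: (attached_clique yD ndy cD DV noh hhq hqV ch qhq ac aq cq).
    case: cpq => cx; rewrite cx ?andbT /= in ncc.
      (* c sees p: the path from r to q is shorter *)
      have i0 : 0 < index r R.
        rewrite lt0n; apply/eqP => i0; apply: (@trif c p r) => //.
        by move: pR; rewrite -nth0 -{1}i0 nth_index.
      have : far (size (drop (index r R) R)).
        apply/asboolP; exists c, q, (drop (index r R) R); split=> //; split.
        - by rewrite size_drop; move: rs; clear; lia.
        - by move=> w /mem_drop/RD.
        - exact: drop_sorted.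
        - by rewrite -nth0 nth_drop addn0 nth_index.
        - have last_idx a b : a < b -> a + (b - a).-1 = b.-1 by clear; lia.
          by rewrite -nth_last nth_drop size_drop last_idx // nth_last.
      by move/minn; rewrite size_drop -Rn leqNgt ltn_subrL i0 R0.
    have il : (index r R).+1 < size R.
      rewrite ltn_neqAle rs andbT; apply/eqP => E; apply: (@trif c q r) => //.
      by move: qR; rewrite -nth_last -E /= nth_index.
    have : far (size (take (index r R).+1 R)).
      apply/asboolP; exists p, c, (take (index r R).+1 R); split=> //.
        by rewrite eq_sym cp eS ncc.
      split.
      - by rewrite size_takel.
      - by move=> w /mem_take/RD.
      - exact: take_sorted.
      - by rewrite -nth0 nth_take // nth0.
      - by rewrite -nth_last size_takel //= nth_take // nth_index.
    by move/minn; rewrite size_takel // -Rn leqNgt il.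
  - rewrite (conn_sym eS) => /(closed_connect (C := D)) h; move/negP: yD; apply; apply: h y'D => a b aD.
    by rewrite in_setD => /andP[bS bV] ab; case: (clD _ _ aD bV ab) => // bS'; rewrite bS' in bS.
have [_ _ [n nD yn]] := SP _ yS.
(* A second attachment lies on a hole through [y]; the stretch of that hole from [y] to [q] and [D]
   would contain a hole through [y] that meets [D]. *)
have onlyS q : q \in S -> q = y.
  move=> qS; apply/eqP; apply: contraT => qy; exfalso.
  have [_ + [d dD qd]] := SP _ qS; rewrite inE => /asboolP[E|[s [hs sV qs]]]; first by rewrite E eqxx in qy.
  have [ips s2 ys _] := hs.
  have dq : e d q by rewrite eS.
  have qT : q \in [set w in take (index q s).+1 s] by rewrite inE -{1}(nth_index y qs) mem_take_nth // index_mem.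
  have cC : conn e (D :|: [set w in take (index q s).+1 s]).
    apply: (connU eS cD _ dD qT); rewrite ?dq ?orbT //.
    by apply: conn_seq => //; apply: take_sorted; exact: ipath_sorted ips.
  have hT : nth y s 0 \in [set w in take (index q s).+1 s] by rewrite inE mem_take_nth //; apply: ltn_trans s2.
  have [|||w|w _ wD|s' [hs' s'C hA hB]] :=
    @hole_two _ e trif y _ (mem D) (mem [set w in take (index q s).+1 s]) n _ cC _ _ _ yn (hole_head y hs) nD hT.
  - by rewrite in_setU in_set negb_or yD; apply: contra ys => /mem_take.
  - by rewrite in_setU nD.
  - by rewrite in_setU hT orbT.
  - by rewrite in_setU.
  - by rewrite /= in_set => /mem_take/(noh _ _ hs sV); rewrite (wD : w \in D).
  have s'V : {subset s' <= V1}.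
    by move=> w /s'C; rewrite in_setU in_set => /orP[/(subsetP DV)//|/mem_take/sV].
  have hs0 : head y s' \in s' by case: (s') hs' => [[]//|x s0 _]; exact: mem_head.
  by have := noh _ _ hs' s'V hs0; rewrite (hA : head y s' \in D).
have onlyn m : m \in D -> e y m -> m = n.
  move=> mD ym; apply/eqP; apply: contraT => mn; exfalso.
  have [w _ _|w _ /eqP-> /negP[]|s' [hs' s'C _ _]] :=
    @hole_two _ e trif y D (pred1 n) (predC1 n) n m cD yD nD mD yn ym (eqxx n) mn.
  - by rewrite /=; case: eqP.
  - by [].
  have hs0 : head y s' \in s' by case: (s') hs' => [[]//|x s0 _]; exact: mem_head.
  have s'V : {subset s' <= V1} by move=> w /s'C/(subsetP DV).
  by have := noh _ _ hs' s'V hs0; rewrite (s'C _ hs0).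
exists [set n]; split.
- by rewrite sub1set (subsetP DV).
- by rewrite in_set1; apply: contraNneq yD => ->.
- by rewrite in_set1; apply: contraNneq nyy' => ->.
- by move=> a b; rewrite !in_set1 => /eqP-> /eqP->; rewrite eqxx.
- rewrite (conn_sym eS) => /(closed_connect (C := D :\ n)) h.
  suff : y \in D :\ n by rewrite in_setD1 (negbTE yD) andbF.
  apply: h => [a b|]; last by rewrite in_setD1 y'D andbT; apply: contraNneq nyy' => ->.
  rewrite !in_setD1 => /andP[an aD] /andP[bn bV] ab; rewrite bn.
  case: (clD _ _ aD bV ab) => // /onlyS E; rewrite E in ab.
  by move/eqP: an; case; apply: onlyn; rewrite // eS.
Qed.

End Separation.

(** * Induced subgraphs, pyramids and prisms *)

Lemma last_rev (T : Type) (d : T) s : last d (rev s) = head d s.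
Proof. by case: s => //= x s; rewrite rev_cons last_rcons. Qed.

Section Ipath.
Variables (V : finType) (e : rel V).
Hypothesis eS : symmetric e.

Lemma ipath_take n (s : seq V) : ipath e s -> ipath e (take n s).
Proof.
move=> [us h]; split; first exact: take_uniq.
move=> d i j ij; rewrite size_take_min leq_min => /andP[jn js].
by rewrite !nth_take // ?h //; exact: ltn_trans jn.
Qed.

Lemma ipath_drop n (s : seq V) : ipath e s -> ipath e (drop n s).
Proof.
move=> [us h]; split; first exact: drop_uniq.
move=> d i j ij; rewrite size_drop => js; rewrite !nth_drop h; try by move: ij js; clear; lia.
Qed.

Lemma ipath_rcons d (s : seq V) x : ipath e s -> 0 < size s -> x \notin s -> e (last d s) x ->
  (forall z, z \in s -> e z x -> z = last d s) -> ipath e (rcons s x).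
Proof.
move=> [us h] s0 xs lx only; split; first by rewrite rcons_uniq xs.
move=> d' i j ij; rewrite size_rcons ltnS leq_eqVlt => /orP[/eqP E|js]; last first.
  by rewrite !nth_rcons js (ltn_trans ij js) h.
have il : i < size s by rewrite -E.
rewrite !nth_rcons il E ltnn eqxx; have E2 : (size s).-1 < size s by rewrite prednK.
apply/idP/eqP => [/(only _ (mem_nthV _ il))|Ej].
  rewrite -nth_last (set_nth_default d d' il) => /eqP; rewrite nth_uniq // => /eqP ->.
  by rewrite prednK.
by rewrite (set_nth_default d) // -[i]/(i.+1.-1) -Ej nth_last.
Qed.

End Ipath.

Section InducedSubgraphs.

Lemma induced_subgraphP (H G : sgraph) : induced_subgraph H G <->
  exists f : H -> G, injective f /\ forall x y, sedge (f x) (f y) = sedge x y.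
Proof.
split=> [[S [f [bf fE]]]|[f [fI fE]]].
  by exists (fun x => val (f x)); split=> [x y /val_inj/(bij_inj bf)|x y]; last exact: fE.
pose S := [set f x | x in [set: H]].
have fS x : f x \in S by rewrite imset_f.
exists S, (fun x => exist _ (f x) (fS x) : induced S); split=> [|x y]; last exact: fE.
apply: inj_card_bij => [x y [/fI]//|]; rewrite card_sig.
by rewrite -cardsT -(card_imset _ fI) leqnn.
Qed.

Lemma induced_subgraph_trans (H G F : sgraph) :
  induced_subgraph H G -> induced_subgraph G F -> induced_subgraph H F.
Proof.
move=> /induced_subgraphP[f [fI fE]] /induced_subgraphP[g [gI gE]]; apply/induced_subgraphP.
by exists (g \o f); split=> [|x y /=]; [exact: inj_comp|rewrite gE fE].
Qed.

Lemma induced_induced (G : sgraph) (S : {set G}) : induced_subgraph (induced S) G.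
Proof. by apply/induced_subgraphP; exists val; split; [exact: val_inj|]. Qed.

Lemma is_hole_map (H G : sgraph) (f : H -> G) s : injective f ->
  (forall x y, sedge (f x) (f y) = sedge x y) -> is_hole s -> is_hole (map f s).
Proof.
move=> fI fE [s4 us h]; split; rewrite ?size_map ?map_inj_uniq //.
move=> _ _ /mapP[x xs ->] /mapP[y ys ->]; rewrite fE h //.
by rewrite !next_map // !(inj_eq fI).
Qed.

Lemma sparse_hereditary (H G : sgraph) : induced_subgraph H G -> sparse G -> sparse H.
Proof.
move=> /induced_subgraphP[f [fI fE]] sp s v hs vs.
have [|a' [b' [/mapP[a as' ->] /mapP[b bs ->] ab /subsetP sub]]] := sp _ (f v) (is_hole_map fI fE hs).
  by rewrite mem_map.
exists a, b; split=> //; first by rewrite -fE.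
apply/subsetP => x; rewrite !inE => /andP[vx xs].
have := sub (f x); rewrite !inE fE vx (mem_map fI) xs !(inj_eq fI); exact.
Qed.

Lemma class_hereditary t (H G : sgraph) : induced_subgraph H G -> class_F t G -> class_F t H.
Proof.
move=> HG [[sp pp] nc]; split; first split.
- exact: sparse_hereditary HG sp.
- by move=> F FH; apply: pp; exact: induced_subgraph_trans FH HG.
- move: HG => /induced_subgraphP[f [fI fE]] [K [cK Kt]]; apply: nc; exists [set f x | x in K].
  split; last by rewrite card_imset.
  move=> _ _ /imsetP[x xK ->] /imsetP[y yK ->] ne; rewrite fE; apply: cK => //.
  by apply: contraNneq ne => ->.
Qed.
End InducedSubgraphs.

Lemma tdl_induced (G : sgraph) (S : {set G}) k : tdl (@sedge (induced S)) k setT -> tdl (@sedge G) k S.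
Proof.
move=> [n [b [q [rk [r [[h1 h2 h3 h4 [h5 h6]] _]]]]]].
exists n, (fun i => [set val x | x in b i]), q, rk, r; split; last exact: sub0set.
split=> //.
- move=> i il; split; last by rewrite card_imset; [case: (h2 i il)|exact: val_inj].
  by apply/subsetP => _ /imsetP[x _ ->]; exact: (svalP x).
- move=> i l v il ll lt /imsetP[x xi Ex] /imsetP[x' x'l Ex'].
  have E : x = x' by apply: val_inj; rewrite /= -Ex -Ex'.
  by rewrite Ex; apply/imsetP; exists x => //; apply: (h4 i l x) => //; rewrite E.
- split=> [v vS|u v uS vS uv].
    have [i il xi] := h5 (exist _ v vS) (in_setT _); exists i => //.
    by apply/imsetP; exists (exist _ v vS).
  have [i il /andP[ui vi]] := h6 (exist _ u uS) (exist _ v vS) (in_setT _) (in_setT _) uv.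
  by exists i => //; apply/andP; split; apply/imsetP; [exists (exist _ u uS)|exists (exist _ v vS)].
Qed.

Section Configurations.
Variable G : sgraph.
Hypothesis vs : very_sparse G.
Notation e := (@sedge G).

(** A criterion inside [G] itself, with conditions on ordered pairs of paths only; the induced
    subgraph on the union of the paths is the pyramid. *)
Lemma pyramid_free (a : G) (s : 'I_3 -> seq G) :
  (forall i, ipath e (a :: s i) /\ 0 < size (s i)) ->
  (forall i j : 'I_3, i < j -> e (last a (s i)) (last a (s j)) /\
     forall x y, x \in s i -> y \in s j -> x != y /\ (e x y -> x = last a (s i) /\ y = last a (s j))) ->
  (forall i j, size (s i) = 1 -> size (s j) = 1 -> i = j) -> False.
Proof.
move=> ips sep one; pose S := [set x | [exists i, x \in a :: s i]].
have inS i x : x \in a :: s i -> x \in S by move=> h; rewrite inE; apply/existsP; exists i.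
have aS : a \in S by apply: (inS ord0); exact: mem_head.
have sS i : {subset s i <= S} by move=> x xs; apply: (inS i); rewrite inE xs orbT.
case: vs => _ /(_ _ (induced_induced S))[+ _]; apply.
pose a' : induced S := exist _ a aS; pose p i := lift_seq S (s i).
have mp i : map val (p i) = s i by exact/map_lift/sS.
have lE i : val (last a' (p i)) = last a (s i) by rewrite -mp -(last_map val).
have sz i : size (p i) = size (s i) by rewrite -mp size_map.
have sep' (i j : 'I_3) x y : i != j -> x \in s i -> y \in s j ->
    x != y /\ (e x y -> x = last a (s i) /\ y = last a (s j)).
  move=> ij xi yj; case: (ltngtP i j) => lt; last by rewrite (val_inj lt) eqxx in ij.
    by have [_] := sep _ _ lt; exact.
  have [_ h] := sep _ _ lt; have [h1 h2] := h _ _ yj xi; rewrite eq_sym; split=> // xy.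
  by rewrite sedge_sym in xy; case: (h2 xy).
exists a', (fun i => last a' (p i)), p; split.
- move=> i j ij; change (e (val (last a' (p i))) (val (last a' (p j)))); rewrite !lE.
  case: (ltngtP i j) => lt; last by rewrite (val_inj lt) eqxx in ij.
    by have [] := sep _ _ lt.
  by have [] := sep _ _ lt; rewrite sedge_sym.
- move=> i; have [ip i0] := ips i; split=> //; last by rewrite sz.
  have -> : a' :: p i = lift_seq S (a :: s i).
    by apply: (inj_map val_inj); rewrite map_lift => [|x /inS//]; rewrite /= mp.
  by apply: is_path_lift => // x /inS.
- move=> i j ij; split.
    apply/pred0P => x /=; rewrite !mem_lift; apply/negP => /andP[xi xj].
    by have [/eqP] := sep' _ _ _ _ ij xi xj.
  move=> x y; rewrite !mem_lift => xi yj xy; have [_ h] := sep' _ _ _ _ ij xi yj.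
  by have [E1 E2] := h xy; split; apply: val_inj; rewrite lE.
- by move=> i j; rewrite !sz; exact: one.
- move=> x; have := svalP x; rewrite inE => /existsP[i h]; exists i.
  by rewrite inE mem_lift; move: h; rewrite inE.
Qed.

Lemma prism_free (a : 'I_3 -> G) (s : 'I_3 -> seq G) :
  (forall i, ipath e (a i :: s i) /\ 0 < size (s i)) ->
  (forall i j : 'I_3, i < j -> [/\ e (a i) (a j), e (last (a i) (s i)) (last (a j) (s j)) &
     forall x y, x \in a i :: s i -> y \in a j :: s j -> x != y /\
       (e x y -> (x = a i /\ y = a j) \/ (x = last (a i) (s i) /\ y = last (a j) (s j)))]) -> False.
Proof.
move=> ips sep; pose S := [set x | [exists i, x \in a i :: s i]].
have inS i x : x \in a i :: s i -> x \in S by move=> h; rewrite inE; apply/existsP; exists i.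
have aS i : a i \in S by apply: (inS i); exact: mem_head.
have sS i : {subset s i <= S} by move=> x xs; apply: (inS i); rewrite inE xs orbT.
case: vs => _ /(_ _ (induced_induced S))[_]; apply.
pose a' i : induced S := exist _ (a i) (aS i); pose p i := lift_seq S (s i).
have mp i : map val (p i) = s i by exact/map_lift/sS.
have lE i : val (last (a' i) (p i)) = last (a i) (s i) by rewrite -mp -(last_map val).
have sz i : size (p i) = size (s i) by rewrite -mp size_map.
have sep' (i j : 'I_3) x y : i != j -> x \in a i :: s i -> y \in a j :: s j ->
    x != y /\ (e x y -> (x = a i /\ y = a j) \/ (x = last (a i) (s i) /\ y = last (a j) (s j))).
  move=> ij xi yj; case: (ltngtP i j) => lt; last by rewrite (val_inj lt) eqxx in ij.
    by have [_ _] := sep _ _ lt; exact.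
  have [_ _ h] := sep _ _ lt; have [h1 h2] := h _ _ yj xi; rewrite eq_sym; split=> // xy.
  by rewrite sedge_sym in xy; case: (h2 xy) => -[-> ->]; [left|right].
have mem_p i (x : induced S) : (x \in a' i :: p i) = (val x \in a i :: s i).
  by rewrite !inE mem_lift.
exists a', (fun i => last (a' i) (p i)), p; split.
- split=> [i j ij|i j ij|i j].
  + change (e (a i) (a j)); case: (ltngtP i j) => lt; last by rewrite (val_inj lt) eqxx in ij.
      by have [] := sep _ _ lt.
    by have [] := sep _ _ lt; rewrite sedge_sym.
  + change (e (val (last (a' i) (p i))) (val (last (a' j) (p j)))); rewrite !lE.
    case: (ltngtP i j) => lt; last by rewrite (val_inj lt) eqxx in ij.
      by have [_ h _] := sep _ _ lt; exact: h.
    by have [_ h _] := sep _ _ lt; rewrite sedge_sym; exact: h.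
  + apply/eqP => /(congr1 val) /= E; rewrite lE in E; have [ij|ij] := eqVneq i j.
      subst j; have [[/= /andP[/negP h _] _] s0] := ips i; apply: h; rewrite E.
      by case: (s i) s0 => //= x s' _; exact: mem_last.
    by have [/eqP] := sep' _ _ _ _ ij (mem_head _ _) (mem_last (a j) (s j)).
- move=> i; have [ip i0] := ips i; split=> //; last by rewrite sz.
  have -> : a' i :: p i = lift_seq S (a i :: s i).
    by apply: (inj_map val_inj); rewrite map_lift => [|x /inS//]; rewrite /= mp.
  by apply: is_path_lift => // x /inS.
- move=> i j ij; split.
    apply/pred0P => x; apply/negP => /andP[xi xj].
    have {}xi : x \in a' i :: p i := xi; have {}xj : x \in a' j :: p j := xj.
    by rewrite !mem_p in xi xj; have [/eqP] := sep' _ _ _ _ ij xi xj.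
  move=> x y; rewrite !mem_p => xi yj xy; have [_ h] := sep' _ _ _ _ ij xi yj.
  case: (h xy) => -[E1 E2]; [left|right]; split; apply: val_inj; rewrite ?lE //.
- move=> x; have := svalP x; rewrite inE => /existsP[i h]; exists i; by rewrite mem_p.
Qed.
End Configurations.

(** * Triangles in minimal graphs *)

Section Minimal.
Variables (G : sgraph) (k t : nat).
Notation e := (@sedge G).
Hypothesis clG : class_F t G.
Hypothesis tk : t <= k.
Hypothesis ntd : ~ tdl e k setT.
Hypothesis small : forall S : {set G}, S != setT -> tdl e k S.

Let eS : symmetric e := @sedge_sym G.
Let eI : irreflexive e := @sedge_irr G.

Lemma glue (W1 W2 : {set G}) : W1 :|: W2 = setT -> W1 != setT -> W2 != setT ->
  {in W1 :&: W2 &, forall x y, x != y -> e x y} ->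
  (forall u v, u \in W1 -> v \in W2 -> e u v -> (u \in W2) || (v \in W1)) -> False.
Proof.
move=> W12 n1 n2 cK sep; apply: ntd; rewrite -W12.
have r1 := rtd_clique (small n1) (subsetIl _ _) cK.
have r2 := rtd_clique (small n2) (subsetIr _ _) cK.
exact: rtd_sub (sub0set _) (rtd_glue r1 r2 (subxx _) (subxx _) eS sep).
Qed.

Lemma clique_small (K : {set G}) : clique K -> #|K| <= t.
Proof.
move=> cK; rewrite leqNgt; apply/negP => lt; case: clG => _; apply.
have [s [us ss sK]] : exists s : seq G, [/\ uniq s, size s = t.+1 & {subset s <= K}].
  exists (take t.+1 (enum K)); split; first exact/take_uniq/enum_uniq.
    by rewrite size_takel // -cardE.
  by move=> x /mem_take; rewrite mem_enum.
exists [set x in s]; split; last by rewrite cardsE (card_uniqP us).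
by move=> x y; rewrite !inE => /sK xK /sK yK; exact: cK.
Qed.

(** Here [t <= k] enters: a graph that is itself a clique would fit into one bag. *)
Lemma clique_out (K : {set G}) : clique K -> exists z, z \notin K.
Proof.
move=> /clique_small Kt; apply/existsP; rewrite -negb_forall; apply/negP => /forallP h; apply: ntd.
apply: rtd_leaf => //; apply: leq_trans (leq_trans Kt tk); apply: subset_leq_card.
by apply/subsetP => x _; exact: h.
Qed.

Lemma no_clique_cutset (K : {set G}) : clique K -> conn e (~: K).
Proof.
move=> cK x y xK yK; apply: contraT => nxy; exfalso; pose C := comp e (~: K) x.
have CK z : z \in C -> z \notin K by move/(subsetP (comp_sub xK)); rewrite inE.
have xC : x \in C := comp_id _ _ _.
have yC : y \notin C by rewrite inE.
have clC a b : a \in C -> b \notin K -> e a b -> b \in C.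
  by move=> aC bK ab; apply: (comp_closed xK aC _ ab); rewrite inE.
clearbody C; rewrite !inE in xK yK.
have E : (C :|: K) :&: ~: C = K.
  by apply/setP => z; rewrite !inE; have [/CK/negbTE->|] := boolP (z \in C); rewrite ?andbT.
apply: (@glue (C :|: K) (~: C)).
- by apply/setP => z; rewrite !inE; case: (z \in C); rewrite ?orbT.
- by apply/eqP => /setP/(_ y); rewrite !inE (negbTE yC) (negbTE yK).
- by apply/eqP => /setP/(_ x); rewrite !inE xC.
- by rewrite E.
- move=> u v; rewrite !inE; have [uC|//] := boolP (u \in C) => _ vC uv /=.
  by rewrite (negbTE vC) /=; apply: contraR vC => vK; exact: clC uC vK uv.
Qed.

(** If all neighbours of [w] were in [K], then [K] and the graph without [w] could be glued along
    [K :\ w]. *)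
Lemma clique_attached (K : {set G}) w : clique K -> w \in K -> exists2 z, z \notin K & e w z.
Proof.
move=> cK wK; apply: contrapT => H; have [z zK] := clique_out cK.
have E : K :&: [set~ w] = K :\ w by apply/setP => x; rewrite !inE andbC.
apply: (@glue K [set~ w]).
- by apply/setP => x; rewrite !inE; case: eqVneq => [->|]; rewrite ?wK ?orbT.
- by apply/eqP => /setP/(_ z); rewrite inE (negbTE zK).
- by apply/eqP => /setP/(_ w); rewrite !inE eqxx.
- by rewrite E => x y; rewrite !inE => /andP[_ xK] /andP[_ yK]; exact: cK.
- move=> u v uK; rewrite !inE => vw uv; have [E'|//] := eqVneq u w.
  by apply: contraT => vK; case: H; exists v => //; rewrite -E'.
Qed.

Lemma sparseG : sparse G. Proof. by case: clG => -[]. Qed.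

Lemma hole_ends (P : seq G) (k1 k2 d1 d2 : G) : ipath e P -> 1 < size P ->
  head k1 P = d1 -> last k1 P = d2 -> e k1 k2 -> k1 \notin P -> k2 \notin P ->
  e k1 d1 -> (forall w, w \in P -> e k1 w -> w = d1) ->
  e k2 d2 -> (forall w, w \in P -> e k2 w -> w = d2) -> hole e k1 (rcons P k2).
Proof.
move=> ipP P2 hP lP k12 k1P k2P kd1 u1 kd2 u2; have P0 : 0 < size P := ltnW P2.
have n0 : nth k1 P 0 = d1 by rewrite nth0.
have [uP _] := ipP; split.
- by apply: (ipath_rcons (d := k1)) => // [|z zP]; rewrite lP eS // => /(u2 _ zP).
- by rewrite size_rcons.
- by rewrite mem_rcons inE negb_or k1P andbT; apply: contraTneq k12 => ->; rewrite eI.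
- move=> i; rewrite size_rcons ltnS leq_eqVlt nth_rcons => /orP[/eqP->|iP].
    by rewrite ltnn !eqxx k12 orbT.
  rewrite iP eqSS (ltn_eqF iP) orbF; apply/idP/eqP => [/(u1 _ (mem_nthV _ iP))|->]; last by rewrite n0.
  by rewrite -n0 => /eqP; rewrite nth_uniq // => /eqP.
Qed.

(* P closes to a hole with k1 and k2, so the last vertex of R sees one vertex of P or two consecutive
   ones: the first case gives a pyramid, the second one a prism. *)
Lemma three_attachments (P R : seq G) (k1 k2 k3 d1 d2 : G) :
  ipath e P -> 1 < size P -> head k1 P = d1 -> last k1 P = d2 ->
  ipath e R -> 0 < size R -> e k1 k2 -> e k1 k3 -> e k2 k3 ->
  {subset [:: k1; k2; k3] <= [predC P]} -> {subset [:: k1; k2; k3] <= [predC R]} ->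
  (forall w, w \in P -> w \notin R) ->
  e k1 d1 -> (forall w, w \in P ++ R -> e k1 w -> w = d1) ->
  e k2 d2 -> (forall w, w \in P ++ R -> e k2 w -> w = d2) ->
  e k3 (head k1 R) -> (forall w, w \in P ++ R -> e k3 w -> w = head k1 R) ->
  (exists2 w, w \in P & e (last k1 R) w) ->
  (forall w v, w \in P -> v \in R -> e v w -> v = last k1 R) -> False.
Proof.
move=> ipP P2 hP lP ipR R0 k12 k13 k23 kP kR PR kd1 u1 kd2 u2 kd3 u3 [w0 w0P rw0] uR.
have [uP hP'] := ipP; have [uuR hR] := ipR.
have P0 : 0 < size P by exact: ltnW.
have nk x : x \in [:: k1; k2; k3] -> (x \notin P) * (x \notin R).
  by move=> h; have := kP _ h; have := kR _ h; rewrite !inE.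
have [k1P k1R] := nk k1 (mem_head _ _).
have [k2P k2R] : (k2 \notin P) * (k2 \notin R) by apply: nk; rewrite !inE eqxx orbT.
have [k3P k3R] : (k3 \notin P) * (k3 \notin R) by apply: nk; rewrite !inE eqxx !orbT.
have n0 : nth k1 P 0 = d1 by rewrite nth0.
have nl : nth k1 P (size P).-1 = d2 by rewrite nth_last.
have l0 : (size P).-1 < size P by rewrite prednK.
have d1P : d1 \in P by rewrite -n0 mem_nthV.
have d2P : d2 \in P by rewrite -nl mem_nthV.
have inPR w : w \in P -> w \in P ++ R by rewrite mem_cat => ->.
have inRP w : w \in R -> w \in P ++ R by rewrite mem_cat orbC => ->.
have hRR : head k1 R \in R by rewrite -nth0 mem_nthV.
have lRR : last k1 R \in R by rewrite -nth_last mem_nthV // prednK.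
have nR1 w : w \in R -> ~~ e k1 w.
  by move=> wR; apply/negP => /(u1 _ (inRP _ wR)) E; have := PR _ d1P; rewrite -E wR.
have nR2 w : w \in R -> ~~ e k2 w.
  by move=> wR; apply/negP => /(u2 _ (inRP _ wR)) E; have := PR _ d2P; rewrite -E wR.
have nP3 w : w \in P -> ~~ e k3 w.
  by move=> wP; apply/negP => /(u3 _ (inPR _ wP)) E; have := PR _ wP; rewrite E hRR.
set r := last k1 R in rw0 uR lRR.
have hh : hole e k1 (rcons P k2).
  by apply: (hole_ends ipP P2 hP lP) => // w wP; [apply: u1|apply: u2]; exact: inPR.
have rH : r \notin k1 :: rcons P k2.
  rewrite inE mem_rcons inE !negb_or; apply/and3P; split.
  - by apply: contraNneq k1R => <-.
  - by apply: contraNneq k2R => <-.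
  - by apply/negP => /PR; rewrite lRR.
have [a0 [b0 [a0s b0s ab0 /subsetP sub]]] := sparseG (hole_is_hole hh) rH.
have ends c : c \in P -> e r c -> c = a0 \/ c = b0.
  move=> cs vc; have cH : c \in k1 :: rcons P k2 by rewrite inE mem_rcons inE cs !orbT.
  have := sub c; rewrite in_setI !in_set vc cH => /(_ isT).
  by case/orP => /set1P; [left|right].
have iw0 : index w0 P < size P by rewrite index_mem.
have exj : exists j, (j < size P) && e r (nth k1 P j) by exists (index w0 P); rewrite iw0 nth_index.
case: (ex_minnP exj) => j /andP[jP rj] minj.
have rR : ipath e (rcons (rev R) k3).
  apply: (ipath_rcons (d := k1)); rewrite ?size_rev ?mem_rev //; first exact: ipath_rev.
    by rewrite last_rev eS.
  by move=> z; rewrite mem_rev last_rev eS => zR; exact: u3 (inRP _ zR).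
have s1 : ipath e (rcons (rev (take j.+1 P)) k1).
  have hd : head k1 (take j.+1 P) = d1 by rewrite -nth0 nth_take // nth0.
  apply: (ipath_rcons (d := k1)).
  - exact/ipath_rev/ipath_take.
  - by rewrite size_rev size_takel.
  - by rewrite mem_rev; apply: contra k1P => /mem_take.
  - by rewrite last_rev hd eS.
  - by move=> z; rewrite mem_rev last_rev hd eS => /mem_take zP; exact: u1 (inPR _ zP).
have drop_path i : i < size P -> ipath e (rcons (drop i P) k2).
  move=> iP; have ld : last k1 (drop i P) = d2.
    by move: lP; rewrite -{1}(cat_take_drop i P) last_cat (drop_nth k1 iP).
  apply: (ipath_rcons (d := k1)).
  - exact: ipath_drop.
  - by rewrite size_drop subn_gt0.
  - by apply: contra k2P => /mem_drop.
  - by rewrite ld eS.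
  - by move=> z; rewrite ld eS => /mem_drop zP; exact: u2 (inPR _ zP).
have revtake : rev (take j.+1 P) = nth k1 P j :: rev (take j P) by rewrite (take_nth k1 jP) rev_rcons.
have revR : rev R = r :: behead (rev R).
  by rewrite /r -[X in last _ X]revK last_rev; case: (rev R) (size_rev R) R0 => //= <-.
have sepk (Q : G -> G -> Prop) a b A B : a \notin B -> b \notin A -> a != b -> (forall w, w \in B -> ~~ e a w) ->
    (forall w, w \in A -> ~~ e b w) -> (forall x y, x \in A -> y \in B -> x != y /\ (e x y -> Q x y)) ->
    forall x y, x \in rcons A a -> y \in rcons B b -> x != y /\ (e x y -> Q x y \/ (x = a /\ y = b)).
  move=> aB bA ab h1 h2 h x y; rewrite !mem_rcons !inE => /orP[/eqP->|xA] /orP[/eqP->|yB].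
  - by split=> // _; right.
  - by split; [apply: contraNneq aB => ->|rewrite (negbTE (h1 _ yB))].
  - by split; [apply: contraNneq bA => <-|rewrite eS (negbTE (h2 _ xA))].
  - by have [h3 h4] := h _ _ xA yB; split=> // /h4; left.
have pathR x : x \in P -> e r x -> ipath e (x :: rcons (rev R) k3).
  move=> xP rx; have -> : x :: rcons (rev R) k3 = rev (rcons (k3 :: R) x) by rewrite rev_rcons rev_cons.
  apply: ipath_rev => //.
  apply: (ipath_rcons (d := k1)) => //.
  - by have := ipath_rev eS rR; rewrite rev_rcons revK.
  - rewrite inE negb_or (PR _ xP) andbT; by apply: contraNneq k3P => <-.
  - by rewrite /=; move: rx; rewrite /r; case: (R) R0.
  - move=> z; rewrite inE => /orP[/eqP->|zR zx]; first by rewrite (negbTE (nP3 _ xP)).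
    by rewrite (uR _ _ xP zR zx) /r; case: (R) R0.
have ne a b : e a b -> a != b by apply: contraTneq => ->; rewrite eI.
(* By sparsity the neighbours of [r] on [P] lie on one edge of the hole. A single one is the apex of
   a pyramid with base [k1], [k2], [k3]; two of them form with [r] the other triangle of a prism. *)
have [two|one] := boolP ((j.+1 < size P) && e r (nth k1 P j.+1)); last first.
- have uj c : c \in P -> e r c -> c = nth k1 P j.
    move=> cP rc; have jmem : nth k1 P j \in P by exact: mem_nthV.
    apply/eqP; apply: contraT => cj; exfalso.
    have ecj : e (nth k1 P j) c.
      by case: (ends _ cP rc) (ends _ jmem rj) cj => -> [] -> //; rewrite ?eqxx // eS.
    have ic : index c P < size P by rewrite index_mem.
    have cE := nth_index k1 cP.
    have jc : j < index c P.
      rewrite ltn_neqAle minj ?ic ?cE // andbT.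
      by apply: contraNneq cj => ->; rewrite cE.
    have := hP' k1 _ _ jc ic; rewrite cE ecj => /esym/eqP E.
    by move: one; rewrite -E ic cE rc.
  have sepP x y : x \in rev (take j P) -> y \in drop j.+1 P -> x != y /\ (e x y -> False).
    rewrite mem_rev; case: (j) => [|j']; first by rewrite take0.
    move=> xt yd; have [h1 /(_ (ltnSn _)) h2] := ipath_split ipP (leqnSn _) xt yd.
    by split=> //; exact/negP.
  have sepR x y : x \in P -> x != nth k1 P j -> y \in R -> x != y /\ (e x y -> False).
    move=> xP xj yR; split; first by apply: contraNneq (PR _ xP) => ->.
    rewrite eS => yx; have E := uR _ _ xP yR yx; rewrite E in yx.
    by rewrite (uj _ xP yx) eqxx in xj.
  have tj x : x \in rev (take j P) -> x \in P /\ x != nth k1 P j.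
    rewrite mem_rev => xt; have h1 := mem_take xt; split=> //; apply/eqP => E.
    by move: xt; rewrite in_take // E index_uniq // ltnn.
  have dj x : x \in drop j.+1 P -> x \in P /\ x != nth k1 P j.
    move=> xt; split; first exact: mem_drop xt.
    apply/eqP => E; have := uP; rewrite -(cat_take_drop j P) (drop_nth k1 jP) cat_uniq.
    by case/and3P=> _ _ /= /andP[]; rewrite -E xt.
  have d1d x : x \in drop j.+1 P -> ~~ e k1 x.
    move=> xd; apply/negP => /(u1 _ (inPR _ (mem_drop xd))) E.
    have dt : d1 \in take j.+1 P by rewrite -n0 mem_take_nth.
    by have [/eqP] := ipath_split ipP (ltnSn j) dt xd; rewrite E.
  have d2t x : x \in rev (take j P) -> ~~ e k2 x.
    rewrite mem_rev => xt; apply/negP => /(u2 _ (inPR _ (mem_take xt))) E.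
    have dd : d2 \in drop j P by rewrite -nl mem_drop_nth // -ltnS prednK.
    have := uP; rewrite -(cat_take_drop j P) cat_uniq => /and3P[_ /hasPn/(_ _ dd)].
    by rewrite /= -E xt.
  have memR w : w \in rev R -> w \in R by rewrite mem_rev.
  pose s (i : 'I_3) := nth [::] [:: rcons (rev (take j P)) k1; rcons (drop j.+1 P) k2; rcons (rev R) k3] i.
  have clean x y a b : x != y /\ (e x y -> False \/ (x = a /\ y = b)) ->
      x != y /\ (e x y -> x = a /\ y = b).
    by move=> [h1 h2]; split=> // /h2[].
  apply: (@pyramid_free G _ (nth k1 P j) s); first by case: clG.
  + move=> [[|[|[|i]]] // il]; rewrite /s /=; split; rewrite ?size_rcons //.
    * by rewrite -rcons_cons -revtake.
    * by rewrite -rcons_cons -(drop_nth k1 jP); exact: drop_path.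
    * by apply: pathR => //; exact: mem_nthV.
  + move=> [[|[|[|i]]] // il] [[|[|[|i']]] // il'] //= _; rewrite /s /= !last_rcons; split=> // x y xA yB; apply: clean => //; move: x y xA yB.
    apply: (sepk (fun _ _ => False)) => //.
    * by apply: contra k1P => /mem_drop.
    * by rewrite mem_rev; apply: contra k2P => /mem_take.
    * exact: ne.
    apply: (sepk (fun _ _ => False)) => //.
    * by rewrite mem_rev.
    * by rewrite mem_rev; apply: contra k3P => /mem_take.
    * exact: ne.
    * by move=> w /memR/nR1.
    * by move=> w /tj[/nP3].
    * by move=> x y /tj[xP xj] /memR yR; exact: sepR.
    apply: (sepk (fun _ _ => False)) => //.
    * by rewrite mem_rev.
    * by apply: contra k3P => /mem_drop.
    * exact: ne.
    * by move=> w /memR/nR2.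
    * by move=> w /dj[/nP3].
    * by move=> x y /dj[xP xj] /memR yR; exact: sepR.
  (* The paths to [k1] and [k2] cannot both have length one, as [P] has at least two vertices; the
     path to [k3] is longer since it passes through [R]. *)
  + have sz0 : size (rcons (rev (take j P)) k1) = 1 -> size (rcons (drop j.+1 P) k2) = 1 -> False.
      rewrite !size_rcons size_rev (size_takel (ltnW jP)) size_drop; move: jP P2; clear; lia.
    have szR : size (rcons (rev R) k3) = 1 -> False.
      by rewrite size_rcons size_rev; move: R0; clear; lia.
    move=> [[|[|[|i]]] // il] [[|[|[|i']]] // il']; rewrite /s /=; move=> h1 h2;
      by first [exact: val_inj | case: (sz0 h1 h2) | case: (sz0 h2 h1) | case: (szR h1) | case: (szR h2)].
case/andP: two => j1P rj1.
have jm : nth k1 P j \in P by exact: mem_nthV.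
have jm1 : nth k1 P j.+1 \in P by exact: mem_nthV.
have only2 c : c \in P -> e r c -> c = nth k1 P j \/ c = nth k1 P j.+1.
  have nn : nth k1 P j != nth k1 P j.+1 by rewrite nth_uniq // ltn_eqF.
  move=> cP rc; case: (ends _ cP rc) (ends _ jm rj) (ends _ jm1 rj1) nn => -> [] -> [] ->; rewrite ?eqxx //; by [left|right].
have ptj : nth k1 P j \in take j.+1 P by rewrite mem_take_nth.
have pdj : nth k1 P j.+1 \in drop j.+1 P by rewrite mem_drop_nth.
have tP x : x \in rev (take j.+1 P) -> x \in P by rewrite mem_rev => /mem_take.
have dP x : x \in drop j.+1 P -> x \in P by move/mem_drop.
have memR w : w \in rev R -> w \in R by rewrite mem_rev.
have dropE : drop j.+1 P = nth k1 P j.+1 :: drop j.+2 P by rewrite (drop_nth k1 j1P).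
have sep01 x y : x \in rev (take j.+1 P) -> y \in drop j.+1 P -> x != y /\
    (e x y -> x = nth k1 P j /\ y = nth k1 P j.+1).
  rewrite mem_rev => xt yd; have [h1 _] := ipath_split ipP (ltnSn j) xt yd; split=> // xy.
  have xP := mem_take xt; have yP := mem_drop yd.
  have Ix : index x P <= j by rewrite -ltnS -(in_take _ xP).
  have Iy : j < index y P.
    rewrite ltnNge; apply/negP => le; have : y \in take j.+1 P by rewrite in_take // ltnS.
    by move=> yt; have [/eqP] := ipath_split ipP (ltnSn j) yt yd.
  have iy : index y P < size P by rewrite index_mem.
  have := hP' k1 _ _ (leq_ltn_trans Ix Iy) iy; rewrite !nth_index // xy => /esym/eqP E.
  have E1 : index x P = j by move: Ix Iy E; clear; lia.
  by split; rewrite -E1 ?nth_index // -E nth_index.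
have sepR x y : x \in P -> y \in R -> x != y /\ (e x y -> (x = nth k1 P j \/ x = nth k1 P j.+1) /\ y = r).
  move=> xP yR; split; first by apply: contraNneq (PR _ xP) => ->.
  rewrite eS => yx; have E := uR _ _ xP yR yx; split=> //; apply: only2 => //; by rewrite -E.
have sep02 x y : x \in rev (take j.+1 P) -> y \in rev R -> x != y /\ (e x y -> x = nth k1 P j /\ y = r).
  move=> xt /memR yR; have [h1 h2] := sepR _ _ (tP _ xt) yR; split=> // /h2[[E|E] ->]; first by [].
  by rewrite mem_rev in xt; have [/eqP] := ipath_split ipP (ltnSn j) xt pdj; rewrite E.
have sep12 x y : x \in drop j.+1 P -> y \in rev R -> x != y /\ (e x y -> x = nth k1 P j.+1 /\ y = r).
  move=> xd /memR yR; have [h1 h2] := sepR _ _ (dP _ xd) yR; split=> // /h2[[E|E] ->]; last by [].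
  by have [/eqP] := ipath_split ipP (ltnSn j) ptj xd; rewrite E.
have d1d x : x \in drop j.+1 P -> ~~ e k1 x.
  move=> xd; apply/negP => /(u1 _ (inPR _ (mem_drop xd))) E.
  have dt : d1 \in take j.+1 P by rewrite -n0 mem_take_nth.
  by have [/eqP] := ipath_split ipP (ltnSn j) dt xd; rewrite E.
have d2t x : x \in rev (take j.+1 P) -> ~~ e k2 x.
  rewrite mem_rev => xt; apply/negP => /(u2 _ (inPR _ (mem_take xt))) E.
  have dd : d2 \in drop j.+1 P by rewrite -nl mem_drop_nth // -ltnS prednK.
  by have [/eqP] := ipath_split ipP (ltnSn j) xt dd; rewrite E.
pose a (i : 'I_3) := nth k1 [:: nth k1 P j; nth k1 P j.+1; r] i.
pose s (i : 'I_3) := nth [::] [:: rcons (rev (take j P)) k1; rcons (drop j.+2 P) k2; rcons (behead (rev R)) k3] i.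
have as0 (H : 0 < 3) : a (Ordinal H) :: s (Ordinal H) = rcons (rev (take j.+1 P)) k1.
  by rewrite /a /s /= -rcons_cons revtake.
have as1 (H : 1 < 3) : a (Ordinal H) :: s (Ordinal H) = rcons (drop j.+1 P) k2.
  by rewrite /a /s /= -rcons_cons dropE.
have as2 (H : 2 < 3) : a (Ordinal H) :: s (Ordinal H) = rcons (rev R) k3.
  by rewrite /a /s /= -rcons_cons -revR.
have ejj : e (nth k1 P j) (nth k1 P j.+1) by rewrite hP'.
apply: (@prism_free G _ a s); first by case: clG.
- move=> [[|[|[|i]]] // il]; rewrite ?as0 ?as1 ?as2; split; rewrite /s /= ?size_rcons //.
  exact: drop_path.
- move=> [[|[|[|i]]] // il] [[|[|[|i']]] // il'] //= _; rewrite ?as0 ?as1 ?as2 /a /s /= !last_rcons; split=> //; try (by rewrite eS).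
  + apply: sepk => //.
    * by apply: contra k1P => /mem_drop.
    * by rewrite mem_rev; apply: contra k2P => /mem_take.
    * exact: ne.
  + apply: sepk => //.
    * by rewrite mem_rev.
    * by apply: contra k3P => /tP.
    * exact: ne.
    * by move=> w /memR/nR1.
    * by move=> w /tP/nP3.
  + apply: sepk => //.
    * by rewrite mem_rev.
    * by apply: contra k3P => /mem_drop.
    * exact: ne.
    * by move=> w /memR/nR2.
    * by move=> w /dP/nP3.
Qed.

(** Let [D] be a minimal connected set outside a maximal clique [K] that sees all of [K]. By
    maximality of [K] it has two vertices, hence two that do not disconnect it, and by minimality
    each of these is the only neighbour in [D] of some vertex of [K]. With a third vertex of [K] the
    situation of [three_attachments] is reached. *)
Lemma triangle_free x y z : e x y -> e y z -> e x z -> False.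
Proof.
move=> xy yz xz.
have ne a b : e a b -> a != b by apply: contraTneq => ->; rewrite eI.
pose isK (K : {set G}) := `[< clique K >] && ([set x; y; z] \subset K).
have K0 : isK [set x; y; z].
  rewrite /isK subxx andbT; apply/asboolP => a b; rewrite !inE.
  by case/orP=> [/orP[]|] /eqP->; case/orP=> [/orP[]|] /eqP->; rewrite ?eqxx // eS.
case: (arg_maxnP (fun K : {set G} => #|K|) K0) => K /andP[/asboolP cK /subsetP sK] maxK.
have xK : x \in K by apply: sK; rewrite !inE eqxx.
have yK : y \in K by apply: sK; rewrite !inE eqxx orbT.
have zK : z \in K by apply: sK; rewrite !inE eqxx orbT.
pose isD (D : {set G}) := [&& `[< conn e D >], D \subset ~: K &
  [forall w in K, exists d in D, e w d]].
have D0 : isD (~: K).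
  apply/and3P; split=> //; first exact/asboolP/no_clique_cutset.
  apply/forall_inP => w wK; have [d dK wd] := clique_attached cK wK.
  by apply/exists_inP; exists d; rewrite ?inE.
case: (arg_minnP (fun D : {set G} => #|D|) D0) => D /and3P[/asboolP cD /subsetP DK /forall_inP aD] minD.
have outK d : d \in D -> d \notin K by move/DK; rewrite inE.
have [d0 d0D _] := exists_inP (aD _ xK).
have D2 : 1 < #|D|.
  rewrite ltnNge; apply/negP => D1; have only d : d \in D -> d = d0.
    by move=> dD; apply: (card_le1_eqP D1).
  have all w : w \in K -> e w d0 by move=> wK; have /exists_inP[d /only->] := aD _ wK.
  have : isK (d0 |: K).
    apply/andP; split; last by apply/subsetP => w /sK; rewrite !inE => ->; rewrite orbT.
    apply/asboolP => a b; rewrite !inE => /orP[/eqP->|aK] /orP[/eqP->|bK]; rewrite ?eqxx // => ab.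
    - by rewrite eS all.
    - exact: all.
    - exact: cK.
  by move/maxK => /=; rewrite cardsU1 (outK _ d0D) /= add1n ltnn.
have private d : d \in D -> conn e (D :\ d) ->
    exists2 w, w \in K & e w d /\ forall d', d' \in D -> e w d' -> d' = d.
  move=> dD cDd; have nD : ~~ isD (D :\ d).
    by apply/negP => /minD; rewrite leqNgt; rewrite [X in _ < X](cardsD1 d) dD ltnSn.
  have : ~~ [forall w in K, exists d' in D :\ d, e w d'].
    apply: contra nD => h; apply/and3P; split=> //; first exact/asboolP.
    by apply/subsetP => d'; rewrite in_setD1 => /andP[_ /DK].
  rewrite negb_forall_in => /exists_inP[w wK]; rewrite negb_exists_in => /forall_inP nw.
  have u d' : d' \in D -> e w d' -> d' = d.
    move=> d'D wd'; apply/eqP; apply: contraT => dd; have := nw d'.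
    by rewrite in_setD1 dd d'D wd' => /(_ isT).
  exists w => //; split=> //; have /exists_inP[d' d'D wd'] := aD _ wK.
  by rewrite -(u _ d'D wd').
have [d1 [d1D _ c1]] := noncut eS cD d0D D2.
have [d2 [d2D d21 c2]] := noncut eS cD d1D D2.
have [k1 k1K [kd1 u1]] := private _ d1D c1; have [k2 k2K [kd2 u2]] := private _ d2D c2.
have k12 : k1 != k2 by apply: contraNneq d21 => E; apply/eqP; apply: u1; rewrite // E.
have [k3 [k3K k31 k32]] : exists k3, [/\ k3 \in K, k3 != k1 & k3 != k2].
  have [h|/negP] := boolP [exists w in K, (w != k1) && (w != k2)].
    by have [w wK /andP[]] := exists_inP h; exists w.
  move=> H; exfalso; have only w : w \in K -> w = k1 \/ w = k2.
    move=> wK; have [->|w1] := eqVneq w k1; first by left.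
    have [->|w2] := eqVneq w k2; first by right.
    by case: H; apply/exists_inP; exists w; rewrite ?w1.
  have n1 := ne _ _ xy; have n2 := ne _ _ yz; have n3 := ne _ _ xz.
  by case: (only _ xK) n1 n3 => ->; case: (only _ yK) n2 => ->; case: (only _ zK) => ->; rewrite ?eqxx.
have k13 : k1 != k3 by rewrite eq_sym.
have k23 : k2 != k3 by rewrite eq_sym.
have [P [P0 PD ipP [/eqP hP /eqP lP] _]] :=
  shortest (eqxx d1 : pred1 d1 d1) (eqxx d2 : pred1 d2 d2) d1D (cD _ _ d1D d2D).
have hE d d' (s : seq G) : 0 < size s -> head d s = head d' s by case: s.
have lE d d' (s : seq G) : 0 < size s -> last d s = last d' s by case: s.
have P2 : 1 < size P.
  case: (P) P0 hP lP => [//|a [|b s]] // _ /= -> E; by rewrite E eqxx in d21.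
rewrite (hE _ k1 _ P0) in hP; rewrite (lE _ k1 _ P0) in lP.
have KP w : w \in K -> w \notin P by move=> wK; apply/negP => /PD/outK; rewrite wK.
have hh : hole e k1 (rcons P k2).
  apply: (hole_ends ipP P2 hP lP) => //; try exact: KP.
  - exact: cK.
  - by move=> w /PD; exact: u1.
  - by move=> w /PD; exact: u2.
(* [k3] already sees [k1] and [k2] on the hole, so sparsity allows no third neighbour. *)
have k3P w : w \in P -> ~~ e k3 w.
  move=> wP; apply/negP => k3w; have k3H : k3 \notin k1 :: rcons P k2.
    by rewrite inE mem_rcons inE !negb_or k31 k32 KP.
  have [a0 [b0 [_ _ _ /subsetP sub]]] := sparseG (hole_is_hole hh) k3H.
  have ends c : c \in k1 :: rcons P k2 -> e k3 c -> c = a0 \/ c = b0.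
    move=> cs vc; have := sub c; rewrite in_setI !in_set vc cs => /(_ isT).
    by case/orP => /set1P; [left|right].
  have wk1 : w != k1 by apply: contraTneq wP => ->; exact: KP.
  have wk2 : w != k2 by apply: contraTneq wP => ->; exact: KP.
  have e1 : k1 = a0 \/ k1 = b0 by apply: ends; [exact: mem_head|exact: cK].
  have e2 : k2 = a0 \/ k2 = b0 by apply: ends; [rewrite inE mem_rcons mem_head orbT|exact: cK].
  have e3 : w = a0 \/ w = b0 by apply: ends; [rewrite inE mem_rcons inE wP !orbT|].
  by case: e1 e2 e3 k12 wk1 wk2 => -> [] -> [] ->; rewrite ?eqxx.
have [n3 n3D kn3] := exists_inP (aD _ k3K).
(* Stopping at the first vertex that sees [P] keeps [R] disjoint from [P], with only its last vertex
   seeing [P]. *)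
pose B w := (w \notin P) && [exists v, (v \in P) && e w v].
have d1P : d1 \in P by rewrite -hP -nth0 mem_nthV.
have n3P : n3 \notin P by apply/negP => /k3P; rewrite kn3.
have [a aD' Ba] : exists2 a, a \in D & B a.
  have [s [s0 sD ips [/eqP hs /eqP ls] _]] :=
    shortest (eqxx n3 : pred1 n3 n3) (eqxx d1 : pred1 d1 d1) n3D (cD _ _ n3D d1D).
  have h1 : head n3 s \notin P by rewrite hs.
  have h2 : ~~ (last n3 s \notin P) by rewrite ls negbK.
  have [a [b [as' bs aP bP ab]]] := path_exit (A := [predC P]) (ipath_sorted ips) s0 h1 h2.
  exists a; first exact: sD.
  rewrite /B; move: aP bP; rewrite /= negbK => -> bP; by apply/existsP; exists b; rewrite bP.
have [R [R0 RD ipR [kR BR] [oA oB]]] := shortest (A := e k3) kn3 Ba n3D (cD _ _ n3D aD').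
have KR w : w \in K -> w \notin R by move=> wK; apply/negP => /RD/outK; rewrite wK.
have onlyB w : w \in R -> B w -> w = last n3 R by move=> wR Bw; exact: only_last oB wR Bw.
have PR w : w \in P -> w \notin R.
  move=> wP; apply/negP => wR; have iw : index w R < size R by rewrite index_mem.
  pose s := take (index w R).+1 R.
  have hs : head n3 s = head n3 R by rewrite /s; case: (R) R0.
  have ls : last n3 s = w by rewrite -nth_last size_takel //= nth_take // nth_index.
  have h1 : head n3 s \notin P by rewrite hs; apply/negP => /k3P; rewrite kR.
  have h2 : ~~ (last n3 s \notin P) by rewrite ls negbK.
  have s0 : 0 < size s by rewrite size_takel.
  have [b [c [bs cs bP cP bc]]] :=
    path_exit (A := [predC P]) (take_sorted _ (ipath_sorted ipR)) s0 h1 h2.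
  rewrite /= in bP; move: cP; rewrite /= negbK => cP.
  have bR := mem_take bs; have Eb : b = last n3 R.
    by apply: onlyB => //; rewrite /B bP; apply/existsP; exists c; rewrite cP.
  have [uR _] := ipR; have l0 : (size R).-1 < size R by rewrite prednK.
  have := bs; rewrite in_take // Eb -nth_last index_uniq // ltnS => le.
  have E : index w R = (size R).-1 by apply/eqP; rewrite eqn_leq le andbT -ltnS prednK.
  by move: bP; rewrite Eb -nth_last -E nth_index // wP.
have clean w : w \in P ++ R -> w \in D by rewrite mem_cat => /orP[/PD|/RD].
apply: (@three_attachments P R k1 k2 k3 d1 d2) => //.
- exact: cK.
- exact: cK.
- exact: cK.
- by move=> w; rewrite !inE => /or3P[] /eqP->; exact: KP.
- by move=> w; rewrite !inE => /or3P[] /eqP->; exact: KR.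
- by move=> w /clean; exact: u1.
- by move=> w /clean; exact: u2.
- by rewrite (hE _ n3).
- move=> w; rewrite mem_cat => /orP[/k3P/negbTE->//|wR kw]; rewrite (hE _ n3) //.
  exact: only_head oA wR kw.
- by move: BR => /andP[_ /existsP[v /andP[vP lv]]]; exists v => //; rewrite (lE _ n3).
- move=> w v wP vR vw; rewrite (lE _ n3) //; apply: onlyB => //.
  rewrite /B; apply/andP; split; first by apply: contraL vR; exact: PR.
  by apply/existsP; exists w; rewrite wP.
Qed.
End Minimal.

(** * Light neighbours *)

Lemma tdl_sub (V : finType) (e e' : rel V) k (W W' : {set V}) : tdl e k W -> W' \subset W ->
  (forall u v, u \in W' -> v \in W' -> e' u v -> e u v) -> tdl e' k W'.
Proof.
move=> [n [b [q [rk [r [[h1 h2 h3 h4 [h5 h6]] _]]]]]] /subsetP sub ee.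
exists n, (fun i => b i :&: W'), q, rk, r; split; last exact: sub0set.
split=> //.
- move=> i il; split; first exact: subsetIr.
  by have [_ bk] := h2 i il; apply: leq_trans bk; exact/subset_leq_card/subsetIl.
- move=> i l v il ll lt; rewrite !in_setI => /andP[vi vW] /andP[vl _].
  by rewrite vW andbT; exact: h4 vl.
- split=> [v vW|u v uW vW uv].
    by have [i il vi] := h5 v (sub _ vW); exists i; rewrite // in_setI vi.
  have [i il /andP[ui vi]] := h6 u v (sub _ uW) (sub _ vW) (ee _ _ uW vW uv).
  by exists i; rewrite // !in_setI ui vi uW.
Qed.

Section Light.
Variable G : sgraph.
Notation e := (@sedge G).
Hypothesis sp : sparse G.
Hypothesis trif : forall x y z : G, e x y -> e y z -> e x z -> False.

Let eS : symmetric e := @sedge_sym G.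
Let eI : irreflexive e := @sedge_irr G.

Section Side.
Variables (x y y' : G) (K C C' : {set G}).
Hypothesis cK : clique K.
Hypothesis xK : x \notin K.
Hypothesis cC : conn e C.
Hypothesis cC' : conn e C'.
Hypothesis Cout : forall c, c \in C -> c != x /\ c \notin K.
Hypothesis C'out : forall c, c \in C' -> c != x /\ c \notin K.
Hypothesis anti : forall c c', c \in C -> c' \in C' -> c != c' /\ ~~ e c c'.
Hypothesis Cclosed : forall a b, a \in C -> e a b -> [\/ b \in C, b = x | b \in K].
Hypothesis CK : forall w, w \in K -> exists2 c, c \in C & e w c.
Hypothesis C'K : forall w, w \in K -> exists2 c, c \in C' & e w c.
Hypothesis yC : y \in C.
Hypothesis xy : e x y.
Hypothesis y'C : y' \in C'.
Hypothesis xy' : e x y'.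
Hypothesis minC : forall B : {set G}, B \subset C -> conn e B -> (exists2 b, b \in B & e x b) ->
  (forall w, w \in K -> exists2 b, b \in B & e w b) -> B = C.
Hypothesis not_clique : exists2 w, w \in K & ~~ e x w.

(** From [y] to [y'] through [C], [v] and [C']: the two sides are not joined by an edge, so the hole
    closed by [x] must use [v]. *)
Lemma around u v : u \in K -> v \in K -> u != v -> ~~ e x v -> exists s, [/\ hole e x s, v \in s, u \notin x :: s &
  head x s \in C].
Proof.
move=> uK vK uv nxv; have [c cC1 vc] := CK vK; have [c' cC2 vc'] := C'K vK.
have vx : v != x by apply: contraNneq xK => <-.
have cS : conn e ((C :|: [set v]) :|: C').
  apply: (connU eS (a := v) (b := c') _ cC') => //; last by rewrite vc' orbT.
    by apply: (connU eS cC (@conn1 _ e v) cC1 (set11 v)); rewrite eS vc orbT.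
  by rewrite !inE eqxx orbT.
have C_C' w : w \in C -> w \in C' -> False by move=> h1 /(anti h1)[/eqP].
have [||| w wS xw|w _ wA wB|s [hs sS hA hB]] :=
  @hole_two _ e trif x _ (mem C) (mem C') y y' cS _ _ _ xy xy' yC y'C.
- rewrite !inE !negb_or eq_sym vx andbT; apply/andP; split; apply/negP.
    by move=> /Cout[]; rewrite eqxx.
  by move=> /C'out[]; rewrite eqxx.
- by rewrite !inE yC.
- by rewrite !inE y'C orbT.
- move: wS; rewrite !inE -orbA => /or3P[->//|/eqP E|->]; last by rewrite orbT.
  by rewrite E (negbTE nxv) in xw.
- exact: C_C' wA wB.
have [ips s2 xs _] := hs.
have nl : last x s \notin C by apply/negP => h; exact: C_C' h hB.
have [a [b [as' bs aC bC ab]]] := path_exit (A := mem C) (ipath_sorted ips) (leq_trans (ltnW (ltnW (ltnSn 2))) s2) hA nl.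
exists s; split=> //.
- have {}bC : b \notin C := bC.
  have := sS _ bs; rewrite !inE (negbTE bC) /= => /orP[/eqP<-//|bC'].
  by have [_] := anti aC bC'; rewrite ab.
- rewrite inE negb_or; apply/andP; split; first by apply: contraNneq xK => <-.
  apply/negP => /sS; rewrite !inE (negbTE uv) orbF => /orP[/Cout|/C'out] []; by rewrite uK.
Qed.

Lemma light_of_nbrs a : (forall z, e y z -> z = x \/ z = a) -> light e x y.
Proof. by move=> h; left; exists a. Qed.

(** By [minC] the side [C] has no vertex beyond those connecting [x] and [K]. If [K] is a single
    vertex, [C] is a path. Otherwise [K] is an edge [uv], and [C] is a path closing [uv] to a hole,
    possibly with a path from [y] to it. *)
Lemma light_side : light e x y.
Proof.
have ne a b : e a b -> a != b by apply: contraTneq => ->; rewrite eI.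
have [a aK nxa] := not_clique.
have [[[u v] [uK vK uv nxu]]|single] := pselect (exists uv : G * G, [/\ uv.1 \in K, uv.2 \in K, uv.1 != uv.2 & ~~ e x uv.1]); last first.
  have onlya w : w \in K -> w = a.
    by move=> wK; apply/eqP; apply: contraT => wa; case: single; exists (a, w); rewrite /= eq_sym.
  have [c cC1 ac] := CK aK.
  have [R [R0 RC ipR [xR aR] [oA oB]]] := shortest (A := e x) (B := e a) xy ac yC (cC yC cC1).
  have RE : [set z in R] = C.
    apply: minC.
    - by apply/subsetP => z; rewrite inE => /RC.
    - exact/conn_seq/ipath_sorted.
    - by exists (head y R) => //; rewrite inE -nth0 mem_nthV.
    - move=> w /onlya->; exists (last y R) => //; rewrite inE -nth_last mem_nthV //.
      by rewrite prednK.
  have CR w : w \in C -> w \in R by rewrite -RE inE.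
  have yh : y = head y R := only_head oA (CR _ yC) xy.
  have [us hR] := ipR.
  have n0 : nth y R 0 = y by rewrite nth0 -yh.
  have [l|l] := leqP (size R) 1.
    apply: (@light_of_nbrs a) => z yz; case: (Cclosed yC yz) => [zC|->|/onlya->]; [|by left|by right].
    have zR := CR _ zC; have : index z R < size R by rewrite index_mem.
    move=> iz; have i0 : index z R = 0 by move: iz l; clear; lia.
    by move: yz; rewrite -(nth_index y zR) i0 n0 eI.
  apply: (@light_of_nbrs (nth y R 1)) => z yz; case: (Cclosed yC yz) => [zC|->|/onlya E]; [right|by left|].
    have zR := CR _ zC; have iz : index z R < size R by rewrite index_mem.
    have i0 : 0 < index z R.
      rewrite lt0n; apply: contraTneq yz => i0; by rewrite -(nth_index y zR) i0 n0 eI.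
    have := hR y 0 _ i0 iz; rewrite nth_index // n0 yz => /esym/eqP <-.
    by rewrite nth_index.
  by have := oB 0 l; rewrite n0 -E eS yz.
rewrite /= in uK vK uv nxu; have euv : e u v by exact: cK.
have onlyK w : w \in K -> w = u \/ w = v.
  move=> wK; have [->|wu] := eqVneq w u; first by left.
  have [->|wv] := eqVneq w v; first by right.
  by case: (@trif u v w) => //; apply: cK; rewrite // eq_sym.
have vu : v != u by rewrite eq_sym.
(* Otherwise [v] would see both [x] and [u] on a hole avoiding it. *)
have nxv : ~~ e x v.
  apply/negP => xv; have [s [hs us vs _]] := around vK uK vu nxu.
  have : x = u; last by move=> E; move: xK; rewrite E uK.
  by apply: (hole_one sp trif hs vs); rewrite ?inE ?eqxx ?us ?orbT // eS.
have [c cC1 uc] := CK uK; have [c' cC2 vc'] := CK vK.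
have [Q [Q0 QC ipQ [uQ vQ] [oA oB]]] := shortest (A := e u) (B := e v) uc vc' cC1 (cC cC1 cC2).
have hE d d' (s : seq G) : 0 < size s -> head d s = head d' s by case: s.
have lE d d' (s : seq G) : 0 < size s -> last d s = last d' s by case: s.
have Q2 : 1 < size Q.
  rewrite ltnNge; apply/negP => Q1; case: (Q) Q0 Q1 uQ vQ => [|d [|]] // _ _ /= ud vd.
  by apply: (@trif u v d).
rewrite (hE _ u _ Q0) in uQ; rewrite (lE _ u _ Q0) in vQ.
have Qu : u \notin Q by apply/negP => /QC/Cout[_]; rewrite uK.
have Qv : v \notin Q by apply/negP => /QC/Cout[_]; rewrite vK.
have uQ1 w : w \in Q -> e u w -> w = head u Q.
  by move=> wQ uw; rewrite (hE _ c _ Q0); exact: only_head oA wQ uw.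
have vQ1 w : w \in Q -> e v w -> w = last u Q.
  by move=> wQ vw; rewrite (lE _ c _ Q0); exact: only_last oB wQ vw.
have hh : hole e u (rcons Q v) by exact: (hole_ends ipQ Q2 erefl erefl).
have hhE w : (w \in u :: rcons Q v) = (w == u) || (w == v) || (w \in Q).
  by rewrite inE mem_rcons inE orbA.
have [uniQ hQ] := ipQ.
have cQ : conn e [set z in Q] by exact/conn_seq/ipath_sorted.
have hQQ : head u Q \in Q by rewrite -nth0 mem_nthV.
have lQQ : last u Q \in Q by rewrite -nth_last mem_nthV // prednK.
have KQ w : w \in K -> exists2 b, b \in Q & e w b.
  by case/onlyK => ->; [exists (head u Q)|exists (last u Q)].
(* If [x] sees [Q], then [C] is [Q], and [y] is the only vertex seen because [u Q v] is a hole: the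
   second form of lightness. *)
have [[b bQ xb]|nxQ] := pselect (exists2 b, b \in Q & e x b).
  have QE : [set z in Q] = C.
    apply: minC => //.
    - by apply/subsetP => z; rewrite inE => /QC.
    - by exists b => //; rewrite inE.
    - by move=> w /KQ[d dQ wd]; exists d => //; rewrite inE.
  have CQ w : w \in C -> w \in Q by rewrite -QE inE.
  have yQ := CQ _ yC; have iy : index y Q < size Q by rewrite index_mem.
  have xH : x \notin u :: rcons Q v.
    rewrite hhE !negb_or; apply/andP; split; last by apply/negP => /QC/Cout[]; rewrite eqxx.
    by apply/andP; split; apply: contraNneq xK => ->.
  (* The default [v] of [nth] serves as the last vertex [c (size Q).+1], and [c 0] is [u]. *)
  right; exists (size Q), (nth v (u :: Q)), (index y Q).+1; split.
  - by split; rewrite /= ?nth_index.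
  - move=> i j; rewrite -[_ <= _](ltnS _ (size Q).+1) -[j <= _](ltnS _ (size Q).+1).
    have szE : size (rcons (u :: Q) v) = (size Q).+2 by rewrite size_rcons.
    have nE i' : i' < (size Q).+2 -> nth v (u :: Q) i' = nth v (rcons (u :: Q) v) i'.
      rewrite ltnS leq_eqVlt nth_rcons => /orP[/eqP->|h]; last by rewrite /= h.
      by rewrite /= ltnn eqxx nth_default.
    move=> il jl; rewrite !nE // => /eqP; rewrite nth_uniq ?szE //; first by move/eqP.
    by have [_ _ h _] := hh; have [[h' _] _ _ _] := hh; rewrite /= h h'.
  - case=> [|j] jl /=; first by rewrite nth0 (hE _ u _ Q0).
    move: jl; rewrite leq_eqVlt => /orP[/eqP E|jl]; last by rewrite hQ ?eqxx.
    have Ej : j = (size Q).-1 by rewrite -E.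
    by rewrite [nth v Q j.+1]nth_default ?E // Ej nth_last eS (lE _ u _ Q0).
  - by rewrite /= nth_default.
  - case=> // j z /andP[_ jl]; rewrite /= => jz.
    have jC : nth v Q j \in C by apply: QC; exact: mem_nthV.
    have jQ : nth v Q j \in Q by exact: mem_nthV.
    case: (Cclosed jC jz) => [zC|zx|/onlyK[zu|zv]].
    + have zQ := CQ _ zC; have iz : index z Q < size Q by rewrite index_mem.
      case: (ltngtP j (index z Q)) => lt.
      * have := hQ v _ _ lt iz; rewrite nth_index // jz => /esym/eqP E.
        by apply: Or32; rewrite -E nth_index.
      * have := hQ v _ _ lt jl; rewrite nth_index // eS jz => /esym/eqP E.
        by apply: Or31; rewrite E /= nth_index.
      * by move: jz; rewrite -(nth_index v zQ) lt eI.
    + apply: Or33; split=> //; congr _.+1; rewrite zx eS in jz.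
      have E : nth v Q j = y by apply: (hole_one sp trif hh xH) => //; rewrite hhE ?jQ ?yQ orbT.
      by rewrite -E index_uniq.
    + apply: Or31; rewrite zu eS in jz; have := uQ1 _ jQ jz => E.
      rewrite -nth0 (set_nth_default v) // in E; have /eqP := E.
      by rewrite nth_uniq // => /eqP ->.
    + apply: Or32; rewrite zv eS in jz; have := vQ1 _ jQ jz => E.
      rewrite -nth_last (set_nth_default v) ?prednK // in E; have /eqP := E.
      by rewrite nth_uniq ?prednK // => /eqP ->; rewrite prednK // nth_default.
(* x sees no vertex of Q: the side consists of Q and a path from x to Q *)
pose B w := (w \notin Q) && [exists d, (d \in Q) && e w d].
have nxQ' w : w \in Q -> ~~ e x w by move=> wQ; apply/negP => xw; apply: nxQ; exists w.
have yQ : y \notin Q by apply/negP => /nxQ'; rewrite xy.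
have [d dC Bd] : exists2 d, d \in C & B d.
  have [s [s0 sC ips [/eqP hs /eqP ls] _]] :=
    shortest (eqxx y : pred1 y y) (eqxx (head u Q) : pred1 (head u Q) _) yC (cC yC (QC _ hQQ)).
  have h1 : head y s \notin Q by rewrite hs.
  have h2 : ~~ (last y s \notin Q) by rewrite ls negbK.
  have [d [d' [ds d's dQ d'Q dd']]] := path_exit (A := [predC Q]) (ipath_sorted ips) s0 h1 h2.
  exists d; first exact: sC.
  by rewrite /B; move: dQ d'Q; rewrite /= negbK => -> d'Q; apply/existsP; exists d'; rewrite d'Q.
have [R [R0 RC ipR [xR BR] [oxR oBR]]] := shortest (A := e x) xy Bd yC (cC yC dC).
have lRR : last y R \in R by rewrite -nth_last mem_nthV // prednK.
have hRR : head y R \in R by rewrite -nth0 mem_nthV.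
have [lQ /existsP[q /andP[qQ lq]]] := andP BR.
have cE : [set z in Q] :|: [set z in R] = C.
  apply: minC.
  - by apply/subsetP => z; rewrite !inE => /orP[/QC|/RC].
  - apply: (connU eS (a := q) (b := last y R) cQ); rewrite ?inE //; last by rewrite eS lq orbT.
    exact/conn_seq/ipath_sorted.
  - by exists (head y R) => //; rewrite !inE hRR orbT.
  - by move=> w /KQ[d0 d0Q wd]; exists d0 => //; rewrite !inE d0Q.
have Csplit w : w \in C -> w \in Q \/ w \in R by rewrite -cE !inE => /orP.
have yR : y \in R by case: (Csplit _ yC) => // h; rewrite h in yQ.
have yh : y = head y R := only_head oxR yR xy.
have xonly w : w \in C -> e x w -> w = y.
  move=> wC xw; case: (Csplit _ wC) => [/nxQ'|wR]; first by rewrite xw.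
  by rewrite yh; exact: only_head oxR wR xw.
have nyK w w' : w \in K -> w' \in K -> w != w' -> ~~ e x w' -> ~~ e y w.
  move=> wK w'K ww' nx; apply/negP => yw; have [s [hs w's ws hsC]] := around wK w'K ww' nx.
  have Eh : head x s = y by apply: xonly => //; rewrite -nth0; exact: hole_head.
  have : y = w'.
    apply: (hole_one sp trif hs ws); rewrite ?inE ?w's ?orbT //; last 2 first.
    - by rewrite eS.
    - exact: cK.
    rewrite -Eh; apply/orP; right; have [_ s2 _ _] := hs.
    by rewrite -nth0 mem_nthV //; apply: ltn_trans s2.
  by move=> E; have [_] := Cout yC; rewrite E w'K.
have yK w : w \in K -> ~~ e y w.
  by case/onlyK => ->; [exact: (nyK u v)|exact: (nyK v u)].
have [uR hR] := ipR; have n0 : nth y R 0 = y by rewrite nth0 -yh.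
have [l|l] := leqP (size R) 1.
  have Ey : last y R = y by rewrite -nth_last (_ : (size R).-1 = 0) //; move: l; clear; lia.
  have yH : y \notin u :: rcons Q v.
    by rewrite hhE (negbTE yQ) orbF negb_or; apply/andP; split; apply: contraNneq (Cout yC).2 => ->.
  apply: (@light_of_nbrs q) => z yz; case: (Cclosed yC yz) => [zC|->|/yK]; [right|by left|by rewrite yz].
  case: (Csplit _ zC) => [zQ|zR].
    apply: (hole_one sp trif hh yH) => //; rewrite ?hhE ?zQ ?qQ ?orbT //.
    by rewrite -Ey.
  have iz : index z R < size R by rewrite index_mem.
  have i0 : index z R = 0 by move: iz l; clear; lia.
  by move: yz; rewrite -(nth_index y zR) i0 n0 eI.
apply: (@light_of_nbrs (nth y R 1)) => z yz; case: (Cclosed yC yz) => [zC|->|/yK]; [right|by left|by rewrite yz].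
case: (Csplit _ zC) => [zQ|zR].
  have := oBR 0 l; rewrite n0 /B yQ /= => /negP; case; by apply/existsP; exists z; rewrite zQ.
have iz : index z R < size R by rewrite index_mem.
have i0 : 0 < index z R.
  rewrite lt0n; apply: contraTneq yz => i0; by rewrite -(nth_index y zR) i0 n0 eI.
have := hR y 0 _ i0 iz; rewrite nth_index // n0 yz => /esym/eqP <-.
by rewrite nth_index.
Qed.
End Side.
End Light.

(** * Of two neighbours of a vertex, one is light *)

Section Matching.
Variables (G : sgraph) (k t : nat).
Notation e := (@sedge G).
Hypothesis clG : class_F t G.
Hypothesis tk : t <= k.
Hypothesis ntd : ~ tdl e k setT.
Hypothesis small : forall S : {set G}, S != setT -> tdl e k S.

Let eS : symmetric e := @sedge_sym G.
Let eI : irreflexive e := @sedge_irr G.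

(** Take a smallest clique [K] separating [y1] from [y2] in [G - x], so that both components see all
    of [K]. At least one of the two torsos has no decomposition, and then the component deleted from
    it satisfies the minimality asked for by [light_side]. *)
Lemma two_light x y1 y2 : y1 != y2 -> e x y1 -> e x y2 -> light e x y1 \/ light e x y2.
Proof.
move=> y12 xy1 xy2; have sp := sparseG clG; have trif := triangle_free clG tk ntd small.
have ny12 : ~~ e y1 y2 by apply/negP => h; exact: trif xy1 h xy2.
pose V1 := ~: [set x].
have inV a : e x a -> a \in V1 by move=> xa; rewrite !inE; apply: contraTneq xa => ->; rewrite eI.
(* [x] would see two vertices of such a hole. *)
have nohole s : hole e y1 s -> {subset s <= V1} -> y2 \notin s.
  move=> hs sV; apply/negP => y2s; move/eqP: y12; apply; have xs : x \notin y1 :: s.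
    rewrite inE negb_or; apply/andP; split; first by apply: contraTneq xy1 => <-; rewrite eI.
    by apply/negP => /sV; rewrite !inE eqxx.
  by apply: (hole_one sp trif hs xs); rewrite ?inE ?eqxx ?y2s ?orbT.
pose P (K : {set G}) := `[< [/\ K \subset V1, y1 \notin K, y2 \notin K, clique K &
   ~ connect (restr e (V1 :\: K)) y1 y2] >].
have [K0 PK0] : exists K, P K.
  have [K [h1 h2 h3 h4 h5]] := separating_clique sp trif (inV _ xy1) (inV _ xy2) y12 ny12 nohole.
  by exists K; apply/asboolP.
case: (arg_minnP (fun K : {set G} => #|K|) PK0) => K /asboolP[KV y1K y2K cK nc12] minK.
have xK : x \notin K by apply/negP => /(subsetP KV); rewrite !inE eqxx.
pose C a := comp e (V1 :\: K) a.
have VK a : a \in V1 -> a \notin K -> a \in V1 :\: K by rewrite in_setD => -> ->.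
have Csub a c : a \in V1 :\: K -> c \in C a -> c != x /\ c \notin K.
  move=> aVK /(subsetP (comp_sub aVK)); rewrite in_setD => /andP[cK' cV]; split=> //.
  by move: cV; rewrite !inE.
have Ccl a c d : a \in V1 :\: K -> c \in C a -> e c d -> [\/ d \in C a, d = x | d \in K].
  move=> aVK cC cd; have [->|dx] := eqVneq d x; first by apply: Or32.
  have [dK|dK] := boolP (d \in K); first by apply: Or33.
  by apply: Or31; apply: (comp_closed aVK cC _ cd); apply: VK => //; rewrite !inE.
have anti a b c c' : a \in V1 :\: K -> b \in V1 :\: K -> ~ connect (restr e (V1 :\: K)) a b ->
    c \in C a -> c' \in C b -> c != c' /\ ~~ e c c'.
  move=> aVK bVK nab ca cb; have key d : d \in C a -> d \in C b -> False.
    rewrite !inE => h1 h2; apply: nab; apply: connect_trans h1 _; by rewrite (conn_sym eS).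
  split; first by apply/negP => /eqP E; apply: (key c); rewrite // E.
  apply/negP => cc'; have [c'x c'K] := Csub _ _ bVK cb.
  case: (Ccl _ _ _ aVK ca cc') => [h|E|h]; first exact: key h cb.
    by rewrite E eqxx in c'x.
  by rewrite h in c'K.
have attached a b w : a \in V1 :\: K -> ~ connect (restr e (V1 :\: K)) a b ->
    (forall K' : {set G}, K' \subset K -> ~ connect (restr e (V1 :\: K')) a b -> P K') ->
    w \in K -> exists2 c, c \in C a & e w c.
  move=> aVK nab PK' wK; apply: contrapT => H.
  have : P (K :\ w).
    apply: PK'; first exact: subD1set.
    move=> /(closed_connect (C := C a)) h; apply: nab.
    suff : b \in C a by rewrite inE.
    apply: h (comp_id _ _ _) => c d cC dV cd; case: (Ccl _ _ _ aVK cC cd) => // [E|dK].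
      by move: dV; rewrite !inE E eqxx andbF.
    have [E|dw] := eqVneq d w; first by case: H; exists c; rewrite // eS -E.
    by move: dV; rewrite !inE dw dK.
  by move/minK; rewrite (cardsD1 w K) wK add1n ltnn.
have y1V := VK _ (inV _ xy1) y1K; have y2V := VK _ (inV _ xy2) y2K.
have nc21 : ~ connect (restr e (V1 :\: K)) y2 y1 by rewrite (conn_sym eS).
have Psub (K' : {set G}) : K' \subset K -> ~ connect (restr e (V1 :\: K')) y1 y2 -> P K'.
  move=> /subsetP sub nc; apply/asboolP; split=> //.
  - by apply/subsetP => z /sub/(subsetP KV).
  - by apply: contra y1K => /sub.
  - by apply: contra y2K => /sub.
  - by move=> a b /sub aK /sub bK; exact: cK.
have Psub' (K' : {set G}) : K' \subset K -> ~ connect (restr e (V1 :\: K')) y2 y1 -> P K'.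
  by rewrite (conn_sym eS); exact: Psub.
(* Otherwise [x |: K] would be a clique cutset of [G]. *)
have not_clique : exists2 w, w \in K & ~~ e x w.
  apply: contrapT => H; apply: nc12.
  have cL : clique (x |: K).
    have all w : w \in K -> e x w by move=> wK; apply: contraT => nw; case: H; exists w.
    move=> a b; rewrite !inE => /orP[/eqP->|aK] /orP[/eqP->|bK]; rewrite ?eqxx //.
    - by move=> _; exact: all.
    - by move=> _; rewrite eS all.
    - exact: cK.
  have := no_clique_cutset ntd small cL.
  have -> : ~: (x |: K) = V1 :\: K by apply/setP => z; rewrite !inE negb_or andbC.
  by apply.
pose L := x |: K.
(* The torso relation, in which [K] and [x] form a clique. *)
pose eL u v := e u v || [&& u \in L, v \in L & u != v].
have eLS : symmetric eL by move=> u v; rewrite /eL eS andbCA eq_sym.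
have LC a c : a \in V1 :\: K -> c \in C a -> c \notin L.
  by move=> aVK /(Csub _ _ aVK)[cx cK']; rewrite !inE negb_or cx.
(* If a proper [B] would do instead of [C a], contracting [x |: B] to [x] in the proper induced
   subgraph without [C a :\: B] makes [x] see all of [K] and gives the excluded decomposition of the
   torso. *)
have side a b : e x a -> e x b -> a \in V1 :\: K -> b \in V1 :\: K ->
    ~ connect (restr e (V1 :\: K)) a b ->
    (forall w, w \in K -> exists2 c, c \in C a & e w c) ->
    (forall w, w \in K -> exists2 c, c \in C b & e w c) ->
    ~ tdl eL k (~: C a) -> light e x a.
  move=> xa xb aVK bVK nab attA attB nt.
  apply: (@light_side G sp trif x a b K (C a) (C b)) => //.
  - exact: comp_conn.
  - exact: comp_conn.
  - by move=> c; exact: Csub.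
  - by move=> c; exact: Csub.
  - by move=> c c'; exact: anti.
  - by move=> c d; exact: Ccl.
  - exact: comp_id.
  - exact: comp_id.
  move=> B BC cB [b0 b0B xb0] attBB; apply/eqP; apply: contraT => BneC; case: nt.
  have [c cC cB'] : exists2 c, c \in C a & c \notin B.
    by apply/subsetPn; apply: contra BneC => h; rewrite eqEsubset BC.
  pose W := ~: (C a :\: B).
  have tW : tdl e k W.
    by apply: small; apply/eqP => /setP/(_ c); rewrite !inE cB' /=; move: cC; rewrite inE => ->.
  have xC : x \notin C a by apply/negP => /(Csub _ _ aVK)[]; rewrite eqxx.
  have cF : conn e (x |: B) by apply: (connU eS (@conn1 _ e x) cB (set11 x) b0B); rewrite xb0 orbT.
  have FW : x |: B \subset W.
    apply/subsetP => z; rewrite in_setU1 in_setC in_setD => /orP[/eqP->|zB]; first by rewrite (negbTE xC) andbF.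
    by rewrite zB.
  have WE : x |: (W :\: (x |: B)) = ~: C a.
    apply/setP => z; rewrite in_setU1 in_setD in_setU1 !in_setC in_setD.
    have [->|_] := eqVneq z x; first by rewrite xC.
    rewrite /=; have [zB|] := boolP (z \in B); last by [].
    by rewrite (subsetP BC _ zB).
  rewrite -WE; apply: (tdl_contract tW eS eLS cF (setU11 _ _) FW) => [u v|v].
    rewrite !in_setD !in_setU1 !negb_or => /andP[/andP[ux _] _] /andP[/andP[vx _] _].
    rewrite /eL !in_setU1 (negbTE ux) (negbTE vx) /= => /orP[//|/and3P[uK vK uv]]; exact: cK.
  rewrite in_setD in_setU1 negb_or => /andP[/andP[vx _] _].
  rewrite /eL !in_setU1 eqxx (negbTE vx) /= => /orP[xv|/andP[vK _]].
    by exists x; rewrite ?in_setU1 ?eqxx.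
  by have [b1 b1B vb] := attBB _ vK; exists b1; rewrite ?in_setU1 ?b1B ?orbT // eS.
have attA w : w \in K -> exists2 c, c \in C y1 & e w c by exact: attached y1V nc12 Psub.
have attB w : w \in K -> exists2 c, c \in C y2 & e w c by exact: attached y2V nc21 Psub'.
have [t1|n1] := pselect (tdl eL k (~: C y1)); last first.
  by left; exact: (side y1 y2).
have [t2|n2] := pselect (tdl eL k (~: C y2)); last first.
  by right; exact: (side y2 y1).
(* [W2] lies in the second torso, so the decompositions can be glued along [L]. *)
exfalso; pose W2 := C y1 :|: L.
have cL : {in L &, forall u v, u != v -> eL u v} by move=> u v uL vL uv; rewrite /eL uL vL uv orbT.
have LW1 : L \subset ~: C y1 by apply/subsetP => z zL; rewrite in_setC; apply: contraL zL; exact: (LC _ _ y1V).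
have LW2 : L \subset W2 by exact: subsetUr.
have tW2 : tdl eL k W2.
  apply: (tdl_sub t2) => //; apply/subsetP => z; rewrite in_setU in_setC => /orP[zC|zL].
    by apply/negP => zC2; have [/eqP] := anti _ _ _ _ y1V y2V nc12 zC zC2.
  by apply: contraL zL; exact: (LC _ _ y2V).
have r1 := rtd_clique t1 LW1 cL; have r2 := rtd_clique tW2 LW2 cL.
have WI : ~: C y1 :&: W2 \subset L.
  by apply/subsetP => z; rewrite in_setI in_setC in_setU => /andP[/negbTE ->].
have := rtd_glue r1 r2 WI WI eLS; have -> : ~: C y1 :|: W2 = setT.
  by apply/setP => z; rewrite in_setU in_setC in_setU in_setT; case: (z \in C y1).
move=> h; apply: ntd; apply: (@tdl_sub _ eL e k setT) => //; last by move=> u v _ _ uv; rewrite /eL uv.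
apply: rtd_sub (sub0set _) (h _) => u v; rewrite !in_setC !in_setU => uC /orP[vC uv|vL _]; last first.
  by apply/orP; right; apply: contraL vL => /(LC _ _ y1V); rewrite /L in_setU.
apply/orP; left; apply/orP; right; have vL := LC _ _ y1V vC.
move: uv; rewrite /eL (negbTE vL) andbF orbF eS => uv; case: (Ccl _ _ _ y1V vC uv) => [h'|->|uK].
- by rewrite h' in uC.
- by rewrite in_set1 eqxx.
- by rewrite uK orbT.
Qed.
End Matching.

(** * Induced walls *)

Lemma tdl_leq (V : finType) (e : rel V) k k' (W : {set V}) : k <= k' -> tdl e k W -> tdl e k' W.
Proof.
move=> kk [n [b [q [rk [r [[h1 h2 h3 h4 h5] h6]]]]]]; exists n, b, q, rk, r; split=> //; split=> //.
by move=> i /h2[bW bk]; split=> //; exact: leq_trans kk.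
Qed.

(** At most one vertical neighbour and one in each horizontal direction. *)
Lemma wall_degree t (w : wall t) : 1 < t -> 0 < degree w <= 3.
Proof.
move=> t2; apply/andP; split.
  have [w' h] := partner_wall t2 w; apply/card_gt0P; exists w'; rewrite in_neighbors.
  by case: h => /below_edge; rewrite // sedge_sym.
have nb w' : w' \in neighbors w -> sedge w w' by rewrite in_neighbors.
pose A1 := [set w' : wall t | `[< below w w' \/ below w' w >]].
pose A2 := [set w' : wall t | `[< before w w' >]].
pose A3 := [set w' : wall t | `[< before w' w >]].
have sub : neighbors w \subset A1 :|: A2 :|: A3.
  apply/subsetP => w' /nb/(wall_edge t2) h; rewrite !in_setU.
  case: h => [h|[h|[h|h]]].
  - by apply/orP; left; apply/orP; left; rewrite /A1 in_set; apply/asboolP; left.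
  - by apply/orP; left; apply/orP; left; rewrite /A1 in_set; apply/asboolP; right.
  - by apply/orP; left; apply/orP; right; rewrite /A2 in_set; apply/asboolP.
  - by apply/orP; right; rewrite /A3 in_set; apply/asboolP.
have one (A : {set wall t}) : (forall a b, a \in A -> b \in A -> a = b) -> #|A| <= 1.
  by move=> h; apply/card_le1_eqP => a b aA bA; apply: h.
apply: leq_trans (subset_leq_card sub) _; apply: leq_trans (leq_card_setU _ _).1 _.
rewrite -[3]/(2 + 1) leq_add //; first (apply: leq_trans (leq_card_setU _ _).1 _; rewrite -[2]/(1 + 1) leq_add //).
- apply: one => a b; rewrite /A1 !in_set => /asboolP h /asboolP h'.
  case: h => -[c1 r1 o1]; case: h' => -[c2 r2 o2].
  + by apply: coord_inj; rewrite ?r1 ?r2 // -c1 -c2.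
  + by exfalso; move: o1 o2; rewrite c2 r2 addSn /= negbK => ->.
  + by exfalso; move: o2 o1; rewrite c1 r1 addSn /= negbK => ->.
  + by apply: coord_inj; [apply: succn_inj; rewrite -r1 -r2|rewrite c1 c2].
- apply: one => a b; rewrite /A2 !in_set => /asboolP[r1 l1 n1] /asboolP[r2 l2 n2].
  apply: coord_inj; first by rewrite -r1 -r2.
  case: (ltngtP (col a) (col b)) => // lt; exfalso.
    by move/negP: (n2 (col a) (introT andP (conj l1 lt))); apply; rewrite r1; exact: wall_valid.
  by move/negP: (n1 (col b) (introT andP (conj l2 lt))); apply; rewrite r2; exact: wall_valid.
- apply: one => a b; rewrite /A3 !in_set => /asboolP[r1 l1 n1] /asboolP[r2 l2 n2].
  apply: coord_inj; first by rewrite r1 r2.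
  case: (ltngtP (col a) (col b)) => // lt; exfalso.
    by move/negP: (n1 (col b) (introT andP (conj lt l2))); apply; rewrite r1 -r2; exact: wall_valid.
  by move/negP: (n2 (col a) (introT andP (conj lt l1))); apply; rewrite r2 -r1; exact: wall_valid.
Qed.

(** [gamma 1] is a single edge, and both its ends are deleted as vertices of degree one. *)
Lemma wall1_empty (w : wall 1) : False.
Proof.
have := svalP (sval w); rewrite inE => /negP; apply; case: (sval (sval w)) => i j.
have i0 (a : 'I_1) : a = ord0 by exact: ord1.
have -> : degree ((i, j) : gamma 1) = #|[set ((ord0, rev_ord j) : gamma 1)]|; last by rewrite cards1.
congr (#|pred_of_set _|); apply/setP => -[i' j']; rewrite !inE /= /gamma_rel /gamma_arc /=.
rewrite (i0 i) (i0 i') /= xpair_eqE !eqxx /= !andbF !orbF -val_eqE /=.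
by move: (ltn_ord j) (ltn_ord j'); lia.
Qed.

Section Wall.
Variables (G : sgraph) (k t : nat).
Notation e := (@sedge G).
Hypothesis clG : class_F t G.
Hypothesis tk : t <= k.
Hypothesis ntd : ~ tdl e k setT.
Hypothesis small : forall S : {set G}, S != setT -> tdl e k S.

Let eS : symmetric e := @sedge_sym G.
Let eI : irreflexive e := @sedge_irr G.

Definition heavy (x y : G) : Prop := [/\ e x y, ~ light e x y & ~ light e y x].

Lemma heavy_sym x y : heavy x y -> heavy y x.
Proof. by case=> h1 h2 h3; split=> //; rewrite eS. Qed.

Lemma heavy_matching x y y' : heavy x y -> heavy x y' -> y = y'.
Proof.
move=> [h1 h2 _] [h3 h4 _]; apply/eqP; apply: contraT => ne.
by case: (two_light clG tk ntd small ne h1 h3).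
Qed.

(** Each heavy edge is sent to one of its ends, selected by rank; since these edges form a matching,
    fibres have at most two elements. *)
Lemma contract_heavy : exists rho : G -> G,
  [/\ forall x y, heavy x y -> rho x = rho y, forall v, #|[set u | rho u == v]| <= 2,
      forall u, rho (rho u) = rho u & forall u, rho u = u \/ e u (rho u)].
Proof.
have /choice[p pP] : forall x, exists y, heavy x y \/ y = x /\ ~ exists z, heavy x z.
  move=> x; have [[y h]|n] := pselect (exists y, heavy x y); first by exists y; left.
  by exists x; right.
have pE x y : heavy x y -> p x = y.
  by move=> h; case: (pP x) => [h'|[_ []]]; [exact: heavy_matching h' h|exists y].
have pp x : p (p x) = x.
  by case: (pP x) => [/heavy_sym/pE//|[E _]]; rewrite !E.
pose rho x := if enum_rank x < enum_rank (p x) then x else p x.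
have rhoP x : rho x = x \/ rho x = p x by rewrite /rho; case: ifP; [left|right].
have rho_p x : rho (p x) = rho x.
  rewrite /rho pp; case: ltngtP => // /val_inj/enum_rank_inj E; by rewrite -{2}E.
exists rho; split.
- by move=> x y /pE <-.
- move=> v; have : [set u | rho u == v] \subset [set v; p v].
    apply/subsetP => u; rewrite !inE => /eqP E; case: (rhoP u) => E'; rewrite E in E'.
      by rewrite E' eqxx.
    by rewrite E' pp eqxx orbT.
  by move/subset_leq_card/leq_trans; apply; rewrite cards2; case: (_ == _).
- by move=> u; case: (rhoP u) => E; rewrite {1}E.
- move=> u; case: (rhoP u) => E; first by left.
  by rewrite E; case: (pP u) => [[h _ _]|[]]; [right|left].
Qed.

(** The model found in the contracted graph is pulled back along [rho], so both ends of a heavy edge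
    land in the same part. In a minimal such model the two additional vertices are dropped, and the
    parts of the wall itself are subdivided. *)
Lemma contains_wall K : 1 < t -> K * 2 <= k ->
  (forall (V : finType) (r : rel V), symmetric r -> ~ tdl r K setT ->
     exists X : wall t + bool -> {set V}, model r (@wall_ext t) X) ->
  exists S : {set G}, is_subdivision (induced S) (wall t).
Proof.
move=> t2 Kk HK; have trif := triangle_free clG tk ntd small.
have [rho [rhoM rho2 rhoI rhoe]] := contract_heavy.
pose eQ u v := (u != v) && [exists a, exists b, [&& rho a == u, rho b == v & e a b]].
have eQP u v : eQ u v -> exists a b, [/\ rho a = u, rho b = v & e a b].
  by case/andP=> _ /existsP[a /existsP[b /and3P[/eqP h1 /eqP h2 h3]]]; exists a, b.
have eQS : symmetric eQ.
  have half u v : eQ u v -> eQ v u.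
    move=> h; have [a [b [h1 h2 h3]]] := eQP _ _ h; case/andP: h => ne _.
    rewrite /eQ eq_sym ne; apply/existsP; exists b; apply/existsP; exists a.
    by rewrite h1 h2 !eqxx eS.
  by move=> u v; apply/idP/idP; exact: half.
have ntQ : ~ tdl eQ K setT.
  move=> tQ; apply: ntd; apply: tdl_leq Kk _; apply: (tdl_preim _ rho2 tQ) => u v uv.
  have [->|ne] := eqVneq (rho u) (rho v); [by left|right].
  by rewrite /eQ ne; apply/existsP; exists u; apply/existsP; exists v; rewrite !eqxx.
have [X [cX dX eX]] := HK _ _ eQS ntQ.
pose Y u := rho @^-1: X u.
have inY u x : (x \in Y u) = (rho x \in X u) by rewrite inE.
have to_rho u x : x \in Y u -> connect (restr e (Y u)) x (rho x).
  move=> xY; case: (rhoe x) => [->|h]; first exact: connect0.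
  by apply: connect_restr1 => //; rewrite inY rhoI -inY.
have cY u : conn e (Y u).
  have step a b : restr eQ (X u) a b -> connect (restr e (Y u)) a b.
    case/and3P => aX bX /eQP[a' [b' [Ea Eb ab]]].
    have aY : a' \in Y u by rewrite inY Ea.
    have bY : b' \in Y u by rewrite inY Eb.
    have ca := to_rho _ _ aY; have cb := to_rho _ _ bY; rewrite Ea in ca; rewrite Eb in cb.
    rewrite (conn_sym eS) in ca; apply: connect_trans ca _; apply: connect_trans cb.
    exact: connect_restr1.
  move=> x y xY yY; apply: connect_trans (to_rho _ _ xY) _.
  have := to_rho _ _ yY; rewrite (conn_sym eS); apply: connect_trans.
  by apply: (connect_sub step); apply: cX; rewrite -inY.
have mY : mmodel e (@wall_ext t) heavy Y.
  split; first split=> //.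
  - by move=> u v z; rewrite !inY; exact: dX.
  - move=> u v /eX[x [y [xX yX /eQP[a [b [Ea Eb ab]]]]]]; exists a, b.
    by rewrite !inY Ea Eb.
  - by move=> u v x y xu yv _ /rhoM E; move: xu yv; rewrite !inY E; exact: dX.
have lightE x y : e x y -> [\/ heavy x y, light e x y | light e y x].
  move=> xy; have [h|n1] := pselect (light e x y); first by apply: Or32.
  have [h|n2] := pselect (light e y x); first by apply: Or33.
  by apply: Or31.
have [Z [[cZ dZ eZ] [cross uniqZ]]] := minimal_model eS eI (@wall_ext_sym t) (@wall_ext_irr t)
  (wall_ext_degree t2) lightE (ex_intro _ Y mY).
apply: (@subdivision_of_model G (wall t) (fun w => Z (inl w)) trif).
- by move=> w; exact: wall_degree.
- split=> //.
  + by move=> u v z zu zv; have [] := dZ _ _ _ zu zv.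
  + by move=> u v uv; exact: (eZ (inl u) (inl v)).
- by move=> u v x y uv xu yv xy; exact: (cross (inl u) (inl v) x y).
- by move=> u v x y x' y' uv; exact: (uniqZ (inl u) (inl v)).
Qed.
End Wall.

Theorem theorem1p6 :
  forall t : nat, 0 < t ->
  exists c : nat, forall G : sgraph,
    class_F t G -> c < treewidth G ->
    exists H : sgraph, is_subdivision H (wall t) /\ induced_subgraph H G.
Proof.
(* For [t = 1] the wall has no vertices, and the empty induced subgraph subdivides it. *)
case=> [//|[|t0] _].
  exists 0 => G _ _; exists (induced (set0 : {set G})); split; last exact: induced_induced.
  have no_vertex (x : induced (set0 : {set G})) : False by have := svalP x; rewrite inE.
  exists (fun w => False_rect _ (wall1_empty w)), (fun _ _ => [::]).
  by split=> [w|w|w|x|x]; first [case: (wall1_empty w) | case: (no_vertex x)].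
set t := t0.+2; have t2 : 1 < t by [].
(* [K * 2] because lifting a decomposition from the contracted graph doubles its bags at most, [t]
   so that every clique fits into a bag. Treewidth above [c] means no decomposition with bags of
   size at most [c.+1]. *)
have [K HK] := wall_minor t2; pose c := maxn (K * 2) t.
have Kc : K * 2 <= c.+1 by apply: leqW; exact: leq_maxl.
have tc : t <= c.+1 by apply: leqW; exact: leq_maxr.
exists c => G clG ctw.
have ntd : ~ tdl (@sedge G) c.+1 setT by move/tdl_treewidth; rewrite leqNgt ctw.
have [n Gn] : exists n, #|G| <= n by exists #|G|.
elim: n G Gn clG ntd {ctw} => [|n IH] G Gn clG ntd.
  by case: ntd; apply: rtd_leaf => //; rewrite cardsT; apply: leq_trans Gn _.
(* Induction on the number of vertices: either a proper induced subgraph has no decomposition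
   either, or the graph is minimal. *)
have [[S [nS ntS]]|small] := pselect (exists S : {set G}, S != setT /\ ~ tdl (@sedge G) c.+1 S).
  have Sn : #|induced S| <= n.
    rewrite card_sig -ltnS; apply: leq_trans Gn; rewrite -cardsT; apply: proper_card.
    by rewrite properT.
  have [|H [h1 h2]] := IH (induced S) Sn (class_hereditary (induced_induced S) clG).
    by move/tdl_induced.
  by exists H; split=> //; exact: induced_subgraph_trans h2 (induced_induced S).
have small' (S : {set G}) : S != setT -> tdl (@sedge G) c.+1 S.
  by move=> nS; apply: contrapT => n1; apply: small; exists S.
have [S hS] := contains_wall clG tc ntd small' t2 Kc HK.
by exists (induced S); split=> //; exact: induced_induced.
Qed.
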